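(* Let $\Omega\subset\mathbb{R}^n$ be open and bounded, $m>n$, $1<p<\infty$, $Y^m=[0,1)^m$, and let $\mathbf{R}\in\mathbb{R}^{m\times n}$ satisfy $\mathbf{R}^*k\neq0$ for all $k\in\mathbb{Z}^m\setminus\{0\}$. Then a function $v\in L^p(\Omega\times Y^m;\mathbb{R}^n)$ is the $\mathbf{R}$-two-scale limit of a sequence $\{\nabla v_\varepsilon\}_\varepsilon$ with $\{v_\varepsilon\}_\varepsilon$ bounded in $W^{1,p}(\Omega)$ if and only if there exist $v_0\in W^{1,p}(\Omega)$ and $v_1\in L^p(\Omega;\mathcal{G}^p_{\mathbf{R}})$ such that $v=\nabla v_0+v_1$, where $$\mathcal{G}^p_{\mathbf{R}}:=\{w\in L^p_\#(Y^m;\mathbb{R}^n):\ \hat w_k=\lambda_k\mathbf{R}^*k\ \text{for all } k\in\mathbb{Z}^m, \text{ for some } \{\lambda_k\}_{k\in\mathbb{Z}^m}\subset\mathbb{C} \text{ with } \lambda_0=0\},$$ with $\hat w_k:=\int_{Y^m}w(y)e^{-2\pi i k\cdot y}\,dy$.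
   Context: $\varepsilon$ ranges over a sequence of positive numbers converging to $0$. $L^p_\#(Y^m;\mathbb{R}^n)$ denotes the $Y^m$-periodic functions in $L^p_{\rm loc}(\mathbb{R}^m;\mathbb{R}^n)$; $C_\#(Y^m;\mathbb{R}^n)$ the continuous $Y^m$-periodic ones. A sequence $\{u_\varepsilon\}\subset L^p(\Omega;\mathbb{R}^n)$ $\mathbf{R}$-two-scale converges to $u\in L^p(\Omega\times Y^m;\mathbb{R}^n)$ if for all $\varphi\in L^{p'}(\Omega;C_\#(Y^m;\mathbb{R}^n))$ ($p'=p/(p-1)$), $\lim_{\varepsilon\to0^+}\int_\Omega u_\varepsilon(x)\cdot\varphi(x,\mathbf{R}x/\varepsilon)\,dx=\int_\Omega\int_{Y^m}u(x,y)\cdot\varphi(x,y)\,dy\,dx$ (here $\mathcal{L}^m(Y^m)=1$). *)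

(* Defs.v *)
From HB Require Import structures.
From mathcomp Require Import all_boot all_order all_algebra.
From mathcomp Require Import all_classical all_reals all_analysis.
Set Implicit Arguments. Unset Strict Implicit. Unset Printing Implicit Defensive.
Import Order.TTheory GRing.Theory Num.Theory.
Import numFieldNormedType.Exports.
Local Open Scope classical_set_scope.
Local Open Scope ring_scope.

Definition Rn (R : realType) (n : nat) :=
  g_sigma_algebraType (@open 'rV[R]_n).

(* A measure on the Borel sets of R^n is the (Borel) Lebesgue measure iff it
   gives every half-open box its volume (this characterizes it uniquely). *)
Definition is_lebesgue (R : realType) (n : nat)
    (mu : {measure set (Rn R n) -> \bar R}) : Prop :=
  forall a b : 'rV[R]_n, (forall i, a 0 i <= b 0 i) ->
    mu [set x : Rn R n | forall i, a 0 i < x 0 i <= b 0 i]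
      = (\prod_i (b 0 i - a 0 i))%:E.

Definition vdot (R : realType) (n : nat) (u v : 'rV[R]_n) : R :=
  \sum_i u 0 i * v 0 i.
Definition vnorm (R : realType) (n : nat) (u : 'rV[R]_n) : R :=
  Num.sqrt (vdot u u).

(* f in L^p(A; R^k), A subset of R^n  (Borel measurable representative) *)
Definition Lp_vec (R : realType) (n k : nat)
    (mu : {measure set (Rn R n) -> \bar R}) (A : set 'rV[R]_n) (p : R)
    (f : 'rV[R]_n -> 'rV[R]_k) : Prop :=
  (forall i, measurable_fun (A : set (Rn R n)) (fun x : Rn R n => f x 0 i)) /\
  (\int[mu]_(x in (A : set (Rn R n))) (powR (vnorm (f x)) p)%:E < +oo)%E.

Definition Lp_scal (R : realType) (n : nat)
    (mu : {measure set (Rn R n) -> \bar R}) (A : set 'rV[R]_n) (p : R)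
    (f : 'rV[R]_n -> R) : Prop :=
  measurable_fun (A : set (Rn R n)) (f : Rn R n -> R) /\
  (\int[mu]_(x in (A : set (Rn R n))) (powR `|f x| p)%:E < +oo)%E.

Definition pderiv (R : realType) (n : nat) (f : 'rV[R]_n -> R) (i : 'I_n)
    (x : 'rV[R]_n) : R := derive f x (delta_mx 0 i).

Fixpoint Ck (R : realType) (n : nat) (k : nat) (f : 'rV[R]_n -> R) : Prop :=
  continuous f /\
  match k with
  | 0 => True
  | k'.+1 => forall i : 'I_n,
      (forall x, derivable f x (delta_mx 0 i)) /\ Ck k' (pderiv f i)
  end.

Definition test_fun (R : realType) (n : nat) (Om : set 'rV[R]_n)
    (phi : 'rV[R]_n -> R) : Prop :=
  (forall k, Ck k phi) /\
  compact (closure [set x | phi x != 0]) /\ closure [set x | phi x != 0] `<=` Om.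

Definition weak_grad (R : realType) (n : nat)
    (mu : {measure set (Rn R n) -> \bar R}) (Om : set 'rV[R]_n)
    (u : 'rV[R]_n -> R) (g : 'rV[R]_n -> 'rV[R]_n) : Prop :=
  forall phi, test_fun Om phi -> forall i : 'I_n,
    (\int[mu]_(x in (Om : set (Rn R n))) (u x * pderiv phi i x)%:E
     = - \int[mu]_(x in (Om : set (Rn R n))) (g x 0 i * phi x)%:E)%E.

Definition W1p (R : realType) (n : nat)
    (mu : {measure set (Rn R n) -> \bar R}) (Om : set 'rV[R]_n) (p : R)
    (u : 'rV[R]_n -> R) (g : 'rV[R]_n -> 'rV[R]_n) : Prop :=
  Lp_scal mu Om p u /\ Lp_vec mu Om p g /\ weak_grad mu Om u g.

Definition Ycell (R : realType) (m : nat) : set 'rV[R]_m :=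
  [set y | forall i, 0 <= y 0 i < 1].
Arguments Ycell : clear implicits.

Definition periodic (R : realType) (m : nat) (T : Type) (w : 'rV[R]_m -> T) :=
  forall (y : 'rV[R]_m) (i : 'I_m), w (y + delta_mx 0 i) = w y.

Definition jmeas (R : realType) (n m k : nat) (A : set 'rV[R]_n)
    (B : set 'rV[R]_m) (f : 'rV[R]_n -> 'rV[R]_m -> 'rV[R]_k) : Prop :=
  forall i, measurable_fun ((A : set (Rn R n)) `*` (B : set (Rn R m)))
              (fun z : Rn R n * Rn R m => f z.1 z.2 0 i).

Definition int2 (R : realType) (n m : nat)
    (mun : {measure set (Rn R n) -> \bar R})
    (mum : {measure set (Rn R m) -> \bar R}) (Om : set 'rV[R]_n)
    (F : 'rV[R]_n -> 'rV[R]_m -> R) : \bar R :=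
  (\int[mun]_(x in (Om : set (Rn R n)))
     \int[mum]_(y in (Ycell R m : set (Rn R m))) (F x y)%:E)%E.

Definition Lp2 (R : realType) (n m k : nat)
    (mun : {measure set (Rn R n) -> \bar R})
    (mum : {measure set (Rn R m) -> \bar R}) (Om : set 'rV[R]_n) (p : R)
    (v : 'rV[R]_n -> 'rV[R]_m -> 'rV[R]_k) : Prop :=
  jmeas Om (Ycell R m) v /\
  (int2 mun mum Om (fun x y => powR (vnorm (v x y)) p) < +oo)%E.

Definition ts_test (R : realType) (n m : nat)
    (mun : {measure set (Rn R n) -> \bar R}) (Om : set 'rV[R]_n) (p' : R)
    (phi : 'rV[R]_n -> 'rV[R]_m -> 'rV[R]_n) : Prop :=
  (forall x, continuous (phi x) /\ periodic (phi x)) /\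
  jmeas Om setT phi /\
  Lp_scal mun Om p' (fun x => sup [set vnorm (phi x y) | y in Ycell R m]).

Definition two_scale_conv (R : realType) (n m : nat)
    (mun : {measure set (Rn R n) -> \bar R})
    (mum : {measure set (Rn R m) -> \bar R}) (Om : set 'rV[R]_n) (p : R)
    (Rm : 'M[R]_(m, n)) (eps : nat -> R)
    (u : nat -> 'rV[R]_n -> 'rV[R]_n) (v : 'rV[R]_n -> 'rV[R]_m -> 'rV[R]_n)
    : Prop :=
  forall phi, ts_test mun Om (p / (p - 1)) phi ->
    (fun j => \int[mun]_(x in (Om : set (Rn R n)))
        (vdot (u j x) (phi x ((eps j)^-1 *: (x *m Rm^T))))%:E)%E
      @ \oo --> int2 mun mum Om (fun x y => vdot (v x y) (phi x y)).

Definition intv (R : realType) (m : nat) (k : 'rV[int]_m) : 'rV[R]_m :=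
  map_mx (fun z : int => z%:~R) k.
Arguments intv R {m} k.

(* w in G^p_R: w in L^p_#(Y^m;R^n) and each Fourier coefficient
   hat w_k = int_Y w(y) e^{-2 pi i k.y} dy = C_k - i S_k with
   C_k = int_Y w cos(2 pi k.y), S_k = int_Y w sin(2 pi k.y)
   equals lambda_k R^* k for some complex lambda_k with lambda_0 = 0,
   i.e. C_k = a R^*k, S_k = b R^*k with a, b real (a = Re lambda, b = -Im lambda). *)
Definition inG (R : realType) (n m : nat)
    (mum : {measure set (Rn R m) -> \bar R}) (p : R) (Rm : 'M[R]_(m, n))
    (w : 'rV[R]_m -> 'rV[R]_n) : Prop :=
  periodic w /\ Lp_vec mum (Ycell R m) p w /\
  forall k : 'rV[int]_m, exists a b : R,
    (k = 0 -> a = 0 /\ b = 0) /\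
    forall i : 'I_n,
      (\int[mum]_(y in (Ycell R m : set (Rn R m)))
          (w y 0 i * cos (2 * pi * vdot (intv R k) y))%:E
        = (a * (intv R k *m Rm) 0 i)%:E)%E /\
      (\int[mum]_(y in (Ycell R m : set (Rn R m)))
          (w y 0 i * sin (2 * pi * vdot (intv R k) y))%:E
        = (b * (intv R k *m Rm) 0 i)%:E)%E.

(* Main.v *)
From HB Require Import structures.
From mathcomp Require Import all_boot all_order all_algebra.
From mathcomp Require Import all_classical all_reals all_analysis.
From mathcomp Require Import measurable_realfun ring lra.
Require Import Defs.
Set Implicit Arguments. Unset Strict Implicit. Unset Printing Implicit Defensive.
Import Order.TTheory GRing.Theory Num.Theory.
Import numFieldNormedType.Exports.
Import HBNNSimple.
Local Open Scope classical_set_scope.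
Local Open Scope ring_scope.

(**
Write [Fc k s] for the real Fourier coefficients in y (phase s = 0 for the cosine,
s = - pi/2 for the sine).

Necessity. A bounded sequence in L^p has convex combinations of its tails converging
strongly, by uniform convexity; hence the cell mean of v is the weak gradient of some
v0. For k <> 0, integrating by parts twice against psi(x) cos(2 pi k.Rx/eps + s)
shows that (R^*k)_l \int grad_i v_eps psi cos(..) - (R^*k)_i \int grad_l v_eps psi cos(..)
is O(eps), so the k-th coefficient of v(x,.) is parallel to R^*k for almost every x;
subtracting the mean yields v1.

Sufficiency. Convolution with a trigonometric approximate identity on the torus and
density of test functions approximate v1 in L^p by finite sums of
al(x) cos(2 pi k.y + s) R^*k with al smooth and compactly supported. Along y = Rx/eps
such a sum is, up to O(eps), the gradient of the corrector obtained by integrating each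
wave. By the Riemann-Lebesgue lemma, which needs R^*k <> 0, oscillating fields converge
in the two-scale sense and their L^p norms converge as well, so a diagonal sequence of
correctors added to v0 has the required limit.
*)

(** Since $m>n$, for each $\varepsilon$ the points $\mathbf{R}x/\varepsilon$ fill only a null set of
    the torus, so $v_1(x,\mathbf{R}x/\varepsilon)$ has no meaning for a field that is merely
    measurable in $y$. Hence only approximants that are smooth in $y$ are evaluated along the
    oscillation, and there they are compared with each other, never with $v_1$: the norm of the
    difference of two fixed approximants tends to its norm on $\Omega\times Y^m$. The diagonal index
    grows slowly enough to keep the finitely many comparisons with earlier approximants valid. The
    multipliers $\lambda_k(x)$ must be measurable in $x$, which a choice at each point would not
    ensure; they are computed by orthogonal projection onto $\mathbf{R}^*k$. Norms occur only
    through $\int|f|^p$, so each triangle inequality costs a factor $2^p$, and budgets such as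
    $e/2/2^p$ pay for a sum of two terms. *)

(** * Pointwise inequalities for powers: Young, tangent lines, uniform convexity *)

Section real_inequalities.
Context {R : realType}.
Implicit Types a b p t : R.

Lemma powR_le p a b : 0 <= p -> 0 <= a -> a <= b -> a `^ p <= b `^ p.
Proof.
move=> p0 a0 ab; apply: ge0_ler_powR => //; rewrite nnegrE//.
exact: le_trans ab.
Qed.

(** From $|a+b|\le 2\max(|a|,|b|)$. The factor $2^p$ reappears in every later error budget. *)
Lemma powRD_le p a b : 0 <= p ->
  `|a + b| `^ p <= 2 `^ p * (`|a| `^ p + `|b| `^ p).
Proof.
move=> p0.
wlog ab : a b / `|a| <= `|b|.
  move=> H; have [/H//|/ltW/H] := leP `|a| `|b|.
  by rewrite addrC [X in _ * X]addrC.
apply: (@le_trans _ _ ((2 * `|b|) `^ p)).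
  apply: powR_le => //; apply: (le_trans (ler_normD _ _)).
  by rewrite mulr_natl mulr2n lerD2r.
rewrite powRM// ler_wpM2l ?powR_ge0//.
by rewrite lerDr powR_ge0.
Qed.

Definition conj_exp p := p / (p - 1).

Lemma conj_exp_gt0 p : 1 < p -> 0 < conj_exp p.
Proof. by move=> p1; rewrite divr_gt0 ?subr_gt0// (lt_trans _ p1). Qed.

Lemma conj_exp_gt1 p : 1 < p -> 1 < conj_exp p.
Proof. by move=> p1; rewrite ltr_pdivlMr ?subr_gt0// mul1r gtrBl. Qed.

Lemma conj_expE p : 1 < p -> p^-1 + (conj_exp p)^-1 = 1.
Proof.
move=> p1; rewrite /conj_exp invf_div -{1}(mul1r p^-1) -mulrDl.
by rewrite addrC subrK divff// gt_eqF// (lt_trans _ p1).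
Qed.

(** The factors $1/p$ and $1/p'$ of Young's inequality are at most 1 and are dropped. *)
Lemma young_le p a b : 1 < p -> `|a * b| <= `|a| `^ p + `|b| `^ conj_exp p.
Proof.
move=> p1; have p0 := lt_trans (@ltr01 R) p1; rewrite normrM.
apply: le_trans (conjugate_powR _ _ p0 (conj_exp_gt0 p1) (conj_expE p1)) _ => //.
apply: lerD; rewrite ler_piMr ?powR_ge0// invf_le1//; try exact: ltW.
  exact/ltW/conj_exp_gt1.
exact: conj_exp_gt0.
Qed.

(** Young's inequality for $b$ and $a^{p-1}$, whose conjugate power is $a^p$ because $(p-1)p'=p$, is
    already the tangent line inequality at $a$, the point $a=0$ included. *)
Lemma powR_tangent p a b : 1 < p -> 0 <= a -> 0 <= b ->
  a `^ p + p * a `^ (p - 1) * (b - a) <= b `^ p.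
Proof.
move=> p1 a0 b0; have p0 := lt_trans (@ltr01 R) p1.
have q0 := conj_exp_gt0 p1.
have := conjugate_powR b0 (powR_ge0 a (p - 1)) p0 q0 (conj_expE p1).
rewrite -powRrM (_ : (p - 1) * conj_exp p = p); last first.
  by rewrite /conj_exp mulrCA divff ?mulr1// subr_eq0 gt_eqF.
have aE : a `^ (p - 1) * a = a `^ p.
  have [->|an0] := eqVneq a 0; first by rewrite mulr0 powR0// gt_eqF.
  by rewrite -{2}(powRr1 a0) -powRD ?an0 ?implybT// subrK.
rewrite /conj_exp invf_div mulrA [X in _ <= _ + X](_ : _ =
  a `^ p * (p - 1) / p); last by [].
rewrite -mulrDl ler_pdivlMr// => H.
have -> : p * a `^ (p - 1) * (b - a) =
   b * a `^ (p - 1) * p - p * (a `^ (p - 1) * a) by ring.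
by rewrite aE; move: H; lra.
Qed.

Lemma normr_powR_lt p a e : 0 < p -> 0 < e -> `|a| < e `^ p^-1 -> `|a| `^ p < e.
Proof.
move=> p0 e0 ae.
rewrite -[ltRHS](@powRr1 _ e) ?ltW// -[in ltRHS](@mulVf _ p) ?gt_eqF// powRrM.
by apply: gt0_ltr_powR; rewrite ?nnegrE ?powR_ge0.
Qed.

Lemma continuous_normr_powR p : 0 < p -> continuous (fun t : R => `|t| `^ p).
Proof.
move=> p0 x; have [->|x0] := eqVneq x 0.
  apply/cvgrPdist_lt => e e0; rewrite normr0 powR0 ?gt_eqF//.
  near=> y; rewrite sub0r normrN ger0_norm ?powR_ge0//.
  apply: normr_powR_lt => //.
  by near: y; apply: (@cvgr0_norm_lt _ _ _ _ _ id); rewrite ?powR_gt0//.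
apply: (@continuous_comp _ _ _ (fun y : R => `|y|) ((@powR R)^~ p)).
  exact: norm_continuous.
apply: differentiable_continuous; apply/derivable1_diffP.
by apply: derivable_powR; rewrite in_itv/= andbT normr_gt0.
Unshelve. all: by end_near. Qed.

(** How strictly $|t|^p$ is convex at the midpoint. Integrated, it is what averaging two functions
    gains in [Np]. *)
Definition cvx_gap p a b : R :=
  (`|a| `^ p + `|b| `^ p) / 2 - `|(a + b) / 2| `^ p.

(** As a function of its second argument the gap vanishes at 1 and has negative derivative between
    $t$ and 1, so the mean value theorem makes it positive. *)
Lemma cvx_gap_gt0_01 p t : 1 < p -> 0 <= t -> t < 1 -> 0 < cvx_gap p 1 t.
Proof.
move=> p1 t0 t1; have p0 := lt_trans (@ltr01 R) p1.
rewrite /cvx_gap normr1 powR1 (ger0_norm t0) ger0_norm; last by rewrite divr_ge0// addr_ge0.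
pose h (x : R) := (1 + x `^ p) / 2 - ((1 + x) / 2) `^ p.
pose dh (x : R) := (p * x `^ (p - 1)) / 2 - (p * ((1 + x) / 2) `^ (p - 1)) / 2.
have Dh (x : R) : x \in `]t, 1[ -> is_derive x 1 h (dh x).
  rewrite in_itv/= => /andP[tx x1].
  have x0 : 0 < x by exact: le_lt_trans tx.
  have d1 := is_derive1_powR p x0.
  have x2 : 0 < (1 + x) / 2 by rewrite divr_gt0// addr_gt0.
  have d2 := is_derive1_powR p x2.
  have d3 : is_derive x 1 (fun y : R => (1 + y) / 2) 2^-1.
    rewrite (_ : (fun y : R => (1 + y) / 2) = (2^-1 : R) \*: (cst 1 + id)); last first.
      by apply/funext => y /=; rewrite !fctE mulrC.
    by apply: is_derive_eq; rewrite add0r /GRing.scale/= mulr1.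
  have d4 : is_derive x 1 ((@powR R)^~ p \o (fun y : R => (1 + y) / 2))
      (p * ((1 + x) / 2) `^ (p - 1) * 2^-1).
    exact: (@is_derive1_comp _ ((@powR R)^~ p) (fun y : R => (1 + y) / 2)).
  rewrite /h (_ : (fun x0 => _) = (2^-1 : R) \*: (cst 1 + (@powR R)^~ p) -
      ((@powR R)^~ p \o (fun y : R => (1 + y) / 2))); last first.
    by apply/funext => y /=; rewrite !fctE mulrC.
  apply: is_derive_eq; rewrite /dh add0r /GRing.scale/=; ring.
(* The left end may be 0. Continuity is therefore read off the form with absolute values, which is
   continuous on the whole line and agrees with [h] on the interval. *)
have ch : {within `[t, 1], continuous h}.
  have hE : {in `[t, 1], h =1 fun x => (1 + `|x| `^ p) / 2 - `|(1 + x) / 2| `^ p}.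
    move=> y; rewrite in_itv/= => /andP[ty _]; have y0 := le_trans t0 ty.
    by rewrite /h !ger0_norm// divr_ge0 ?addr_ge0.
  have hE' : {in `[t, 1]%classic, (fun x => (1 + `|x| `^ p) / 2 - `|(1 + x) / 2| `^ p) =1 h}.
    by move=> y /set_mem yt; rewrite hE.
  refine (subspace_eq_continuous hE' _); apply: continuous_subspaceT => x.
  apply: cvgB.
    apply: cvgMl; apply: cvgD; first exact: cvg_cst.
    exact: continuous_normr_powR.
  apply: (@continuous_comp _ _ _ (fun y : R => (1 + y) / 2) (fun x : R => `|x| `^ p)).
    by apply: cvgMl; apply: cvgD; [exact: cvg_cst|exact: cvg_id].
  exact: continuous_normr_powR.
have [c] := MVT t1 Dh ch.
rewrite in_itv/= => /andP[tc c1] /eqP; rewrite subr_eq /h powR1.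
have -> : (1 + 1) / 2 = 1 :> R by rewrite divff.
rewrite powR1 subrr => /eqP H.
have c0 : 0 <= c by exact: le_trans (ltW tc).
have : dh c < 0.
  rewrite /dh subr_lt0 ltr_pM2r ?invr_gt0// ltr_pM2l//.
  apply: gt0_ltr_powR; rewrite ?nnegrE ?subr_gt0//; first by rewrite divr_ge0 ?addr_ge0.
  by rewrite ltr_pdivlMr//; move: c1; lra.
move=> dc.
have : 0 < - (dh c * (1 - t)) by rewrite -mulNr mulr_gt0 ?oppr_gt0 ?subr_gt0.
move: H; set A := (1 + t `^ p) / 2; set B := powR _ p; lra.
Qed.

(** For negative $t$, replacing $t$ by $|t|$ keeps the powers and raises the midpoint term, so the
    gap only shrinks; $t=-1$ is treated apart because then $|t|$ is not below 1. *)
Lemma cvx_gap_gt0 p t : 1 < p -> -1 <= t -> t < 1 -> 0 < cvx_gap p 1 t.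
Proof.
move=> p1 t1 tl1; have p0 := lt_trans (@ltr01 R) p1.
have [t0|t0] := leP 0 t; first exact: cvx_gap_gt0_01.
have [tE|tN1] := eqVneq t (-1).
  rewrite /cvx_gap tE subrr mul0r normr0 powR0 ?gt_eqF// subr0.
  by rewrite normrN normr1 powR1; lra.
have tn : `|t| < 1 by rewrite ltr0_norm// ltrNl lt_neqAle eq_sym tN1.
have := cvx_gap_gt0_01 p1 (normr_ge0 t) tn.
rewrite /cvx_gap normr_id => H; apply: (lt_le_trans H).
rewrite lerD2l lerN2; apply: powR_le => //; first exact: ltW.
rewrite !normrM ler_wpM2r//; apply: (le_trans (ler_normD _ _)).
by rewrite normr1 [leRHS]ger0_norm.
Qed.

Lemma continuous_cvx_gap p : 1 < p -> continuous (cvx_gap p 1).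
Proof.
move=> p1 t; have p0 := lt_trans (@ltr01 R) p1.
have cp := continuous_normr_powR p0.
apply: cvgB.
  by apply: cvgMl; apply: cvgD; [exact: cvg_cst|exact: cp].
apply: (@continuous_comp _ _ _ (fun y : R => (1 + y) / 2) (fun x : R => `|x| `^ p)).
  by apply: cvgMl; apply: cvgD; [exact: cvg_cst|exact: cvg_id].
exact: cp.
Qed.

Lemma cvx_gapM p c a b : 0 < p -> cvx_gap p (c * a) (c * b) = `|c| `^ p * cvx_gap p a b.
Proof.
move=> p0; rewrite /cvx_gap -mulrDr -mulrA !normrM !powRM//.
by ring.
Qed.

(** Quantitative uniform convexity: the convexity gap controls the difference, up to an arbitrarily
    small share of the sizes. By symmetry and homogeneity the pair becomes $(1,t)$ with $|t|\le1$.
    For $t$ near 1 the share [d] suffices; elsewhere the gap has a positive minimum. *)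
Lemma cvx_gap_uniform p d : 1 < p -> 0 < d -> exists2 C : R, 0 <= C &
  forall a b, `|a - b| `^ p <= d * (`|a| `^ p + `|b| `^ p) + C * cvx_gap p a b.
Proof.
move=> p1 d0; have p0 := lt_trans (@ltr01 R) p1.
have [C C0 HC] : exists2 C : R, 0 <= C & forall t, -1 <= t <= 1 ->
    0 <= cvx_gap p 1 t /\ `|1 - t| `^ p <= d + C * cvx_gap p 1 t.
  pose dd := d `^ p^-1.
  have dd0 : 0 < dd by rewrite powR_gt0.
  have ddp : dd `^ p = d by rewrite -powRrM mulVf ?gt_eqF// powRr1// ltW.
  have small t : t <= 1 -> 1 - t <= dd -> `|1 - t| `^ p <= d.
    move=> t1 tdd; rewrite -ddp; apply: powR_le => //; first exact: ltW.
    by rewrite ger0_norm// subr_ge0.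
  have gap1 : cvx_gap p 1 1 = 0.
    rewrite /cvx_gap (_ : (1 + 1) / 2 = 1 :> R) ?divff// normr1 powR1.
    by rewrite divff// subrr.
  have gap0 t : -1 <= t <= 1 -> 0 <= cvx_gap p 1 t.
    move=> /andP[t1]; rewrite le_eqVlt => /predU1P[->|tl1]; first by rewrite gap1.
    exact/ltW/cvx_gap_gt0.
  have [dd2|dd2] := leP 2 dd.
    exists 0 => // t /andP[t1 t2]; split; first by apply: gap0; rewrite t1.
    by rewrite mul0r addr0 small//; apply: le_trans dd2; move: t1; lra.
  have le1 : -1 <= 1 - dd by move: dd2; lra.
  have [c] := EVT_min le1 (continuous_subspaceT (continuous_cvx_gap p1)).
  rewrite in_itv/= => /andP[c1 c2] cmin.
  have gc : 0 < cvx_gap p 1 c.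
    by apply: cvx_gap_gt0 => //; apply: (le_lt_trans c2); move: dd0; lra.
  (* On the rest of the interval $|1-t|^p$ is at most $2^p$ and the gap is at least its minimum,
     attained at [c]. *)
  exists (2 `^ p / cvx_gap p 1 c); first by rewrite divr_ge0 ?powR_ge0 ?ltW.
  move=> t /andP[t1 t2]; split; first by apply: gap0; rewrite t1.
  have [tdd|tdd] := leP (1 - t) dd.
    apply: (le_trans (small _ t2 tdd)); rewrite lerDl mulr_ge0//.
      by rewrite divr_ge0 ?powR_ge0 ?ltW.
    by apply: gap0; rewrite t1.
  have ct : cvx_gap p 1 c <= cvx_gap p 1 t.
    by apply: cmin; rewrite in_itv/= t1; move: tdd; lra.
  apply: (@le_trans _ _ (2 `^ p)).
    apply: powR_le; [exact: ltW|by []|].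
    by rewrite ger0_norm ?subr_ge0//; move: t1; lra.
  rewrite (@le_trans _ _ (2 `^ p / cvx_gap p 1 c * cvx_gap p 1 t))//; last first.
    by rewrite lerDr ltW.
  by rewrite mulrAC ler_pdivlMr// ler_wpM2l// powR_ge0.
exists C => // a b.
wlog ab : a b / `|b| <= `|a|.
  move=> H; have [/H//|/ltW/H] := leP `|b| `|a|.
  by rewrite distrC /cvx_gap (addrC b a) [`|b| `^ p + _]addrC.
have [a0|a0] := eqVneq a 0.
  have b0 : b = 0 by apply/eqP; rewrite -normr_le0 (le_trans ab)// a0 normr0.
  rewrite a0 b0 subrr /cvx_gap addr0 mul0r normr0 powR0 ?gt_eqF//.
  by rewrite addr0 mulr0 mul0r subrr mulr0 addr0.
have [|g0] := HC (b / a).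
  rewrite -ler_norml normrM normfV ler_pdivrMr ?normr_gt0//.
  by rewrite mul1r.
move=> H.
have := ler_wpM2l (powR_ge0 `|a| p) H.
rewrite -powRM// -normrM mulrBr mulr1 mulrCA divff// mulr1.
move=> /le_trans; apply; rewrite mulrDr lerD//.
  by rewrite mulrC ler_wpM2l ?(ltW d0)// lerDl powR_ge0.
by rewrite mulrCA -cvx_gapM// mulr1 mulrCA divff// mulr1.
Qed.

(** Add the tangent inequalities at $s=|(a+b)/2|$ for $|a|$ and for $|b|$: the linear terms have
    nonnegative sum because $|a|+|b|\ge2s$. *)
Lemma cvx_gap_ge0 p a b : 1 < p -> 0 <= cvx_gap p a b.
Proof.
move=> p1; have p0 := lt_trans (@ltr01 R) p1.
have t0 := normr_ge0 ((a + b) / 2).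
have Ha := powR_tangent p1 t0 (normr_ge0 a).
have Hb := powR_tangent p1 t0 (normr_ge0 b).
have ab : 0 <= `|a| + `|b| - 2 * `|(a + b) / 2|.
  rewrite subr_ge0 normrM [`|2^-1|]ger0_norm ?invr_ge0// mulrCA divff// mulr1.
  exact: ler_normD.
have := mulr_ge0 (mulr_ge0 (ltW p0) (powR_ge0 `|(a + b) / 2| (p - 1))) ab.
rewrite /cvx_gap; move: Ha Hb; set s := `|(a + b) / 2|; set S := s `^ p.
set T := s `^ (p - 1); nra.
Qed.

End real_inequalities.

(* The p-th power of the L^p norm; no p-th root is ever needed. *)
HB.lock Definition Np d (T : measurableType d) (R : realType)
    (mu : {measure set T -> \bar R}) (p : R) (f : T -> R) : \bar R :=
  (\int[mu]_x (`|f x| `^ p)%:E)%E.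

(** * Estimates for [Np]: sums, products, dominated convergence, Jensen *)

Section Lp_integrals.
Context d (T : measurableType d) {R : realType}.

Lemma NpE (mu : {measure set T -> \bar R}) p (f : T -> R) :
  Np mu p f = (\int[mu]_x (`|f x| `^ p)%:E)%E.
Proof. by rewrite Np.unlock. Qed.

Lemma measurable_powR_norm p (f : T -> R) : measurable_fun setT f ->
  measurable_fun setT (fun x => `|f x| `^ p).
Proof.
move=> mf; apply: (@measurableT_comp _ _ _ _ _ _ (@powR R ^~ p)) => //.
exact: measurableT_comp.
Qed.

Lemma measurable_powR_normE p (f : T -> R) : measurable_fun setT f ->
  measurable_fun setT (fun x => (`|f x| `^ p)%:E).
Proof. by move=> mf; apply/measurable_EFinP; exact: measurable_powR_norm. Qed.

Section any_measure.
Variable mu : {measure set T -> \bar R}.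
Implicit Types (p c s e B C dl : R) (f g : T -> R).

Lemma Np_ge0 p f : (0 <= Np mu p f)%E.
Proof. by rewrite NpE; apply: integral_ge0 => x _; rewrite lee_fin powR_ge0. Qed.

Lemma Np_le p f g : 0 <= p -> measurable_fun setT f -> measurable_fun setT g ->
  (forall x, `|f x| <= `|g x|) -> (Np mu p f <= Np mu p g)%E.
Proof.
move=> p0 mf mg fg; rewrite !NpE; apply: ge0_le_integral => //.
- exact: measurable_powR_normE.
- exact: measurable_powR_normE.
- by move=> x _; rewrite lee_fin; exact: powR_le.
Qed.

Lemma NpD p f g : 0 <= p -> measurable_fun setT f -> measurable_fun setT g ->
  (Np mu p (fun x => f x + g x)%R <= (2 `^ p)%:E * (Np mu p f + Np mu p g))%E.
Proof.
move=> p0 mf mg; rewrite !NpE -ge0_integralD//; last first.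
- exact: measurable_powR_normE.
- exact: measurable_powR_normE.
rewrite -ge0_integralZl_EFin ?powR_ge0//; last first.
- by apply: emeasurable_funD; exact: measurable_powR_normE.
- by move=> x _; rewrite -EFinD lee_fin addr_ge0 ?powR_ge0.
apply: ge0_le_integral => //.
- by apply: measurable_powR_normE; exact: measurable_funD.
- apply: emeasurable_funM; first exact: measurable_cst.
  by apply: emeasurable_funD; exact: measurable_powR_normE.
- by move=> x _; rewrite -EFinD -EFinM lee_fin; exact: powRD_le.
Qed.

Lemma NpZ p c f : measurable_fun setT f ->
  Np mu p (fun x => c * f x) = ((`|c| `^ p)%:E * Np mu p f)%E.
Proof.
move=> mf; rewrite !NpE -ge0_integralZl_EFin ?powR_ge0//.
- by apply: eq_integral => x _; rewrite normrM powRM// EFinM.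
- exact: measurable_powR_normE.
Qed.

Lemma NpN p f : Np mu p (fun x => - f x) = Np mu p f.
Proof. by rewrite !NpE; apply: eq_integral => x _; rewrite normrN. Qed.

Lemma NpB p f g : 0 <= p -> measurable_fun setT f -> measurable_fun setT g ->
  (Np mu p (fun x => f x - g x)%R <= (2 `^ p)%:E * (Np mu p f + Np mu p g))%E.
Proof.
move=> p0 mf mg; rewrite -(NpN p g); apply: NpD => //.
exact: measurableT_comp.
Qed.

Lemma NpC p f g : Np mu p (fun x => f x - g x) = Np mu p (fun x => g x - f x).
Proof. by rewrite !NpE; apply: eq_integral => x _; rewrite distrC. Qed.

Lemma Np0 p : 0 < p -> Np mu p (fun=> 0) = 0%E.
Proof.
by move=> p0; rewrite NpE; apply: integral0_eq => x _; rewrite normr0 powR0// gt_eqF.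
Qed.

(** Young's inequality applied to $(f/s)(sg)$. The free weight [s] trades the size of one factor
    against the other and does the work of Hölder's inequality. *)
Lemma integral_mul_young p f g s : 1 < p -> 0 < s ->
  measurable_fun setT f -> measurable_fun setT g ->
  (\int[mu]_x `|f x * g x|%:E <=
     (s^-1 `^ p)%:E * Np mu p f + (s `^ conj_exp p)%:E * Np mu (conj_exp p) g)%E.
Proof.
move=> p1 s0 mf mg.
have si0 : 0 <= s^-1 by rewrite invr_ge0 ltW.
have := NpZ p s^-1 mf; rewrite (ger0_norm si0) => <-.
have := NpZ (conj_exp p) s mg; rewrite (ger0_norm (ltW s0)) => <-.
rewrite !NpE -ge0_integralD//; last first.
- by apply: measurable_powR_normE; exact: measurable_funM.
- by apply: measurable_powR_normE; exact: measurable_funM.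
apply: ge0_le_integral => //.
- by apply/measurable_EFinP; apply: measurableT_comp => //; exact: measurable_funM.
- apply: emeasurable_funD; apply: measurable_powR_normE; exact: measurable_funM.
move=> x _; rewrite -EFinD lee_fin.
rewrite (_ : f x * g x = (s^-1 * f x) * (s * g x)) ?young_le//.
by rewrite mulrACA mulVf ?gt_eqF// mul1r.
Qed.

(** Pairing with a bounded set of the dual exponent is continuous at 0, uniformly over that set;
    this is how every $L^p$ error enters an integral later on. *)
Lemma integral_mul_small p e B : 1 < p -> 0 < e -> 0 <= B -> exists2 dl, 0 < dl &
  forall f g, measurable_fun setT f -> measurable_fun setT g ->
  (Np mu p f <= dl%:E)%E -> (Np mu (conj_exp p) g <= B%:E)%E ->
  (\int[mu]_x `|f x * g x|%:E <= e%:E)%E.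
Proof.
move=> p1 e0 B0; have q0 := conj_exp_gt0 p1; have p0 := lt_trans (@ltr01 R) p1.
(* With $s^{p'}=r$ the term in [g] costs at most $rB\le e/2$; the summand 1 keeps the denominator
   positive when $B=0$. The choice of [dl] then makes the term in [f] cost the other half. *)
pose r := e / (2 * (B + 1)).
have r0 : 0 < r by rewrite divr_gt0// mulr_gt0// ltr_wpDl.
pose s := r `^ (conj_exp p)^-1.
have s0 : 0 < s by rewrite powR_gt0.
have sq : s `^ conj_exp p = r by rewrite -powRrM mulVf ?gt_eqF// powRr1// ltW.
exists (e / 2 / (s^-1 `^ p)); first by rewrite !divr_gt0// powR_gt0 ?invr_gt0.
move=> f g mf mg fd gB; apply: (le_trans (integral_mul_young p1 s0 mf mg)).
rewrite sq [e in leRHS](splitr e) EFinD leeD//.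
  rewrite muleC -lee_pdivlMr; last by rewrite powR_gt0 ?invr_gt0.
  by rewrite -EFinM.
apply: (@le_trans _ _ (r%:E * B%:E)%E); first by rewrite lee_wpmul2l// lee_fin ltW.
rewrite -EFinM lee_fin /r mulrAC ler_pdivrMr ?mulr_gt0 ?ltr_wpDl//.
rewrite (_ : e / 2 * _ = e * (B + 1)); last by field.
by rewrite ler_wpM2l ?(ltW e0)// lerDl.
Qed.

Lemma integrable_mul p f g : 1 < p -> measurable_fun setT f ->
  measurable_fun setT g -> (Np mu p f < +oo)%E -> (Np mu (conj_exp p) g < +oo)%E ->
  mu.-integrable setT (fun x => (f x * g x)%:E).
Proof.
move=> p1 mf mg fy gy; apply/integrableP; split.
  by apply/measurable_EFinP; exact: measurable_funM.
apply: (le_lt_trans (integral_mul_young p1 (@ltr01 R) mf mg)).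
by rewrite invr1 !powR1 !mul1e; exact: lte_add_pinfty.
Qed.

(** The pointwise limit inherits the bound by [g], so $2^p|g|^p$ dominates the powers of the
    differences. *)
Lemma Np_dct p (f_ : nat -> T -> R) f g : 0 < p ->
  (forall n, measurable_fun setT (f_ n)) -> measurable_fun setT f ->
  measurable_fun setT g -> (Np mu p g < +oo)%E ->
  {ae mu, forall x, f_ ^~ x @ \oo --> f x} -> (forall n x, `|f_ n x| <= `|g x|) ->
  (fun n => Np mu p (fun x => f x - f_ n x)) @ \oo --> 0%E.
Proof.
move=> p0 mf_ mf mg gy ff fg.
pose F n x := (`|f x - f_ n x| `^ p)%:E.
pose G x := ((2 `^ p)%:E * (`|g x| `^ p)%:E)%E.
have mF n : measurable_fun setT (F n).
  by apply: measurable_powR_normE; exact: measurable_funB.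
have F0 : {ae mu, forall x, setT x -> F ^~ x @ \oo --> cst 0%E x}.
  apply: filterS ff => x fx _; rewrite /F /=.
  apply: cvg_EFin; first by apply: nearW => n; rewrite fin_numE.
  have : (fun n => f x - f_ n x) @ \oo --> 0.
    by rewrite -[X in _ --> X](subrr (f x)); apply: cvgB => //; exact: cvg_cst.
  have cp0 : {for (0 : R), continuous (fun t : R => `|t| `^ p)}.
    exact: continuous_normr_powR.
  by move=> /(continuous_cvg _ cp0); rewrite normr0 powR0 ?gt_eqF.
have iG : mu.-integrable setT G.
  apply: integrableZl => //; apply/integrableP; split; first exact: measurable_powR_normE.
  by under eq_integral do rewrite gee0_abs ?lee_fin ?powR_ge0//; rewrite -NpE.
have FG : {ae mu, forall x n, setT x -> (`|F n x| <= G x)%E}.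
  apply: filterS ff => x fx n _; rewrite /F /G gee0_abs ?lee_fin ?powR_ge0//.
  rewrite -powRM//; apply: powR_le => //; first exact: ltW.
  have fgx : `|f x| <= `|g x|.
    have cn : (fun n => `|f_ n x|) @ \oo --> `|f x| by exact: cvg_norm.
    rewrite -(cvg_lim _ cn)//; apply: limr_le; first by apply/cvg_ex; eexists; exact: cn.
    by apply: nearW => k; exact: fg.
  by apply: (le_trans (ler_normB _ _)); rewrite mulr_natl mulr2n lerD.
have [_ _] := dominated_convergence measurableT mF (measurable_cst _) F0 iG FG.
by rewrite integral_cst// mul0e; under eq_fun do rewrite -NpE.
Qed.

End any_measure.

Section finite_measure.
Variable mu : {finite_measure set T -> \bar R}.
Implicit Types (p c s e B C dl : R) (f g : T -> R).

Lemma Np_bounded p C f : 0 <= p -> measurable_fun setT f ->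
  (forall x, `|f x| <= C) -> (Np mu p f <= (C `^ p)%:E * mu setT)%E.
Proof.
move=> p0 mf fC; rewrite NpE -integral_cst//; apply: ge0_le_integral => //.
- exact: measurable_powR_normE.
- by move=> x _ /=; rewrite lee_fin powR_le.
Qed.

Lemma Np_bounded_lty p C f : 0 <= p -> measurable_fun setT f ->
  (forall x, `|f x| <= C) -> (Np mu p f < +oo)%E.
Proof.
move=> p0 mf fC; apply: (le_lt_trans (Np_bounded p0 mf fC)).
by rewrite -ge0_fin_numE ?mule_ge0 ?lee_fin ?powR_ge0// fin_numM// fin_num_measure.
Qed.

(** On a finite measure space, from $|f|\le 1+|f|^p$. *)
Lemma Lp_integrable p f : 1 <= p -> measurable_fun setT f -> (Np mu p f < +oo)%E ->
  mu.-integrable setT (EFin \o f).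
Proof.
move=> p1 mf fy; apply/integrableP; split; first exact/measurable_EFinP.
apply: (@le_lt_trans _ _ (\int[mu]_x (1%:E + (`|f x| `^ p)%:E))%E).
  apply: ge0_le_integral => //.
  - by apply: measurableT_comp => //; exact/measurable_EFinP.
  - by apply: emeasurable_funD; [exact: measurable_cst|exact: measurable_powR_normE].
  move=> x _ /=; rewrite -EFinD lee_fin.
  have [f1|/ltW f1] := leP `|f x| 1; first by rewrite (le_trans f1)// lerDl powR_ge0.
  rewrite (@le_trans _ _ (`|f x| `^ p))// ?lerDr// -[leLHS]powRr1//.
  exact: ler_powR.
rewrite ge0_integralD//; last exact: measurable_powR_normE.
by rewrite -NpE integral_cst// mul1e lte_add_pinfty// -ge0_fin_numE// fin_num_measure.
Qed.

(** Integrate the tangent inequality at $a=\int w|f|$ against the probability density [w]: its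
    linear part integrates to zero. The bound [C] makes all products integrable. *)
Lemma jensen_weighted p C (w f : T -> R) : 1 < p -> measurable_fun setT w ->
  measurable_fun setT f -> (forall x, 0 <= w x <= C) ->
  \int[mu]_x w x = 1 -> (Np mu p f < +oo)%E ->
  ((`|\int[mu]_x (w x * f x)| `^ p)%:E <= \int[mu]_x (w x * `|f x| `^ p)%:E)%E.
Proof.
move=> p1 mw mf wC w1 fy; have p0 := lt_trans (@ltr01 R) p1.
have iw : mu.-integrable setT (EFin \o w).
  apply: (Lp_integrable (lexx 1) mw); apply: (@Np_bounded_lty 1 C _ ler01 mw) => x.
  by have /andP[? ?] := wC x; rewrite ger0_norm.
have wM h : mu.-integrable setT (EFin \o h) ->
    mu.-integrable setT (EFin \o (fun x => w x * h x)).
  move=> ih; have mh : measurable_fun setT h by apply/measurable_EFinP; exact: measurable_int ih.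
  apply: (@le_integrable _ _ _ mu _ measurableT _ (fun x => (C%:E * (h x)%:E)%E)).
  - by apply/measurable_EFinP; exact: measurable_funM.
  - move=> x _ /=; rewrite lee_fin !normrM ler_wpM2r//.
    by have /andP[? ?] := wC x; rewrite !ger0_norm// (le_trans _ (_ : w x <= C)).
  - exact: integrableZl.
have ifp : mu.-integrable setT (EFin \o (fun x => `|f x| `^ p)).
  apply/integrableP; split; first exact: measurable_powR_normE.
  by under eq_integral do rewrite gee0_abs ?lee_fin ?powR_ge0//; rewrite -NpE.
have iff' : mu.-integrable setT (EFin \o f) by apply: Lp_integrable fy => //; exact: ltW.
have ifn : mu.-integrable setT (EFin \o (fun x => `|f x|)) by exact: (integrable_abse iff').
pose a := \int[mu]_x (w x * `|f x|).
have a0 : 0 <= a by apply: Rintegral_ge0 => x _; rewrite mulr_ge0//; case/andP: (wC x).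
have fa : `|\int[mu]_x (w x * f x)| <= a.
  apply: (le_trans (le_normr_Rintegral measurableT (wM _ iff'))).
  rewrite le_eqVlt; apply/orP; left; apply/eqP; apply: eq_Rintegral => x _.
  by rewrite normrM ger0_norm//; case/andP: (wC x).
apply: (@le_trans _ _ (a `^ p)%:E).
  by rewrite lee_fin; apply: powR_le => //; exact: ltW.
have -> : (\int[mu]_x (w x * `|f x| `^ p)%:E)%E = (\int[mu]_x (w x * `|f x| `^ p))%:E.
  by rewrite /Rintegral fineK//; apply: integrable_fin_num => //; exact: wM.
rewrite lee_fin.
have i1 : mu.-integrable setT (EFin \o (fun x => (a `^ p - p * a `^ (p - 1) * a) * w x)).
  exact: (integrableZl _ _ iw).
have i2 : mu.-integrable setT (EFin \o (fun x => (p * a `^ (p - 1)) * (w x * `|f x|))).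
  exact: (integrableZl _ _ (wM _ ifn)).
apply: (@le_trans _ _ (\int[mu]_x ((a `^ p - p * a `^ (p - 1) * a) * w x +
   (p * a `^ (p - 1)) * (w x * `|f x|)))).
  rewrite RintegralD// RintegralZl// w1 mulr1 RintegralZl ?subrK//.
  exact: wM.
apply: le_Rintegral => //.
- exact: (integrableD _ i1 i2).
- exact: wM.
move=> x _; have /andP[w0 _] := wC x.
have := ler_wpM2l w0 (powR_tangent p1 a0 (normr_ge0 (f x))).
by apply: le_trans; rewrite le_eqVlt; apply/orP; left; apply/eqP; ring.
Qed.

End finite_measure.
End Lp_integrals.

Lemma powRV (R : realType) (a p : R) : 0 <= a -> a^-1 `^ p = (a `^ p)^-1.
Proof. by move=> a0; rewrite -powR_inv1// -powRrM mulN1r powRN. Qed.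

(** * An induction principle for $L^p$ *)

Section Lp_induction.
Context d (T : measurableType d) {R : realType} (mu : {finite_measure set T -> \bar R}).
Implicit Types (p c e : R) (f g : T -> R).

(** A monotone class principle: a property stable under sums, scaling and $L^p$ limits holds
    everywhere once it holds for the indicators of a generating $\pi$-system. It is used with the
    open sets, once for the density of test functions and once for the convergence of
    convolutions. *)
Lemma Lp_induction p (G : set (set T)) (P : (T -> R) -> Prop) :
  1 <= p -> measurable = <<s G >> -> setI_closed G -> G setT ->
  (forall A, G A -> P \1_A) ->
  (forall f g, measurable_fun setT f -> measurable_fun setT g ->
    (Np mu p f < +oo)%E -> (Np mu p g < +oo)%E -> P f -> P g ->
    P (fun x => f x + g x)) ->
  (forall c f, measurable_fun setT f -> (Np mu p f < +oo)%E -> P f ->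
    P (fun x => c * f x)) ->
  (forall f, measurable_fun setT f -> (Np mu p f < +oo)%E ->
    (forall e, 0 < e -> exists g, [/\ measurable_fun setT g, (Np mu p g < +oo)%E,
       P g & (Np mu p (fun x => f x - g x)%R <= e%:E)%E]) -> P f) ->
  forall f, measurable_fun setT f -> (Np mu p f < +oo)%E -> P f.
Proof.
move=> p1 mG GI GT PG PD PZ Pcl.
have p0 : 0 < p by exact: lt_le_trans p1.
have mindic A : measurable A -> measurable_fun setT (\1_A : T -> R).
  by move=> mA; exact: measurable_indic.
have indicy A : measurable A -> (Np mu p \1_A < +oo)%E.
  move=> mA; apply: (@Np_bounded_lty _ _ _ _ p 1 _ (ltW p0) (mindic A mA)) => x.
  by rewrite indicE; case: (_ \in _); rewrite ?normr1 ?normr0.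
(* Dominated pointwise limits stay in [P], since dominated convergence makes them $L^p$ limits. *)
have Plim (f_ : nat -> T -> R) f g : (forall n, measurable_fun setT (f_ n)) ->
    measurable_fun setT f -> measurable_fun setT g -> (Np mu p g < +oo)%E ->
    (forall x, f_ ^~ x @ \oo --> f x) -> (forall n x, `|f_ n x| <= `|g x|) ->
    (Np mu p f < +oo)%E -> (forall n, P (f_ n)) -> P f.
  move=> mf_ mf mg gy ff fg fy Pf_; apply: Pcl => // e e0.
  have := Np_dct p0 mf_ mf mg gy (aeW _ ff) fg.
  move=> /fine_cvgP[fin cv]; have [N _ HN] := fin.
  move/cvgrPdist_lt : cv => /(_ _ e0) [M _ HM].
  pose k := maxn N M; exists (f_ k); split => //.
    by apply: (le_lt_trans _ gy); apply: (Np_le mu (ltW p0)).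
  have := HM k (leq_maxr _ _); have := HN k (leq_maxl _ _) => /= fk.
  rewrite sub0r normrN => H; rewrite -(fineK fk) lee_fin ltW//.
  by apply: le_lt_trans H; rewrite ler_norm.
have PA A : measurable A -> P \1_A.
  suff : <<s G >> `<=` [set A | measurable A /\ P \1_A].
    by rewrite -mG => H mA; have [] := H _ mA.
  have mG' B : G B -> measurable B by move=> GB; rewrite mG; exact: sub_sigma_algebra.
  apply: lambda_system_subset => //; last first.
    by move=> B GB; split; [exact: mG'|exact: PG].
  split => //.
  - by split; [exact: measurableT|exact: PG].
  - move=> A0 B BA [mA PA0] [mB PB]; split; first exact: measurableD.
    have -> : \1_(A0 `\` B) = (fun x => \1_A0 x + (-1) * \1_B x) :> (T -> R).
      apply/funext => x; rewrite !indicE in_setD.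
      have [xB|xB] := boolP (x \in B).
        by rewrite andbF (mem_set (BA _ (set_mem xB))) mulN1r subrr.
      by rewrite andbT mulr0 addr0.
    apply: PD; [exact: mindic| |exact: indicy| |exact: PA0|].
    + by apply: measurable_funM => //; exact: mindic.
    + by rewrite NpZ ?normrN1 ?powR1 ?mul1e ?indicy//; exact: mindic.
    + by apply: PZ; [exact: mindic|exact: indicy|exact: PB].
  - move=> F ndF HF; have mF i : measurable (F i) by have [] := HF i.
    have mU : measurable (\bigcup_i F i) by exact: bigcupT_measurable.
    split => //; apply: (Plim (fun n => \1_(F n)) _ (cst 1)).
    + by move=> n; exact: mindic.
    + exact: mindic.
    + exact: measurable_cst.
    + by apply: (@Np_bounded_lty _ _ _ _ p 1) => //; [exact: ltW|move=> x; rewrite normr1].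
    + move=> x; rewrite indicE; have [|xU] := boolP (x \in _).
        move=> /set_mem[n _ Fnx]; apply: cvg_near_cst.
        exists n => // k /= nk; rewrite indicE mem_set//.
        by move/subsetPset : (ndF _ _ nk); exact.
      apply: cvg_near_cst; exists 0%N => // k _ /=; rewrite indicE memNset//.
      by move: xU; rewrite notin_setE => xU Fk; apply: xU; exists k.
    + move=> n x; rewrite indicE normr1; case: (_ \in _); by rewrite ?normr1 ?normr0.
    + exact: indicy.
    + by move=> n; have [] := HF n.
have P0 : P (fun=> 0).
  have -> : (fun=> 0) = (fun x => 0 * \1_[set: T] x) :> (T -> R) by apply/funext => x; rewrite mul0r.
  by apply: PZ; [exact: mindic|exact: indicy|exact: PA].
have Pnn (h : {nnsfun T >-> R}) : P h.
  have [t ->] : exists t : seq R, (h : T -> R) = (fun x => \sum_(y <- t) y * \1_(h @^-1` [set y]) x).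
    by eexists; apply/funext => x; rewrite {1}fimfunE fsbig_finite.
  have mh y : measurable (h @^-1` [set y]) by exact: measurable_funPTI.
  suff H (s : seq R) : P (fun x => \sum_(y <- s) y * \1_(h @^-1` [set y]) x) by exact: H.
  elim: s => [|y s IH].
    by under eq_fun do rewrite big_nil.
  have mterm z : measurable_fun setT (fun x => z * \1_(h @^-1` [set z]) x : R).
    by apply: measurable_funM => //; exact: mindic.
  have fterm z : (Np mu p (fun x => z * \1_(h @^-1` [set z]) x)%R < +oo)%E.
    rewrite NpZ; last exact: mindic.
    by rewrite -ge0_fin_numE ?mule_ge0 ?Np_ge0 ?lee_fin ?powR_ge0// fin_numM// ge0_fin_numE ?Np_ge0 ?indicy.
  under eq_fun do rewrite big_cons.
  apply: PD => //.
  - by apply: measurable_sum => z.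
  - elim: s {IH} => [|z s IHs].
      by under eq_fun do rewrite big_nil; rewrite Np0.
    under eq_fun do rewrite big_cons.
    apply: (le_lt_trans (NpD mu (ltW p0) (mterm z) _)); first by apply: measurable_sum => ?.
    rewrite -ge0_fin_numE ?mule_ge0 ?adde_ge0 ?Np_ge0 ?lee_fin ?powR_ge0//.
    by rewrite fin_numM// fin_numD !ge0_fin_numE ?Np_ge0 ?fterm.
  - by apply: PZ; [exact: mindic|exact: indicy|exact: PA].
have Pge0 f : measurable_fun setT f -> (Np mu p f < +oo)%E -> (forall x, 0 <= f x) -> P f.
  move=> mf fy f0; have mEf : measurable_fun setT (EFin \o f) by exact/measurable_EFinP.
  pose h n := nnsfun_approx measurableT mEf n.
  have hcv x : (fun n => h n x) @ \oo --> f x.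
    have f0' : forall x, setT x -> (0 <= (EFin \o f) x)%E by move=> y _; rewrite lee_fin.
    by have /fine_cvgP[_] := @cvg_nnsfun_approx _ _ _ _ measurableT _ mEf f0' x I.
  apply: (Plim (fun n => h n) f f) => //.
  move=> n x; rewrite !ger0_norm//.
  have nd : nondecreasing_seq (fun n => h n x).
    by move=> a b ab; have /lefP := nd_nnsfun_approx measurableT mEf ab; exact.
  rewrite -(cvg_lim _ (hcv x))//.
  by apply: (nondecreasing_cvgn_le nd); apply/cvg_ex; eexists; exact: hcv.
move=> f mf fy.
pose fp x := Num.max (f x) 0; pose fn x := Num.max (- f x) 0.
have mfp : measurable_fun setT fp by exact: measurable_maxr.
have mfn : measurable_fun setT fn.
  by apply: measurable_maxr => //; exact: measurableT_comp.
have fpy : (Np mu p fp < +oo)%E.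
  apply: le_lt_trans fy; apply: Np_le => // [|x]; first exact: ltW.
  by rewrite /fp; case: (leP (f x) 0) => // ; rewrite normr0.
have fny : (Np mu p fn < +oo)%E.
  apply: le_lt_trans fy; apply: Np_le => // [|x]; first exact: ltW.
  by rewrite /fn; case: (leP (- f x) 0) => //; rewrite ?normr0 ?normrN.
have -> : f = (fun x => fp x + (-1) * fn x).
  apply/funext => x; rewrite /fp /fn mulN1r; have [f0|f0] := leP (f x) 0.
    by rewrite max_l ?oppr_ge0// opprK add0r.
  by rewrite max_r ?oppr_le0 ?ltW// subr0.
apply: PD => //.
- exact: measurable_funM.
- by rewrite NpZ// normrN1 powR1 mul1e.
- by apply: Pge0 => // x; rewrite le_max lexx orbT.
- by apply: PZ => //; apply: Pge0 => // x; rewrite le_max lexx orbT.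
Qed.

End Lp_induction.

(** * Strong limits of convex combinations *)

(** Only midpoints are generated, hence dyadic convex combinations; the midpoint of two functions is
    all that uniform convexity compares. *)
Inductive tail_mean (T : Type) (R : realType) (u : nat -> T -> R) (N : nat) : (T -> R) -> Prop :=
| tail_mean_base j : (N <= j)%N -> tail_mean u N (u j)
| tail_mean_mid w w' : tail_mean u N w -> tail_mean u N w' ->
    tail_mean u N (fun x => (w x + w' x) / 2).

Lemma tail_meanW (T : Type) (R : realType) (u : nat -> T -> R) (N M : nat) w :
  (N <= M)%N -> tail_mean u M w -> tail_mean u N w.
Proof.
move=> NM; elim=> [j Mj|f g _ Hf _ Hg]; last exact: tail_mean_mid.
exact/tail_mean_base/(leq_trans NM).
Qed.

(** With $r_k$ the remaining tail of the geometric series, $z_k-r_k$ increases and $z_k+r_k$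
    decreases. Monotone convergence gives both the limit and the rate. *)
Lemma geometric_cvg (R : realType) (z : nat -> R) (A : R) : 0 <= A ->
  (forall k, `|z k.+1 - z k| <= A * 2^-1 ^+ k) ->
  cvgn z /\ (forall k, `|z k - limn z| <= 2 * A * 2^-1 ^+ k).
Proof.
move=> A0 zA.
pose r k := 2 * A * (2^-1 : R) ^+ k.
have r0 k : 0 <= r k by rewrite !mulr_ge0// exprn_ge0// invr_ge0.
have rS k : r k - r k.+1 = A * 2^-1 ^+ k by rewrite /r exprS; field.
pose a k := z k - r k; pose b k := z k + r k.
have nda : nondecreasing_seq a.
  apply/nondecreasing_seqP => k; have := zA k; rewrite -rS ler_distl /a; lra.
have nib : nonincreasing_seq b.
  apply/nonincreasing_seqP => k; have := zA k; rewrite -rS ler_distl /b; lra.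
have ab k l : a k <= b l.
  have := nda k (maxn k l) (leq_maxl _ _); have := nib l (maxn k l) (leq_maxr _ _).
  by have := r0 (maxn k l); rewrite /a /b; lra.
have ca : cvgn a.
  apply: nondecreasing_is_cvgn => //; exists (b 0%N) => _ [k _ <-]; exact: ab.
have cr : r @ \oo --> 0.
  rewrite -(mulr0 (2 * A)); apply: cvgMr; apply: cvg_expr.
  by rewrite ger0_norm ?invr_ge0// invf_lt1// ltr1n.
have cz : z @ \oo --> limn a.
  have -> : z = a \+ r by apply/funext => k /=; rewrite /a subrK.
  by rewrite -[X in _ --> X]addr0; apply: cvgD.
have lz := cvg_lim (@Rhausdorff R) cz.
split; first by apply/cvg_ex; exists (limn a).
move=> k; rewrite lz ler_distl -/(r k); apply/andP; split.
  have : limn a <= b k by apply: limr_le => //; apply: nearW => l; exact: ab.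
  by rewrite /b; lra.
have : a k <= limn a by apply: nondecreasing_cvgn_le.
by rewrite /a; lra.
Qed.

Section Lp_mean_limit.
Context d (T : measurableType d) {R : realType} (mu : {finite_measure set T -> \bar R}).
Implicit Types (p c e : R) (f g : T -> R).

(** Riesz-Fischer with $p$-th powers: along a fast subsequence the sum of $c_k|z_{k+1}-z_k|^p$ with
    weights $c_k=2^{kp}$ is integrable, and wherever it is finite the increments are $O(2^{-k})$. *)
Lemma Lp_cauchy_limit p (w : nat -> T -> R) : 1 < p ->
  (forall n, measurable_fun setT (w n)) -> (forall n, (Np mu p (w n) < +oo)%E) ->
  (forall e, 0 < e -> exists N, forall n m, (N <= n)%N -> (N <= m)%N ->
     (Np mu p (fun x => w n x - w m x)%R <= e%:E)%E) ->
  exists v, [/\ measurable_fun setT v, (Np mu p v < +oo)%E &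
    forall e N, 0 < e -> exists2 n, (N <= n)%N &
     (Np mu p (fun x => w n x - v x)%R <= e%:E)%E].
Proof.
move=> p1 mw wy cw; have p0 : 0 < p by exact: lt_trans p1.
pose c k : R := 2 `^ (k%:R * p).
have c0 k : 0 < c k by rewrite powR_gt0.
pose r k : R := (2^-1 ^+ k) / c k.
have r0 k : 0 < r k by rewrite divr_gt0// exprn_gt0// invr_gt0.
have /choice[N HN] k : exists N, forall n m, (N <= n)%N -> (N <= m)%N ->
  (Np mu p (fun x => w n x - w m x)%R <= (r k)%:E)%E by exact: cw.
(* These partial sums increase strictly and dominate both $N_k$ and $k$. *)
pose K k := (\sum_(i < k.+1) (N i).+1)%N.
have NK k : (N k <= K k)%N.
  by rewrite /K big_ord_recr/= (leq_trans (leqnSn _))// leq_addl.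
have KS k : (K k < K k.+1)%N by rewrite /K [in ltnRHS]big_ord_recr/= -addn1 leq_add2l.
have kK k : (k <= K k)%N by elim: k => // k IH; exact: leq_ltn_trans (KS k).
pose z k := w (K k).
have mz k : measurable_fun setT (z k) by exact: mw.
have zz k : (Np mu p (fun x => z k.+1 x - z k x)%R <= (r k)%:E)%E.
  by apply: HN => //; rewrite (leq_trans (NK k))// ltnW.
pose t k x := ((c k)%:E * (`|z k.+1 x - z k x| `^ p)%:E)%E.
have mt k : measurable_fun setT (t k).
  apply: emeasurable_funM; first exact: measurable_cst.
  by apply: measurable_powR_normE; exact: measurable_funB.
have t0 k x : setT x -> (0 <= t k x)%E.
  by move=> _; rewrite mule_ge0// lee_fin ?powR_ge0// ltW.
pose S x := (\sum_(0 <= k <oo) t k x)%E.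
have S0 x : (0 <= S x)%E by apply: nneseries_ge0 => k _ _; exact: t0.
have mS : measurable_fun setT S.
  by apply: (@ge0_emeasurable_sum _ _ _ _ t xpredT) => // k x _ _; exact: t0.
have iS : (\int[mu]_x S x <= 2%:E)%E.
  rewrite /S integral_nneseries//.
  apply: (@le_trans _ _ (\sum_(0 <= k <oo) ((2^-1 : R) ^+ k)%:E)%E).
    apply: lee_nneseries; first by move=> *; apply: integral_ge0 => x _; exact: t0.
    move=> k _.
    rewrite ge0_integralZl_EFin//; last 2 first.
      by apply: measurable_powR_normE; exact: measurable_funB.
      exact: ltW.
    rewrite -NpE; apply: (@le_trans _ _ ((c k)%:E * (r k)%:E)%E).
      by rewrite lee_wpmul2l// lee_fin ltW.
    by rewrite -EFinM lee_fin /r mulrCA divff ?mulr1// gt_eqF.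
  have := @cvg_geometric_eseries_half R 1 0.
  rewrite /eseries /= => H.
  have h : (fun n => (\sum_(0 <= k < n) ((2^-1 : R) ^+ k)%:E)%E) @ \oo --> 2%:E.
    apply: (@cvg_trans _ ((fun n => (\sum_(0 <= k < n) (2^-1 ^+ k))%:E) @ \oo)).
      by apply: near_eq_cvg; near=> n; rewrite sumEFin.
    apply: cvg_EFin; first by apply: nearW.
    have := @cvg_geometric_series R 1 2^-1.
    rewrite ger0_norm ?invr_ge0// invf_lt1// ltr1n => /(_ isT).
    rewrite (_ : 1 / (1 - 2^-1) = 2 :> R); last by field.
    rewrite /series /geometric/=; apply: cvg_trans; apply: near_eq_cvg; near=> n.
    by apply: eq_bigr => k _; rewrite mul1r.
  by rewrite (cvg_lim _ h).
have iS' : mu.-integrable setT S.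
  apply/integrableP; split => //; under eq_integral do rewrite gee0_abs//.
  exact: le_lt_trans iS (ltry _).
(* The upper limit is measurable before any convergence is known; it is the limit wherever [S] is
   finite, hence almost everywhere. *)
pose v x := fine (limn_esup (fun k => (z k x)%:E)).
have mv : measurable_fun setT v.
  apply: measurableT_comp => //; apply: measurable_fun_limn_esup => k.
  exact/measurable_EFinP.
(* From $|z_k-v|\le 2A\,2^{-k}$ with $A^p=S$. Integrating, the weight $c_k$ in the denominator gives
   the convergence. *)
have vz : {ae mu, forall x, forall k, (`|z k x - v x| `^ p)%:E <= ((2 `^ p) / c k)%:E * S x}%E.
  apply: filterS (integrable_ae measurableT iS') => x /(_ I) Sx k.
  have tS j : (t j x <= S x)%E.
    apply: le_trans (nneseries_lim_ge j.+1 _); last by move=> ? _ _; exact: t0.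
    by rewrite big_nat_recr//= leeDr// sume_ge0// => ? _; exact: t0.
  pose A := fine (S x) `^ p^-1.
  have A0 : 0 <= A by exact: powR_ge0.
  have Ap : A `^ p = fine (S x).
    by rewrite -powRrM mulVf ?gt_eqF// powRr1// fine_ge0.
  have cE j : c j = (2 ^+ j) `^ p by rewrite /c powRrM powR_mulrn.
  have zA j : `|z j.+1 x - z j x| <= A * 2^-1 ^+ j.
    have := tS j; rewrite /t -(fineK Sx) -EFinM lee_fin -Ap => H.
    rewrite exprVn ler_pdivlMr ?exprn_gt0// leNgt; apply/negP => H'.
    move: H; rewrite leNgt => /negP; apply.
    rewrite cE -powRM ?exprn_ge0//; apply: gt0_ltr_powR; rewrite ?nnegrE//.
    by rewrite mulrC.
  have [cz lz] := geometric_cvg A0 zA.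
  have vE : v x = limn (fun j => z j x).
    rewrite /v (_ : limn_esup _ = (limn (fun j => z j x))%:E)//.
    apply/esym; have H : (fun j => (z j x)%:E) @ \oo --> (limn (fun j => z j x))%:E.
      by apply: cvg_EFin; first exact: nearW.
    by have [_ ->] := cvg_limn_einf_sup H.
  rewrite -(fineK Sx) -EFinM lee_fin -Ap vE cE.
  apply: (@le_trans _ _ ((2 * A * 2^-1 ^+ k) `^ p)).
    by apply: powR_le; [exact: ltW|by []|exact: lz].
  rewrite !powRM ?mulr_ge0 ?exprn_ge0 ?invr_ge0//.
  by rewrite exprVn powRV ?exprn_ge0// mulrAC.
have zv k : (Np mu p (fun x => z k x - v x)%R <= ((2 `^ p) / c k * 2)%:E)%E.
  rewrite NpE EFinM; apply: (@le_trans _ _ (\int[mu]_x (((2 `^ p) / c k)%:E * S x))%E).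
    apply: ae_ge0_le_integral => //.
    - by apply: measurable_powR_normE; exact: measurable_funB.
    - by move=> x _; rewrite mule_ge0// lee_fin divr_ge0 ?powR_ge0// ltW.
    - by apply: emeasurable_funM => //; exact: measurable_cst.
    - by apply: filterS vz => x /(_ k) + _.
  rewrite ge0_integralZl_EFin//; last by rewrite divr_ge0 ?powR_ge0// ltW.
  by rewrite lee_wpmul2l// lee_fin divr_ge0 ?powR_ge0// ltW.
exists v; split => //.
  have -> : v = (fun x => z 0%N x - (z 0%N x - v x)) by apply/funext => x; rewrite subKr.
  apply: (le_lt_trans (NpB mu (ltW p0) (mz 0%N) _)); first exact: measurable_funB.
  rewrite -ge0_fin_numE ?mule_ge0 ?adde_ge0 ?Np_ge0 ?lee_fin ?powR_ge0//.
  rewrite fin_numM// fin_numD !ge0_fin_numE ?Np_ge0// (wy _)/=.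
  exact: le_lt_trans (zv 0%N) (ltry _).
move=> e M e0.
have : (fun k => 2 `^ p * 2 * (2 `^ (- p)) ^+ k) @ \oo --> 0.
  rewrite -[X in _ --> X](mulr0 (2 `^ p * 2)); apply: cvgMr; apply: cvg_expr.
  rewrite ger0_norm ?powR_ge0// powRN invf_lt1 ?powR_gt0//.
  have : (1 : R) `^ p < 2 `^ p by apply: gt0_ltr_powR; rewrite ?nnegrE// ltr1n.
  by rewrite powR1.
move/cvgrPdist_lt => /(_ _ e0)[k0 _ Hk].
pose k := maxn k0 M.
exists (K k); first by rewrite (leq_trans _ (kK k))// leq_maxr.
apply: (le_trans (zv k)); rewrite lee_fin.
have := Hk k (leq_maxl _ _); rewrite sub0r normrN => H.
apply: (le_trans _ (ltW (le_lt_trans (ler_norm _) H))).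
rewrite -powR_mulrn ?powR_ge0// -powRrM mulNr powRN [p * _]mulrC -/(c k).
by rewrite mulrAC.
Unshelve. all: by end_near. Qed.

Lemma tail_mean_Np p (u : nat -> T -> R) (C : R) N w : 1 < p ->
  (forall n, measurable_fun setT (u n)) -> (forall n, (Np mu p (u n) <= C%:E)%E) ->
  tail_mean u N w -> measurable_fun setT w /\ (Np mu p w <= C%:E)%E.
Proof.
move=> p1 mu_ uC; elim=> [j _|f g _ [mf fC] _ [mg gC]]; first by split.
have mfg : measurable_fun setT (fun x => (f x + g x) / 2).
  by apply: measurable_funM => //; exact: measurable_funD.
split => //.
apply: (@le_trans _ _ (2^-1%:E * (Np mu p f + Np mu p g))%E).
  rewrite !NpE -ge0_integralD//; last 2 first.
    exact: measurable_powR_normE.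
    exact: measurable_powR_normE.
  rewrite -ge0_integralZl_EFin ?invr_ge0//; last 2 first.
    by move=> x _; rewrite -EFinD lee_fin addr_ge0 ?powR_ge0.
    by apply: emeasurable_funD; exact: measurable_powR_normE.
  apply: ge0_le_integral => //.
  - exact: measurable_powR_normE.
  - apply: emeasurable_funM; first exact: measurable_cst.
    by apply: emeasurable_funD; exact: measurable_powR_normE.
  - move=> x _; rewrite -EFinD -EFinM lee_fin -subr_ge0 mulrC.
    exact: (cvx_gap_ge0 (f x) (g x) p1).
apply: (@le_trans _ _ (2^-1%:E * (C%:E + C%:E))%E).
  by rewrite lee_wpmul2l ?lee_fin ?invr_ge0// leeD.
by rewrite -EFinD -EFinM lee_fin; lra.
Qed.

(* Strong limits of convex combinations replace weak compactness: almost minimal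
   elements of the convex hulls of the tails form a Cauchy sequence by uniform
   convexity. *)
Lemma tail_mean_limit p (u : nat -> T -> R) (C : R) : 1 < p ->
  (forall n, measurable_fun setT (u n)) -> (forall n, (Np mu p (u n) <= C%:E)%E) ->
  exists v, [/\ measurable_fun setT v, (Np mu p v < +oo)%E &
    forall e N, 0 < e -> exists2 w, tail_mean u N w &
     (Np mu p (fun x => w x - v x)%R <= e%:E)%E].
Proof.
move=> p1 mu_ uC; have p0 : 0 < p by exact: lt_trans p1.
have C0 : 0 <= C by have := le_trans (Np_ge0 mu p (u 0%N)) (uC 0%N); rewrite lee_fin.
have tm N w : tail_mean u N w -> measurable_fun setT w by move=> /(tail_mean_Np p1 mu_ uC)[].
have tC N w : tail_mean u N w -> (Np mu p w <= C%:E)%E by move=> /(tail_mean_Np p1 mu_ uC)[].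
have tf N w : tail_mean u N w -> Np mu p w \is a fin_num.
  by move=> /tC H; rewrite ge0_fin_numE ?Np_ge0// (le_lt_trans H) ?ltry.
pose S N := [set fine (Np mu p w) | w in tail_mean u N].
have S0 N : S N !=set0 by exists (fine (Np mu p (u N))); exists (u N) => //; exact: tail_mean_base.
have Sl N : lbound (S N) 0 by move=> _ [w _ <-]; exact/fine_ge0/Np_ge0.
have hiS N : has_inf (S N) by split => //; exists 0.
(* The infimum of [Np] over the means of a tail increases with the tail and stays below [C], so it
   converges. *)
pose D N := inf (S N).
have DW N w : tail_mean u N w -> D N <= fine (Np mu p w).
  by move=> tw; apply: ge_inf; [exists 0|exists w].
have DM N M : (N <= M)%N -> D N <= D M.
  move=> NM; apply: lb_le_inf => // _ [w tw <-].
  exact/DW/(tail_meanW NM).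
have DC N : D N <= C.
  apply: (le_trans (DW _ _ (tail_mean_base u (leqnn N)))).
  have tb := tail_mean_base u (leqnn N).
  by rewrite -lee_fin (fineK (tf _ _ tb)); exact: tC tb.
have cD : cvgn D.
  by apply: nondecreasing_is_cvgn; [move=> ? ? /DM|exists C => _ [k _ <-]].
have DL N : D N <= limn D by apply: nondecreasing_cvgn_le => // ? ? /DM.
have /choice[w Hw] N : exists w, tail_mean u N w /\ fine (Np mu p w) <= D N + N.+1%:R^-1.
  have e0 : (0 : R) < N.+1%:R^-1 by rewrite invr_gt0.
  have [_ [w tw <-] H] := inf_adherent e0 (hiS N).
  by exists w; split => //; exact: ltW.
have tw N : tail_mean u N (w N) by have [] := Hw N.
have Dw N : fine (Np mu p (w N)) <= D N + N.+1%:R^-1 by have [] := Hw N.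
have mw N := tm _ _ (tw N).
pose gap N M := (\int[mu]_x (cvx_gap p (w N x) (w M x))%:E)%E.
have mgap N M : measurable_fun setT (fun x => cvx_gap p (w N x) (w M x)).
  apply: measurable_funB.
    apply: measurable_funM => //; apply: measurable_funD; exact: measurable_powR_norm.
  apply: measurable_powR_norm; apply: measurable_funM => //; exact: measurable_funD.
(* The midpoint of [w N] and [w M] is a mean of the [N]-th tail, so its [Np] is at least [D N],
   while both functions are nearly minimal in their tails. The gap is squeezed between. *)
have gapE N M : (N <= M)%N -> (gap N M <= ((limn D - D N) / 2 + N.+1%:R^-1)%:E)%E.
  move=> NM.
  pose mid x := (w N x + w M x) / 2.
  have tmid : tail_mean u N mid by apply: tail_mean_mid => //; exact: tail_meanW (tw M).
  have H : (gap N M + Np mu p mid = 2^-1%:E * (Np mu p (w N) + Np mu p (w M)))%E.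
    rewrite !NpE -!ge0_integralD//; last 5 first.
    - exact: measurable_powR_normE.
    - exact: measurable_powR_normE.
    - by move=> x _; rewrite lee_fin cvx_gap_ge0.
    - exact/measurable_EFinP.
    - by apply: measurable_powR_normE; exact: tm tmid.
    rewrite -ge0_integralZl_EFin ?invr_ge0//; last 2 first.
      by move=> x _; rewrite -EFinD lee_fin addr_ge0 ?powR_ge0.
      by apply: emeasurable_funD; exact: measurable_powR_normE.
    apply: eq_integral => x _; rewrite -!EFinD -EFinM /cvx_gap /mid subrK.
    by rewrite mulrC.
  have fm := tf _ _ tmid; have fN := tf _ _ (tw N); have fM := tf _ _ (tw M).
  rewrite -(leeD2rE _ _ fm) H -(fineK fm) -(fineK fN) -(fineK fM) -!EFinD -EFinM lee_fin.
  have := DW _ _ tmid; have := Dw N; have := Dw M; have := DL M.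
  have : (M.+1%:R^-1 : R) <= N.+1%:R^-1 by rewrite lef_pV2 ?posrE// ler_nat ltnS.
  move: (N.+1%:R^-1) (M.+1%:R^-1) (fine _) (fine _) (fine _) (limn D) (D M) (D N) => *.
  lra.
have cau e : 0 < e -> exists N, forall n m, (N <= n)%N -> (N <= m)%N ->
     (Np mu p (fun x => w n x - w m x)%R <= e%:E)%E.
  (* [dl] makes the share of the two norms, at most $2C$ together, cost [e / 2]; [eta] does the same
     for the gap term with factor [K]. *)
  move=> e0; pose dl := e / (4 * (C + 1)).
  have dl0 : 0 < dl by rewrite divr_gt0// mulr_gt0// ltr_wpDl.
  have [K K0 HK] := cvx_gap_uniform p1 dl0.
  pose eta := e / (2 * (K + 1)).
  have eta0 : 0 < eta by rewrite divr_gt0// mulr_gt0// ltr_wpDl.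
  have e2 : 0 < eta / 2 by rewrite divr_gt0.
  have [N1 _ H1] : \forall N \near \oo, limn D - D N <= eta.
    have /cvgrPdist_le/(_ _ eta0) := cD; apply: filterS => N; exact: le_trans (ler_norm _).
  have [N2 _ H2] : \forall N \near \oo, (N.+1%:R^-1 : R) <= eta / 2.
    have /cvgrPdist_le/(_ _ e2) := @cvg_harmonic R; apply: filterS => N.
    by rewrite sub0r normrN /harmonic ger0_norm// invr_ge0.
  exists (maxn N1 N2).
  suff W n m : (maxn N1 N2 <= n)%N -> (n <= m)%N -> (Np mu p (fun x => w n x - w m x)%R <= e%:E)%E.
    move=> n m Nn Nm; have [nm|/ltnW mn] := leqP n m; first exact: W.
    by rewrite NpC; exact: W.
  move=> Nn nm.
  have g1 : (gap n m <= eta%:E)%E.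
    apply: (le_trans (gapE _ _ nm)); rewrite lee_fin.
    have := H1 n (leq_trans (leq_maxl _ _) Nn); have := H2 n (leq_trans (leq_maxr _ _) Nn).
    by move: (n.+1%:R^-1) (limn D) (D n) => *; lra.
  apply: (@le_trans _ _ (dl%:E * (Np mu p (w n) + Np mu p (w m)) + K%:E * gap n m)%E).
    rewrite !NpE -ge0_integralD//; last 2 first.
      exact: measurable_powR_normE.
      exact: measurable_powR_normE.
    rewrite -!ge0_integralZl_EFin ?(ltW dl0)//; last 4 first.
    - by move=> x _; rewrite lee_fin cvx_gap_ge0.
    - exact/measurable_EFinP.
    - by move=> x _; rewrite -EFinD lee_fin addr_ge0 ?powR_ge0.
    - by apply: emeasurable_funD; exact: measurable_powR_normE.
    have mA : measurable_fun setT (fun x => dl%:E * ((`|w n x| `^ p)%:E + (`|w m x| `^ p)%:E))%E.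
      apply: emeasurable_funM; first exact: measurable_cst.
      by apply: emeasurable_funD; exact: measurable_powR_normE.
    have mB : measurable_fun setT (fun x => K%:E * (cvx_gap p (w n x) (w m x))%:E)%E.
      by apply: emeasurable_funM; [exact: measurable_cst|exact/measurable_EFinP].
    rewrite -ge0_integralD//; last 2 first.
      by move=> x _; rewrite -EFinD -EFinM lee_fin mulr_ge0 ?addr_ge0 ?powR_ge0// ltW.
      by move=> x _; rewrite -EFinM lee_fin mulr_ge0// cvx_gap_ge0.
    apply: ge0_le_integral => //.
    - by apply: measurable_powR_normE; exact: measurable_funB.
    - exact: emeasurable_funD.
    - by move=> x _; have := HK (w n x) (w m x); rewrite -lee_fin EFinD !EFinM EFinD.
  apply: (@le_trans _ _ (dl%:E * (C%:E + C%:E) + K%:E * eta%:E)%E).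
    apply: leeD; first by rewrite lee_wpmul2l ?lee_fin ?(ltW dl0)// leeD// (tC _ _ (tw _)).
    by rewrite lee_wpmul2l// lee_fin.
  suff H : dl * (C + C) + K * eta <= e by move: H; rewrite -lee_fin EFinD !EFinM EFinD.
  have : dl * (C + C) <= e / 2.
    rewrite /dl mulrAC ler_pdivrMr ?mulr_gt0 ?ltr_wpDl//.
    rewrite (_ : e / 2 * _ = e * (2 * (C + 1))); last by field.
    by rewrite ler_wpM2l ?(ltW e0)//; lra.
  have : K * eta <= e / 2.
    rewrite /eta mulrA ler_pdivrMr ?mulr_gt0 ?ltr_wpDl//.
    rewrite (_ : e / 2 * _ = (K + 1) * e); last by field.
    by rewrite ler_wpM2r ?(ltW e0)//; lra.
  lra.
have wy n : (Np mu p (w n) < +oo)%E by exact: le_lt_trans (tC _ _ (tw n)) (ltry _).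
have [v [mv vy Hv]] := Lp_cauchy_limit p1 mw wy cau.
exists v; split => // e N e0; have [n Nn H] := Hv e N e0.
by exists (w n) => //; exact: tail_meanW (tw n).
Qed.

End Lp_mean_limit.

(** * Continuity and smoothness of functions of several variables *)

Lemma continuous_addr (R : realType) (T : topologicalType) (f g : T -> R) :
  continuous f -> continuous g -> continuous (fun x => f x + g x).
Proof. by move=> cf cg x; exact: (cvgD (cf x) (cg x)). Qed.

Lemma continuous_mulr (R : realType) (T : topologicalType) (f g : T -> R) :
  continuous f -> continuous g -> continuous (fun x => f x * g x).
Proof. by move=> cf cg x; exact: (cvgM (cf x) (cg x)). Qed.

Lemma continuous_sumr (R : realType) (T : topologicalType) (I : Type)
    (F : I -> T -> R) (s : seq I) :
  (forall i, continuous (F i)) -> continuous (fun x => \sum_(i <- s) F i x).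
Proof.
move=> cF; elim: s => [|i s IH].
  by under eq_fun do rewrite big_nil; exact: cst_continuous.
under eq_fun do rewrite big_cons.
by move=> x; exact: (cvgD (cF i x) (IH x)).
Qed.

Lemma continuous_prodr (R : realType) (T : topologicalType) (I : Type)
    (F : I -> T -> R) (s : seq I) :
  (forall i, continuous (F i)) -> continuous (fun x => \prod_(i <- s) F i x).
Proof.
move=> cF; elim: s => [|i s IH].
  by under eq_fun do rewrite big_nil; exact: cst_continuous.
under eq_fun do rewrite big_cons.
by move=> x; exact: (cvgM (cF i x) (IH x)).
Qed.

Section smooth_functions.
Context {R : realType} {n : nat}.
Implicit Types (f g : 'rV[R]_n -> R) (k : nat) (x v : 'rV[R]_n).

Lemma coord_continuous (i : 'I_n) : continuous (fun x : 'rV[R]_n => x 0 i).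
Proof. by move=> x; exact/differentiable_continuous/differentiable_coord. Qed.

Lemma vdot_continuous (a : 'rV[R]_n) : continuous (vdot a).
Proof.
apply: (@continuous_sumr _ _ _ (fun i (x : 'rV[R]_n) => a 0 i * x 0 i)) => i.
by apply: continuous_mulr; [exact: cst_continuous|exact: coord_continuous].
Qed.

Lemma vdotDr (a x y : 'rV[R]_n) : vdot a (x + y) = vdot a x + vdot a y.
Proof. by rewrite /vdot -big_split/=; apply: eq_bigr => i _; rewrite mxE mulrDr. Qed.

Lemma vdotZr (a x : 'rV[R]_n) (c : R) : vdot a (c *: x) = c * vdot a x.
Proof. by rewrite /vdot mulr_sumr; apply: eq_bigr => i _; rewrite mxE mulrCA. Qed.

Lemma vdot_delta (a : 'rV[R]_n) i : vdot a (delta_mx 0 i) = a 0 i.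
Proof.
rewrite /vdot (bigD1 i)//= big1 ?addr0 => [|j ji]; rewrite mxE eqxx/=.
  by rewrite eqxx mulr1.
by rewrite (negbTE ji) mulr0.
Qed.

Lemma CkS k f : Ck k.+1 f -> Ck k f.
Proof.
elim: k f => [|k IH] f [cf Hf]; first by split.
split=> // i; have [df Cf] := Hf i; split=> //.
exact: IH.
Qed.

Lemma Ck_continuous k f : Ck k f -> continuous f.
Proof. by case: k => [|k] []. Qed.

Lemma Ck_cst k (c : R) : Ck k (fun _ : 'rV[R]_n => c).
Proof.
elim: k c => [|k IH] c; (split; first exact: cst_continuous) => // i.
split; first by move=> x; exact: derivable_cst.
rewrite (_ : pderiv _ i = fun=> 0); first exact: IH.
by apply/funext => x; rewrite /pderiv derive_cst.
Qed.

Lemma pderivD f g i : (forall x, derivable f x (delta_mx 0 i)) ->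
  (forall x, derivable g x (delta_mx 0 i)) ->
  pderiv (fun x => f x + g x) i = fun x => pderiv f i x + pderiv g i x.
Proof. by move=> df dg; apply/funext => x; rewrite /pderiv -deriveD. Qed.

Lemma pderivM f g i : (forall x, derivable f x (delta_mx 0 i)) ->
  (forall x, derivable g x (delta_mx 0 i)) ->
  pderiv (fun x => f x * g x) i = fun x => f x * pderiv g i x + pderiv f i x * g x.
Proof.
move=> df dg; apply/funext => x; rewrite /pderiv.
by rewrite (deriveM (df x) (dg x)) /GRing.scale/= [g x * _]mulrC.
Qed.

Lemma CkD k f g : Ck k f -> Ck k g -> Ck k (fun x => f x + g x).
Proof.
elim: k f g => [|k IH] f g [cf Hf] [cg Hg];
  (split; first by move=> x; exact: (cvgD (cf x) (cg x))) => // i.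
have [df Cf] := Hf i; have [dg Cg] := Hg i; split.
  by move=> x; apply: derivableD.
by rewrite pderivD//; exact: IH.
Qed.

Lemma CkM k f g : Ck k f -> Ck k g -> Ck k (fun x => f x * g x).
Proof.
elim: k f g => [|k IH] f g Cf Cg; have cf := Ck_continuous Cf; have cg := Ck_continuous Cg;
  (split; first by move=> x; exact: (cvgM (cf x) (cg x))) => // i.
have [_ /(_ i)[df Cdf]] := Cf; have [_ /(_ i)[dg Cdg]] := Cg; split.
  by move=> x; apply: derivableM.
rewrite pderivM//; apply: CkD; apply: IH => //; exact: CkS.
Qed.

Definition smooth f := forall k, Ck k f.

Lemma smooth_cst (c : R) : smooth (fun=> c). Proof. by move=> k; exact: Ck_cst. Qed.

Lemma smoothD f g : smooth f -> smooth g -> smooth (fun x => f x + g x).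
Proof. by move=> sf sg k; exact: CkD. Qed.

Lemma smoothM f g : smooth f -> smooth g -> smooth (fun x => f x * g x).
Proof. by move=> sf sg k; exact: CkM. Qed.

Lemma smoothZ (c : R) f : smooth f -> smooth (fun x => c * f x).
Proof. by move=> sf; exact: (smoothM (smooth_cst c)). Qed.

Lemma smooth_continuous f : smooth f -> continuous f.
Proof. by move=> /(_ 0%N)[]. Qed.

Lemma smooth_derivable f : smooth f -> forall i x, derivable f x (delta_mx 0 i).
Proof. by move=> /(_ 1%N)[_ H] i x; have [] := H i. Qed.

Lemma smooth_pderiv f i : smooth f -> smooth (pderiv f i).
Proof. by move=> sf k; have [_ /(_ i)[]] := sf k.+1. Qed.

Lemma smooth_sum (I : Type) (s : seq I) (F : I -> 'rV[R]_n -> R) :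
  (forall j, smooth (F j)) -> smooth (fun x => \sum_(j <- s) F j x).
Proof.
move=> sF; elim: s => [|j s IH].
  by under eq_fun do rewrite big_nil; exact: smooth_cst.
by under eq_fun do rewrite big_cons; exact: smoothD.
Qed.

Lemma smooth_prod (I : Type) (s : seq I) (F : I -> 'rV[R]_n -> R) :
  (forall j, smooth (F j)) -> smooth (fun x => \prod_(j <- s) F j x).
Proof.
move=> sF; elim: s => [|j s IH].
  by under eq_fun do rewrite big_nil; exact: smooth_cst.
by under eq_fun do rewrite big_cons; exact: smoothM.
Qed.

(** Along the line through [x] in direction [v] the function is [h] of an affine function of one
    real variable, so the one-dimensional chain rule applies. *)
Lemma is_derive_affine (h : R -> R) (dh : R) (a x v : 'rV[R]_n) (s : R) :
  is_derive (vdot a x + s) 1 h dh ->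
  is_derive x v (fun y => h (vdot a y + s)) (dh * vdot a v).
Proof.
move=> Hh.
have Hl : is_derive (0 : R) 1 (fun t : R => vdot a (t *: v + x) + s) (vdot a v).
  rewrite (_ : (fun t : R => _) = (vdot a v \*: id) + cst (vdot a x + s)); last first.
    apply/funext => t; rewrite !fctE vdotDr vdotZr addrA /GRing.scale/=.
    by rewrite [t * _]mulrC.
  by apply: is_derive_eq; rewrite addr0 /GRing.scale/= mulr1.
have Hc : is_derive (0 : R) 1 (fun t : R => h (vdot a (t *: v + x) + s)) (dh * vdot a v).
  apply: (@is_derive1_comp _ h (fun t : R => vdot a (t *: v + x) + s)).
  by rewrite scale0r add0r.
split; first by apply/derivable1P; case: Hc.
have [dc <-] := Hc.
rewrite /derive; set F := (X in lim (X @ _)); set G := (X in _ = lim (X @ _)).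
suff -> : F = G by [].
apply/funext => t; have tE : t%:A = t :> R by rewrite /GRing.scale/= mulr1.
by rewrite /F /G /= tE addr0 scale0r add0r.
Qed.

(** Derivatives of all orders are carried as data, so that the induction for [Ck] treats every level
    of the tower at once. *)
Definition smooth1 (h : R -> R) := exists D : nat -> R -> R,
  D 0%N = h /\ forall j (t : R), is_derive t (1 : R) (D j) (D j.+1 t).

Lemma smooth_affine (h : R -> R) (a : 'rV[R]_n) (s : R) :
  smooth1 h -> smooth (fun x => h (vdot a x + s)).
Proof.
move=> [D [<- HD]] k.
suff: forall j, Ck k (fun x => D j (vdot a x + s)) by apply.
elim: k => [|k IH] j.
  split=> // x.
  apply: (@continuous_comp _ _ _ (fun x => vdot a x + s) (D j)).
    by apply: continuous_addr; [exact: vdot_continuous|exact: cst_continuous].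
  apply: differentiable_continuous; apply/derivable1_diffP.
  by have [] := HD j (vdot a x + s).
split; first exact: Ck_continuous (IH j).
move=> i; split.
  by move=> x; have [] := is_derive_affine (delta_mx 0 i) (HD j (vdot a x + s)).
rewrite (_ : pderiv _ i = fun x => a 0 i * D j.+1 (vdot a x + s)).
  by apply: CkM; [exact: Ck_cst|exact: IH].
apply/funext => x; rewrite /pderiv.
have [_ ->] := is_derive_affine (delta_mx 0 i) (HD j (vdot a x + s)).
by rewrite vdot_delta mulrC.
Qed.

Lemma pderiv_affine (h : R -> R) (dh : R -> R) (a : 'rV[R]_n) (s : R) i :
  (forall t : R, is_derive t (1 : R) h (dh t)) ->
  pderiv (fun x => h (vdot a x + s)) i = fun x => a 0 i * dh (vdot a x + s).
Proof.
move=> Hh; apply/funext => x; rewrite /pderiv.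
have [_ ->] := is_derive_affine (delta_mx 0 i) (Hh (vdot a x + s)).
by rewrite vdot_delta mulrC.
Qed.

End smooth_functions.

Section cos_smooth.
Context {R : realType}.

Lemma is_derive_cosD (t : R) : is_derive t 1 cos (cos (t + pi / 2)).
Proof. by rewrite cosDpihalf; exact: is_derive_cos. Qed.

(** Differentiating a cosine advances its phase by $\pi/2$, which gives the tower in closed form.
    Read backwards, the rule integrates a wave by lowering its phase. *)
Lemma smooth1_cos : smooth1 (@cos R).
Proof.
exists (fun j t => cos (t + j%:R * (pi / 2))); split.
  by apply/funext => t; rewrite mul0r addr0.
move=> j t.
have -> : t + j.+1%:R * (pi / 2) = (t + j%:R * (pi / 2)) + pi / 2.
  by rewrite -addn1 natrD mulrDl mul1r addrA.
rewrite -[X in is_derive _ _ _ X]mulr1.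
apply: (@is_derive1_comp _ cos (fun t => t + j%:R * (pi / 2))).
  exact: is_derive_cosD.
by apply: is_derive_eq; rewrite addr0.
Qed.

End cos_smooth.

(** * The smooth profile $e^{-1/t}$ *)

Section exp_bump.
Context {R : realType}.

(* Polynomials in 1/t times exp(-1/t) are stable under differentiation, which makes
   the induction behind the smoothness of [pexp 1] go through. *)
Definition pexp (P : {poly R}) (t : R) : R :=
  if 0 < t then P.[t^-1] * expR (- t^-1) else 0.

(** Taken at $u=1/t$, this makes a polynomial in $1/t$ harmless against $e^{-1/t}$ as $t\to0^+$. *)
Lemma poly_le_expR (P : {poly R}) : exists2 C : R, 0 <= C &
  forall u : R, 0 <= u -> `|P.[u]| <= C * expR u.
Proof.
have mono k : exists2 C : R, 0 <= C & forall u : R, 0 <= u -> u ^+ k <= C * expR u.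
  case: k => [|k].
    by exists 1 => // u u0; rewrite expr0 mul1r -(@expR0 R) ler_expR.
  exists (k.+1)`!%:R => // u u0; rewrite -ler_pdivrMl ?ltr0n ?fact_gt0//.
  by apply: le_trans (expR_ge1Dxn k u0); rewrite mulrC lerDr.
have /choice[C HC] k : exists C : R, 0 <= C /\ forall u : R, 0 <= u -> u ^+ k <= C * expR u.
  by have [C ? ?] := mono k; exists C.
exists (\sum_(i < size P) `|P`_i| * C i).
  by apply: sumr_ge0 => i _; rewrite mulr_ge0//; have [] := HC i.
move=> u u0; rewrite horner_coef mulr_suml.
apply: (le_trans (ler_norm_sum _ _ _)); apply: ler_sum => i _.
rewrite normrM -mulrA ler_wpM2l// ger0_norm ?exprn_ge0//.
by have [_] := HC i; exact.
Qed.

(** For $t>0$ the polynomial comes from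
    $\frac{d}{dt}\bigl[P(1/t)e^{-1/t}\bigr]=t^{-2}(P-P')(1/t)\,e^{-1/t}$; at 0 a quadratic bound on
    [pexp P] gives derivative zero. *)
Lemma is_derive_pexp (P : {poly R}) (t : R) :
  is_derive t 1 (pexp P) (pexp ('X^2 * (P - P^`())) t).
Proof.
have [t0|t0|t0] := ltgtP t 0.
- have nz : \forall s \near t, cst 0 s = pexp P s.
    near=> s; rewrite /pexp ltNge; suff -> : s <= 0 by [].
    by apply: ltW; near: s; exact: lt_nbhsl.
  apply: (near_eq_is_derive _ _ (f := cst 0)) => //.
  by apply: is_derive_eq; rewrite /pexp ltNge (ltW t0).
- have nz : \forall s \near t, P.[s^-1] * expR (- s^-1) = pexp P s.
    by near=> s; rewrite /pexp ifT//; near: s; exact: lt_nbhsr.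
  apply: (near_eq_is_derive nz).
  have tn0 : t != 0 by rewrite gt_eqF.
  have dV : is_derive t 1 (fun s : R => s^-1) (- t ^- 2).
    by apply: is_derive_eq; [exact: (is_deriveV tn0 (is_derive_id t 1))|rewrite /GRing.scale/= mulr1].
  have dP : is_derive t 1 (fun s : R => P.[s^-1]) (P^`().[t^-1] * (- t ^- 2)).
    by apply: (@is_derive1_comp _ (horner P) (fun s : R => s^-1)).
  have dN : is_derive t 1 (fun s : R => - s^-1) (t ^- 2).
    by rewrite -[t ^- 2]opprK; apply: is_deriveN.
  have dE : is_derive t 1 (fun s : R => expR (- s^-1)) (expR (- t^-1) * t ^- 2).
    by apply: (@is_derive1_comp _ expR (fun s : R => - s^-1)).
  have := is_deriveM dP dE.
  rewrite (_ : _ *: _ + _ = pexp ('X^2 * (P - P^`())) t)//.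
  rewrite /pexp t0 hornerM hornerXn hornerD hornerN exprVn /GRing.scale/=.
  by ring.
(* The extra factor $u^2$ turns into $h^2$ on the other side, so the difference quotient at 0 is
   $O(h)$. *)
- have [C C0 HC] := poly_le_expR ('X^2 * P).
  have HP (h : R) : `|pexp P h| <= C * h ^+ 2.
    rewrite /pexp; case: ifPn => [h0|_]; last by rewrite normr0 mulr_ge0// exprn_even_ge0.
    have hV : 0 < h^-1 by rewrite invr_gt0.
    have := HC _ (ltW hV); rewrite hornerM hornerXn normrM => H.
    rewrite expRN normrM normfV (gtr0_norm (expR_gt0 _)) ler_pdivrMr ?expR_gt0//.
    move: H; rewrite ger0_norm ?exprn_ge0 ?(ltW hV)// exprVn ler_pdivrMl ?exprn_gt0//.
    by rewrite [C * h ^+ 2]mulrC mulrA.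
  have P0 : pexp P 0 = 0 by rewrite /pexp ltxx.
  have H : (fun h : R => h^-1 *: (pexp P (h *: 1 + 0) - pexp P 0)) @ 0^' --> (0 : R).
    apply/cvgrPdist_le => e e0.
    have ec : 0 < e / (C + 1) by rewrite divr_gt0// ltr_wpDl.
    near=> h.
    rewrite sub0r normrN addr0 P0 subr0 /GRing.scale/= mulr1.
    have hn0 : h != 0 by near: h; exact: nbhs_dnbhs_neq.
    rewrite normrM normfV ler_pdivrMl ?normr_gt0//.
    apply: (le_trans (HP h)); rewrite -real_normK ?num_real// expr2 mulrA [leRHS]mulrC.
    rewrite ler_wpM2r//.
    have : `|h| <= e / (C + 1).
      by near: h; apply: cvg_within; exact: (@nbhs0_le _ R^o _ ec).
    rewrite ler_pdivlMr ?ltr_wpDl// => /(le_trans _); apply.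
    by rewrite mulrC ler_wpM2l//; lra.
  rewrite t0; split; first by apply/cvg_ex; exists 0.
  by rewrite /pexp ltxx; apply: cvg_lim.
Unshelve. all: by end_near. Qed.

Lemma smooth1_pexp : smooth1 (pexp 1).
Proof.
exists (fun j => pexp (iter j (fun P : {poly R} => 'X^2 * (P - P^`())) 1)).
by split => // j t; exact: is_derive_pexp.
Qed.

Lemma pexp_gt0 (t : R) : (0 < pexp 1 t) = (0 < t).
Proof. by rewrite /pexp; case: ifP => //; rewrite ?ltxx// hornerC mul1r expR_gt0. Qed.

Lemma pexp_ge0 (t : R) : 0 <= pexp 1 t.
Proof. by rewrite /pexp; case: ifP => // _; rewrite hornerC mul1r expR_ge0. Qed.

Lemma pexp_le1 (t : R) : pexp 1 t <= 1.
Proof.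
rewrite /pexp; case: ifP => // t0; rewrite hornerC mul1r -(@expR0 R) ler_expR.
by rewrite oppr_le0 invr_ge0 ltW.
Qed.

End exp_bump.

(** * Test functions and bumps *)

Section compact_support.
Context {R : realType} {n : nat}.
Implicit Types (f g : 'rV[R]_n -> R) (x v : 'rV[R]_n) (Om : set 'rV[R]_n).

(** Some compact set outside which [f] vanishes combines more easily under sums and products than
    the closure of the support does. *)
Lemma test_funP Om f : test_fun Om f <-> smooth f /\
  exists K, [/\ compact K, K `<=` Om & forall x, ~ K x -> f x = 0].
Proof.
split=> [[sf [cK KO]]|[sf [K [cK KO K0]]]].
  split=> //; exists (closure [set x | f x != 0]); split => // x Kx.
  apply/eqP/negPn/negP => fx; apply: Kx; exact: subset_closure.
have clK : closed K by apply: compact_closed => //; exact: norm_hausdorff.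
have sub : closure [set x | f x != 0] `<=` K.
  rewrite [K in _ `<=` K](closure_id K).1//; apply: closureS => x /= fx.
  by apply: contrapT => /K0 fx0; rewrite fx0 eqxx in fx.
split => //; split; last exact: subset_trans KO.
exact: (subclosed_compact (@closed_closure _ _) cK sub).
Qed.

Lemma test_fun_smooth Om f : test_fun Om f -> smooth f. Proof. by case. Qed.

Lemma test_fun0 Om : test_fun Om (fun=> 0).
Proof.
by apply/test_funP; split; [exact: smooth_cst|exists set0; split => //; exact: compact0].
Qed.

Lemma test_funD Om f g : test_fun Om f -> test_fun Om g -> test_fun Om (fun x => f x + g x).
Proof.
move=> /test_funP[sf [K [cK KO K0]]] /test_funP[sg [L [cL LO L0]]].
apply/test_funP; split; first exact: smoothD.
exists (K `|` L); split; first exact: compactU.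
  by move=> x [/KO|/LO].
by move=> x KL; rewrite K0 ?L0 ?addr0//; move=> ?; apply: KL; [right|left].
Qed.

Lemma test_funMr Om f g : test_fun Om f -> smooth g -> test_fun Om (fun x => f x * g x).
Proof.
move=> /test_funP[sf [K [cK KO K0]]] sg; apply/test_funP; split; first exact: smoothM.
by exists K; split => // x /K0 ->; rewrite mul0r.
Qed.

Lemma test_funMl Om f g : smooth g -> test_fun Om f -> test_fun Om (fun x => g x * f x).
Proof. by move=> sg tf; under eq_fun do rewrite mulrC; exact: test_funMr. Qed.

Lemma test_funZ Om (c : R) f : test_fun Om f -> test_fun Om (fun x => c * f x).
Proof. by apply: test_funMl; exact: smooth_cst. Qed.

Lemma test_fun_sum Om (I : Type) (s : seq I) (F : I -> 'rV[R]_n -> R) :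
  (forall j, test_fun Om (F j)) -> test_fun Om (fun x => \sum_(j <- s) F j x).
Proof.
move=> sF; elim: s => [|j s IH].
  by under eq_fun do rewrite big_nil; exact: test_fun0.
by under eq_fun do rewrite big_cons; exact: test_funD.
Qed.

Lemma pderiv_support f (K : set 'rV[R]_n) i : compact K -> (forall x, ~ K x -> f x = 0) ->
  forall x, ~ K x -> pderiv f i x = 0.
Proof.
move=> cK K0 x Kx.
have oK : open (~` K) by apply: closed_openC; apply: compact_closed => //; exact: norm_hausdorff.
rewrite /pderiv -(@derive_cst R _ _ 0 x (delta_mx 0 i)).
by apply: near_eq_derive; have : nbhs x (~` K) by [exact: open_nbhs_nbhs]; apply: filterS => y /K0.
Qed.

Lemma test_fun_pderiv Om f i : test_fun Om f -> test_fun Om (pderiv f i).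
Proof.
move=> /test_funP[sf [K [cK KO K0]]]; apply/test_funP; split; first exact: smooth_pderiv.
by exists K; split => // x; exact: pderiv_support.
Qed.

Lemma test_fun_support Om f x : test_fun Om f -> ~ Om x -> f x = 0.
Proof. by move=> /test_funP[_ [K [_ KO K0]]] Ox; apply: K0 => /KO. Qed.

Lemma test_fun_bounded Om f : test_fun Om f -> exists2 C : R, 0 <= C & forall x, `|f x| <= C.
Proof.
move=> /test_funP[/smooth_continuous cf [K [cK KO K0]]].
have /compact_bounded[M [_ HM]] : compact (f @` K).
  by apply: continuous_compact => //; exact: continuous_subspaceT.
exists `|M + 1|%R => // x.
have [Kx|/K0 ->] := pselect (K x); last by rewrite normr0.
apply: (le_trans _ (ler_norm _)); apply: HM; first by rewrite ltrDl.
by exists x.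
Qed.

(* Positive exactly on the open cube of centre [c] and half-side [r]. *)
Definition bump (c : 'rV[R]_n) (r : R) (x : 'rV[R]_n) : R :=
  \prod_(i < n) (pexp 1 (x 0 i + (r - c 0 i)) * pexp 1 (- x 0 i + (r + c 0 i))).

Lemma smooth_bump c r : smooth (bump c r).
Proof.
apply: smooth_prod => i; apply: smoothM.
  rewrite (_ : (fun x => _) = fun x : 'rV[R]_n => pexp 1 (vdot (delta_mx 0 i) x + (r - c 0 i))).
    exact/smooth_affine/smooth1_pexp.
  by apply/funext => x; rewrite /vdot (bigD1 i)//= big1 ?addr0 => [|j ji]; rewrite mxE ?eqxx ?mul1r// (negbTE ji) mul0r.
rewrite (_ : (fun x => _) = fun x : 'rV[R]_n => pexp 1 (vdot (- delta_mx 0 i) x + (r + c 0 i))).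
  exact/smooth_affine/smooth1_pexp.
apply/funext => x; rewrite /vdot (bigD1 i)//= big1 ?addr0 => [|j ji]; rewrite !mxE eqxx/=.
  by rewrite eqxx mulN1r.
by rewrite (negbTE ji) oppr0 mul0r.
Qed.

Lemma bump_ge0 c r x : 0 <= bump c r x.
Proof. by apply: prodr_ge0 => i _; rewrite mulr_ge0 ?pexp_ge0. Qed.

Lemma bump_le1 c r x : bump c r x <= 1.
Proof.
apply: prodr_ile1 => i _; rewrite mulr_ge0 ?pexp_ge0//=.
by rewrite mulr_ile1 ?pexp_ge0 ?pexp_le1.
Qed.

Lemma bump_gt0 (c : 'rV[R]_n) r x : (forall i, `|x 0 i - c 0 i| < r) -> 0 < bump c r x.
Proof.
move=> H; apply: prodr_gt0 => i _; rewrite mulr_gt0 ?pexp_gt0//;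
by have := H i; rewrite ltr_distl; lra.
Qed.

Lemma bump_support (c : 'rV[R]_n) r (x : 'rV[R]_n) : ~ (forall i, c 0 i - r <= x 0 i <= c 0 i + r) -> bump c r x = 0.
Proof.
move=> H; apply/eqP/negPn/negP => b0; apply: H => i.
move: b0; rewrite /bump prodf_seq_neq0 => /allP /(_ i (mem_index_enum i)) /=.
rewrite mulf_eq0 negb_or => /andP[].
rewrite !neq_lt !ltNge !pexp_ge0/= -!ltNge !pexp_gt0; lra.
Qed.

Lemma compact_box (a b : 'rV[R]_n) : compact [set x : 'rV[R]_n | forall i, a 0 i <= x 0 i <= b 0 i].
Proof.
have := @rV_compact R^o n (fun i => `[a 0 i, b 0 i]%classic) (fun i => @segment_compact _ _ _).
congr compact; apply/seteqP; split => x /= H i; by have := H i; rewrite /= in_itv.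
Qed.

Lemma test_fun_bump Om (c : 'rV[R]_n) r : [set x : 'rV[R]_n | forall i, c 0 i - r <= x 0 i <= c 0 i + r] `<=` Om ->
  test_fun Om (bump c r).
Proof.
move=> sub; apply/test_funP; split; first exact: smooth_bump.
exists [set x : 'rV[R]_n | forall i, c 0 i - r <= x 0 i <= c 0 i + r]; split => //.
  have := @compact_box (c - const_mx r) (c + const_mx r).
  by congr compact; apply/seteqP; split => x /= H i; have := H i; rewrite !mxE.
by move=> x; exact: bump_support.
Qed.

End compact_support.

(** * Borel sets of $\mathbb{R}^n$ generated by boxes *)

Section borel.
Context {R : realType}.

Lemma open_measurable_Rn n (U : set 'rV[R]_n) : open U -> measurable (U : set (Rn R n)).
Proof. by move=> oU; exact: sub_sigma_algebra. Qed.

Lemma continuous_measurable_Rn n (f : 'rV[R]_n -> R) : continuous f ->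
  measurable_fun [set: Rn R n] (f : Rn R n -> R).
Proof.
move=> cf; apply: (measurability _ (RGenOpens.measurableE R)).
move=> _ [_ [a [b ->] <-]]; rewrite setTI; apply: open_measurable_Rn.
by apply: open_comp; [move=> x _; exact: cf|exact: interval_open].
Qed.

Lemma continuous_measurable_RnRn n m (f : 'rV[R]_n -> 'rV[R]_m) : continuous f ->
  measurable_fun [set: Rn R n] (f : Rn R n -> Rn R m).
Proof.
move=> cf; apply: (@measurability _ _ (Rn R n) (Rn R m) setT (f : Rn R n -> Rn R m)
  (@open 'rV[R]_m) erefl).
move=> _ [U oU <-]; rewrite setTI; apply: open_measurable_Rn.
by apply: open_comp => // x _; exact: cf.
Qed.

Lemma rV_norm_lt n (x : 'rV[R]_n) (e : R) : 0 < e ->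
  (forall i, `|x 0 i| < e) -> `|x| < e.
Proof.
move=> e0 xe; have [->//|] := eqVneq `|x| 0.
move=> /mx_norm_neq0[[i j] /= xE]; rewrite (ord1 i) in xE.
by have -> : `|x| = `|x 0 j| := xE.
Qed.

Lemma rV_coord_le n (x : 'rV[R]_n) i : `|x 0 i| <= `|x|.
Proof.
rewrite [leRHS]mx_normrE.
by have := le_bigmax 0 (fun ij : 'I_1 * 'I_n => `|x ij.1 ij.2|) (0, i).
Qed.

Lemma rV_continuousP n (T : topologicalType) (f : T -> 'rV[R]_n) :
  (forall i, continuous (fun x => f x 0 i)) -> continuous f.
Proof.
move=> cf x; apply/cvgrPdist_lt => e e0.
have H : \forall y \near x, forall i : 'I_n, `|f x 0 i - f y 0 i| < e.
  by apply: filter_forall => i; have /cvgrPdist_lt/(_ e e0) := cf i x.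
near=> y; apply: rV_norm_lt => // i; rewrite !mxE; move: i.
by near: y.
Unshelve. all: by end_near. Qed.

Lemma open_boxP n (U : set 'rV[R]_n) (x : 'rV[R]_n) : open U -> U x ->
  exists2 e : R, 0 < e & forall y : 'rV[R]_n, (forall i, `|y 0 i - x 0 i| < e) -> U y.
Proof.
rewrite openE => /(_ x) oU /oU /nbhs_ballP[e /= e0 He].
exists e => // y xy; apply: He; rewrite -ball_normE /= /ball_ /=.
by apply: rV_norm_lt => // i; rewrite !mxE distrC.
Qed.

Definition box n (a b : 'rV[R]_n) : set (Rn R n) :=
  [set x : Rn R n | forall i, a 0 i < x 0 i <= b 0 i].

Lemma measurable_box n (a b : 'rV[R]_n) : measurable (box a b).
Proof.
have -> : box a b = \bigcap_(i in [set: 'I_n]) ((fun x : Rn R n => x 0 i) @^-1` `]a 0 i, b 0 i]).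
  apply/seteqP; split => x H i; first by move=> _; rewrite /= in_itv /=; exact: H.
  by have := H i I; rewrite /= in_itv.
apply: fin_bigcap_measurable => [|i _]; first exact: finite_finset.
rewrite -[X in measurable X]setTI; apply: continuous_measurable_Rn => //.
exact: coord_continuous.
Qed.

Lemma boxI n (a b a' b' : 'rV[R]_n) :
  box a b `&` box a' b' = box (\row_i Num.max (a 0 i) (a' 0 i)) (\row_i Num.min (b 0 i) (b' 0 i)).
Proof.
apply/seteqP; split => x /=.
  move=> [H H'] i; rewrite !mxE gt_max le_min.
  by have /andP[-> ->] := H i; have /andP[-> ->] := H' i.
move=> H; split => i; have := H i; rewrite !mxE gt_max le_min.
  by move=> /andP[/andP[-> _] /andP[-> _]].
by move=> /andP[/andP[_ ->] /andP[_ ->]].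
Qed.

(** The empty set is added because the intersection of two boxes may have crossed bounds. *)
Definition boxes n : set (set (Rn R n)) :=
  [set A | A = set0 \/ exists a b : 'rV[R]_n, (forall i, a 0 i <= b 0 i) /\ A = box a b].

Lemma boxes_setI n : setI_closed (@boxes n).
Proof.
move=> A B [->|[a [b [ab ->]]]]; first by move=> _; left; rewrite set0I.
move=> [->|[a' [b' [ab' ->]]]]; first by left; rewrite setI0.
rewrite boxI; set c := \row_i _; set e := \row_i _.
have [ce|ce] := pselect (forall i, c 0 i <= e 0 i); first by right; exists c, e.
left; apply/seteqP; split => // x /= H; apply: ce => i.
by have /andP[/ltW h1 h2] := H i; exact: le_trans h2.
Qed.

(** An open set is the union of the countably many boxes with rational corners that it contains.
    This makes [is_lebesgue], which speaks only of boxes, usable through uniqueness of measures. *)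
Lemma measurable_boxes n : @measurable _ (Rn R n) = <<s @boxes n >>.
Proof.
apply/seteqP; split; last first.
  apply: smallest_sub; first exact: sigma_algebra_measurable.
  by move=> A [->|[a [b [_ ->]]]]; [exact: measurable0|exact: measurable_box].
apply: smallest_sub; first exact: smallest_sigma_algebra.
move=> U oU.
pose Q := ('rV[rat]_n * 'rV[rat]_n)%type.
pose lo (q : Q) : 'rV[R]_n := map_mx ratr q.1.
pose hi (q : Q) : 'rV[R]_n := map_mx ratr q.2.
pose good (q : Q) := (forall i, lo q 0 i <= hi q 0 i) /\ box (lo q) (hi q) `<=` U.
(* Codes that name no admissible pair of corners contribute the empty set. *)
pose B (k : nat) : set (Rn R n) := if @choice.unpickle Q k is Some q then
   (if pselect (good q) then box (lo q) (hi q) else set0) else set0.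
have -> : U = \bigcup_k B k.
  apply/seteqP; split; last first.
    move=> x [k _]; rewrite /B; case: choice.unpickle => // q.
    by case: pselect => // -[_ sub] /sub.
  move=> x Ux; have [e e0 He] := open_boxP oU Ux.
  have /choice[q1 Hq1] (i : 'I_n) : exists q : rat, x 0 i - e < ratr q < x 0 i.
    have := @rat_in_itvoo R (x 0 i - e) (x 0 i); rewrite gtrBl e0 => /(_ isT)[q].
    by rewrite in_itv/=; exists q.
  have /choice[q2 Hq2] (i : 'I_n) : exists q : rat, x 0 i < ratr q < x 0 i + e.
    have := @rat_in_itvoo R (x 0 i) (x 0 i + e); rewrite ltrDl e0 => /(_ isT)[q].
    by rewrite in_itv/=; exists q.
  pose q : Q := (\row_i q1 i, \row_i q2 i).
  exists (choice.pickle q) => //; rewrite /B choice.pickleK; case: pselect => [a|] /=.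
    by move=> i; rewrite /lo /hi !mxE; have /andP[_ ->] := Hq1 i; have /andP[/ltW -> _] := Hq2 i.
  case; split.
    move=> i; rewrite /lo /hi !mxE; have /andP[_ /ltW h1] := Hq1 i.
    by have /andP[/ltW h2 _] := Hq2 i; exact: le_trans h2.
  move=> y Hy; apply: He => i; have := Hy i; rewrite /lo /hi !mxE.
  by have /andP[? ?] := Hq1 i; have /andP[? ?] := Hq2 i; rewrite ltr_distl => /andP[? ?]; lra.
apply: sigma_algebra_bigcup => k; rewrite /B; case: choice.unpickle => [q|].
  case: pselect => [a|na] /=; last exact: sigma_algebra0.
  have [lh sub] := a; by apply: sub_sigma_algebra; right; exists (lo q), (hi q).
exact: sigma_algebra0.
Qed.

End borel.

(** * Translation invariance and vanishing integrals of derivatives *)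

Section translation.
Context {R : realType} (n : nat) (mu : {measure set (Rn R n) -> \bar R}).
Hypothesis lmu : is_lebesgue mu.

Lemma lebesgue_box_lty (a b : 'rV[R]_n) : (mu (box a b) < +oo)%E.
Proof.
have [ab|nab] := pselect (forall i, a 0 i <= b 0 i).
  by rewrite (lmu ab) ltry.
rewrite (_ : box a b = set0) ?measure0//.
apply/seteqP; split => // x /= H; apply: nab => i.
by have /andP[/ltW h1 h2] := H i; exact: le_trans h2.
Qed.

Definition cube (M : R) : set (Rn R n) := box (const_mx (- M)) (const_mx M).

Lemma bounded_sub_cube (A : set 'rV[R]_n) : bounded_set A ->
  exists2 M : R, 0 < M & A `<=` cube M.
Proof.
move=> [M [_ HM]]; exists (`|M| + 1 + 1)%R; first by rewrite ltr_wpDl// addr_ge0.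
move=> x Ax i; rewrite !mxE.
have : `|x| <= `|M| + 1 by apply: HM => //; rewrite ltr_pwDr// ler_norm.
by move=> /(le_trans (rV_coord_le x i)); rewrite ler_norml; lra.
Qed.

Lemma bounded_lty (A : set 'rV[R]_n) : bounded_set A -> measurable (A : set (Rn R n)) ->
  (mu (A : set (Rn R n)) < +oo)%E.
Proof.
move=> /bounded_sub_cube[M _ AM] mA; apply: le_lt_trans (lebesgue_box_lty (const_mx (- M)) (const_mx M)).
by apply: le_measure => //; rewrite inE//; exact: measurable_box.
Qed.

Lemma continuous_shift_rV (h : 'rV[R]_n) : continuous (fun x : 'rV[R]_n => x + h).
Proof.
apply: rV_continuousP => i; under eq_fun do rewrite mxE.
by apply: continuous_addr; [exact: coord_continuous|exact: cst_continuous].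
Qed.

Lemma measurable_shift (h : 'rV[R]_n) :
  measurable_fun [set: Rn R n] ((fun x => x + h) : Rn R n -> Rn R n).
Proof.
apply: (@continuous_measurable_RnRn _ n n (fun x : 'rV[R]_n => x + h)).
exact: continuous_shift_rV.
Qed.

Definition shift_meas (h : 'rV[R]_n) : {measure set (Rn R n) -> \bar R} :=
  measure_function_pushforward__canonical__measure_function_Measure mu (measurable_shift h).

Lemma cube_cover : \bigcup_k cube k%:R = [set: Rn R n].
Proof.
apply/seteqP; split => // x _.
exists (Num.truncn (`|x : 'rV[R]_n| + 1)).+1 => // i; rewrite !mxE.
have := rV_coord_le x i; have := truncnS_gt (`|x : 'rV[R]_n| + 1).
by rewrite ler_norml; set N := _%:R => *; apply/andP; split; lra.
Qed.

(** Both measures give a box its volume and are finite on the covering cubes, so uniqueness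
    applies. *)
Lemma lebesgue_shift (h : 'rV[R]_n) (A : set (Rn R n)) : measurable A ->
  mu A = shift_meas h A.
Proof.
apply: (measure_unique (@boxes R n) (fun k => cube k%:R)).
- exact: measurable_boxes.
- exact: boxes_setI.
- move=> k; right; exists (const_mx (- k%:R)), (const_mx k%:R); split => // i.
  by rewrite !mxE; apply: (@le_trans _ _ 0); rewrite ?oppr_le0.
- exact: cube_cover.
- move=> B [->|[a [b [ab ->]]]]; first by rewrite !measure0.
  rewrite /shift_meas /= /pushforward.
  have -> : (fun x : Rn R n => x + h) @^-1` box a b = box (a - h) (b - h).
    apply/seteqP; split => x /= H i; have := H i; rewrite !mxE.
      by rewrite ltrBlDr lerBrDr.
    by rewrite ltrBlDr lerBrDr.
  rewrite (lmu ab) lmu; last by move=> i; rewrite !mxE lerD2r.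
  by congr EFin; apply: eq_bigr => i _; rewrite !mxE; ring.
- by move=> k; exact: lebesgue_box_lty.
Qed.

Lemma integral_shift (h : 'rV[R]_n) (f : Rn R n -> \bar R) :
  mu.-integrable setT f ->
  (\int[mu]_x f (x + h)%R)%E = (\int[mu]_x f x)%E.
Proof.
move=> intf; have mf := measurable_int _ intf.
have mfh : measurable_fun [set: Rn R n] (fun x : Rn R n => f (x + h)).
  exact: (measurableT_comp mf (measurable_shift h)).
have E (g : Rn R n -> \bar R) : measurable_fun setT g -> (forall x, (0 <= g x)%E) ->
    (\int[mu]_x g (x + h)%R)%E = (\int[mu]_x g x)%E.
  move=> mg g0.
  rewrite [RHS](@eq_measure_integral _ _ _ _ (shift_meas h)); last first.
    by move=> A mA _; exact: lebesgue_shift.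
  by rewrite (ge0_integral_pushforward (measurable_shift h)).
rewrite integralE [RHS]integralE; congr (_ - _)%E.
  by rewrite -(E (f^\+)%E (measurable_funepos mf) (funepos_ge0 f)); apply: eq_integral => x _; rewrite funepos.unlock.
by rewrite -(E (f^\-)%E (measurable_funeneg mf) (funeneg_ge0 f)); apply: eq_integral => x _; rewrite funeneg.unlock.
Qed.

Lemma integrable_cube (M : R) : mu.-integrable setT (fun x => (\1_(cube M) x)%:E).
Proof.
apply/integrableP; split.
  by apply/measurable_EFinP; apply: measurable_indic; exact: measurable_box.
rewrite (eq_integral (fun x => (\1_(cube M) x)%:E)); last first.
  by move=> x _; rewrite gee0_abs// lee_fin.
rewrite integral_indic//; last exact: measurable_box.
by rewrite setIT; exact: lebesgue_box_lty.
Qed.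

Lemma bounded_support_integrable (f : Rn R n -> R) (M C : R) : measurable_fun setT f ->
  (forall x, ~ cube M x -> f x = 0) -> (forall x, `|f x| <= C) ->
  mu.-integrable setT (EFin \o f).
Proof.
move=> mf f0 fC.
have C0 : 0 <= C by apply: le_trans (fC 0).
apply: (@le_integrable _ _ _ mu _ measurableT _ (fun x => (C * \1_(cube M) x)%:E)).
- exact/measurable_EFinP.
- move=> x _ /=; rewrite lee_fin indicE.
  have [xA|/negP xA] := boolP (x \in cube M); first by rewrite mulr1 (le_trans (fC x))// ler_norm.
  by rewrite f0 ?normr0// => Ax; apply: xA; rewrite inE.
under eq_fun do rewrite EFinM.
by apply: integrableZl => //; exact: integrable_cube.
Qed.

(** Turns the limit defining a derivative into one along a sequence, as dominated convergence
    requires. *)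
Lemma cvg_to_0_seq (T : topologicalType) (F : R -> T) (l : T) :
  F @ 0^' --> l -> (fun k : nat => F (k.+1%:R^-1)) @ \oo --> l.
Proof.
move=> Fl; apply: cvg_comp Fl.
move=> A [e /= e0 He]; have := @cvg_harmonic R; move/cvgrPdist_lt => /(_ _ e0).
apply: filterS => k; rewrite /harmonic => H; apply: He; last by rewrite invr_neq0.
exact: H.
Qed.

Lemma MVT_line (F : 'rV[R]_n -> R) (x v : 'rV[R]_n) (h : R) : 0 < h ->
  (forall y, derivable F y v) ->
  exists t, F (x + h *: v) - F x = h * 'D_v F (x + t *: v).
Proof.
move=> h0 dF.
pose g (t : R) := F (x + t *: v).
have dg (t : R) : is_derive t (1 : R) g ('D_v F (x + t *: v)).
  have [d1 d2] := derivableP (dF (x + t *: v)).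
  have E : (fun s : R => s^-1 *: ((g \o shift t) (s *: (1 : R)) - g t)) =
           (fun s : R => s^-1 *: ((F \o shift (x + t *: v)) (s *: v) - F (x + t *: v))).
    apply/funext => s; rewrite /g /=; congr (_ *: (F _ - _)).
    by rewrite /GRing.scale/= mulr1 -/(GRing.scale _ _) scalerDl addrCA [s *: v + _]addrC.
  split.
    by rewrite /derivable E; exact: dF.
  by rewrite /derive E.
have cg : {within `[0, h], continuous g}.
  apply: continuous_subspaceT => t; apply: differentiable_continuous; apply/derivable1_diffP.
  by have [] := dg t.
have [t _] := @MVT R g _ 0 h h0 (fun t _ => dg t) cg.
by move=> H; exists t; move: H; rewrite /g scale0r addr0 subr0 => ->; rewrite mulrC.
Qed.

(** Difference quotients have zero integral by translation invariance. They are bounded by the mean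
    value theorem and supported in one cube, so dominated convergence passes the zero to the
    derivative. *)
Lemma integral_pderiv0 (F : 'rV[R]_n -> R) i (K : set 'rV[R]_n) : smooth F -> compact K ->
  (forall x, ~ K x -> F x = 0) ->
  (\int[mu]_x (pderiv F i x)%:E)%E = 0%E.
Proof.
move=> sF cK F0.
have [M M0 KM] := bounded_sub_cube (compact_bounded cK).
have tF : test_fun setT F by apply/test_funP; split => //; exists K; split.
have [C1 C10 FC1] := test_fun_bounded tF.
have [C2 C20 FC2] := test_fun_bounded (test_fun_pderiv i tF).
have dF := @smooth_derivable _ _ F sF i.
pose e : 'rV[R]_n := delta_mx 0 i.
pose h (k : nat) : R := k.+1%:R^-1.
have h0 k : 0 < h k by rewrite invr_gt0.
have h1 k : h k <= 1 by rewrite invf_le1// ler1n.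
pose D k (x : Rn R n) := (h k)^-1 * (F (x + h k *: e) - F x).
have mF : measurable_fun [set: Rn R n] (F : Rn R n -> R).
  by apply: continuous_measurable_Rn; exact: smooth_continuous.
have mFh k : measurable_fun [set: Rn R n] (fun x : Rn R n => F (x + h k *: e)).
  exact: (measurableT_comp mF (measurable_shift _)).
have Fcube (x : Rn R n) : ~ cube M x -> F x = 0 by move=> xM; apply: F0 => /KM.
have iF : mu.-integrable setT (fun x : Rn R n => (F x)%:E).
  exact: (bounded_support_integrable mF Fcube FC1).
(* The steps [h k] are at most 1, so enlarging the cube by 1 covers the supports of all shifted
   copies. *)
have FhM k (x : Rn R n) : ~ cube (M + 1) x -> F (x + h k *: e) = 0 /\ F x = 0.
  move=> xM; split; apply: Fcube => H; apply: xM => j; have := H j; rewrite !mxE.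
    rewrite eqxx/=; have := h0 k; have := h1 k; case: (j == i); rewrite ?mulr0 ?mulr1; lra.
  lra.
have iFh k : mu.-integrable setT (fun x : Rn R n => (F (x + h k *: e))%:E).
  apply: (bounded_support_integrable (M := M + 1) (C := C1) (mFh k)) => // x /(FhM k)[]//.
have iD k : (\int[mu]_x (D k x)%:E)%E = 0%E.
  rewrite /D; under eq_integral do rewrite EFinM.
  rewrite integralZl//; last first.
    under eq_fun do rewrite EFinB.
    exact: (integrableB _ (iFh k) iF).
  under eq_integral do rewrite EFinB.
  have sh : (\int[mu]_x (F (x + h k *: e)%R)%:E = \int[mu]_x (F x)%:E)%E := integral_shift (h k *: e) iF.
  have -> : (\int[mu]_x ((F (x + h k *: e)%R)%:E - (F x)%:E) =
      \int[mu]_x (F (x + h k *: e)%R)%:E - \int[mu]_x (F x)%:E)%E.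
    exact: (integralB_EFin measurableT (iFh k) iF).
  rewrite sh subee ?mule0//.
  exact: integrable_fin_num.
have mD k : measurable_fun [set: Rn R n] (D k).
  by apply: measurable_funM => //; exact: measurable_funB.
have DC k (x : Rn R n) : `|D k x| <= C2.
  have [t Ht] := MVT_line x (h0 k) dF.
  by rewrite /D Ht mulKf ?gt_eqF//; exact: FC2.
have Dlim (x : Rn R n) : (fun k => D k x) @ \oo --> pderiv F i x.
  have := @cvg_to_0_seq _ _ _ (dF x); apply: cvg_trans.
  by apply: near_eq_cvg; near=> k; rewrite /D /h /= [x + _]addrC.
have mdF : measurable_fun [set: Rn R n] (pderiv F i : Rn R n -> R).
  by apply: continuous_measurable_Rn; apply: smooth_continuous; exact: smooth_pderiv.
have iG : mu.-integrable setT (fun x : Rn R n => (C2 * \1_(cube (M + 1)) x)%:E).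
  under eq_fun do rewrite EFinM.
  by apply: integrableZl => //; exact: integrable_cube.
have DG : {ae mu, forall x k, setT x -> (`|(D k x)%:E| <= (C2 * \1_(cube (M + 1)) x)%:E)%E}.
  apply: aeW => x k _; rewrite lee_fin indicE.
  have [xA|/negP xA] := boolP (x \in cube (M + 1)); first by rewrite mulr1.
  have [E1 E2] : F (x + h k *: e) = 0 /\ F x = 0.
    by apply: FhM => Ax; apply: xA; rewrite inE.
  by rewrite /D E1 E2 subrr mulr0 normr0 mulr0.
have Dae : {ae mu, forall x, setT x -> (fun k => (D k x)%:E) @ \oo --> (pderiv F i x)%:E}.
  by apply: aeW => x _; apply: cvg_EFin; [exact: nearW|exact: Dlim].
have [_ _] := dominated_convergence measurableT
  (fun k => (measurable_EFinP _ _).2 (mD k)) ((measurable_EFinP _ _).2 mdF) Dae iG DG.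
under eq_fun do rewrite iD.
by move=> /cvg_lim <- //; rewrite lim_cst.
Unshelve. all: by end_near. Qed.

End translation.

(** * Density of test functions in $L^p(\Omega)$ *)

Section density.
Context {R : realType} (n : nat) (mun : {measure set (Rn R n) -> \bar R}).
Variable Om : set 'rV[R]_n.
Hypothesis oOm : open Om.
Let mOm : measurable (Om : set (Rn R n)) := open_measurable_Rn oOm.
Hypothesis Omoo : (mun (Om : set (Rn R n)) < +oo)%E.
Let mu : {finite_measure set (Rn R n) -> \bar R} := mfrestr mOm Omoo.

Lemma mfrestr_ae (P : Rn R n -> Prop) : (forall x, Om x -> P x) -> {ae mu, forall x, P x}.
Proof.
move=> OP; exists (~` (Om : set (Rn R n))); split.
- exact: measurableC.
- by rewrite /mu /= /mfrestr /mrestr setICl measure0.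
- by move=> x /= nP Ox; apply: nP; exact: OP.
Qed.

(** The family consists of the bumps on rational cubes contained in [U], enumerated by their
    codes. *)
Lemma open_bump_cover (U : set 'rV[R]_n) : open U -> exists psi : nat -> 'rV[R]_n -> R,
  [/\ forall k, test_fun U (psi k), forall k x, 0 <= psi k x <= 1 &
    forall x, U x -> exists k, 0 < psi k x].
Proof.
move=> oU.
pose Q := ('rV[rat]_n * rat)%type.
pose cen (q : Q) : 'rV[R]_n := map_mx ratr q.1.
pose rad (q : Q) : R := ratr q.2.
pose good (q : Q) := [set x : 'rV[R]_n | forall i, cen q 0 i - rad q <= x 0 i <= cen q 0 i + rad q] `<=` U.
pose psi (k : nat) : 'rV[R]_n -> R := if @choice.unpickle Q k is Some q then
   (if pselect (good q) then bump (cen q) (rad q) else fun=> 0) else fun=> 0.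
exists psi; split.
- move=> k; rewrite /psi; case: choice.unpickle => [q|]; last exact: test_fun0.
  by case: pselect => [a|na] /=; [exact: test_fun_bump|exact: test_fun0].
- move=> k x; rewrite /psi; case: choice.unpickle => [q|]; last by rewrite lexx ler01.
  by case: pselect => [a|na] /=; [rewrite bump_ge0 bump_le1|rewrite lexx ler01].
move=> x Ux; have [e e0 He] := open_boxP oU Ux.
have /choice[c Hc] (i : 'I_n) : exists q : rat, x 0 i - e / 4 < ratr q < x 0 i + e / 4.
  have := @rat_in_itvoo R (x 0 i - e / 4) (x 0 i + e / 4).
  have -> : x 0 i - e / 4 < x 0 i + e / 4 by move: e0; lra.
  by move=> /(_ isT)[q]; rewrite in_itv/=; exists q.
have [r Hr] : exists q : rat, e / 4 < ratr q < e / 2.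
  have := @rat_in_itvoo R (e / 4) (e / 2).
  have -> : e / 4 < e / 2 by move: e0; lra.
  by move=> /(_ isT)[q]; rewrite in_itv/=; exists q.
pose q : Q := (\row_i c i, r).
exists (choice.pickle q); rewrite /psi choice.pickleK; case: pselect => [a|] /=.
  apply: bump_gt0 => i; rewrite /cen /rad !mxE ltr_distl.
  by have := Hc i; move: Hr; rewrite /=; lra.
case; move=> y Hy; apply: He => i; have := Hy i; rewrite /cen /rad !mxE/=.
by have := Hc i; move: Hr; rewrite ltr_distl; lra.
Qed.

(** The approximants are $1-\prod_{i<N}(1-\psi_i)^N$. Where some $\psi_k$ is positive, the factor of
    index $k$ tends to 0 geometrically and the others are at most 1. *)
Lemma open_test_approx (U : set 'rV[R]_n) : open U -> exists phi : nat -> 'rV[R]_n -> R,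
  [/\ forall k, test_fun U (phi k), forall k x, 0 <= phi k x <= 1 &
    forall x, U x -> phi ^~ x @ \oo --> (1 : R)].
Proof.
move=> oU; have [psi [tpsi psi01 psip]] := open_bump_cover oU.
pose P N x := \prod_(i < N) (1 - psi i x) ^+ N.
have P01 N x : 0 <= P N x <= 1.
  apply/andP; split.
    by apply: prodr_ge0 => i _; rewrite exprn_ge0// subr_ge0; have /andP[] := psi01 i x.
  apply: prodr_ile1 => i _; have /andP[p0 p1] := psi01 i x.
  by rewrite exprn_ge0 ?subr_ge0//= exprn_ile1 ?subr_ge0// gerBl.
exists (fun N x => 1 - P N x); split.
- move=> N.
  (* Stable under products because $1-fg=(1-f)+(1-g)-(1-f)(1-g)$; the factors $1-\psi_i$ themselves
     have no compact support. *)
  pose good (f : 'rV[R]_n -> R) := test_fun U (fun x => 1 - f x).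
  have good1 : good (fun=> 1) by rewrite /good; under eq_fun do rewrite subrr; exact: test_fun0.
  have goodM f g : good f -> good g -> good (fun x => f x * g x).
    move=> gf gg; rewrite /good.
    rewrite (_ : (fun x => _) = fun x => ((1 - f x) + (1 - g x)) + (-1) * ((1 - f x) * (1 - g x))).
      apply: test_funD; first exact: test_funD.
      by apply: test_funZ; apply: test_funMr => //; exact: test_fun_smooth gg.
    by apply/funext => x; ring.
  suff : good (P N) by [].
  rewrite /P; elim: (index_enum _) => [|i s IH].
    by under eq_fun do rewrite big_nil.
  under eq_fun do rewrite big_cons.
  apply: (goodM) => //.
  have gX k : good (fun x => (1 - psi i x) ^+ k).
    elim: k => [|j IHj]; first by under eq_fun do rewrite expr0.
    under eq_fun do rewrite exprS; apply: (goodM) => //.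
    by rewrite /good; under eq_fun do rewrite subKr; exact: tpsi.
  exact: gX.
- by move=> N x; have /andP[? ?] := P01 N x; rewrite subr_ge0 gerBl; apply/andP.
move=> x Ux; have [k kx] := psip x Ux; have /andP[k0 k1] := psi01 k x.
rewrite -[X in _ --> X]subr0; apply: cvgB; first exact: cvg_cst.
have c : (fun N => (1 - psi k x) ^+ N) @ \oo --> (0 : R).
  by apply: cvg_expr; rewrite ger0_norm ?subr_ge0// gtrBl.
apply: (@squeeze_cvgr _ _ _ _ (cst 0) (fun N => (1 - psi k x) ^+ N)) => //; last exact: cvg_cst.
exists k.+1 => // N /= kN; have /andP[-> _] /= := P01 N x.
rewrite /P (bigD1 (Ordinal kN))//= ler_piMr ?exprn_ge0 ?subr_ge0//.
apply: prodr_ile1 => i _; have /andP[p0 p1] := psi01 i x.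
by rewrite exprn_ge0 ?subr_ge0//= exprn_ile1 ?subr_ge0// gerBl.
Qed.

Lemma measurable_test_fun (phi : 'rV[R]_n -> R) U : test_fun U phi ->
  measurable_fun [set: Rn R n] (phi : Rn R n -> R).
Proof. by move=> /test_fun_smooth/smooth_continuous; exact: continuous_measurable_Rn. Qed.

(** By [Lp_induction] only indicators of open sets have to be approximated; the remaining cases
    distribute the error budget. *)
Lemma test_fun_dense p (f : Rn R n -> R) : 1 <= p -> measurable_fun setT f ->
  (Np mu p f < +oo)%E -> forall e : R, 0 < e -> exists2 phi, test_fun Om phi &
  (Np mu p (fun x => f x - phi x)%R <= e%:E)%E.
Proof.
move=> p1; have p0 : 0 < p by exact: lt_le_trans p1.
have p2 : 0 < 2 `^ p :> R by rewrite powR_gt0.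
pose P (f : Rn R n -> R) := forall e : R, 0 < e -> exists2 phi, test_fun Om phi &
  (Np mu p (fun x => f x - phi x)%R <= e%:E)%E.
move=> mf fy; suff : P f by [].
move: f mf fy.
apply: (@Lp_induction _ (Rn R n) R mu p (@open 'rV[R]_n) P p1 erefl).
- by move=> A B; exact: openI.
- exact: openT.
- move=> U oU e e0.
  (* Approximating $U\cap\Omega$ keeps the supports inside $\Omega$; the restricted measure does not
     distinguish this set from [U]. *)
  have [phi [tphi phi01 phi1]] := open_test_approx (openI oU oOm).
  have mphi k := measurable_test_fun (tphi k).
  have mU : measurable_fun [set: Rn R n] (\1_U : Rn R n -> R).
    by apply: measurable_indic; exact: open_measurable_Rn.
  have m1 : measurable_fun [set: Rn R n] (cst (1 : R)) by exact: measurable_cst.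
  have ae1 : {ae mu, forall x : Rn R n, phi ^~ x @ \oo --> (\1_U x : R)}.
    apply: mfrestr_ae => x Ox; rewrite indicE.
    have [xU|/negP xU] := boolP (x \in U).
      by apply: phi1; split => //; rewrite inE in xU.
    apply: cvg_near_cst; apply: nearW => k.
    by rewrite (test_fun_support (tphi k))// => -[Ux _]; apply: xU; rewrite inE.
  have n1 : (Np mu p (cst 1%R : Rn R n -> R) < +oo)%E.
    by apply: (Np_bounded_lty mu (ltW p0) m1 (C := 1)) => x; rewrite normr1.
  have bd k (x : Rn R n) : `|phi k x| <= `|cst (1 : R) x|.
    by have /andP[? ?] := phi01 k x; rewrite normr1 ger0_norm.
  have /fine_cvgP[[N _ HN] /cvgrPdist_lt/(_ _ e0)[M _ HM]] := Np_dct p0 mphi mU m1 n1 ae1 bd.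
  pose k := maxn N M; exists (phi k).
    have /test_funP[sk [K [cK KO K0]]] := tphi k.
    by apply/test_funP; split => //; exists K; split => // x /KO[].
  have := HM k (leq_maxr _ _); have /= fk := HN k (leq_maxl _ _).
  rewrite sub0r normrN => H; rewrite -(fineK fk) lee_fin ltW//.
  by apply: le_lt_trans H; rewrite ler_norm.
- move=> f g mf mg fy gy Pf Pg e e0.
  have e1 : 0 < e / 2 / 2 `^ p by rewrite !divr_gt0.
  have [phi tphi Hphi] := Pf _ e1; have [psi tpsi Hpsi] := Pg _ e1.
  exists (fun x => phi x + psi x); first exact: test_funD.
  rewrite (_ : (fun x => _) = fun x : Rn R n => (f x - phi x) + (g x - psi x)); last first.
    by apply/funext => x; ring.
  have mfp : measurable_fun setT (fun x : Rn R n => f x - phi x).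
    by apply: measurable_funB => //; exact: measurable_test_fun tphi.
  have mgp : measurable_fun setT (fun x : Rn R n => g x - psi x).
    by apply: measurable_funB => //; exact: measurable_test_fun tpsi.
  apply: (le_trans (NpD mu (ltW p0) mfp mgp)).
  apply: (@le_trans _ _ ((2 `^ p)%:E * ((e / 2 / 2 `^ p)%:E + (e / 2 / 2 `^ p)%:E))%E).
    by rewrite lee_wpmul2l ?lee_fin ?(ltW p2)// leeD.
  suff H : 2 `^ p * (e / 2 / 2 `^ p + e / 2 / 2 `^ p) <= e.
    by move: H; rewrite -lee_fin EFinM EFinD.
  by rewrite -mulrDl -splitr mulrC divfK// gt_eqF.
- move=> c f mf fy Pf e e0.
  have c0 : 0 < `|c| `^ p + 1 by rewrite ltr_wpDl ?powR_ge0.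
  have e1 : 0 < e / (`|c| `^ p + 1) by rewrite divr_gt0.
  have [phi tphi Hphi] := Pf _ e1.
  exists (fun x => c * phi x); first exact: test_funZ.
  under eq_fun do rewrite -mulrBr.
  rewrite NpZ; last by apply: measurable_funB => //; exact: measurable_test_fun tphi.
  apply: (@le_trans _ _ ((`|c| `^ p)%:E * (e / (`|c| `^ p + 1))%:E)%E).
    by rewrite lee_wpmul2l// lee_fin powR_ge0.
  rewrite -EFinM lee_fin mulrCA ler_piMr ?(ltW e0)// ler_pdivrMr// mul1r.
  by rewrite lerDl.
- move=> f mf fy Happ e e0.
  have e1 : 0 < e / 2 / 2 `^ p by rewrite !divr_gt0.
  have [g [mg gy Pg Hg]] := Happ _ e1; have [phi tphi Hphi] := Pg _ e1.
  exists phi => //.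
  rewrite (_ : (fun x => _) = fun x : Rn R n => (f x - g x) + (g x - phi x)); last first.
    by apply/funext => x; rewrite addrA subrK.
  have mfp : measurable_fun setT (fun x : Rn R n => f x - g x) by exact: measurable_funB.
  have mgp : measurable_fun setT (fun x : Rn R n => g x - phi x).
    by apply: measurable_funB => //; exact: measurable_test_fun tphi.
  apply: (le_trans (NpD mu (ltW p0) mfp mgp)).
  apply: (@le_trans _ _ ((2 `^ p)%:E * ((e / 2 / 2 `^ p)%:E + (e / 2 / 2 `^ p)%:E))%E).
    by rewrite lee_wpmul2l ?lee_fin ?(ltW p2)// leeD.
  suff H : 2 `^ p * (e / 2 / 2 `^ p + e / 2 / 2 `^ p) <= e.
    by move: H; rewrite -lee_fin EFinM EFinD.
  by rewrite -mulrDl -splitr mulrC divfK// gt_eqF.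
Qed.

End density.

(** * Waves on the torus and the kernel [qker] *)

Section trig.
Context {R : realType} {m : nat}.
Implicit Types (k l : 'rV[int]_m) (s : R) (y t : 'rV[R]_m).

Definition trig k s y : R := cos (2 * pi * vdot (intv R k) y + s).

Lemma vdotDl (a b x : 'rV[R]_m) : vdot (a + b) x = vdot a x + vdot b x.
Proof. by rewrite /vdot -big_split/=; apply: eq_bigr => i _; rewrite mxE mulrDl. Qed.

Lemma vdotNl (a x : 'rV[R]_m) : vdot (- a) x = - vdot a x.
Proof. by rewrite /vdot -sumrN; apply: eq_bigr => i _; rewrite mxE mulNr. Qed.

Lemma vdotNr (a x : 'rV[R]_m) : vdot a (- x) = - vdot a x.
Proof. by rewrite /vdot -sumrN; apply: eq_bigr => i _; rewrite mxE mulrN. Qed.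

Lemma vdotZl (c : R) (a x : 'rV[R]_m) : vdot (c *: a) x = c * vdot a x.
Proof. by rewrite /vdot mulr_sumr; apply: eq_bigr => i _; rewrite mxE mulrA. Qed.

Lemma vdot0l (x : 'rV[R]_m) : vdot 0 x = 0.
Proof. by rewrite /vdot big1// => i _; rewrite mxE mul0r. Qed.

Lemma intvD k l : intv R (k + l) = intv R k + intv R l.
Proof. by apply/rowP => i; rewrite !mxE intrD. Qed.

Lemma intvN k : intv R (- k) = - intv R k.
Proof. by apply/rowP => i; rewrite !mxE intrN. Qed.

Lemma intv0 : intv R (0 : 'rV[int]_m) = 0.
Proof. by apply/rowP => i; rewrite !mxE. Qed.

Lemma trig0 s y : trig 0 s y = cos s.
Proof. by rewrite /trig intv0 vdot0l mulr0 add0r. Qed.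

Lemma trig_le1 k s y : `|trig k s y| <= 1.
Proof. by rewrite ler_norml cos_geN1 cos_le1. Qed.

Lemma cos_int_period (t : R) (z : int) : cos (t + 2 * pi * z%:~R) = cos t.
Proof.
have pos (u : R) (j : nat) : cos (u + 2 * pi * j%:R) = cos u.
  elim: j u => [|j IH] u; first by rewrite mulr0 addr0.
  rewrite (_ : u + _ = (u + 2 * pi * j%:R) + pi *+ 2); first by rewrite cosD2pi IH.
  by rewrite -addn1 natrD mulr2n; ring.
case: z => j; first exact: pos.
by rewrite NegzE intrN mulrN -pmulrn -[LHS](pos _ j.+1) subrK.
Qed.

Lemma trig_shift_int k s y (z : 'rV[int]_m) : trig k s (y + intv R z) = trig k s y.
Proof.
rewrite /trig vdotDr mulrDr addrAC.
have [w ->] : exists w : int, vdot (intv R k) (intv R z) = w%:~R.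
  exists (\sum_i k 0 i * z 0 i); rewrite /vdot rmorph_sum/=.
  by apply: eq_bigr => i _; rewrite !mxE intrM.
exact: cos_int_period.
Qed.

Lemma intv_delta i : intv R (delta_mx 0 i : 'rV[int]_m) = delta_mx 0 i.
Proof. by apply/rowP => j; rewrite !mxE; case: (_ && _). Qed.

Lemma periodic_trig k s : periodic (trig k s).
Proof. by move=> y i; rewrite -intv_delta trig_shift_int. Qed.

Lemma trig_affineE k s : trig k s = fun y => cos (vdot ((2 * pi) *: intv R k) y + s).
Proof. by apply/funext => y; rewrite /trig vdotZl. Qed.

Lemma smooth_trig k s : smooth (trig k s).
Proof. rewrite trig_affineE; apply: smooth_affine; exact: smooth1_cos. Qed.

Lemma continuous_trig k s : continuous (trig k s).
Proof. apply: smooth_continuous; exact: smooth_trig. Qed.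

Lemma measurable_trig k s : measurable_fun [set: Rn R m] (trig k s : Rn R m -> R).
Proof. by apply: continuous_measurable_Rn; exact: continuous_trig. Qed.

(** The phase $-\pi/2$ turns the cosine into the sine. The formula separates [y] from [t], which
    later makes the convolution kernel of finite rank. *)
Lemma trigB k y t : trig k 0 (y - t) =
  trig k 0 y * trig k 0 t + trig k (- (pi / 2)) y * trig k (- (pi / 2)) t.
Proof.
rewrite /trig vdotDr vdotNr mulrBr !addr0 cosB.
by rewrite !(cosB _ (pi / 2)) cos_pihalf sin_pihalf !mulr0 !add0r !mulr1.
Qed.

Definition cosum (L : seq (R * 'rV[int]_m)) y : R := \sum_(ck <- L) ck.1 * trig ck.2 0 y.

(** Product-to-sum formula: frequencies $k$ and $k'$ give $k\pm k'$, each with half the product of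
    the weights. *)
Lemma cosumM (L1 L2 : seq (R * 'rV[int]_m)) : exists L, forall y,
  cosum L y = cosum L1 y * cosum L2 y.
Proof.
elim: L1 => [|[c k] L1 [L HL]].
  by exists [::] => y; rewrite /cosum !big_nil mul0r.
exists (flatten [seq [:: (c * ck.1 / 2, k + ck.2); (c * ck.1 / 2, k - ck.2)] | ck <- L2] ++ L) => y.
rewrite /cosum big_cat/= -/(cosum L y) HL big_cons mulrDl; congr (_ + _).
rewrite big_flatten/= big_map mulr_sumr; apply: eq_bigr => -[c' k'] _ /=.
rewrite !big_cons big_nil addr0 /= /trig intvD intvD intvN !vdotDl vdotNl !mulrDr mulrN !addr0.
by rewrite cosD cosB; field.
Qed.

(* Powers of [qker], normalised to mass 1, form a nonnegative trigonometric
   approximate identity on the torus; this replaces the Fejer kernel. *)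
Definition qker y : R := \prod_i ((1 + cos (2 * pi * y 0 i)) / 2).

Lemma qker_ge0 y : 0 <= qker y.
Proof. by apply: prodr_ge0 => i _; rewrite divr_ge0//; have := cos_geN1 (2 * pi * y 0 i); lra. Qed.

Lemma qker_le1 y : qker y <= 1.
Proof.
apply: prodr_ile1 => i _; have := cos_geN1 (2 * pi * y 0 i); have := cos_le1 (2 * pi * y 0 i).
by move: (cos _) => c; lra.
Qed.

Lemma qker_cosum : exists L, forall y, cosum L y = qker y.
Proof.
rewrite /qker; elim: (index_enum _) => [|i s [L HL]].
  by exists [:: (1, 0)] => y; rewrite /cosum big_seq1 big_nil/= trig0 cos0 mulr1.
have [L' HL'] := cosumM [:: (2^-1, 0); (2^-1, delta_mx 0 i)] L.
exists L' => y; rewrite HL' HL big_cons; congr (_ * _).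
rewrite /cosum !big_cons big_nil addr0/= trig0 cos0 mulr1.
rewrite /trig intv_delta addr0 (_ : vdot _ _ = y 0 i); first by field.
rewrite /vdot (bigD1 i)//= big1 ?addr0 => [|j ji]; rewrite mxE eqxx/=.
  by rewrite eqxx mul1r.
by rewrite (negbTE ji) mul0r.
Qed.

Lemma qkerX_cosum N : exists L, forall y, cosum L y = qker y ^+ N.
Proof.
elim: N => [|N [L HL]].
  by exists [:: (1, 0)] => y; rewrite /cosum big_seq1/= trig0 cos0 mulr1.
have [L1 H1] := qker_cosum; have [L2 H2] := cosumM L1 L.
by exists L2 => y; rewrite H2 H1 HL exprS.
Qed.

Lemma near_int (x : R) : exists z : int, `|x - z%:~R| <= 2^-1.
Proof.
exists (Num.floor (x + 2^-1)).
have := floor_le_tmp (x + 2^-1); have := floorD1_gt (x + 2^-1).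
by rewrite intrD ler_distl; move: (_ %:~R : R) => z; lra.
Qed.

(** $\cos(2\pi x)$ depends only on the distance from $x$ to the nearest integer and decreases with
    it on $[0,1/2]$; [eta] is the drop at distance $\min(dl,1/2)$. *)
Lemma cos_near1 (dl : R) : 0 < dl -> exists2 eta : R, 0 < eta &
  forall x : R, 1 - eta < cos (2 * pi * x) -> exists z : int, `|x - z%:~R| < dl.
Proof.
move=> dl0; pose d := Num.min dl (2^-1).
have d0 : 0 < d by rewrite lt_min dl0 invr_gt0/=.
have d2 : d <= 2^-1 by rewrite ge_min lexx orbT.
have pi0 := pi_gt0 R.
have pd : 0 < 2 * pi * d by rewrite !mulr_gt0.
have hp (t : R) : t <= 2^-1 -> 2 * pi * t <= pi.
  move=> t2; rewrite (_ : 2 * pi * t = pi * (2 * t)); last by ring.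
  by rewrite -[leRHS]mulr1 ler_wpM2l ?(ltW pi0)//; move: t2; lra.
have pd2 := hp d d2.
exists (1 - cos (2 * pi * d)).
  have i0 : (0 : R) \in `[0, pi] by rewrite in_itv/= lexx ltW.
  have id : 2 * pi * d \in `[0, pi] by rewrite in_itv/= (ltW pd).
  by rewrite subr_gt0 -[ltRHS]cos0 ltr_cos.
move=> x; rewrite subKr => cx; have [z xz] := near_int x; exists z.
rewrite ltNge; apply/negP => dx; move: cx; rewrite ltNge => /negP; apply.
have -> : cos (2 * pi * x) = cos (2 * pi * `|x - z%:~R|).
  have -> : cos (2 * pi * x) = cos (2 * pi * (x - z%:~R)).
    by rewrite -(cos_int_period (2 * pi * (x - z%:~R)) z) -mulrDr subrK.
  by case: (ler0P (x - z%:~R)) => _ //; rewrite mulrN cosN.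
have [->|ne] := eqVneq (`|x - z%:~R|) d; first by [].
have m1 : 2 * pi * d \in `[0, pi] by rewrite in_itv/= (ltW pd).
have m2 : 2 * pi * `|x - z%:~R| \in `[0, pi].
  by rewrite in_itv/= hp// andbT mulr_ge0// mulr_ge0// ltW.
apply: ltW; rewrite ltr_cos// ltr_pM2l ?mulr_gt0// lt_neqAle eq_sym ne/=.
by apply: le_trans dx; rewrite /d ge_min lexx.
Qed.

(** All factors of [qker] lie in $[0,1]$, so each is at least the product. A factor $(1+c)/2$ above
    $1-\eta/2$ means $c>1-\eta$, whence the halved [eta]. *)
Lemma qker_near1 (dl : R) : 0 < dl -> exists2 eta : R, 0 < eta &
  forall y, 1 - eta < qker y -> exists z : 'rV[int]_m, forall i, `|y 0 i - (z 0 i)%:~R| < dl.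
Proof.
move=> dl0; have [eta eta0 H] := cos_near1 dl0.
exists (eta / 2); first by rewrite divr_gt0.
move=> y qy.
suff /choice[z Hz] (i : 'I_m) : exists z : int, `|y 0 i - z%:~R| < dl.
  by exists (\row_i z i) => i; rewrite mxE.
apply: H; move: qy; rewrite /qker (bigD1 i)//= => qy.
have : \prod_(j < m | j != i) ((1 + cos (2 * pi * y 0 j)) / 2) <= 1.
  apply: prodr_ile1 => j _; have := cos_geN1 (2 * pi * y 0 j); have := cos_le1 (2 * pi * y 0 j).
  by move: (cos _) => c; lra.
have : 0 <= \prod_(j < m | j != i) ((1 + cos (2 * pi * y 0 j)) / 2).
  by apply: prodr_ge0 => j _; rewrite divr_ge0//; have := cos_geN1 (2 * pi * y 0 j); lra.
have := cos_geN1 (2 * pi * y 0 i); have := cos_le1 (2 * pi * y 0 i).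
move: qy; move: (\prod_(j < m | _) _) (cos _) => P c; nra.
Qed.

Lemma qker_continuous : continuous qker.
Proof.
apply: continuous_prodr => i; apply: continuous_mulr; last exact: cst_continuous.
apply: continuous_addr; first exact: cst_continuous.
rewrite (_ : (fun x => _) = trig (delta_mx 0 i) 0); first exact: continuous_trig.
apply/funext => y; rewrite /trig intv_delta addr0; congr (cos (_ * _)).
rewrite /vdot (bigD1 i)//= big1 ?addr0 => [|j ji]; rewrite mxE eqxx/=.
  by rewrite eqxx mul1r.
by rewrite (negbTE ji) mul0r.
Qed.

Lemma qker0 : qker 0 = 1.
Proof. by rewrite /qker big1// => i _; rewrite mxE mulr0 cos0 divff. Qed.

Lemma periodic_int (T : Type) (w : 'rV[R]_m -> T) : periodic w ->
  forall y z, w (y + intv R z) = w y.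
Proof.
move=> pw.
have nat1 y (j : nat) i : w (y + j%:R *: delta_mx 0 i) = w y.
  elim: j y => [|j IH] y; first by rewrite scale0r addr0.
  by rewrite -natr1 scalerDl scale1r addrA pw IH.
have int1 y (j : int) i : w (y + j%:~R *: delta_mx 0 i) = w y.
  case: j => j; first exact: nat1.
  rewrite NegzE intrN scaleNr -[LHS](nat1 _ j.+1 i).
  by rewrite subrK.
move=> y z.
have -> : intv R z = \sum_(i <- enum 'I_m) (z 0 i)%:~R *: delta_mx 0 i.
  by rewrite big_enum/= [LHS]row_sum_delta; apply: eq_bigr => i _; rewrite mxE.
elim: (enum 'I_m) y => [|i s IH] y; first by rewrite big_nil addr0.
by rewrite big_cons addrA IH int1.
Qed.

Lemma periodic_reduce y : exists z : 'rV[int]_m, Ycell R m (y + intv R z).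
Proof.
exists (\row_i - Num.floor (y 0 i)) => i; rewrite !mxE intrN.
have := floor_le_tmp (y 0 i); have := floorD1_gt (y 0 i).
by rewrite intrD; move: (_ %:~R : R) => z; lra.
Qed.

(** Closeness on the torus is expressed by [qker (y - t)] being near 1, the form in which the kernel
    estimates produce it. The uniformity comes from compactness of a box containing the cell. *)
Lemma periodic_unif_continuous (g : 'rV[R]_m -> R) (e : R) : continuous g -> periodic g ->
  0 < e -> exists2 eta : R, 0 < eta & forall y t, 1 - eta < qker (y - t) -> `|g y - g t| < e.
Proof.
move=> cg pg e0.
pose K := [set x : 'rV[R]_m | forall i, (const_mx (-1) : 'rV[R]_m) 0 i <= x 0 i <= (const_mx 2 : 'rV[R]_m) 0 i].
have cK : compact K by exact: compact_box.
have [dl dl0 Hdl] : exists2 dl : R, 0 < dl &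
    forall a b : 'rV[R]_m, K a -> (forall i, `|b 0 i - a 0 i| < dl) -> `|g a - g b| < e.
  have Hcov : \forall h \near (0 : 'rV[R]_m), K `<=` (fun x => `|g x - g (x + h)| < e).
    move/compact_near_coveringP : cK =>
      /(_ _ (nbhs (0 : 'rV[R]_m)) (fun h x => `|g x - g (x + h)| < e)); apply => x _.
    have c1 : (fun z : 'rV[R]_m * 'rV[R]_m => z.1) @ (x, (0 : 'rV[R]_m)) --> x by exact: cvg_fst.
    have c2 : (fun z : 'rV[R]_m * 'rV[R]_m => z.1 + z.2) @ (x, (0 : 'rV[R]_m)) --> x + 0.
      by apply: cvgD; [exact: cvg_fst|exact: cvg_snd].
    have c3 : (fun z : 'rV[R]_m * 'rV[R]_m => g z.1 - g (z.1 + z.2)) @ (x, (0 : 'rV[R]_m)) -->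
         g x - g (x + 0).
      have c1' : g z.1 @[z --> (x, (0 : 'rV[R]_m))] --> g x by apply: continuous_cvg c1; exact: cg.
      have c2' : g (z.1 + z.2) @[z --> (x, (0 : 'rV[R]_m))] --> g (x + 0).
        by apply: continuous_cvg c2; exact: cg.
      exact: (cvgB c1' c2').
    rewrite addr0 subrr in c3.
    by have /cvgrPdist_lt/(_ _ e0) := c3; apply: filterS => -[a h] /=; rewrite sub0r normrN.
  have /nbhs_ballP[dl /= dl0 H] := Hcov; exists dl => // a b Ka ab.
  have := H (b - a); rewrite -ball_normE /= sub0r normrN => H'.
  have := H' _ a Ka; rewrite [a + _]addrC subrK; apply.
  by apply: rV_norm_lt => // i; rewrite !mxE.
have [eta eta0 H] := qker_near1 dl0.
exists eta => // y t qyt; have [z Hz] := H _ qyt.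
have [w Yw] := periodic_reduce y.
(* One integer translation brings [y] into the cell and another brings [t] next to it; [g] takes the
   same values. *)
rewrite -(periodic_int pg y w) -(periodic_int pg t (z + w)).
apply: Hdl.
  move=> i; rewrite !mxE; have := Yw i; rewrite !mxE; lra.
move=> i; have := Hz i; rewrite !mxE intrD -normrN; congr (`|_| < _); ring.
Qed.

End trig.

(** A shifted unit interval loses $[0,sg)$ and gains $[1,1+sg)$. In the integral of a periodic
    function the two pieces cancel. *)
Lemma indic_interval_shift {R : realType} (sg a : R) : 0 < sg -> sg <= 1 ->
  (sg <= a < 1 + sg)%R%:R =
  (0 <= a < 1)%R%:R - ((0 <= a < 1) && (a < sg))%:R + ((1 <= a < 1 + 1) && (a < sg + 1))%:R :> R.
Proof.
move=> sg0 sg1; rewrite [sg + 1]addrC.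
have [h1|h1] := leP sg a; have [h2|h2] := leP 1 a; try (exfalso; lra);
  have [h3|h3] := leP 0 a; try (exfalso; lra);
  have [h4|h4] := leP (1 + sg) a; try (exfalso; lra); rewrite /= ?subrr ?subr0 ?addr0 ?add0r//.
  by rewrite andbF.
by rewrite andbT (_ : a < 1 + 1) //; lra.
Qed.

(** * The cell as a probability space, and the mean of a wave *)

Section torus.
Context {R : realType} {m : nat} (mum : {measure set (Rn R m) -> \bar R}).
Hypothesis lmum : is_lebesgue mum.
Implicit Types (k l : 'rV[int]_m) (s : R) (y t : 'rV[R]_m).

Lemma measurable_coord_set (i : 'I_m) (A : set R) : measurable A ->
  measurable [set y : Rn R m | A (y 0 i)].
Proof.
move=> mA; rewrite -[X in measurable X]setTI.
apply: (_ : measurable_fun [set: Rn R m] (fun y : Rn R m => y 0 i)) => //.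
by apply: continuous_measurable_Rn; exact: coord_continuous.
Qed.

Lemma measurable_Ycell : measurable (Ycell R m : set (Rn R m)).
Proof.
have -> : (Ycell R m : set (Rn R m)) = \bigcap_(i in [set: 'I_m]) [set y : Rn R m | `[0, 1[%classic (y 0 i)].
  apply/seteqP; split => y H i; first by move=> _; rewrite /= in_itv /=; exact: H.
  by have := H i I; rewrite /= in_itv.
apply: fin_bigcap_measurable => [|i _]; first exact: finite_finset.
by apply: measurable_coord_set; exact: measurable_itv.
Qed.

(** The open cell: around its points small torus neighbourhoods do not wrap around, which the
    convergence for indicators requires. *)
Definition Yint : set 'rV[R]_m := [set y | forall i, 0 < y 0 i < 1].

Lemma measurable_Yint : measurable (Yint : set (Rn R m)).
Proof.
have -> : (Yint : set (Rn R m)) = \bigcap_(i in [set: 'I_m]) [set y : Rn R m | `]0, 1[%classic (y 0 i)].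
  apply/seteqP; split => y H i; first by move=> _; rewrite /= in_itv /=; exact: H.
  by have := H i I; rewrite /= in_itv.
apply: fin_bigcap_measurable => [|i _]; first exact: finite_finset.
by apply: measurable_coord_set; exact: measurable_itv.
Qed.

Lemma Yint_sub : Yint `<=` Ycell R m.
Proof. by move=> y H i; have /andP[/ltW -> ->] := H i. Qed.

Lemma cvg_scaled_cube (c : R) : (fun j : nat => (1 + c * j.+1%:R^-1) ^+ m) @ \oo --> (1 : R).
Proof.
have c1 : (fun j : nat => 1 + c * j.+1%:R^-1) @ \oo --> (1 : R).
  rewrite -[X in _ --> X]addr0; apply: cvgD; first exact: cvg_cst.
  by rewrite -[X in _ --> X](mulr0 c); apply: cvgMr; exact: cvg_harmonic.
elim: m => [|d IH]; first by under eq_fun do rewrite expr0; exact: cvg_cst.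
rewrite (_ : (fun j => _ ^+ d.+1) = (fun j : nat => (1 + c * j.+1%:R^-1) * (1 + c * j.+1%:R^-1) ^+ d)).
  by rewrite -[X in _ --> X]mulr1; exact: cvgM.
by apply/funext => j; rewrite exprS.
Qed.

(** [is_lebesgue] measures boxes closed on the right, whereas the cell is closed on the left. Its
    measure is squeezed between those of $(0,1-\frac1{j+1}]^m$ and $(-\frac1{j+1},1]^m$. *)
Lemma mum_Yint_ge1 : (1 <= mum (Yint : set (Rn R m)))%E.
Proof.
have H j : (((1 + (-1) * j.+1%:R^-1) ^+ m)%:E <= mum (Yint : set (Rn R m)))%E.
  have j0 : 0 <= 1 - (j.+1%:R^-1 : R) by rewrite subr_ge0 invf_le1// ler1n.
  have jp : 0 < (j.+1%:R^-1 : R) by rewrite invr_gt0.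
  have := @lmum 0 (const_mx (1 - j.+1%:R^-1)) _.
  rewrite (eq_bigr (fun=> 1 + (-1) * j.+1%:R^-1)); last first.
    by move=> i _; rewrite !mxE subr0 mulN1r.
  rewrite prodr_const card_ord => <-; last by move=> i; rewrite !mxE.
  apply: le_measure; rewrite ?inE; [exact: measurable_box|exact: measurable_Yint|].
  by move=> y Hy i; have := Hy i; rewrite !mxE; move: (j.+1%:R^-1) jp => a; lra.
have [fin|] := boolP (mum (Yint : set (Rn R m)) \is a fin_num); last first.
  by rewrite ge0_fin_numE// -leNgt leye_eq => /eqP ->; rewrite leey.
rewrite -(fineK fin) lee_fin.
have c := @cvg_scaled_cube (-1); rewrite -(cvg_lim _ c)//.
apply: limr_le; first by apply/cvg_ex; exists 1.
by apply: nearW => j; rewrite -lee_fin fineK.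
Qed.

Lemma mum_Ycell_le1 : (mum (Ycell R m : set (Rn R m)) <= 1)%E.
Proof.
have H j : (mum (Ycell R m : set (Rn R m)) <= ((1 + 1 * j.+1%:R^-1) ^+ m)%:E)%E.
  have jp : 0 < (j.+1%:R^-1 : R) by rewrite invr_gt0.
  have := @lmum (const_mx (- j.+1%:R^-1)) (const_mx 1) _.
  rewrite (eq_bigr (fun=> 1 + 1 * j.+1%:R^-1)); last first.
    by move=> i _; rewrite !mxE opprK mul1r.
  rewrite prodr_const card_ord => <-; last by move=> i; rewrite !mxE; move: (j.+1%:R^-1) jp => a; lra.
  apply: le_measure; rewrite ?inE; [exact: measurable_Ycell|exact: measurable_box|].
  by move=> y Hy i; have := Hy i; rewrite !mxE; move: (j.+1%:R^-1) jp => a; lra.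
have fin : mum (Ycell R m : set (Rn R m)) \is a fin_num.
  by rewrite ge0_fin_numE// (le_lt_trans (H 0%N))// ltry.
rewrite -(fineK fin) lee_fin.
have c := @cvg_scaled_cube 1; rewrite -(cvg_lim _ c)//.
apply: limr_ge; first by apply/cvg_ex; exists 1.
by apply: nearW => j; rewrite -lee_fin fineK.
Qed.

Lemma mum_Ycell : mum (Ycell R m : set (Rn R m)) = 1%E.
Proof.
apply/eqP; rewrite eq_le mum_Ycell_le1/=; apply: (le_trans mum_Yint_ge1).
by apply: le_measure; rewrite ?inE; [exact: measurable_Yint|exact: measurable_Ycell|exact: Yint_sub].
Qed.

Lemma mum_Yint : mum (Yint : set (Rn R m)) = 1%E.
Proof.
apply/eqP; rewrite eq_le mum_Yint_ge1 andbT -mum_Ycell.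
by apply: le_measure; rewrite ?inE; [exact: measurable_Yint|exact: measurable_Ycell|exact: Yint_sub].
Qed.

Lemma mum_Ycell_lty : (mum (Ycell R m : set (Rn R m)) < +oo)%E.
Proof. by rewrite mum_Ycell ltry. Qed.

(** A measure on the whole space carried by the cell: integrands need no restriction, and what they
    do off the cell is negligible. *)
Definition nuY : {finite_measure set (Rn R m) -> \bar R} :=
  mfrestr measurable_Ycell mum_Ycell_lty.

Lemma nuY_setT : nuY setT = 1%E.
Proof. by rewrite /nuY /= /mfrestr /mrestr setTI mum_Ycell. Qed.

Lemma nuYE (f : Rn R m -> \bar R) :
  (\int[nuY]_y (f \_ (Ycell R m : set (Rn R m))) y)%E = (\int[mum]_(y in (Ycell R m : set (Rn R m))) f y)%E.
Proof.
rewrite -integral_mkcond; apply: eq_measure_integral => A mA AY.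
by rewrite /nuY /= /mfrestr /mrestr setIidl.
Qed.

Lemma nuY_ae (P : Rn R m -> Prop) : (forall y, Ycell R m y -> P y) -> {ae nuY, forall y, P y}.
Proof.
move=> OP; exists (~` (Ycell R m : set (Rn R m))); split.
- by apply: measurableC; exact: measurable_Ycell.
- by rewrite /nuY /= /mfrestr /mrestr setICl measure0.
- by move=> x /= nP Ox; apply: nP; exact: OP.
Qed.

Lemma nuY_ae_int : {ae nuY, forall y : Rn R m, Yint y}.
Proof.
exists (~` (Yint : set (Rn R m))); split => //.
  by apply: measurableC; exact: measurable_Yint.
rewrite /nuY /= /mfrestr /mrestr setIC -setDE measureD//; first last.
- exact: mum_Ycell_lty.
- exact: measurable_Yint.
- exact: measurable_Ycell.
by rewrite (setIidr Yint_sub) [X in (X - _)%E]mum_Ycell [X in (_ - X)%E]mum_Yint subee.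
Qed.

Lemma nuY_integral (f : Rn R m -> \bar R) : measurable_fun setT f ->
  (\int[nuY]_y f y)%E = (\int[mum]_(y in (Ycell R m : set (Rn R m))) f y)%E.
Proof.
move=> mf; rewrite -nuYE; apply: ae_eq_integral => //.
  apply/measurable_restrict => //; first exact: measurable_Ycell.
  exact: measurable_funTS.
apply: nuY_ae => y Yy _; rewrite patchE mem_set//.
Qed.

(** Moving by half a wavelength along a coordinate with $k_i\ne0$ changes the sign of the wave,
    while the moved cell differs from the cell only by a slab translated by an integer. So the
    integral equals its own negative. *)
Lemma integral_trig k s : k != 0 -> (\int[nuY]_y (trig k s y)%:E)%E = 0%E.
Proof.
move=> k0.
have [i ki] : exists i, k 0 i != 0.
  apply/existsP; apply: contra_neqT k0; rewrite negb_exists => /forallP H.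
  by apply/rowP => i; rewrite mxE; apply/eqP; have := H i; rewrite negbK.
have mtr := measurable_trig k s.
rewrite nuY_integral; last exact/measurable_EFinP.
(* Half a wavelength along coordinate [i]: the argument of the cosine moves by $\pm\pi$. *)
pose sg : R := (2 * `|k 0 i|%:~R)^-1.
have kp : (1 : R) <= `|k 0 i|%:~R by rewrite ler1z -gtz0_ge1 normr_gt0.
have sg0 : 0 < sg by rewrite invr_gt0 mulr_gt0// (lt_le_trans _ kp).
have sg1 : sg <= 1 by rewrite invf_le1 ?mulr_gt0 ?(lt_le_trans _ kp)//; move: kp; lra.
pose e : 'rV[R]_m := delta_mx 0 i.
have flip y : trig k s (y + sg *: e) = - trig k s y.
  rewrite /trig vdotDr vdotZr vdot_delta mxE mulrDr addrAC.
  have -> : 2 * pi * (sg * (k 0 i)%:~R) = pi * (Num.sg (k 0 i))%:~R.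
    have kE : ((k 0 i)%:~R : R) = (Num.sg (k 0 i))%:~R * `|k 0 i|%:~R by rewrite -intrM -numEsg.
    rewrite /sg kE.
    have : (`|k 0 i|%:~R : R) != 0 by rewrite gt_eqF// (lt_le_trans _ kp).
    by move: (`|k 0 i|%:~R) => b b0; field.
  have [->|->] : Num.sg (k 0 i) = 1 \/ Num.sg (k 0 i) = -1.
    case: (ltgtP (k 0 i) 0) => [/ltr0_sg|/gtr0_sg|k00]; [by right|by left|].
    by rewrite k00 eqxx in ki.
    by rewrite mulr1 cosDpi.
  by rewrite intrN mulrN1 -[in RHS](subrK pi (_ + s)) cosDpi opprK.
pose Y : set (Rn R m) := Ycell R m.
(* The slab that the moved cell loses; its translate by [e] is the slab gained. *)
pose A : set (Rn R m) := Y `&` [set y : Rn R m | `]-oo, sg[%classic (y 0 i)].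
have mA : measurable A.
  by apply: measurableI; [exact: measurable_Ycell|apply: measurable_coord_set; exact: measurable_itv].
pose F (y : Rn R m) : R := trig k s y.
have mI B : measurable B -> measurable_fun [set: Rn R m] (fun y : Rn R m => \1_B y * F y : R).
  by move=> mB; apply: measurable_funM => //; exact: measurable_indic.
have Ycube (y : Rn R m) : Y y -> cube 3 y by move=> H j; have := H j; rewrite !mxE; lra.
have iI (B : set (Rn R m)) : measurable B -> (forall y, B y -> cube 3 y) ->
    mum.-integrable setT (EFin \o (fun y : Rn R m => \1_B y * F y : R)).
  move=> mB B3; apply: (bounded_support_integrable lmum (M := 3) (C := 1) (mI B mB)).
    by move=> y yM; rewrite indicE memNset ?mul0r// => /B3.
  move=> y; rewrite normrM indicE.
  case: (_ \in _); rewrite ?normr0 ?mul0r// normr1 mul1r; exact: trig_le1.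
have mY : measurable Y := measurable_Ycell.
have A3 y : A y -> cube 3 y by move=> [/Ycube].
pose G B (y : Rn R m) : \bar R := (\1_B y * F y)%:E.
have GY : (\int[mum]_(y in Y) (trig k s y)%:E = \int[mum]_y G Y y)%E.
  rewrite integral_mkcond; apply: eq_integral => y _; rewrite patchE /G indicE.
  by case: ifP => _; rewrite ?mul1r ?mul0r.
rewrite GY.
have fY : (\int[mum]_y G Y y)%E \is a fin_num.
  by apply: (integrable_fin_num measurableT); exact: (iI Y mY Ycube).
have iY := iI Y mY Ycube; have iA := iI A mA A3.
have sh1 : (\int[mum]_y G Y (y + - sg *: e)%R = \int[mum]_y G Y y)%E := integral_shift lmum (- sg *: e) iY.
have sh2 : (\int[mum]_y G A (y + - e)%R = \int[mum]_y G A y)%E := integral_shift lmum (- e) iA.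
have GE (y : Rn R m) : G Y (y + - sg *: e) = ((G A y - G Y y) - G A (y + - e)%R)%E.
  have F1 : F (y + - sg *: e) = - F y.
    by rewrite -[in RHS](subrK (sg *: e) y) -scaleNr /F flip opprK.
  have F2 : F (y + - e) = F y by rewrite -[in RHS](subrK e y) /F periodic_trig.
  rewrite /G F1 F2 -!EFinB; congr EFin.
  suff : (\1_Y (y + - sg *: e) = \1_Y y - \1_A y + \1_A (y + - e) :> R)%R.
    by move=> ->; ring.
  pose C (x : Rn R m) := forall j, j != i -> 0 <= x 0 j < 1.
  have YE x : (x \in Y) = `[< C x >] && (0 <= x 0 i < 1).
    apply/idP/andP => [/set_mem Yx|[/asboolP Cx xi]]; first by split; [apply/asboolP => j _|].
    apply/mem_set => j; have [->//|ji] := eqVneq j i; exact: Cx.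
  have AE x : (x \in A) = [&& `[< C x >], 0 <= x 0 i < 1 & x 0 i < sg].
    rewrite /A in_setI YE -andbA.
    suff -> : (x \in [set y : Rn R m | `]-oo, sg[%classic (y 0 i)]) = (x 0 i < sg) by [].
    apply/idP/idP => [/set_mem|H]; first by rewrite /= in_itv.
    by apply/mem_set; rewrite /= in_itv.
  have Csh c : C (y + c *: e) = C y.
    apply/propext; split => H j ji; have := H j ji; rewrite !mxE eqxx/= (negbTE ji) mulr0 addr0//.
  rewrite !indicE !YE !AE -[- e]scaleN1r !Csh !mxE !eqxx/= !mulr1 !subr_ge0 !ltrBlDr.
  case: `[< C y >]; rewrite ?addr0 ?subr0//=.
  exact: indic_interval_shift.
have : (\int[mum]_y G Y y = - \int[mum]_y G Y y)%E.
  rewrite -{1}sh1; under eq_integral do rewrite GE.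
  have iAY : mum.-integrable setT (fun y => G A y - G Y y)%E by exact: (integrableB measurableT iA iY).
  have iAe : mum.-integrable setT (fun y : Rn R m => G A (y + - e)%R).
    apply: (@eq_integrable _ _ _ mum _ measurableT (EFin \o (fun y : Rn R m => \1_A (y + - e)%R * F y))).
      by move=> y _; rewrite /G /= /F -[in LHS](subrK e y) periodic_trig addrK.
    have mAe : measurable_fun [set: Rn R m] (fun y : Rn R m => \1_A (y + - e)%R * F y : R).
      apply: measurable_funM => //.
      exact: (measurableT_comp (measurable_indic mA) (measurable_shift (- e))).
    apply: (bounded_support_integrable lmum (M := 3) (C := 1) mAe).
      move=> y yM; rewrite indicE memNset ?mul0r// => -[Yy _]; apply: yM => j; have := Yy j.
      by rewrite !mxE eqxx/=; case: (j == i) => /=; lra.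
    move=> y; rewrite normrM indicE.
    case: (_ \in _); rewrite ?normr0 ?mul0r// normr1 mul1r; exact: trig_le1.
  rewrite integralB// sh2 integralB//.
  have fA : (\int[mum]_y G A y)%E \is a fin_num by exact: (integrable_fin_num measurableT iA).
  by rewrite -(fineK fA) -(fineK fY) -!EFinB -EFinN; congr EFin; ring.
move/eqP; rewrite -(fineK fY) -EFinN eqe => /eqP H; congr EFin.
by move: H; move: (fine _) => a; lra.
Qed.

End torus.

Section Rintegral_extra.
Context d (T : measurableType d) {R : realType} (mu : {finite_measure set T -> \bar R}).
Implicit Types (f g : T -> R).

Lemma bounded_integrable f (C : R) : measurable_fun setT f -> (forall x, `|f x| <= C) ->
  mu.-integrable setT (EFin \o f).
Proof.
move=> mf fC; apply: (Lp_integrable (lexx 1) mf).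
exact: (Np_bounded_lty mu ler01 mf fC).
Qed.

Lemma integrable_mul_bounded f g (C : R) : measurable_fun setT f -> (forall x, `|f x| <= C) ->
  mu.-integrable setT (EFin \o g) -> mu.-integrable setT (EFin \o (fun x => f x * g x)).
Proof.
move=> mf fC ig.
have mg : measurable_fun setT g by apply/measurable_EFinP; exact: measurable_int ig.
apply: (@le_integrable _ _ _ mu _ measurableT _ (fun x => (C%:E * (g x)%:E)%E)).
- by apply/measurable_EFinP; exact: measurable_funM.
- by move=> x _ /=; rewrite lee_fin !normrM ler_wpM2r// (le_trans (fC x))// ler_norm.
- exact: (integrableZl _ _ ig).
Qed.

Lemma integrable_sumr (I : Type) (s : seq I) (F : I -> T -> R) :
  (forall i, mu.-integrable setT (EFin \o F i)) ->
  mu.-integrable setT (EFin \o (fun x => \sum_(i <- s) F i x)).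
Proof.
move=> iF; elim: s => [|i s IH].
  rewrite (_ : _ \o _ = cst 0%E); last by apply/funext => x /=; rewrite big_nil.
  exact: integrable0.
rewrite (_ : _ \o _ = (EFin \o F i) \+ (EFin \o (fun x => (\sum_(i <- s) F i x)%R)))%E; last first.
  by apply/funext => x /=; rewrite big_cons EFinD.
exact: integrableD.
Qed.

Lemma Rintegral_sumr (I : Type) (s : seq I) (F : I -> T -> R) :
  (forall i, mu.-integrable setT (EFin \o F i)) ->
  \int[mu]_x (\sum_(i <- s) F i x) = \sum_(i <- s) \int[mu]_x F i x.
Proof.
move=> iF; elim: s => [|i s IH].
  under eq_Rintegral do rewrite big_nil.
  by rewrite big_nil Rintegral_cst// mul0r.
under eq_Rintegral do rewrite big_cons.
by rewrite RintegralD ?IH ?big_cons//; exact: integrable_sumr.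
Qed.

Lemma integrableZr f (c : R) : mu.-integrable setT (EFin \o f) ->
  mu.-integrable setT (EFin \o (fun x => c * f x)).
Proof. by move=> i; exact: (integrableZl _ _ i). Qed.

Lemma integrable_addr f g : mu.-integrable setT (EFin \o f) -> mu.-integrable setT (EFin \o g) ->
  mu.-integrable setT (EFin \o (fun x => f x + g x)).
Proof. by move=> i j; exact: (integrableD measurableT i j). Qed.

Lemma integrable_subr f g : mu.-integrable setT (EFin \o f) -> mu.-integrable setT (EFin \o g) ->
  mu.-integrable setT (EFin \o (fun x => f x - g x)).
Proof. by move=> i j; exact: (integrableB measurableT i j). Qed.

Lemma Rintegral_fineK f : mu.-integrable setT (EFin \o f) ->
  (\int[mu]_x (f x)%:E)%E = (\int[mu]_x f x)%:E.
Proof. by move=> i; rewrite /Rintegral fineK//; exact: integrable_fin_num. Qed.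

End Rintegral_extra.

(** * The approximate identity: mass, concentration, finite-rank expansion *)

Section kernel.
Context {R : realType} {m : nat} (mum : {measure set (Rn R m) -> \bar R}).
Hypothesis lmum : is_lebesgue mum.
Implicit Types (k l : 'rV[int]_m) (s : R) (y t : 'rV[R]_m).
Notation nu := (nuY lmum).

Lemma Rintegral_cst1 (c : R) : \int[nu]_y c = c.
Proof.
by rewrite Rintegral_cst// [X in _ * fine X]nuY_setT mulr1.
Qed.

Lemma integrable_trig k s : nu.-integrable setT (EFin \o (trig k s : Rn R m -> R)).
Proof. exact: (bounded_integrable nu (measurable_trig k s) (trig_le1 k s)). Qed.

Lemma Rintegral_trig k s : \int[nu]_y trig k s y = (k == 0)%:R * cos s.
Proof.
have [->|k0] := eqVneq k 0.
  under eq_Rintegral do rewrite trig0.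
  by rewrite Rintegral_cst1 mul1r.
by rewrite /Rintegral integral_trig// mul0r.
Qed.

Lemma measurable_qkerX N : measurable_fun [set: Rn R m] (fun y : Rn R m => qker y ^+ N).
Proof.
apply: continuous_measurable_Rn; elim: N => [|N IH].
  by under eq_fun do rewrite expr0; exact: cst_continuous.
by under eq_fun do rewrite exprS; apply: continuous_mulr => //; exact: qker_continuous.
Qed.

Lemma integrable_qkerX N : nu.-integrable setT (EFin \o (fun y : Rn R m => qker y ^+ N)).
Proof.
apply: (bounded_integrable nu (measurable_qkerX N) (C := 1)) => y.
by rewrite ger0_norm ?exprn_ge0 ?qker_ge0// exprn_ile1 ?qker_ge0 ?qker_le1.
Qed.

Definition qmass N : R := \int[nu]_y (qker y ^+ N).
Definition Kf N y : R := qker y ^+ N / qmass N.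

(** [qker] is continuous with value 1 at 0, so the level set contains a small box $(0,r]^m$, which
    also lies in the cell and has volume $r^m$. *)
Lemma qker_level_pos (eta : R) : 0 < eta -> exists2 dl : R, 0 < dl &
  (dl%:E <= nu [set y : Rn R m | (1 - eta < qker y)%R])%E.
Proof.
move=> eta0.
pose U : set 'rV[R]_m := [set y | 1 - eta < qker y].
have oU : open U.
  apply: (@open_comp _ _ (@qker R m) [set x | 1 - eta < x]).
    by move=> y _; exact: qker_continuous.
  exact: open_gt.
have U0 : U 0 by rewrite /U /= qker0 gtrBl.
have [e e0 He] := open_boxP oU U0.
pose r : R := Num.min e 1 / 2.
have r0 : 0 < r by rewrite divr_gt0// lt_min e0 ltr01.
have re : r < e.
  have : Num.min e 1 <= e by rewrite ge_min lexx.
  by rewrite /r; move: (Num.min e 1) => a; move: e0; lra.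
have r1 : r < 1.
  have : Num.min e 1 <= 1 by rewrite ge_min lexx orbT.
  by rewrite /r; move: (Num.min e 1) => a; lra.
exists (r ^+ m); first by rewrite exprn_gt0.
have := @lmum 0 (const_mx r) _.
rewrite (eq_bigr (fun=> r)); last by move=> i _; rewrite !mxE subr0.
rewrite prodr_const card_ord => <-; last by move=> i; rewrite !mxE ltW.
rewrite /nuY /= /mfrestr /mrestr; apply: le_measure; rewrite ?inE.
- exact: measurable_box.
- by apply: measurableI; [exact: open_measurable_Rn|exact: measurable_Ycell].
move=> y Hy; split.
  by apply: He => i; have := Hy i; rewrite !mxE subr0 ltr_norml; move: re; lra.
by move=> i; have := Hy i; rewrite !mxE; move: r1; lra.
Qed.

Lemma qmass_ge N (eta dl : R) : 0 < eta -> eta <= 1 ->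
  (dl%:E <= nu [set y : Rn R m | (1 - eta < qker y)%R])%E -> (1 - eta) ^+ N * dl <= qmass N.
Proof.
move=> eta0 eta1 dlU; pose U := [set y : Rn R m | 1 - eta < qker y].
have mU : measurable U.
  apply: open_measurable_Rn; apply: (@open_comp _ _ (@qker R m) [set x | 1 - eta < x]).
    by move=> y _; exact: qker_continuous.
  exact: open_gt.
have e1 : 0 <= (1 - eta) ^+ N by rewrite exprn_ge0// subr_ge0.
apply: (@le_trans _ _ (\int[nu]_y ((1 - eta) ^+ N * \1_U y))).
  have iU : nu.-integrable setT (EFin \o (\1_U : Rn R m -> R)).
    apply: (bounded_integrable nu (measurable_indic mU) (C := 1)) => y.
    by rewrite indicE; case: (_ \in _); rewrite ?normr1 ?normr0.
  rewrite RintegralZl// ler_wpM2l// /Rintegral integral_indic// setIT.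
  by rewrite -lee_fin fineK// fin_num_measure.
apply: le_Rintegral => //.
- apply: (bounded_integrable nu (C := (1 - eta) ^+ N)).
    by apply: measurable_funM => //; exact: measurable_indic.
  move=> y; rewrite indicE; case: (_ \in _); rewrite ?mulr1 ?mulr0 ?normr0 ?ger0_norm//.
- exact: integrable_qkerX.
move=> y _; rewrite indicE; have [|] := boolP (y \in U); last by rewrite mulr0 exprn_ge0 ?qker_ge0.
rewrite inE /U /= => yU; rewrite mulr1 lerXn2r ?nnegrE ?subr_ge0 ?qker_ge0//.
exact: ltW.
Qed.

Lemma qmass_gt0 N : 0 < qmass N.
Proof.
have h : 0 < (2^-1 : R) by rewrite invr_gt0.
have [dl dl0 Hdl] := qker_level_pos h.
have h1 : (2^-1 : R) <= 1 by rewrite invf_le1// ler1n.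
apply: lt_le_trans (qmass_ge N h h1 Hdl).
by rewrite mulr_gt0// exprn_gt0//; lra.
Qed.

Lemma Kf_ge0 N y : 0 <= Kf N y.
Proof. by rewrite divr_ge0 ?exprn_ge0 ?qker_ge0// ltW// qmass_gt0. Qed.

Lemma Kf_le N y : Kf N y <= (qmass N)^-1.
Proof.
rewrite /Kf ler_pdivrMr ?qmass_gt0// mulVf ?gt_eqF ?qmass_gt0//.
by rewrite exprn_ile1 ?qker_ge0 ?qker_le1.
Qed.

(** Where [qker] is at most $1-\eta$ its power is at most $(1-\eta)^N$, whereas the mass is at least
    a constant times $(1-\eta/2)^N$; the quotient decays geometrically. *)
Lemma Kf_small (eta e : R) : 0 < eta -> 0 < e ->
  exists N0, forall N, (N0 <= N)%N -> forall y, qker y <= 1 - eta -> Kf N y <= e.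
Proof.
move=> eta0 e0.
have [eta1|eta1] := leP eta 1; last first.
  by exists 0%N => N _ y; have := qker_ge0 y; move: eta1; lra.
have h0 : 0 < eta / 2 by rewrite divr_gt0.
have h1 : eta / 2 <= 1 by move: eta1; lra.
have [dl dl0 Hdl] := qker_level_pos h0.
pose q := (1 - eta) / (1 - eta / 2).
have d0 : 0 < 1 - eta / 2 by move: eta0 eta1; lra.
have q0 : 0 <= q by rewrite divr_ge0 ?subr_ge0// ltW.
have q1 : q < 1 by rewrite ltr_pdivrMr// mul1r; move: eta0; lra.
have : (fun N => q ^+ N / dl) @ \oo --> 0.
  rewrite -(mul0r dl^-1); apply: cvgMl; apply: cvg_expr; by rewrite ger0_norm.
move/cvgrPdist_le => /(_ _ e0)[N0 _ HN]; exists N0 => N N0N y qy.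
have := HN N N0N; rewrite sub0r normrN => H; apply: le_trans (le_trans (ler_norm _) H).
rewrite /Kf ler_pdivrMr ?qmass_gt0//.
apply: (@le_trans _ _ ((1 - eta) ^+ N)).
  by rewrite lerXn2r ?nnegrE ?qker_ge0// subr_ge0.
apply: (@le_trans _ _ (q ^+ N / dl * ((1 - eta / 2) ^+ N * dl))).
  rewrite /q expr_div_n -mulrA [X in _ <= _ * X]mulrCA mulVf ?gt_eqF// mulr1.
  by rewrite divfK// gt_eqF// exprn_gt0.
rewrite ler_wpM2l//; first by rewrite divr_ge0 ?exprn_ge0// ltW.
exact: qmass_ge.
Qed.

(** The phases are recorded because the hypothesis on the coefficients of $v_1$ is known for the
    cosine and the sine only. *)
Lemma Kf_expand N : exists L : seq (R * 'rV[int]_m * R),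
  all (fun e => (e.2 == 0) || (e.2 == - (pi / 2))) L /\
  forall y t, Kf N (y - t) = \sum_(e <- L) e.1.1 * trig e.1.2 e.2 y * trig e.1.2 e.2 t.
Proof.
have [L HL] := @qkerX_cosum R m N.
exists (flatten [seq [:: (ck.1 / qmass N, ck.2, 0); (ck.1 / qmass N, ck.2, - (pi / 2))] | ck <- L]).
split; first by elim: L {HL} => //= ck L ->; rewrite !eqxx orbT.
move=> y t; rewrite /Kf -HL /cosum mulr_suml big_flatten/= big_map; apply: eq_bigr => -[c k] _ /=.
rewrite !big_cons big_nil addr0 /= trigB; ring.
Qed.

Definition KL N : seq (R * 'rV[int]_m * R) := projT1 (cid (Kf_expand N)).

Lemma KL_phase N : all (fun e => (e.2 == 0) || (e.2 == - (pi / 2))) (KL N).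
Proof. by have [] := projT2 (cid (Kf_expand N)). Qed.

Lemma KLE N y t : Kf N (y - t) = \sum_(e <- KL N) e.1.1 * trig e.1.2 e.2 y * trig e.1.2 e.2 t.
Proof. by have [_] := projT2 (cid (Kf_expand N)). Qed.

Lemma measurable_Kf N y : measurable_fun [set: Rn R m] (fun t : Rn R m => Kf N (y - t)).
Proof.
under eq_fun do rewrite KLE.
by apply: measurable_sum => e; apply: measurable_funM => //; exact: measurable_trig.
Qed.

Lemma Kf_norm N y : `|Kf N y| <= (qmass N)^-1.
Proof. by rewrite ger0_norm ?Kf_ge0// Kf_le. Qed.

Lemma qkerB0 y : qker (- y) = qker y.
Proof. by apply: eq_bigr => i _; rewrite mxE mulrN cosN. Qed.

Lemma Rintegral_Kf0 N : \int[nu]_t Kf N t = 1.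
Proof.
rewrite /Kf; under eq_Rintegral do rewrite mulrC.
by rewrite RintegralZl ?mulVf ?gt_eqF ?qmass_gt0//; exact: integrable_qkerX.
Qed.

(** Invariance under translation, proved term by term: every wave with $k\ne0$ has mean zero
    whatever its shift. *)
Lemma Rintegral_cosum L y : \int[nu]_t cosum L (y - t) = \int[nu]_t cosum L t.
Proof.
have it k z : nu.-integrable setT (EFin \o (fun t : Rn R m => trig k 0 (z - t))).
  apply: (bounded_integrable nu (C := 1)) => [|t]; last exact: trig_le1.
  under eq_fun do rewrite trigB.
  by apply: measurable_funD; apply: measurable_funM => //; exact: measurable_trig.
rewrite /cosum !Rintegral_sumr; last 2 first.
- by move=> ck; apply: integrableZr; exact: integrable_trig.
- by move=> ck; apply: integrableZr; exact: it.
apply: eq_bigr => -[c k] _ /=; rewrite (RintegralZl _ measurableT (it k y)) (RintegralZl _ measurableT (integrable_trig k 0)).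
congr (_ * _); under eq_Rintegral do rewrite trigB.
rewrite RintegralD//; last 2 first.
- by apply: integrableZr; exact: integrable_trig.
- by apply: integrableZr; exact: integrable_trig.
rewrite !(RintegralZl _ measurableT (integrable_trig k _)).
rewrite !Rintegral_trig cosN cos_pihalf cos0 mulr0 mulr0 addr0 mulr1.
by have [->|] := eqVneq k 0; rewrite ?trig0 ?cos0 ?mulr1 ?mulr0.
Qed.

Lemma Rintegral_Kf N y : \int[nu]_t Kf N (y - t) = 1.
Proof.
have [L HL] := @qkerX_cosum R m N.
pose L' := [seq (ck.1 / qmass N, ck.2) | ck <- L].
have HL' z : Kf N z = cosum L' z.
  rewrite /Kf -HL /cosum mulr_suml big_map; apply: eq_bigr => ck _ /=; ring.
under eq_Rintegral do rewrite HL'.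
rewrite Rintegral_cosum -(Rintegral_Kf0 N); apply: eq_Rintegral => z _; exact/esym/HL'.
Qed.

Lemma Kf_sym N y t : Kf N (y - t) = Kf N (t - y).
Proof. by rewrite /Kf -[qker (y - t)]qkerB0 opprB. Qed.

Lemma Rintegral_Kfl N t : \int[nu]_y Kf N (y - t) = 1.
Proof. by under eq_Rintegral do rewrite Kf_sym; exact: Rintegral_Kf. Qed.

End kernel.

Lemma Np_add_small d (T : measurableType d) (R : realType) (mu : {measure set T -> \bar R})
    (p e : R) (f g : T -> R) : 0 <= p -> measurable_fun setT f -> measurable_fun setT g ->
  (Np mu p f <= (e / 2 / 2 `^ p)%:E)%E -> (Np mu p g <= (e / 2 / 2 `^ p)%:E)%E ->
  (Np mu p (fun x => f x + g x)%R <= e%:E)%E.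
Proof.
move=> p0 mf mg Hf Hg; apply: (le_trans (NpD mu p0 mf mg)).
have p2 : 0 < 2 `^ p :> R by rewrite powR_gt0.
apply: (@le_trans _ _ ((2 `^ p)%:E * ((e / 2 / 2 `^ p)%:E + (e / 2 / 2 `^ p)%:E))%E).
  by rewrite lee_wpmul2l ?lee_fin ?(ltW p2)// leeD.
suff H : 2 `^ p * (e / 2 / 2 `^ p + e / 2 / 2 `^ p) <= e.
  by move: H; rewrite -lee_fin EFinM EFinD.
by rewrite -mulrDl -splitr mulrC divfK// gt_eqF.
Qed.

Lemma aeS d (T : measurableType d) (R : realType) (mu : {measure set T -> \bar R})
    (P Q : T -> Prop) :
  {ae mu, forall x, P x} -> (forall x, P x -> Q x) -> {ae mu, forall x, Q x}.
Proof.
move=> [N [mN N0 sub]] PQ; exists N; split => // x /= nQ; apply: sub => /= Px.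
by apply: nQ; exact: PQ.
Qed.

(** * Convolution with the kernel and its convergence *)

Section TN.
Context {R : realType} {m : nat} (mum : {measure set (Rn R m) -> \bar R}).
Hypothesis lmum : is_lebesgue mum.
Implicit Types (k l : 'rV[int]_m) (s : R) (y t : 'rV[R]_m) (f g h : Rn R m -> R).
Notation nu := (nuY lmum).

(* [Fc k 0] and [Fc k (- (pi / 2))] are the cosine and sine coefficients: a real phase
   [s] replaces complex exponentials. *)
Definition TN N f y : R := \int[nu]_t (Kf lmum N (y - t) * f t).
Definition Fc k s f : R := \int[nu]_t (trig k s t * f t).

Lemma integrable_Kf_mul N y f : nu.-integrable setT (EFin \o f) ->
  nu.-integrable setT (EFin \o (fun t : Rn R m => Kf lmum N (y - t) * f t)).
Proof.
by apply: (integrable_mul_bounded (measurable_Kf lmum N y)) => t; exact: Kf_norm.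
Qed.

Lemma integrable_trig_mul k s f : nu.-integrable setT (EFin \o f) ->
  nu.-integrable setT (EFin \o (fun t : Rn R m => trig k s t * f t)).
Proof. exact: (integrable_mul_bounded (measurable_trig k s) (trig_le1 k s)). Qed.

Lemma TN_expand N f y : nu.-integrable setT (EFin \o f) ->
  TN N f y = \sum_(e <- KL lmum N) e.1.1 * trig e.1.2 e.2 y * Fc e.1.2 e.2 f.
Proof.
move=> i; transitivity (\int[nu]_t \sum_(e <- KL lmum N)
    ((e.1.1 * trig e.1.2 e.2 y) * (trig e.1.2 e.2 t * f t))).
  apply: eq_Rintegral => t _; rewrite KLE mulr_suml; apply: eq_bigr => e _.
  by rewrite -mulrA.
rewrite Rintegral_sumr; last by move=> e; apply: integrableZr; exact: integrable_trig_mul.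
by apply: eq_bigr => e _; rewrite (RintegralZl _ measurableT (integrable_trig_mul e.1.2 e.2 i)).
Qed.

Lemma TN_continuous N f : nu.-integrable setT (EFin \o f) -> continuous (TN N f).
Proof.
move=> i; rewrite (_ : TN N f = fun y => \sum_(e <- KL lmum N) e.1.1 * trig e.1.2 e.2 y * Fc e.1.2 e.2 f).
  apply: continuous_sumr => e; apply: continuous_mulr; last exact: cst_continuous.
  by apply: continuous_mulr; [exact: cst_continuous|exact: continuous_trig].
by apply/funext => y; exact: TN_expand.
Qed.

Lemma measurable_TN N f : nu.-integrable setT (EFin \o f) ->
  measurable_fun [set: Rn R m] (TN N f : Rn R m -> R).
Proof. by move=> i; apply: continuous_measurable_Rn; exact: TN_continuous. Qed.

Lemma TND N f g y : nu.-integrable setT (EFin \o f) -> nu.-integrable setT (EFin \o g) ->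
  TN N (fun t => f t + g t) y = TN N f y + TN N g y.
Proof.
move=> fi gi; rewrite /TN -RintegralD//; [|exact: integrable_Kf_mul|exact: integrable_Kf_mul].
by apply: eq_Rintegral => t _; rewrite mulrDr.
Qed.

Lemma TNB N f g y : nu.-integrable setT (EFin \o f) -> nu.-integrable setT (EFin \o g) ->
  TN N (fun t => f t - g t) y = TN N f y - TN N g y.
Proof.
move=> fi gi; rewrite /TN -RintegralB//; [|exact: integrable_Kf_mul|exact: integrable_Kf_mul].
by apply: eq_Rintegral => t _; rewrite mulrBr.
Qed.

Lemma TNZ N (c : R) f y : nu.-integrable setT (EFin \o f) ->
  TN N (fun t => c * f t) y = c * TN N f y.
Proof.
move=> fi; rewrite /TN -RintegralZl//; last exact: integrable_Kf_mul.
by apply: eq_Rintegral => t _; rewrite mulrCA.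
Qed.

Lemma integrable_cstR (c : R) : nu.-integrable setT (EFin \o (cst c : Rn R m -> R)).
Proof. by apply: (bounded_integrable nu (C := `|c|)). Qed.

Lemma TN_cst N (c : R) y : TN N (cst c) y = c.
Proof.
rewrite /TN; under eq_Rintegral do rewrite /= mulrC.
rewrite RintegralZl ?Rintegral_Kf ?mulr1//.
apply: (bounded_integrable nu (measurable_Kf lmum N y)) => t; exact: Kf_norm.
Qed.

Lemma TN_le N f g y : nu.-integrable setT (EFin \o f) -> nu.-integrable setT (EFin \o g) ->
  (forall t, f t <= g t) -> TN N f y <= TN N g y.
Proof.
move=> fi gi fg; apply: le_Rintegral => //; try exact: integrable_Kf_mul.
by move=> t _; rewrite ler_wpM2l// Kf_ge0.
Qed.

Lemma TN_bound N f (C : R) y : measurable_fun setT f -> (forall t, `|f t| <= C) -> `|TN N f y| <= C.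
Proof.
move=> mf fC; have fi := bounded_integrable nu mf fC.
have h1 : TN N f y <= TN N (cst C) y.
  by apply: TN_le => // [|t]; [exact: integrable_cstR|rewrite (le_trans (ler_norm _))].
have h2 : TN N (cst (- C)) y <= TN N f y.
  by apply: TN_le => // [|t]; [exact: integrable_cstR|have := fC t; rewrite ler_norml => /andP[]].
by rewrite !TN_cst in h1 h2; rewrite ler_norml h1 h2.
Qed.

(** The exchange of integrals is one of finite sums, by the expansion of the kernel; the kernel
    integrates to 1 in its first variable as well. *)
Lemma TN_mass N f : nu.-integrable setT (EFin \o f) -> \int[nu]_y TN N f y = \int[nu]_t f t.
Proof.
move=> fi; transitivity (\sum_(e <- KL lmum N) (e.1.1 * Fc e.1.2 e.2 f) * \int[nu]_y trig e.1.2 e.2 y).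
  transitivity (\int[nu]_y \sum_(e <- KL lmum N) ((e.1.1 * Fc e.1.2 e.2 f) * trig e.1.2 e.2 y)).
    by apply: eq_Rintegral => y _; rewrite TN_expand//; apply: eq_bigr => e _; rewrite mulrAC.
  rewrite Rintegral_sumr; last by move=> e; apply: integrableZr; exact: integrable_trig.
  by apply: eq_bigr => e _; rewrite (RintegralZl _ measurableT (integrable_trig lmum e.1.2 e.2)).
have one t : \sum_(e <- KL lmum N) (e.1.1 * trig e.1.2 e.2 t) * \int[nu]_y trig e.1.2 e.2 y = 1.
  rewrite -(Rintegral_Kfl lmum N t).
  transitivity (\int[nu]_y \sum_(e <- KL lmum N) ((e.1.1 * trig e.1.2 e.2 t) * trig e.1.2 e.2 y)).
    rewrite Rintegral_sumr; last by move=> e; apply: integrableZr; exact: integrable_trig.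
    by apply: eq_bigr => e _; rewrite (RintegralZl _ measurableT (integrable_trig lmum e.1.2 e.2)).
  by apply: eq_Rintegral => y _; rewrite KLE; apply: eq_bigr => e _; rewrite mulrAC.
transitivity (\int[nu]_t \sum_(e <- KL lmum N)
    ((e.1.1 * \int[nu]_y trig e.1.2 e.2 y) * (trig e.1.2 e.2 t * f t))); last first.
  apply: eq_Rintegral => t _; rewrite -[RHS]mul1r -(one t) mulr_suml.
  by apply: eq_bigr => e _; ring.
rewrite Rintegral_sumr; last by move=> e; apply: integrableZr; exact: integrable_trig_mul.
apply: eq_bigr => e _; rewrite (RintegralZl _ measurableT (integrable_trig_mul e.1.2 e.2 fi)).
by rewrite -/(Fc _ _ _); ring.
Qed.

Lemma periodic_bounded (g : 'rV[R]_m -> R) : continuous g -> periodic g ->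
  exists C : R, forall y, `|g y| <= C.
Proof.
move=> cg pg.
pose K := [set x : 'rV[R]_m | forall i, (const_mx 0 : 'rV[R]_m) 0 i <= x 0 i <= (const_mx 1 : 'rV[R]_m) 0 i].
have cK : compact K by exact: compact_box.
have : bounded_set (g @` K).
  by apply: compact_bounded; apply: continuous_compact => //; exact: continuous_subspaceT.
move=> [M [_ HM]]; exists (M + 1) => y.
have [z Yz] := periodic_reduce y; rewrite -(periodic_int pg y z).
apply: (HM (M + 1)); first by rewrite ltrDl.
exists (y + intv R z) => // i; have := Yz i; rewrite [const_mx 0 _ _]mxE [const_mx 1 _ _]mxE.
by move=> /andP[-> /ltW].
Qed.

Lemma TN_unif (g : 'rV[R]_m -> R) (e : R) : continuous g -> periodic g -> 0 < e ->
  exists N0, forall N, (N0 <= N)%N -> forall y, `|TN N g y - g y| <= e.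
Proof.
move=> cg pg e0; have [C HC] := periodic_bounded cg pg.
have C0 : 0 <= C by apply: le_trans (HC 0).
have e20 : 0 < e / 2 by rewrite divr_gt0.
have [eta eta0 Heta] := periodic_unif_continuous cg pg e20.
(* Far from [y] the difference of values is at most $2C$, so kernel values up to [e'] cost at most
   [e / 2]. Near [y] the difference is below [e / 2] and the kernel has mass 1. *)
pose e' := e / 2 / (2 * C + 1).
have e'0 : 0 < e' by rewrite divr_gt0// ltr_wpDl// mulr_ge0.
have [N0 HN0] := Kf_small lmum eta0 e'0.
have mg : measurable_fun [set: Rn R m] (g : Rn R m -> R) by exact: continuous_measurable_Rn.
have ig : nu.-integrable setT (EFin \o (g : Rn R m -> R)) := bounded_integrable nu mg HC.
exists N0 => N NN y.
have idf : nu.-integrable setT (EFin \o (fun t : Rn R m => g t - g y)).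
  apply: (bounded_integrable nu (C := C + C)); first exact: measurable_funB.
  by move=> t; rewrite (le_trans (ler_normB _ _))// lerD.
have iK : nu.-integrable setT (EFin \o (fun t : Rn R m => Kf lmum N (y - t))).
  by apply: (bounded_integrable nu (measurable_Kf lmum N y)) => t; exact: Kf_norm.
rewrite -[X in _ - X](TN_cst N (g y) y) -TNB//; last exact: integrable_cstR.
apply: (le_trans (le_normr_Rintegral measurableT (integrable_Kf_mul N y idf))).
apply: (@le_trans _ _ (\int[nu]_t (e / 2 * Kf lmum N (y - t) + e' * (2 * C)))).
  apply: le_Rintegral => //.
  - exact: (integrable_norm (integrable_Kf_mul N y idf)).
  - apply: integrable_addr; first exact: integrableZr.
    exact: integrable_cstR.
  move=> t _; rewrite normrM (ger0_norm (Kf_ge0 _ _ _)).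
  have K0 := Kf_ge0 lmum N (y - t).
  have [qy|qy] := leP (qker (y - t)) (1 - eta).
    have := HN0 N NN _ qy => Ke.
    have dC : `|g t - g y| <= 2 * C.
      by rewrite (le_trans (ler_normB _ _))// mulr2n mulrDl mul1r lerD.
    apply: (@le_trans _ _ (e' * (2 * C))); first exact: ler_pM.
    by rewrite lerDr mulr_ge0// ltW.
  have := Heta _ _ qy; rewrite distrC => /ltW dl.
  apply: (@le_trans _ _ (e / 2 * Kf lmum N (y - t))); first by rewrite mulrC ler_wpM2r.
  by rewrite lerDl; apply: mulr_ge0; [exact: ltW|exact: mulr_ge0].
rewrite RintegralD//; [|exact: integrableZr|exact: integrable_cstR].
rewrite RintegralZl// Rintegral_Kf Rintegral_cst1 mulr1.
suff : e' * (2 * C) <= e / 2 by lra.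
by rewrite /e' -mulrA ler_piMr ?ltW// mulrC ltr_pdivrMr ?mul1r ?ltrDl// ltr_wpDl// mulr_ge0.
Qed.

(** Jensen's inequality with the probability density $K_N(y-\cdot)$, then conservation of mass for
    $|f|^p$. *)
Lemma TN_contract N (p : R) f : 1 < p -> measurable_fun setT f -> (Np nu p f < +oo)%E ->
  (Np nu p (TN N f : Rn R m -> R) <= Np nu p f)%E.
Proof.
move=> p1 mf fy; have p0 := lt_trans (@ltr01 R) p1.
have fi := Lp_integrable (ltW p1) mf fy.
have pi : nu.-integrable setT (EFin \o (fun t : Rn R m => `|f t| `^ p)).
  apply/integrableP; split; first by apply/measurable_EFinP; exact: measurable_powR_norm.
  move: fy; rewrite NpE; apply: le_lt_trans.
  rewrite le_eqVlt; apply/orP; left; apply/eqP; apply: eq_integral => t _ /=.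
  by rewrite ger0_norm ?powR_ge0.
have mTp := measurable_TN N pi.
have Tpi : nu.-integrable setT (EFin \o (TN N (fun t : Rn R m => `|f t| `^ p) : Rn R m -> R)).
  rewrite (_ : TN _ _ = fun y => \sum_(e <- KL lmum N) (e.1.1 * Fc e.1.2 e.2 (fun t : Rn R m => `|f t| `^ p)) * trig e.1.2 e.2 y).
    by apply: integrable_sumr => e; apply: integrableZr; exact: integrable_trig.
  by apply/funext => y; rewrite TN_expand//; apply: eq_bigr => e _; rewrite mulrAC.
apply: (@le_trans _ _ (\int[nu]_y (TN N (fun t : Rn R m => `|f t| `^ p) y)%:E)%E).
  rewrite NpE; apply: ge0_le_integral => //.
  - exact: measurable_powR_normE (measurable_TN N fi).
  - exact/measurable_EFinP.
  move=> y _; have w1 t : 0 <= Kf lmum N (y - t) <= (qmass lmum N)^-1 by rewrite Kf_ge0 Kf_le.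
  have := jensen_weighted p1 (measurable_Kf lmum N y) mf w1 (Rintegral_Kf lmum N y) fy.
  by rewrite (Rintegral_fineK (integrable_Kf_mul N y pi)).
rewrite (Rintegral_fineK Tpi) (TN_mass N pi) NpE.
by rewrite -(Rintegral_fineK pi).
Qed.

Lemma TN_indic (O : set 'rV[R]_m) y : open O -> O y -> Yint y ->
  (fun N => TN N (\1_O : Rn R m -> R) y) @ \oo --> (1 : R).
Proof.
move=> oO Oy Yy; apply/cvgrPdist_le => e e0.
have [r r0 Hr] := open_boxP oO Oy.
(* [dl] is at most the radius of a box inside [O] and at most the distance from [y] to each face of
   the cell. The latter forces the integer vector supplied by [qker_near1] to vanish. *)
have [dl dl0 [dlr dlY]] : exists2 dl : R, 0 < dl & dl <= r /\ forall i, dl <= y 0 i /\ y 0 i + dl <= 1.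
  pose g i := Num.min (y 0 i) (1 - y 0 i).
  have g0 i : 0 < g i by have /andP[? ?] := Yy i; rewrite lt_min subr_gt0; apply/andP.
  exists (\big[Num.min/r]_i g i); first by apply: lt_bigmin.
  split=> [|i]; first exact: bigmin_le_id.
  have := @bigmin_le_cond _ _ _ r i xpredT g isT.
  by rewrite {2}/g le_min => /andP[h1 h2]; split => //; move: h2; lra.
have [eta eta0 Heta] := @qker_near1 R m dl dl0.
have [N0 HN0] := Kf_small lmum eta0 e0.
have mO : measurable_fun [set: Rn R m] (\1_O : Rn R m -> R).
  by apply: measurable_indic; exact: open_measurable_Rn.
have O01 t : 0 <= (\1_O t : R) <= 1 by rewrite indicE; case: (_ \in _); rewrite /= ?lexx ?ler01.
have iO : nu.-integrable setT (EFin \o (\1_O : Rn R m -> R)).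
  by apply: (bounded_integrable nu mO (C := 1)) => t; have /andP[? ?] := O01 t; rewrite ger0_norm.
have i1 := integrable_cstR 1.
have iD : nu.-integrable setT (EFin \o (fun t : Rn R m => cst 1 t - \1_O t)).
  apply: (bounded_integrable nu (C := 1)); first exact: measurable_funB.
  by move=> t; have /andP[? ?] := O01 t; rewrite ger0_norm ?subr_ge0// gerBl.
exists N0 => // N /= NN; rewrite -{1}(TN_cst N 1 y) -TNB//.
have D0 (t : Rn R m) : 0 <= Kf lmum N (y - t) * (cst 1 t - \1_O t).
  by rewrite mulr_ge0 ?Kf_ge0// subr_ge0; have /andP[] := O01 t.
rewrite ger0_norm; last by apply: Rintegral_ge0 => t _; exact: D0.
rewrite -lee_fin -(Rintegral_fineK (integrable_Kf_mul N y iD)).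
apply: (@le_trans _ _ (\int[nu]_t (cst e%:E) t)%E); last first.
  by rewrite integral_cst// [X in (_ * X <= _)%E]nuY_setT mule1.
apply: ae_ge0_le_integral => //.
- by move=> t _; rewrite lee_fin D0.
- apply/measurable_EFinP; apply: measurable_funM; first exact: measurable_Kf.
  exact: measurable_funB.
- by move=> t _; rewrite lee_fin ltW.
apply: nuY_ae => t Yt _; rewrite lee_fin /= indicE.
have [tO|tO] := boolP (t \in O); first by rewrite subrr mulr0 ltW.
rewrite subr0 mulr1; apply: HN0 => //; rewrite leNgt; apply/negP => /Heta[z Hz].
case/negP : tO; apply/mem_set/Hr => i.
have z0 : z 0 i = 0.
  apply/eqP; apply/negPn/negP => z0.
  have : 1 <= `|z 0 i| by rewrite -gtz0_ge1 normr_gt0.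
  rewrite -(ler_int R) intr_norm leNgt => /negP; apply.
  have := Hz i; have [h1 h2] := dlY i; have := Yt i; rewrite !mxE.
  by move: ((z 0 i)%:~R) => c; rewrite !ltr_norml; lra.
have := Hz i; rewrite z0 subr0 !mxE distrC => /lt_le_trans; apply; exact: dlr.
Qed.

Lemma powR_le_id (p a : R) : 1 <= p -> 0 <= a <= 1 -> a `^ p <= a.
Proof.
move=> p1 /andP[a0 a1]; move: a0; rewrite le_eqVlt => /orP[/eqP <-|a0].
  by rewrite powR0// gt_eqF// (lt_le_trans _ p1).
by apply: ge1r_powR => //; rewrite a0.
Qed.

(** All values lie in $[0,1]$, so the case $p=1$ suffices. Pointwise convergence is known only
    inside [O]; outside, conservation of mass takes over, since $|1_O-T|=2\cdot1_O(1-T)+(T-1_O)$ and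
    the last term has integral zero. *)
Lemma TN_Lp_indic (p : R) (O : set 'rV[R]_m) : 1 <= p -> open O ->
  forall e, 0 < e -> exists N0, forall N, (N0 <= N)%N ->
  (Np nu p (fun y : Rn R m => (\1_O y : R) - TN N (\1_O : Rn R m -> R) y)%R <= e%:E)%E.
Proof.
move=> p1 oO e e0; have p0 : 0 < p by exact: lt_le_trans p1.
have mO : measurable_fun [set: Rn R m] (\1_O : Rn R m -> R).
  by apply: measurable_indic; exact: open_measurable_Rn.
have O01 t : 0 <= (\1_O t : R) <= 1 by rewrite indicE; case: (_ \in _); rewrite /= ?lexx ?ler01.
have iO : nu.-integrable setT (EFin \o (\1_O : Rn R m -> R)).
  by apply: (bounded_integrable nu mO (C := 1)) => t; have /andP[? ?] := O01 t; rewrite ger0_norm.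
pose T N : Rn R m -> R := TN N (\1_O : Rn R m -> R).
have mT N : measurable_fun setT (T N) := measurable_TN N iO.
have T01 N y : 0 <= T N y <= 1.
  rewrite -{1}(TN_cst N 0 y) -(TN_cst N 1 y); apply/andP; split; apply: TN_le => //; 
    try exact: integrable_cstR; by move=> t; have /andP[] := O01 t.
have iT N : nu.-integrable setT (EFin \o T N).
  by apply: (bounded_integrable nu (mT N) (C := 1)) => t; have /andP[? ?] := T01 N t; rewrite ger0_norm.
pose d N (y : Rn R m) : R := \1_O y * (1 - T N y).
have md N : measurable_fun setT (d N) by apply: measurable_funM => //; exact: measurable_funB.
have d01 N y : 0 <= d N y <= 1.
  have /andP[? ?] := O01 y; have /andP[? ?] := T01 N y.
  by rewrite mulr_ge0 ?subr_ge0//= mulr_ile1 ?subr_ge0// gerBl.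
have iD N : nu.-integrable setT (EFin \o d N).
  by apply: (bounded_integrable nu (md N) (C := 1)) => t; have /andP[? ?] := d01 N t; rewrite ger0_norm.
have m0 : measurable_fun [set: Rn R m] (cst (0 : R)) by exact: measurable_cst.
have m1 : measurable_fun [set: Rn R m] (cst (1 : R)) by exact: measurable_cst.
have n1 : (Np nu 1 (cst 1%R : Rn R m -> R) < +oo)%E.
  by apply: (Np_bounded_lty nu ler01 m1 (C := 1)) => x; rewrite normr1.
have ae0 : {ae nu, forall y : Rn R m, d ^~ y @ \oo --> (cst 0 y : R)}.
  apply: (aeS (nuY_ae_int lmum)) => y Yy; rewrite /d /= indicE.
  have [/set_mem yO|_] := boolP (y \in O); last by under eq_fun do rewrite mul0r; exact: cvg_cst.
  under eq_fun do rewrite mul1r.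
  have := cvgB (cvg_cst (1 : R)) (TN_indic oO yO Yy); rewrite subrr; exact.
have bd N (y : Rn R m) : `|d N y| <= `|cst (1 : R) y|.
  by have /andP[? ?] := d01 N y; rewrite normr1 ger0_norm.
have e2 : 0 < e / 2 by rewrite divr_gt0.
have /fine_cvgP[[N1 _ HN1] /cvgrPdist_lt/(_ _ e2)[N2 _ HN2]] := Np_dct ltr01 md m0 m1 n1 ae0 bd.
exists (maxn N1 N2) => N; rewrite geq_max => /andP[NN1 NN2].
have /= fk := HN1 N NN1.
have := HN2 N NN2; rewrite sub0r normrN => /(le_lt_trans (ler_norm _)); rewrite [_ N]/=.
rewrite [X in X < _](_ : _ = \int[nu]_y d N y); last first.
  rewrite NpE /Rintegral; congr fine; apply: eq_integral => y _.
  by rewrite sub0r normrN powRr1// ger0_norm//; have /andP[] := d01 N y.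
move=> dN.
apply: (@le_trans _ _ (\int[nu]_y (2 * d N y + (T N y - \1_O y))%:E)%E).
  rewrite NpE; apply: ge0_le_integral => //.
  - exact: (measurable_powR_normE p (measurable_funB mO (mT N))).
  - apply/measurable_EFinP; apply: measurable_funD; first exact: measurable_funM.
    exact: measurable_funB.
  move=> y _; rewrite lee_fin -[TN _ _ _]/(T N y).
  have /andP[? ?] := T01 N y; have /andP[? ?] := O01 y.
  apply: (@le_trans _ _ `|\1_O y - T N y|).
    by apply: powR_le_id => //; rewrite normr_ge0/= ler_norml; lra.
  rewrite /d indicE; case: (_ \in _) => /=; rewrite ler_norml; lra.
have i2 : nu.-integrable setT (EFin \o (fun y => 2 * d N y)) by exact: integrableZr.
have i3 : nu.-integrable setT (EFin \o (fun y => T N y - \1_O y)) by exact: (integrableB _ (iT N) iO).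
have i4 : nu.-integrable setT (EFin \o (fun y => 2 * d N y + (T N y - \1_O y))) by exact: (integrableD _ i2 i3).
rewrite (Rintegral_fineK i4) RintegralD// RintegralB// TN_mass// subrr addr0 RintegralZl// lee_fin.
by move: dN; lra.
Qed.

(** [Lp_induction] from indicators of open sets; closure under limits rests on the contraction
    property, uniform in [N]. *)
Lemma TN_Lp (p : R) f : 1 < p -> measurable_fun setT f -> (Np nu p f < +oo)%E ->
  forall e, 0 < e -> exists N0, forall N, (N0 <= N)%N ->
  (Np nu p (fun y : Rn R m => f y - TN N f y)%R <= e%:E)%E.
Proof.
move=> p1; have p0 := lt_trans (@ltr01 R) p1.
pose P f := forall e : R, 0 < e -> exists N0, forall N, (N0 <= N)%N ->
  (Np nu p (fun y : Rn R m => f y - TN N f y)%R <= e%:E)%E.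
move=> mf fy; suff : P f by [].
have Li h := @Lp_integrable _ _ _ nu p h (ltW p1).
have mB N h : measurable_fun setT h -> (Np nu p h < +oo)%E ->
    measurable_fun setT (fun y : Rn R m => h y - TN N h y).
  by move=> mh hy; apply: measurable_funB => //; apply: measurable_TN; exact: Li.
move: f mf fy.
apply: (@Lp_induction _ (Rn R m) R nu p (@open 'rV[R]_m) P (ltW p1) erefl).
- by move=> A B; exact: openI.
- exact: openT.
- by move=> O oO e e0; apply: TN_Lp_indic => //; exact: ltW.
- move=> f g mf mg fy gy Pf Pg e e0.
  have e1 : 0 < e / 2 / 2 `^ p by rewrite !divr_gt0// powR_gt0.
  have [N1 H1] := Pf _ e1; have [N2 H2] := Pg _ e1.
  exists (maxn N1 N2) => N; rewrite geq_max => /andP[NN1 NN2].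
  rewrite (_ : (fun y => _) = fun y : Rn R m => (f y - TN N f y) + (g y - TN N g y)); last first.
    by apply/funext => y; rewrite TND; [ring|exact: Li|exact: Li].
  by apply: Np_add_small; [exact: ltW|exact: mB|exact: mB|exact: H1|exact: H2].
- move=> c f mf fy Pf e e0.
  have c0 : 0 < `|c| `^ p + 1 by rewrite ltr_wpDl ?powR_ge0.
  have e1 : 0 < e / (`|c| `^ p + 1) by rewrite divr_gt0.
  have [N1 H1] := Pf _ e1; exists N1 => N NN1.
  rewrite (_ : (fun y => _) = fun y : Rn R m => c * (f y - TN N f y)); last first.
    by apply/funext => y; rewrite TNZ; [ring|exact: Li].
  rewrite NpZ; last exact: mB.
  apply: (@le_trans _ _ ((`|c| `^ p)%:E * (e / (`|c| `^ p + 1))%:E)%E).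
    by rewrite lee_wpmul2l ?lee_fin ?powR_ge0//; exact: H1.
  rewrite -EFinM lee_fin mulrCA ler_piMr ?(ltW e0)// ler_pdivrMr// mul1r.
  by rewrite lerDl.
- move=> f mf fy Happ e e0.
  have p2 : 0 < 2 `^ p :> R by rewrite powR_gt0.
  pose e1 := e / 2 / 2 `^ p; have e10 : 0 < e1 by rewrite !divr_gt0.
  have e20 : 0 < e1 / 2 / 2 `^ p by rewrite !divr_gt0.
  have e21 : e1 / 2 / 2 `^ p <= e1.
    have p21 : 1 <= 2 `^ p :> R by rewrite -[leLHS](congr1 (@^~ p) (@powR1 R)) powR_le// ?ler1n// ltW.
    rewrite ler_pdivrMr// (@le_trans _ _ e1)//; last by rewrite ler_peMr// ltW.
    by move: e10; lra.
  have [g [mg gy Pg Hg]] := Happ _ e20; have [N1 H1] := Pg _ e20.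
  exists N1 => N NN1.
  have mfg : measurable_fun setT (fun y : Rn R m => f y - g y) by exact: measurable_funB.
  have fgy : (Np nu p (fun y : Rn R m => f y - g y)%R < +oo)%E by apply: le_lt_trans Hg _; exact: ltry.
  (* Three errors: [g] approximates [f], convergence is known for [g], and the convolution of
     [f - g] is no larger than [f - g]. *)
  rewrite (_ : (fun y => _) = fun y : Rn R m => (f y - g y) + ((g y - TN N g y) + - TN N (fun t => f t - g t) y)); last first.
    by apply/funext => y; rewrite TNB; [ring|exact: Li|exact: Li].
  have mT : measurable_fun [set: Rn R m] (fun y : Rn R m => TN N (fun t => f t - g t) y).
    by apply: measurable_TN; exact: Li.
  have mT' : measurable_fun [set: Rn R m] (fun y : Rn R m => - TN N (fun t => f t - g t) y).
    exact: measurableT_comp.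
  apply: Np_add_small; [exact: ltW|exact: mfg| |exact: (le_trans Hg)|].
    by apply: measurable_funD => //; exact: mB.
  apply: Np_add_small; [exact: ltW|exact: mB|exact: mT'|exact: H1|].
  by rewrite NpN; apply: le_trans Hg; exact: TN_contract.
Qed.

End TN.

(** * Bounds for integrals and measurability in a parameter *)

Section finite_bounds.
Context d (T : measurableType d) {R : realType} (mu : {finite_measure set T -> \bar R}).
Implicit Types (f g w : T -> R).

Lemma Np1E f : Np mu 1 f = (\int[mu]_x `|f x|%:E)%E.
Proof. by rewrite NpE; apply: eq_integral => x _; rewrite powRr1. Qed.

Lemma Rintegral_bound f (C : R) : measurable_fun setT f -> (forall x, `|f x| <= C) ->
  `|\int[mu]_x f x| <= C * fine (mu setT).
Proof.
move=> mf fC; have fi := bounded_integrable mu mf fC.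
apply: (le_trans (le_normr_Rintegral measurableT fi)).
rewrite -Rintegral_cst//; apply: le_Rintegral => //.
- exact: (integrable_norm fi).
- by apply: (bounded_integrable mu (C := `|C|)).
Qed.

Lemma Rintegral_norm_le f : measurable_fun setT f -> (Np mu 1 f < +oo)%E ->
  (`|\int[mu]_x f x|%:E <= Np mu 1 f)%E.
Proof.
move=> mf fy; have fi := Lp_integrable (lexx 1) mf fy.
apply: (@le_trans _ _ (\int[mu]_x `|f x|)%:E); first by rewrite lee_fin; exact: le_normr_Rintegral.
by rewrite Np1E -(Rintegral_fineK (integrable_norm fi)).
Qed.

End finite_bounds.

Section param_integral.
Context d (T : measurableType d) d' (T' : measurableType d') {R : realType}
  (nu : {finite_measure set T' -> \bar R}).

(** Tonelli applied to the positive and the negative part gives measurability for any signed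
    integrand; [fine] absorbs infinite values. *)
Lemma measurable_Rint_param (F : T -> T' -> R) :
  measurable_fun setT (fun z : T * T' => F z.1 z.2) ->
  measurable_fun setT (fun x => \int[nu]_y F x y).
Proof.
move=> mF; apply: measurableT_comp; first exact: measurable_realfun.fine_measurable.
have mE : measurable_fun setT (fun z : T * T' => (F z.1 z.2)%:E) by exact/measurable_EFinP.
rewrite (_ : (fun x => _) = fun x => (\int[nu]_y ((fun z : T * T' => (F z.1 z.2)%:E)^\+ (x, y)) -
    \int[nu]_y ((fun z : T * T' => (F z.1 z.2)%:E)^\- (x, y)))%E); last first.
  by apply/funext => x; rewrite integralE; congr (_ - _)%E; apply: eq_integral => y _;
    rewrite ?funepos.unlock ?funeneg.unlock.
apply: emeasurable_funB.
- apply: (@measurable_fun_fubini_tonelli_F _ _ T T' R nu ((fun z : T * T' => (F z.1 z.2)%:E)^\+%E)) => //.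
  exact: measurable_funepos.
- apply: (@measurable_fun_fubini_tonelli_F _ _ T T' R nu ((fun z : T * T' => (F z.1 z.2)%:E)^\-%E)) => //.
  exact: measurable_funeneg.
Qed.

End param_integral.

(** * Plane waves on $\Omega$ and the Riemann-Lebesgue lemma *)

Section domain.
Context {R : realType} {n : nat} (mun : {measure set (Rn R n) -> \bar R}).
Hypothesis lmun : is_lebesgue mun.
Context {Om : set 'rV[R]_n}.
Hypothesis oOm : open Om.
Hypothesis Omoo : (mun (Om : set (Rn R n)) < +oo)%E.

Definition muO : {finite_measure set (Rn R n) -> \bar R} :=
  mfrestr (open_measurable_Rn oOm) Omoo.
Notation mu := muO.

Lemma muOE (f : Rn R n -> \bar R) :
  (\int[mu]_x (f \_ (Om : set (Rn R n))) x)%E = (\int[mun]_(x in (Om : set (Rn R n))) f x)%E.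
Proof.
rewrite -integral_mkcond; apply: eq_measure_integral => A mA AY.
by rewrite /muO /= /mfrestr /mrestr setIidl.
Qed.

Lemma muO_support (f : Rn R n -> \bar R) : (forall x, ~ Om x -> f x = 0%E) ->
  (\int[mu]_x f x)%E = (\int[mun]_x f x)%E.
Proof.
move=> f0; have fE : f \_ (Om : set (Rn R n)) = f.
  by apply/funext => x; rewrite patchE; case: ifPn => // /negP Ox; rewrite f0// => /mem_set.
by rewrite -{1}fE muOE integral_mkcond fE.
Qed.

Lemma integrable_test phi U : test_fun U phi -> mu.-integrable setT (EFin \o (phi : Rn R n -> R)).
Proof.
move=> tphi; have [C _ HC] := test_fun_bounded tphi.
exact: (bounded_integrable mu (measurable_test_fun tphi) HC).
Qed.

(** The derivative of the compactly supported product has zero integral over the whole space, which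
    is its integral over $\Omega$. *)
Lemma integration_by_parts (phi psi : 'rV[R]_n -> R) i : test_fun Om phi -> smooth psi ->
  \int[mu]_x (phi x * pderiv psi i x) = - \int[mu]_x (pderiv phi i x * psi x).
Proof.
move=> tphi spsi.
have t1 : test_fun Om (fun x => phi x * pderiv psi i x).
  by apply: test_funMr => //; exact: smooth_pderiv.
have t2 : test_fun Om (fun x => pderiv phi i x * psi x).
  by apply: test_funMr => //; exact: test_fun_pderiv.
have tF : test_fun Om (fun x => phi x * psi x) by exact: test_funMr.
apply/eqP; rewrite -addr_eq0 -RintegralD//; [|exact: integrable_test t1|exact: integrable_test t2].
have /test_funP[sF [K [cK _ K0]]] := tF.
have := integral_pderiv0 lmun i sF cK K0; rewrite -muO_support; last first.
  by move=> x Ox; rewrite (test_fun_support (test_fun_pderiv i tF)).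
rewrite (pderivM (@smooth_derivable _ _ _ (test_fun_smooth tphi) i) (@smooth_derivable _ _ _ spsi i)).
by rewrite /Rintegral => ->.
Qed.

Definition wave (a : 'rV[R]_n) (s : R) (x : 'rV[R]_n) : R := cos (vdot a x + s).

Lemma smooth_wave a s : smooth (wave a s).
Proof. exact/smooth_affine/smooth1_cos. Qed.

Lemma wave_le1 a s x : `|wave a s x| <= 1.
Proof. by rewrite ler_norml cos_geN1 cos_le1. Qed.

Lemma measurable_wave a s : measurable_fun [set: Rn R n] (wave a s : Rn R n -> R).
Proof. by apply: continuous_measurable_Rn; apply: smooth_continuous; exact: smooth_wave. Qed.

Lemma pderiv_wave a s i : pderiv (wave a s) i = fun x => a 0 i * wave a (s + pi / 2) x.
Proof.
rewrite (@pderiv_affine _ _ cos _ a s i (@is_derive_cosD R)).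
by apply/funext => x; rewrite /wave addrA.
Qed.

(** Replace [a] by a test function in $L^1$ and integrate by parts in a direction where the wave
    vector has a nonzero component. *)
Lemma riemann_lebesgue (a : Rn R n -> R) (kap : 'rV[R]_n) s (eps : nat -> R) :
  measurable_fun setT a -> (Np mu 1 a < +oo)%E -> kap != 0 ->
  (forall j, 0 < eps j) -> eps @ \oo --> 0 ->
  (fun j => \int[mu]_x (a x * wave ((eps j)^-1 *: kap) s x)) @ \oo --> (0 : R).
Proof.
move=> ma ay k0 eps0 epsc.
have [i ki] : exists i, kap 0 i != 0.
  apply/existsP; apply: contra_neqT k0; rewrite negb_exists => /forallP H.
  by apply/rowP => i; rewrite mxE; apply/eqP; have := H i; rewrite negbK.
apply/cvgrPdist_le => e e0; have e2 : 0 < e / 2 by rewrite divr_gt0.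
have [phi tphi Hphi] := @test_fun_dense _ _ _ _ oOm Omoo 1 a (lexx 1) ma ay _ e2.
have [C C0 HC] := test_fun_bounded (test_fun_pderiv i tphi).
pose M := fine (mu setT); have M0 : 0 <= M by rewrite fine_ge0.
pose D := `|kap 0 i|^-1 * (C * M).
have D0 : 0 <= D by rewrite mulr_ge0 ?invr_ge0// mulr_ge0.
have e3 : 0 < e / 2 / (D + 1) by rewrite divr_gt0// ltr_wpDl.
have /cvgrPdist_le/(_ _ e3)[J _ HJ] := epsc.
exists J => // j /= /HJ; rewrite !sub0r !normrN (gtr0_norm (eps0 j)) => Hj.
pose b := (eps j)^-1 *: kap; rewrite -/b.
have mphi : measurable_fun [set: Rn R n] (phi : Rn R n -> R) := measurable_test_fun tphi.
have mw := measurable_wave b.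
have amphi : (Np mu 1 (fun x : Rn R n => (a x - phi x) * wave b s x)%R <= (e / 2)%:E)%E.
  apply: le_trans Hphi; apply: Np_le => //.
  - by apply: measurable_funM => //; exact: measurable_funB.
  - exact: measurable_funB.
  - by move=> x; rewrite normrM ler_piMr// wave_le1.
have mam : measurable_fun setT (fun x : Rn R n => (a x - phi x) * wave b s x).
  by apply: measurable_funM => //; exact: measurable_funB.
have iam : mu.-integrable setT (EFin \o (fun x : Rn R n => (a x - phi x) * wave b s x)).
  by apply: (Lp_integrable (lexx 1)) => //; apply: le_lt_trans amphi _; exact: ltry.
have tpw : test_fun Om (fun x => phi x * wave b s x) by apply: test_funMr => //; exact: smooth_wave.
have -> : \int[mu]_x (a x * wave b s x) =
    \int[mu]_x ((a x - phi x) * wave b s x) + \int[mu]_x (phi x * wave b s x).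
  rewrite -RintegralD//; last exact: integrable_test tpw.
  by apply: eq_Rintegral => x _; ring.
rewrite (le_trans (ler_normD _ _))// (splitr e) lerD//.
  rewrite -lee_fin; apply: le_trans (amphi); apply: Rintegral_norm_le => //.
  by apply: le_lt_trans amphi _; exact: ltry.
have bi : b 0 i != 0 by rewrite mxE mulf_neq0// invr_eq0 gt_eqF.
(* Lowering the phase by $\pi/2$ writes the wave as a derivative divided by
   $b_i=\kappa_i/\varepsilon_j$, which supplies the factor $\varepsilon_j$. *)
have -> : \int[mu]_x (phi x * wave b s x) = (b 0 i)^-1 * \int[mu]_x (phi x * pderiv (wave b (s - pi / 2)) i x).
  rewrite -RintegralZl//; last first.
    apply: (integrable_test (U := Om)); apply: test_funMr => //.
    by apply: smooth_pderiv; exact: smooth_wave.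
  by apply: eq_Rintegral => x _; rewrite pderiv_wave subrK; field.
rewrite integration_by_parts//; last exact: smooth_wave.
rewrite normrM normrN normfV mxE normrM normfV (gtr0_norm (eps0 j)) invfM invrK.
apply: (@le_trans _ _ (eps j * D)); last first.
  apply: (@le_trans _ _ (e / 2 / (D + 1) * D)); first by rewrite ler_wpM2r.
  by rewrite -mulrA ler_piMr ?ltW// mulrC ltr_pdivrMr ?mul1r ?ltrDl// ltr_wpDl.
rewrite /D mulrA ler_wpM2l//; first by rewrite mulr_ge0 ?invr_ge0// ltW.
apply: Rintegral_bound.
  by apply: measurable_funM => //; exact: measurable_test_fun (test_fun_pderiv i tphi).
by move=> x; rewrite normrM (le_trans _ (HC x))// ler_piMr// wave_le1.
Qed.

End domain.

Lemma vdot_mulmx (R : realType) (n : nat) (u v : 'rV[R]_n) : vdot u v = (u *m v^T) 0 0.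
Proof. by rewrite mxE; apply: eq_bigr => i _; rewrite mxE. Qed.

Lemma vdot_mulmxr (R : realType) (n m : nat) (k : 'rV[R]_m) (A : 'M[R]_(m, n)) (x : 'rV[R]_n) :
  vdot k (x *m A^T) = vdot (k *m A) x.
Proof. by rewrite !vdot_mulmx trmx_mul trmxK mulmxA. Qed.

Lemma cvg_sum_seq (R : realType) (I : Type) (s : seq I) (F : I -> nat -> R) (l : I -> R) :
  (forall i, F i @ \oo --> l i) ->
  (fun j => \sum_(i <- s) F i j) @ \oo --> \sum_(i <- s) l i.
Proof.
move=> Fl; elim: s => [|i s IH].
  by rewrite big_nil; under eq_fun do rewrite big_nil; exact: cvg_cst.
rewrite big_cons; under eq_fun do rewrite big_cons.
exact: cvgD.
Qed.

(** * Limits of integrals of oscillating functions *)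

Section oscillation.
Context {R : realType} {n m : nat} (mun : {measure set (Rn R n) -> \bar R})
  (mum : {measure set (Rn R m) -> \bar R}).
Hypothesis lmun : is_lebesgue mun.
Hypothesis lmum : is_lebesgue mum.
Context {Om : set 'rV[R]_n}.
Hypothesis oOm : open Om.
Hypothesis Omoo : (mun (Om : set (Rn R n)) < +oo)%E.
Notation mu := (muO oOm Omoo).
Notation nu := (nuY lmum).
Variables (Rm : 'M[R]_(m, n)) (eps : nat -> R).
Hypothesis Rm0 : forall k : 'rV[int]_m, k != 0 -> intv R k *m Rm != 0.
Hypothesis eps0 : forall j, 0 < eps j.
Hypothesis epsc : eps @ \oo --> 0.

Definition osc j (x : 'rV[R]_n) : 'rV[R]_m := (eps j)^-1 *: (x *m Rm^T).

(** The torus wave of frequency [k], seen along $\mathbf{R}x$, is a plane wave with this wave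
    vector. *)
Definition freq (k : 'rV[int]_m) : 'rV[R]_n := (2 * pi) *: (intv R k *m Rm).

Lemma freq_neq0 k : k != 0 -> freq k != 0.
Proof.
move=> k0; rewrite scaler_eq0 negb_or Rm0// andbT mulf_neq0//.
by rewrite gt_eqF// pi_gt0.
Qed.

Lemma trig_osc k s j x : trig k s (osc j x) = wave ((eps j)^-1 *: freq k) s x.
Proof.
rewrite /trig /wave /osc /freq vdotZr vdot_mulmxr !vdotZl; congr (cos (_ + _)).
by rewrite mulrCA mulrA.
Qed.

Lemma measurable_osc j : measurable_fun [set: Rn R n] (osc j : Rn R n -> Rn R m).
Proof.
apply: continuous_measurable_RnRn; apply: rV_continuousP => i.
rewrite (_ : (fun x => _) = vdot ((eps j)^-1 *: (row i Rm))); first exact: vdot_continuous.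
apply/funext => x; rewrite mxE vdotZl; congr (_ * _).
by rewrite mxE; apply: eq_bigr => l _; rewrite !mxE mulrC.
Qed.

Lemma measurable_trig_osc k s j :
  measurable_fun [set: Rn R n] (fun x : Rn R n => trig k s (osc j x)).
Proof. by under eq_fun do rewrite trig_osc; exact: measurable_wave. Qed.

Lemma coef_osc_cvg (a : Rn R n -> R) k s : measurable_fun setT a -> (Np mu 1 a < +oo)%E ->
  (fun j => \int[mu]_x (a x * trig k s (osc j x))) @ \oo -->
    (\int[mu]_x a x) * \int[nu]_y trig k s y.
Proof.
move=> ma ay; rewrite Rintegral_trig; have [->|k0] := eqVneq k 0.
  rewrite mul1r; apply: cvg_near_cst; apply: nearW => j.
  under eq_Rintegral do rewrite trig0 mulrC.
  by rewrite (RintegralZl _ measurableT (Lp_integrable (lexx 1) ma ay)) mulrC.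
rewrite mul0r mulr0; under eq_fun do under eq_Rintegral do rewrite trig_osc.
by apply: riemann_lebesgue => //; exact: freq_neq0.
Qed.

(** For fixed [N] the convolution in $y$ is a finite sum of coefficients $a(x)$ times waves, each
    covered by [coef_osc_cvg]. The error made must be small uniformly in [j]: it is at most its
    supremum over [j], which tends to 0 for every [x] and is dominated by $2G$. *)
Lemma osc_cvg (g : Rn R n -> 'rV[R]_m -> R) (G : Rn R n -> R) :
  measurable_fun setT (fun z : Rn R n * Rn R m => g z.1 z.2) ->
  (forall x, continuous (g x)) -> (forall x, periodic (g x)) ->
  measurable_fun setT G -> (Np mu 1 G < +oo)%E -> (forall x y, `|g x y| <= G x) ->
  (fun j => \int[mu]_x g x (osc j x)) @ \oo --> \int[mu]_x \int[nu]_y g x y.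
Proof.
move=> mg cg pg mG Gy gG.
have G0 x : 0 <= G x by apply: le_trans (gG x 0).
have mgx x : measurable_fun [set: Rn R m] (g x : Rn R m -> R).
  exact: (measurableT_comp mg (pair1_measurable x)).
have igx x : nu.-integrable setT (EFin \o (g x : Rn R m -> R)).
  exact: (bounded_integrable nu (mgx x) (gG x)).
pose a k s (x : Rn R n) : R := Fc lmum k s (g x).
have ma k s : measurable_fun setT (a k s).
  apply: (measurable_Rint_param nu (F := fun (x : Rn R n) (y : Rn R m) => trig k s y * g x y)).
  apply: measurable_funM => //.
  exact: (measurableT_comp (measurable_trig k s) measurable_snd).
have aG k s x : `|a k s x| <= G x.
  have := Rintegral_bound nu (f := fun t : Rn R m => trig k s t * g x t) (C := G x).
  rewrite [X in _ * fine X](nuY_setT lmum) mulr1; apply.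
    by apply: measurable_funM => //; exact: measurable_trig.
  move=> t; rewrite normrM -[leRHS]mul1r; apply: ler_pM => //; exact: trig_le1.
have ay k s : (Np mu 1 (a k s) < +oo)%E.
  apply: le_lt_trans Gy; apply: Np_le => // x.
  by rewrite (ger0_norm (G0 x)) aG.
have iw k s j : mu.-integrable setT (EFin \o (fun x : Rn R n => a k s x * trig k s (osc j x))).
  rewrite (_ : (fun x => _) = fun x : Rn R n => trig k s (osc j x) * a k s x); last first.
    by apply/funext => x; rewrite mulrC.
  apply: (integrable_mul_bounded (measurable_trig_osc k s j) (C := 1)).
    by move=> x; exact: trig_le1.
  exact: (Lp_integrable (lexx 1)).
set I := \int[mu]_x _.
have TNc N : (fun j => \int[mu]_x TN lmum N (g x) (osc j x)) @ \oo --> I.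
  have -> : I = \sum_(e <- KL lmum N) e.1.1 * ((\int[mu]_x a e.1.2 e.2 x) * \int[nu]_y trig e.1.2 e.2 y).
    transitivity (\int[mu]_x \sum_(e <- KL lmum N) (e.1.1 * \int[nu]_y trig e.1.2 e.2 y) * a e.1.2 e.2 x).
      apply: eq_Rintegral => x _; rewrite -(TN_mass N (igx x)).
      transitivity (\int[nu]_y \sum_(e <- KL lmum N) (e.1.1 * a e.1.2 e.2 x) * trig e.1.2 e.2 y).
        by apply: eq_Rintegral => y _; rewrite TN_expand//; apply: eq_bigr => e _; rewrite mulrAC.
      rewrite Rintegral_sumr; last by move=> e; apply: integrableZr; exact: integrable_trig.
      apply: eq_bigr => e _; rewrite (RintegralZl _ measurableT (integrable_trig lmum e.1.2 e.2)).
      by rewrite mulrAC.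
    rewrite Rintegral_sumr; last first.
      by move=> e; apply: integrableZr; exact: (Lp_integrable (lexx 1)).
    apply: eq_bigr => e _; rewrite RintegralZl//; last exact: (Lp_integrable (lexx 1)).
    by rewrite -mulrA [X in _ * X]mulrC.
  rewrite (_ : (fun j => _) = fun j => \sum_(e <- KL lmum N) e.1.1 * \int[mu]_x (a e.1.2 e.2 x * trig e.1.2 e.2 (osc j x))).
    by apply: cvg_sum_seq => e; apply: cvgMr; exact: coef_osc_cvg.
  apply/funext => j.
  transitivity (\int[mu]_x \sum_(e <- KL lmum N) e.1.1 * (a e.1.2 e.2 x * trig e.1.2 e.2 (osc j x))).
    by apply: eq_Rintegral => x _; rewrite TN_expand//; apply: eq_bigr => e _; rewrite -mulrA [X in _ * X]mulrC.
  rewrite Rintegral_sumr; last by move=> e; exact: integrableZr.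
  by apply: eq_bigr => e _; rewrite RintegralZl.
have mTN N j : measurable_fun [set: Rn R n] (fun x : Rn R n => TN lmum N (g x) (osc j x)).
  under eq_fun do rewrite TN_expand//.
  apply: measurable_sum => e; apply: measurable_funM; last exact: ma.
  by apply: measurable_funM => //; exact: measurable_trig_osc.
have mgo j : measurable_fun [set: Rn R n] (fun x : Rn R n => g x (osc j x)).
  have := measurable_fun_pair (@measurable_id _ (Rn R n) setT) (measurable_osc j).
  exact: measurableT_comp mg.
have TG N x y : `|TN lmum N (g x) y| <= G x by apply: TN_bound => //; exact: gG.
pose h N j (x : Rn R n) : R := `|g x (osc j x) - TN lmum N (g x) (osc j x)|.
have mh N j : measurable_fun setT (h N j).
  by apply: measurableT_comp => //; exact: measurable_funB.
have hG N j x : h N j x <= 2 * G x.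
  by rewrite (le_trans (ler_normB _ _))// mulr2n mulrDl mul1r lerD.
have hub N x : has_ubound (range (h N ^~ x)) by exists (2 * G x) => _ [j _ <-].
(* The supremum runs over the countably many sample points [osc j x] only, which keeps it measurable
   in [x]. *)
pose E N (x : Rn R n) : R := sups (h N ^~ x) 0%N.
have mE N : measurable_fun setT (E N).
  by apply: measurable_realfun.measurable_fun_sups => [x _|j]; [exact: hub|exact: mh].
have sdropE (u : nat -> R) : sdrop u 0 = range u.
  by apply/seteqP; split => _ [k _ <-]; exists k.
have EE N x : E N x = sup (range (h N ^~ x)) by rewrite -sdropE.
have hE N j x : h N j x <= E N x.
  by rewrite EE; apply: ub_le_sup; [exact: hub|exists j].
have Eb N x b : (forall j, h N j x <= b) -> E N x <= b.
  move=> hb; rewrite EE; apply: ge_sup; first by exists (h N 0%N x), 0%N.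
  by move=> _ [j _ <-].
have E0 N x : 0 <= E N x by apply: le_trans (hE N 0%N x); exact: normr_ge0.
have Ec : {ae mu, forall x, E ^~ x @ \oo --> (cst 0 x : R)}.
  apply: aeW => x; apply/cvgrPdist_le => e e0.
  have [N0 HN0] := TN_unif lmum (@cg x) (pg x) e0.
  exists N0 => // N /= NN; rewrite sub0r normrN ger0_norm//.
  by apply: Eb => j; rewrite /h distrC; exact: HN0.
have m2G : measurable_fun setT (fun x : Rn R n => 2 * G x) by exact: measurable_funM.
have m0 : measurable_fun [set: Rn R n] (cst (0 : R)) by exact: measurable_cst.
have G2y : (Np mu 1 (fun x : Rn R n => 2 * G x)%R < +oo)%E.
  rewrite NpZ// -ge0_fin_numE ?mule_ge0 ?lee_fin ?powR_ge0 ?Np_ge0//.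
  by rewrite fin_numM// ge0_fin_numE// Np_ge0.
have EG N x : `|E N x| <= `|2 * G x|.
  by rewrite ger0_norm// ger0_norm ?mulr_ge0//; exact: Eb.
apply/cvgrPdist_le => e e0; have e2 : 0 < e / 2 by rewrite divr_gt0.
have /fine_cvgP[[N1 _ HN1] /cvgrPdist_le/(_ _ e2)[N2 _ HN2]] := Np_dct ltr01 mE m0 m2G G2y Ec EG.
pose N := maxn N1 N2.
have ENe : (Np mu 1 (E N) <= (e / 2)%:E)%E.
  rewrite -NpN (_ : (fun x => - E N x) = fun x => cst 0 x - E N x); last first.
    by apply/funext => x; rewrite sub0r.
  rewrite -(fineK (HN1 N (leq_maxl _ _))) lee_fin.
  by have := HN2 N (leq_maxr _ _); rewrite sub0r normrN; apply: le_trans; exact: ler_norm.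
have /cvgrPdist_le/(_ _ e2)[J _ HJ] := TNc N.
exists J => // j /= /HJ HJj.
have itn : mu.-integrable setT (EFin \o (fun x : Rn R n => TN lmum N (g x) (osc j x))).
  apply: (Lp_integrable (lexx 1)) => //; apply: le_lt_trans Gy; apply: Np_le => // x.
  by rewrite (ger0_norm (G0 x)).
have igo : mu.-integrable setT (EFin \o (fun x : Rn R n => g x (osc j x))).
  apply: (Lp_integrable (lexx 1)) => //; apply: le_lt_trans Gy; apply: Np_le => // x.
  by rewrite (ger0_norm (G0 x)).
rewrite -[X in `|_ - X|](subrK (\int[mu]_x TN lmum N (g x) (osc j x))) opprD addrCA.
rewrite (le_trans (ler_normD _ _))// (splitr e) lerD// normrN -RintegralB//.
have Nh : (Np mu 1 (fun x : Rn R n => g x (osc j x) - TN lmum N (g x) (osc j x))%R <= (e / 2)%:E)%E.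
  apply: le_trans ENe; apply: Np_le => //; first exact: measurable_funB.
  by move=> x; rewrite (ger0_norm (E0 _ _)); exact: hE.
rewrite -lee_fin; apply: le_trans (Nh); apply: Rintegral_norm_le.
  exact: measurable_funB.
by apply: le_lt_trans Nh _; exact: ltry.
Qed.

End oscillation.

(** * From integrals over $\Omega$ and the cell to measures on whole spaces *)

Section cut.
Context d (T : measurableType d) {R : realType}.

(** Extension by zero makes a function measurable on [D] measurable everywhere, whatever its values
    off [D]. *)
Definition cut (D : set T) (f : T -> R) (x : T) : R := if x \in D then f x else 0.

Lemma cut_in D f x : D x -> cut D f x = f x.
Proof. by move=> Dx; rewrite /cut mem_set. Qed.

Lemma cut_out D f x : ~ D x -> cut D f x = 0.
Proof. by move=> Dx; rewrite /cut memNset. Qed.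

Lemma measurable_cut D f : measurable D -> measurable_fun D f -> measurable_fun setT (cut D f).
Proof. by move=> mD mf; exact/(measurable_restrictT f mD). Qed.

Lemma mfrestr_integral_cut (m : {measure set T -> \bar R}) D (mD : measurable D)
    (Doo : (m D < +oo)%E) (f : T -> R) :
  (\int[m]_(x in D) (f x)%:E = \int[mfrestr mD Doo]_x (cut D f x)%:E)%E.
Proof.
have -> : (\int[mfrestr mD Doo]_x (cut D f x)%:E = \int[mfrestr mD Doo]_(x in D) (cut D f x)%:E)%E.
  rewrite [RHS]integral_mkcond; apply: eq_integral => x _; rewrite patchE.
  by case: ifPn => // /negP Dx; rewrite cut_out// => /mem_set.
rewrite [RHS](eq_measure_integral m); last first.
  by move=> A mA AD; rewrite /= /mfrestr /mrestr setIidl.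
by apply: eq_integral => x /set_mem Dx; rewrite cut_in.
Qed.

Lemma aeS2 (m : {measure set T -> \bar R}) (P Q S : T -> Prop) : {ae m, forall x, P x} ->
  {ae m, forall x, Q x} -> (forall x, P x -> Q x -> S x) -> {ae m, forall x, S x}.
Proof.
move=> aP aQ PQS; apply: (negligibleS _ (negligibleU aP aQ)) => x /= nS.
by have [Px|] := pselect (P x); [right => /= Qx; apply: nS; exact: PQS|left].
Qed.

Lemma ae_countable (I : countType) (m : {measure set T -> \bar R}) (P : I -> T -> Prop) :
  (forall i, {ae m, forall x, P i x}) -> {ae m, forall x, forall i, P i x}.
Proof.
move=> H; pose N k := if choice.unpickle k is Some i then ~` [set x | P i x] else set0.
have NN k : m.-negligible (N k).
  by rewrite /N; case: choice.unpickle => [i|]; [exact: H|exact: negligible_set0].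
apply: (negligibleS _ (negligible_bigcup NN)) => x /= /existsNP[i nP].
by exists (choice.pickle i) => //; rewrite /N choice.pickleK.
Qed.

Lemma mfrestr_aeP (m : {measure set T -> \bar R}) D (mD : measurable D)
    (Doo : (m D < +oo)%E) (P : T -> Prop) :
  {ae mfrestr mD Doo, forall x, P x} <-> {ae m, forall x, D x -> P x}.
Proof.
split=> -[N [mN N0 sub]].
  exists (N `&` D); split; [exact: measurableI|exact: N0|].
  move=> x /= /not_implyP[Dx nP]; split => //; exact: sub.
exists (N `|` ~` D); split; first by apply: measurableU => //; exact: measurableC.
  rewrite /mfrestr /mrestr /= setIUl setICl setU0.
  by apply: (subset_measure0 (B := N)) => //; exact: measurableI.
by move=> x /= nP; have [Dx|nD] := pselect (D x); [left; apply: sub => /(_ Dx)|right].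
Qed.

End cut.

Section vnorm_bounds.
Context {R : realType} {k : nat}.
Implicit Types u : 'rV[R]_k.

Lemma vdot_ge0 u : 0 <= vdot u u.
Proof. by apply: sumr_ge0 => i _; rewrite -expr2 sqr_ge0. Qed.

Lemma coord_le_vnorm u i : `|u 0 i| <= vnorm u.
Proof.
rewrite /vnorm -sqrtr_sqr ler_sqrt ?vdot_ge0// /vdot (bigD1 i)//= -expr2 lerDl.
by apply: sumr_ge0 => j _; rewrite -expr2 sqr_ge0.
Qed.

Lemma vnorm_ge0 u : 0 <= vnorm u.
Proof. exact: sqrtr_ge0. Qed.

Lemma vnorm_le_sum u : vnorm u <= \sum_i `|u 0 i|.
Proof.
have s0 : 0 <= \sum_i `|u 0 i| by exact: sumr_ge0.
rewrite /vnorm -(ger0_norm s0) -sqrtr_sqr ler_sqrt ?sqr_ge0// /vdot expr2 mulr_suml.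
apply: ler_sum => i _; rewrite -expr2 -normr_id -[leLHS]ger0_norm ?sqr_ge0// normrX expr2.
by rewrite normr_id ler_wpM2l// (bigD1 i)//= lerDl sumr_ge0.
Qed.

(** Each of the [k] coordinates is at most the $p$-th root of the sum of powers. *)
Lemma vnorm_powR_le (p : R) u : 0 < p ->
  vnorm u `^ p <= k%:R `^ p * \sum_i `|u 0 i| `^ p.
Proof.
move=> p0; have p0' := ltW p0.
have s0 : 0 <= \sum_i `|u 0 i| `^ p by apply: sumr_ge0 => i _; exact: powR_ge0.
set S := \sum_i _; pose r := S `^ p^-1.
have r0 : 0 <= r by exact: powR_ge0.
have rp : r `^ p = S by rewrite /r -powRrM mulVf ?gt_eqF// powRr1.
rewrite -rp -powRM//; apply: powR_le => //; first exact: vnorm_ge0.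
apply: (le_trans (vnorm_le_sum u)).
rewrite -[k in k%:R]card_ord mulr_natl -sumr_const; apply: ler_sum => i _.
rewrite -[leLHS]powRr1// -(@mulfV _ p) ?gt_eqF// powRrM /r; apply: powR_le.
- by rewrite invr_ge0.
- exact: powR_ge0.
by rewrite /S (bigD1 i)//= lerDl; apply: sumr_ge0 => j _; exact: powR_ge0.
Qed.

Lemma vnorm_delta (a : R) i : vnorm (a *: (delta_mx 0 i : 'rV[R]_k)) = `|a|.
Proof.
rewrite /vnorm /vdot (bigD1 i)//= !mxE !eqxx mulr1 big1 ?addr0 -?expr2 ?sqrtr_sqr// => j ji.
by rewrite !mxE (negbTE ji) andbF mulr0 mul0r.
Qed.

Lemma measurable_vnorm d (T : measurableType d) (D : set T) (f : T -> 'rV[R]_k) :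
  measurable D -> (forall i, measurable_fun D (fun x => f x 0 i)) ->
  measurable_fun D (fun x => vnorm (f x)).
Proof.
move=> mD mf.
apply: (@measurable_comp _ _ _ _ _ _ setT (@Num.sqrt R) _ (fun x => vdot (f x) (f x))) => //.
  apply: continuous_measurable_fun; exact: sqrt_continuous.
by apply: measurable_sum => i; exact: measurable_funM.
Qed.

End vnorm_bounds.

Section bridge.
Context {R : realType} {n m : nat} (mun : {measure set (Rn R n) -> \bar R})
  (mum : {measure set (Rn R m) -> \bar R}).
Hypothesis lmum : is_lebesgue mum.
Context {Om : set 'rV[R]_n}.
Hypothesis oOm : open Om.
Hypothesis Omoo : (mun (Om : set (Rn R n)) < +oo)%E.
Notation mu := (muO oOm Omoo).
Notation nu := (nuY lmum).
Let Y : set (Rn R m) := Ycell R m.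
Let mOm : measurable (Om : set (Rn R n)) := open_measurable_Rn oOm.
Let mY : measurable Y := measurable_Ycell.

Lemma muO_aeP (P : Rn R n -> Prop) :
  {ae mu, forall x, P x} <-> {ae mun, forall x : Rn R n, Om x -> P x}.
Proof. exact: mfrestr_aeP. Qed.

Lemma nuY_aeP (P : Rn R m -> Prop) :
  {ae nu, forall y, P y} <-> {ae mum, forall y : Rn R m, Ycell R m y -> P y}.
Proof. exact: mfrestr_aeP. Qed.

Lemma muO_integral_cut (f : Rn R n -> R) :
  (\int[mun]_(x in (Om : set (Rn R n))) (f x)%:E = \int[mu]_x (cut (Om : set (Rn R n)) f x)%:E)%E.
Proof. exact: mfrestr_integral_cut. Qed.

Lemma nuY_integral_cut (f : Rn R m -> R) :
  (\int[mum]_(y in Y) (f y)%:E = \int[nu]_y (cut Y f y)%:E)%E.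
Proof. exact: mfrestr_integral_cut. Qed.

Lemma Np_cut (p : R) (f : Rn R n -> R) : 0 < p ->
  Np mu p (cut (Om : set (Rn R n)) f) = (\int[mun]_(x in (Om : set (Rn R n))) (`|f x| `^ p)%:E)%E.
Proof.
move=> p0; rewrite muO_integral_cut NpE; apply: eq_integral => x _; congr EFin.
by rewrite /cut; case: ifP => _; rewrite ?normr0 ?powR0// gt_eqF.
Qed.

Lemma muO_integral_meas (f : Rn R n -> R) : measurable_fun setT f ->
  (\int[mun]_(x in (Om : set (Rn R n))) (f x)%:E = \int[mu]_x (f x)%:E)%E.
Proof.
move=> mf; rewrite muO_integral_cut; apply: ae_eq_integral => //.
- by apply/measurable_EFinP; apply: measurable_cut => //; exact: measurable_funTS.
- exact/measurable_EFinP.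
- by apply/muO_aeP; apply: aeW => x Ox _; rewrite cut_in.
Qed.

Lemma measurable_int_param_signed (F : Rn R n -> Rn R m -> R) :
  measurable_fun setT (fun z : Rn R n * Rn R m => F z.1 z.2) ->
  measurable_fun setT (fun x => \int[nu]_y (F x y)%:E)%E.
Proof.
move=> mF.
have mE : measurable_fun setT (fun z : Rn R n * Rn R m => (F z.1 z.2)%:E) by exact/measurable_EFinP.
rewrite (_ : (fun x => _) = fun x => (\int[nu]_y ((fun z : Rn R n * Rn R m => (F z.1 z.2)%:E)^\+ (x, y)) -
    \int[nu]_y ((fun z : Rn R n * Rn R m => (F z.1 z.2)%:E)^\- (x, y)))%E); last first.
  by apply/funext => x; rewrite integralE; congr (_ - _)%E; apply: eq_integral => y _;
    rewrite ?funepos.unlock ?funeneg.unlock.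
apply: emeasurable_funB.
- apply: (@measurable_fun_fubini_tonelli_F _ _ _ _ R nu ((fun z : Rn R n * Rn R m => (F z.1 z.2)%:E)^\+%E)) => //.
  exact: measurable_funepos.
- apply: (@measurable_fun_fubini_tonelli_F _ _ _ _ R nu ((fun z : Rn R n * Rn R m => (F z.1 z.2)%:E)^\-%E)) => //.
  exact: measurable_funeneg.
Qed.

Lemma section_measurable (F : Rn R n -> Rn R m -> R) x :
  measurable_fun setT (fun z : Rn R n * Rn R m => F z.1 z.2) ->
  measurable_fun setT (F x).
Proof. by move=> mF; exact: (measurableT_comp mF (pair1_measurable x)). Qed.

(** Lets an integrand given only on $\Omega\times Y^m$ be exchanged for a globally measurable one
    that agrees with it on almost every fibre. *)
Lemma int2E (F : 'rV[R]_n -> 'rV[R]_m -> R) (F' : Rn R n -> Rn R m -> R) :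
  measurable_fun ((Om : set (Rn R n)) `*` Y) (fun z : Rn R n * Rn R m => F z.1 z.2) ->
  measurable_fun setT (fun z : Rn R n * Rn R m => F' z.1 z.2) ->
  {ae mu, forall x : Rn R n, {ae nu, forall y : Rn R m, F x y = F' x y}} ->
  int2 mun mum Om F = (\int[mu]_x \int[nu]_y (F' x y)%:E)%E.
Proof.
move=> mF mF' FF'.
pose D : set (Rn R n * Rn R m) := (Om : set (Rn R n)) `*` Y.
pose F2 (x : Rn R n) (y : Rn R m) : R := cut D (fun z => F z.1 z.2) (x, y).
have mF2 : measurable_fun setT (fun z : Rn R n * Rn R m => F2 z.1 z.2).
  rewrite (_ : (fun z => _) = cut D (fun z => F z.1 z.2)); last by apply/funext => -[x y].
  by apply: measurable_cut => //; exact: measurableX.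
have -> : int2 mun mum Om F = (\int[mu]_x \int[nu]_y (F2 x y)%:E)%E.
  rewrite /int2 -muOE; apply: eq_integral => x _; rewrite patchE.
  case: ifPn => [/set_mem Ox|/negP Ox].
    rewrite nuY_integral_cut; apply: eq_integral => y _; congr EFin.
    have [Yy|nY] := pselect (Y y); first by rewrite cut_in// /F2 cut_in.
    by rewrite cut_out// /F2 cut_out// => -[].
  rewrite (eq_integral (cst 0%E)) ?integral0// => y _.
  by rewrite /F2 cut_out// => -[Ox' _]; apply: Ox; exact/mem_set.
apply: ae_eq_integral => //; [exact: measurable_int_param_signed|exact: measurable_int_param_signed|].
have OmP : {ae mu, forall x : Rn R n, Om x} by apply/muO_aeP; exact: aeW.
apply: (aeS2 OmP FF') => x Ox Fx _; apply: ae_eq_integral => //.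
- by apply/measurable_EFinP; exact: section_measurable.
- by apply/measurable_EFinP; exact: section_measurable.
have YP : {ae nu, forall y : Rn R m, Y y} by apply/nuY_aeP; exact: aeW.
by apply: (aeS2 YP Fx) => y Yy <- _; rewrite /F2 cut_in.
Qed.

(** A componentwise representative that is measurable on the whole product and $L^p$ on every fibre,
    not just on almost every one, so that fibrewise coefficients can be formed without
    exceptions. *)
Lemma Lp2_rep k (p : R) (v : 'rV[R]_n -> 'rV[R]_m -> 'rV[R]_k) : 0 < p ->
  Lp2 mun mum Om p v -> exists V : 'I_k -> Rn R n -> Rn R m -> R,
  [/\ forall i, measurable_fun setT (fun z : Rn R n * Rn R m => V i z.1 z.2),
      forall i x, (Np nu p (V i x) < +oo)%E,
      forall i, (\int[mu]_x Np nu p (V i x) < +oo)%E &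
      {ae mu, forall x : Rn R n, forall y : Rn R m, Y y -> forall i, V i x y = v x y 0 i}].
Proof.
move=> p0 [mv vy].
pose D : set (Rn R n * Rn R m) := (Om : set (Rn R n)) `*` Y.
have mD : measurable D by exact: measurableX.
pose W (x : Rn R n) (y : Rn R m) : R := cut D (fun z => vnorm (v z.1 z.2) `^ p) (x, y).
have mvn : measurable_fun D (fun z : Rn R n * Rn R m => vnorm (v z.1 z.2) `^ p).
  apply: (measurableT_comp (measurable_powR p)).
  exact: measurable_vnorm.
have mW : measurable_fun setT (fun z : Rn R n * Rn R m => W z.1 z.2).
  rewrite (_ : (fun z => _) = cut D (fun z => vnorm (v z.1 z.2) `^ p)); last by apply/funext => -[x y].
  exact: measurable_cut.
have W0 x y : 0 <= W x y by rewrite /W /cut; case: ifP => // _; exact: powR_ge0.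
pose A x := (\int[nu]_y (W x y)%:E)%E.
have mA : measurable_fun setT A by exact: measurable_int_param_signed.
have A0 x : (0 <= A x)%E by apply: integral_ge0 => y _; rewrite lee_fin.
have Ay : (\int[mu]_x A x < +oo)%E.
  rewrite -(int2E (F := fun x y => vnorm (v x y) `^ p)) //.
  have OmP : {ae mu, forall x : Rn R n, Om x} by apply/muO_aeP; exact: aeW.
  have YP : {ae nu, forall y : Rn R m, Y y} by apply/nuY_aeP; exact: aeW.
  by apply: (aeS OmP) => x Ox; apply: (aeS YP) => y Yy; rewrite /W cut_in.
(* Fibres of infinite norm form a null set; the representative is zero on them. *)
pose B : set (Rn R n) := (Om : set (Rn R n)) `&` [set x | A x \is a fin_num].
have mB : measurable B.
  by apply: measurableI => //; rewrite -[X in measurable X]setTI; exact: emeasurable_fin_num.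
have aeB : {ae mu, forall x, B x}.
  have OmP : {ae mu, forall x : Rn R n, Om x} by apply/muO_aeP; exact: aeW.
  have iA : mu.-integrable setT A.
    apply/integrableP; split => //; rewrite (eq_integral A)// => x _.
    by rewrite gee0_abs.
  apply: (aeS2 OmP (integrable_ae measurableT iA)) => x Ox /(_ I) fA; split => //=.
pose E : set (Rn R n * Rn R m) := B `*` Y.
have mE : measurable E by exact: measurableX.
pose V i (x : Rn R n) (y : Rn R m) : R := cut E (fun z => v z.1 z.2 0 i) (x, y).
have mV i : measurable_fun setT (fun z : Rn R n * Rn R m => V i z.1 z.2).
  rewrite (_ : (fun z => _) = cut E (fun z => v z.1 z.2 0 i)); last by apply/funext => -[x y].
  apply: measurable_cut => //; apply: measurable_funS (mv i) => //.
  by move=> [x y] [[]].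
have VA i x : (Np nu p (V i x) <= A x)%E.
  rewrite NpE; apply: ge0_le_integral => //.
  - by apply: measurable_powR_normE; exact: section_measurable.
  - by apply/measurable_EFinP; exact: (section_measurable (F := W)).
  move=> y _; rewrite lee_fin /V /cut; case: ifPn => [/set_mem[[/= Ox _] Yy]|_]; last first.
    by rewrite normr0 powR0 ?W0// gt_eqF.
  rewrite /W cut_in//=; apply: powR_le => //; [exact: ltW|exact: coord_le_vnorm].
exists V; split => //.
- move=> i x; have [Bx|nB] := pselect (B x).
    by apply: le_lt_trans (VA i x) _; rewrite -ge0_fin_numE//; case: Bx.
  rewrite (_ : V i x = fun=> 0); first by rewrite Np0// ltry.
  by apply/funext => y; rewrite /V cut_out// => -[].
- move=> i; apply: le_lt_trans Ay; apply: ge0_le_integral => //.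
  + by move=> x _; exact: Np_ge0.
  + under eq_fun do rewrite NpE.
    apply: (measurable_int_param_signed (F := fun x y => `|V i x y| `^ p)).
    exact: (measurable_powR_norm p (mV i)).
- by apply: (aeS aeB) => x Bx y Yy i; rewrite /V cut_in.
Qed.

End bridge.

Lemma sup_mull (R : realType) (T : Type) (A : set T) (f : T -> R) (a b : R) : 0 <= a -> A !=set0 ->
  (forall x, A x -> f x <= b) -> sup [set a * f x | x in A] = a * sup [set f x | x in A].
Proof.
move=> a0 [x0 Ax0] fb.
have ub x : A x -> f x <= sup [set f x | x in A].
  by move=> Ax; apply: ub_le_sup; [exists b => _ [z Az <-]; exact: fb|exists x].
move: a0; rewrite le_eqVlt => /orP[/eqP <-|a0].
  rewrite mul0r; apply/eqP; rewrite eq_le; apply/andP; split.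
    by apply: ge_sup; [exists (0 * f x0), x0|move=> _ [x _ <-]; rewrite mul0r].
  by apply: ub_le_sup; [exists 0 => _ [x _ <-]; rewrite mul0r|exists x0 => //; rewrite mul0r].
apply/eqP; rewrite eq_le; apply/andP; split.
  apply: ge_sup; first by exists (a * f x0), x0.
  by move=> _ [x Ax <-]; rewrite ler_pM2l// ub.
rewrite -ler_pdivlMl//; apply: ge_sup; first by exists (f x0), x0.
move=> _ [x Ax <-]; rewrite ler_pdivlMl//; apply: ub_le_sup; last by exists x.
by exists (a * b) => _ [z Az <-]; rewrite ler_pM2l// fb.
Qed.

Lemma pderivZ (R : realType) (n : nat) (c : R) (f : 'rV[R]_n -> R) i :
  (forall x, derivable f x (delta_mx 0 i)) ->
  pderiv (fun x => c * f x) i = fun x => c * pderiv f i x.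
Proof. by move=> df; apply/funext => x; rewrite /pderiv (deriveZ c (df x)). Qed.

(** Arithmetic of the curl estimate: [a1] and [a2] are individually uncontrolled and enter only
    through their difference. *)
Lemma normr_sub4_le (R : realType) (a1 a2 a3 a4 a5 d1 d3 d4 : R) : a1 - a2 = a3 ->
  `|a3| <= d1 -> `|a4| <= d3 -> `|a5| <= d4 -> `|- a1 - a4 - (- a2 - a5)| <= d1 + d3 + d4.
Proof. by move=> <-; rewrite !ler_norml; lra. Qed.

Lemma conj_expK (R : realType) (p : R) : 1 < p -> conj_exp (conj_exp p) = p.
Proof.
move=> p1; have pn : p - 1 != 0 by rewrite subr_eq0 gt_eqF.
have E : p / (p - 1) - 1 = (p - 1)^-1 by field.
by rewrite /conj_exp E invrK divfK.
Qed.

(** * Moments in $y$ and the fundamental lemma of the calculus of variations *)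

Section joint.
Context {R : realType} {n m : nat} (mun : {measure set (Rn R n) -> \bar R})
  (mum : {measure set (Rn R m) -> \bar R}).
Hypothesis lmun : is_lebesgue mun.
Hypothesis lmum : is_lebesgue mum.
Context {Om : set 'rV[R]_n}.
Hypothesis oOm : open Om.
Hypothesis Omoo : (mun (Om : set (Rn R n)) < +oo)%E.
Notation mu := (muO oOm Omoo).
Notation nu := (nuY lmum).
Variable p : R.
Hypothesis p1 : 1 < p.
Let p0 : 0 < p := lt_trans (@ltr01 R) p1.

Section one_field.
Variable V : Rn R n -> Rn R m -> R.
Hypothesis mV : measurable_fun setT (fun z : Rn R n * Rn R m => V z.1 z.2).
Hypothesis Vx : forall x, (Np nu p (V x) < +oo)%E.
Hypothesis Vy : (\int[mu]_x Np nu p (V x) < +oo)%E.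

Lemma measurable_V x : measurable_fun setT (V x).
Proof. exact: section_measurable. Qed.

Lemma integrable_V x : nu.-integrable setT (EFin \o V x).
Proof. by apply: (Lp_integrable (ltW p1)) => //; exact: measurable_V. Qed.

Lemma measurable_NpV : measurable_fun setT (fun x => Np nu p (V x)).
Proof.
under eq_fun do rewrite NpE.
apply: (measurable_int_param_signed lmum (F := fun x y => `|V x y| `^ p)).
exact: (measurable_powR_norm p mV).
Qed.

Lemma moment_powR (h : Rn R m -> R) x : measurable_fun setT h -> (forall y, `|h y| <= 1) ->
  ((`|\int[nu]_y (h y * V x y)| `^ p)%:E <= Np nu p (V x))%E.
Proof.
move=> mh h1.
have mhV : measurable_fun setT (fun y => h y * V x y) by apply: measurable_funM => //; exact: measurable_V.
have le : (Np nu p (fun y => h y * V x y)%R <= Np nu p (V x))%E.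
  apply: Np_le => //; [exact: ltW|exact: measurable_V|].
  by move=> y; rewrite normrM ler_piMl.
have w1 (y : Rn R m) : 0 <= (cst 1 y : R) <= 1 by rewrite ler01 lexx.
have := @jensen_weighted _ _ _ nu p 1 (cst 1) (fun y => h y * V x y) p1 (measurable_cst _) mhV w1
  (Rintegral_cst1 lmum 1) (le_lt_trans le (Vx x)).
under eq_Rintegral do rewrite mul1r.
under eq_integral do rewrite mul1r.
move/le_trans; apply; apply: le_trans le; rewrite NpE.
by [].
Qed.

Lemma measurable_moment (h : Rn R m -> R) : measurable_fun setT h ->
  measurable_fun setT (fun x => \int[nu]_y (h y * V x y)).
Proof.
move=> mh; apply: (measurable_Rint_param nu (F := fun x y => h y * V x y)).
apply: measurable_funM => //; exact: (measurableT_comp mh measurable_snd).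
Qed.

Lemma Np_moment (h : Rn R m -> R) : measurable_fun setT h -> (forall y, `|h y| <= 1) ->
  (Np mu p (fun x => \int[nu]_y (h y * V x y))%R <= \int[mu]_x Np nu p (V x))%E.
Proof.
move=> mh h1; rewrite NpE; apply: ge0_le_integral => //.
- by apply: measurable_powR_normE; exact: measurable_moment.
- exact: measurable_NpV.
- by move=> x _; exact: moment_powR.
Qed.

Lemma measurable_FcV k s : measurable_fun setT (fun x => Fc lmum k s (V x)).
Proof. by apply: measurable_moment; exact: measurable_trig. Qed.

Lemma Np_FcV k s : (Np mu p (fun x => Fc lmum k s (V x)) < +oo)%E.
Proof.
apply: le_lt_trans Vy; apply: Np_moment; [exact: measurable_trig|exact: trig_le1].
Qed.

Lemma Fc00 (f : Rn R m -> R) : Fc lmum 0 0 f = \int[nu]_y f y.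
Proof. by apply: eq_Rintegral => y _; rewrite trig0 cos0 mul1r. Qed.

End one_field.

(** The sign of [h] is bounded, hence approximable by test functions in the conjugate exponent;
    pairing with [h] then shows that $\int|h|$ is below every positive number. *)
Lemma fundamental_lemma (h : Rn R n -> R) : measurable_fun setT h -> (Np mu p h < +oo)%E ->
  (forall psi, test_fun Om psi -> \int[mu]_x (psi x * h x) = 0) ->
  {ae mu, forall x, h x = 0}.
Proof.
move=> mh hy H.
have q1 := conj_exp_gt1 p1; have q0 := lt_trans (@ltr01 R) q1.
(* The sign of [h], with value $-1$ where [h] vanishes; there the identity $sg\cdot h=|h|$ holds all
   the same. *)
pose sg (x : Rn R n) : R := (2 * \1_[set z | 0 < h z] x - 1).
have msg : measurable_fun setT sg.
  apply: measurable_funB => //; apply: measurable_funM => //; apply: measurable_indic.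
  by rewrite -[X in measurable X]setTI; rewrite (_ : [set z | _] = h @^-1` `]0, +oo[); [exact: mh|apply/funext => z; rewrite /preimage /= in_itv /= andbT].
have sg1 x : `|sg x| <= 1 by rewrite /sg indicE; case: (_ \in _) => /=; rewrite ler_norml; lra.
have sgh x : sg x * h x = `|h x|.
  rewrite /sg indicE; have [/set_mem /= h0|/negP h0] := boolP (x \in _).
    by rewrite gtr0_norm//; ring.
  have : h x <= 0 by rewrite leNgt; apply/negP => hh; apply: h0; exact/mem_set.
  by move=> /ler0_norm ->; rewrite mulr0 sub0r mulN1r.
have sgy : (Np mu (conj_exp p) sg < +oo)%E by apply: (Np_bounded_lty mu (ltW q0) msg sg1).
have ih := Lp_integrable (ltW p1) mh hy.
pose B := fine (Np mu p h); have B0 : 0 <= B by rewrite fine_ge0// Np_ge0.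
have hB : (Np mu p h <= B%:E)%E by rewrite fineK// ge0_fin_numE// Np_ge0.
have cc := conj_expK p1.
have int0 : \int[mu]_x `|h x| = 0.
  apply/eqP; rewrite eq_le; apply/andP; split; last by apply: Rintegral_ge0.
  apply/ler_addgt0Pr => e e0; rewrite add0r.
  have [dl dl0 Hdl] := integral_mul_small mu q1 e0 B0.
  have [psi tpsi Hpsi] := @test_fun_dense _ _ _ _ oOm Omoo (conj_exp p) sg (ltW q1) msg sgy _ dl0.
  have mpsi : measurable_fun [set: Rn R n] (psi : Rn R n -> R) := measurable_test_fun tpsi.
  have [C C0 HC] := test_fun_bounded tpsi.
  have i1 : mu.-integrable setT (EFin \o (fun x : Rn R n => psi x * h x)).
    exact: (integrable_mul_bounded mpsi HC).
  have i2 : mu.-integrable setT (EFin \o (fun x : Rn R n => (sg x - psi x) * h x)).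
    apply: (integrable_mul_bounded (C := 1 + C)) => //; first exact: measurable_funB.
    by move=> x; rewrite (le_trans (ler_normB _ _))// lerD.
  have -> : \int[mu]_x `|h x| = \int[mu]_x ((sg x - psi x) * h x).
    transitivity (\int[mu]_x ((sg x - psi x) * h x + psi x * h x)).
      by apply: eq_Rintegral => x _; rewrite -sgh; ring.
    by rewrite RintegralD// (H _ tpsi) addr0.
  have mD : measurable_fun [set: Rn R n] (fun x : Rn R n => sg x - psi x) by exact: measurable_funB.
  have := Hdl _ h mD mh Hpsi; rewrite cc => /(_ hB).
  rewrite (_ : (fun x => _) = EFin \o (Num.norm \o (fun x : Rn R n => (sg x - psi x) * h x)))//.
  rewrite (Rintegral_fineK (integrable_norm i2)) lee_fin; apply: le_trans.
  by apply: (le_trans (ler_norm _)); exact: (le_normr_Rintegral measurableT i2).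
have mhE : measurable_fun setT (EFin \o h) by exact/measurable_EFinP.
have : ae_eq mu setT (EFin \o h) (cst 0%E).
  apply/(ae_eq_integral_abs mu measurableT mhE).
  rewrite (_ : (fun x => _) = EFin \o (Num.norm \o h))//.
  by rewrite (Rintegral_fineK (integrable_norm ih)) int0.
by move=> H0; apply: (aeS H0) => x /(_ I) [].
Qed.

(** * Necessity: the potential and the curl relation *)

Section forward.
Variables (u : nat -> Rn R n -> R) (G : nat -> 'I_n -> Rn R n -> R) (C : R).
Hypothesis mu_ : forall j, measurable_fun setT (u j).
Hypothesis uC : forall j, (Np mu p (u j) <= C%:E)%E.
Hypothesis mG : forall j i, measurable_fun setT (G j i).
Hypothesis GC : forall j i, (Np mu p (G j i) <= C%:E)%E.
Hypothesis weak : forall psi, test_fun Om psi -> forall j i,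
  \int[mu]_x (u j x * pderiv psi i x) = - \int[mu]_x (G j i x * psi x).
Variable V : 'I_n -> Rn R n -> Rn R m -> R.
Hypothesis mV : forall i, measurable_fun setT (fun z : Rn R n * Rn R m => V i z.1 z.2).
Hypothesis Vx : forall i x, (Np nu p (V i x) < +oo)%E.
Hypothesis Vy : forall i, (\int[mu]_x Np nu p (V i x) < +oo)%E.
Variables (Rm : 'M[R]_(m, n)) (eps : nat -> R).
Hypothesis Rm0 : forall k : 'rV[int]_m, k != 0 -> intv R k *m Rm != 0.
Hypothesis eps0 : forall j, 0 < eps j.
Hypothesis epsc : eps @ \oo --> 0.
Hypothesis ts : forall psi k s i, test_fun Om psi ->
  (fun j => \int[mu]_x (G j i x * (psi x * trig k s (osc Rm eps j x)))) @ \oo -->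
  \int[mu]_x (psi x * Fc lmum k s (V i x)).

Let iu j : mu.-integrable setT (EFin \o u j).
Proof. by apply: (Lp_integrable (ltW p1)) => //; apply: le_lt_trans (uC j) _; exact: ltry. Qed.

Let iG j i : mu.-integrable setT (EFin \o G j i).
Proof. by apply: (Lp_integrable (ltW p1)) => //; apply: le_lt_trans (GC j i) _; exact: ltry. Qed.

Lemma integrable_mul_test (f : Rn R n -> R) (psi : 'rV[R]_n -> R) U :
  mu.-integrable setT (EFin \o f) -> test_fun U psi ->
  mu.-integrable setT (EFin \o (fun x : Rn R n => f x * psi x)).
Proof.
move=> fi tpsi; have [D D0 HD] := test_fun_bounded tpsi.
rewrite (_ : (fun x => _) = fun x : Rn R n => psi x * f x); last by apply/funext => x; rewrite mulrC.
exact: (integrable_mul_bounded (measurable_test_fun tpsi) HD).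
Qed.

(** The pairings of [u j] with $\partial_i\psi$ converge, by the weak gradient relation and the
    two-scale hypothesis at $k=0$. A strong limit of means of the tails has the limiting pairings,
    which identify its gradient as the cell mean. *)
Lemma forward_potential : exists v0 : Rn R n -> R, [/\ measurable_fun setT v0,
  (Np mu p v0 < +oo)%E & forall psi, test_fun Om psi -> forall i,
  \int[mu]_x (v0 x * pderiv psi i x) = - \int[mu]_x ((\int[nu]_y V i x y) * psi x)].
Proof.
have [v0 [mv0 v0y Hv0]] := tail_mean_limit p1 mu_ uC.
exists v0; split => // psi tpsi i.
have tdp := test_fun_pderiv i tpsi.
have [D D0 HD] := test_fun_bounded tdp.
have mdp : measurable_fun [set: Rn R n] (pderiv psi i : Rn R n -> R) := measurable_test_fun tdp.
pose L := \int[mu]_x ((\int[nu]_y V i x y) * psi x); rewrite -/L.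
have aL : (fun j => \int[mu]_x (u j x * pderiv psi i x)) @ \oo --> - L.
  under eq_fun do rewrite weak//.
  apply: cvgN; have := @ts psi 0 0 i tpsi; rewrite /L.
  under eq_fun do under eq_Rintegral do rewrite trig0 cos0 mulr1.
  rewrite (eq_Rintegral mu (g := fun x => (\int[nu]_y V i x y) * psi x)) => [|x _]; first exact.
  by rewrite Fc00 mulrC.
have q0 := conj_exp_gt0 p1.
pose B := fine (Np mu (conj_exp p) (pderiv psi i : Rn R n -> R)).
have By : (Np mu (conj_exp p) (pderiv psi i : Rn R n -> R) < +oo)%E.
  exact: (Np_bounded_lty mu (ltW q0) mdp HD).
have B0 : 0 <= B by rewrite fine_ge0// Np_ge0.
have hB : (Np mu (conj_exp p) (pderiv psi i : Rn R n -> R) <= B%:E)%E.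
  by rewrite fineK// ge0_fin_numE// Np_ge0.
have iv0 := Lp_integrable (ltW p1) mv0 v0y.
apply/eqP; rewrite -subr_eq0 -normr_le0; apply/ler_addgt0Pr => e e0; rewrite add0r.
have e2 : 0 < e / 2 by rewrite divr_gt0.
have [dl dl0 Hdl] := integral_mul_small mu p1 e2 B0.
have /cvgrPdist_le/(_ _ e2)[N _ HN] := aL.
have [w tw Hw] := Hv0 _ N dl0.
(* Lying within [e / 2] of the limit is a convex condition, so it passes from the members of a tail
   to all their means. *)
have tmN w' : tail_mean u N w' -> mu.-integrable setT (EFin \o w') /\
    `|- L - \int[mu]_x (w' x * pderiv psi i x)| <= e / 2.
  elim=> [j Nj|w1 w2 _ [i1 H1] _ [i2 H2]]; first by split => //; exact: HN.
  have i1' := integrable_mul_test i1 tdp; have i2' := integrable_mul_test i2 tdp.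
  have i3 : mu.-integrable setT (EFin \o (fun x : Rn R n => w1 x + w2 x)) by exact: integrable_addr.
  split.
    rewrite (_ : (fun x => _) = fun x => 2^-1 * (w1 x + w2 x)); last by apply/funext => x; rewrite mulrC.
    exact: integrableZr.
  have -> : \int[mu]_x ((w1 x + w2 x) / 2 * pderiv psi i x) =
      (\int[mu]_x (w1 x * pderiv psi i x) + \int[mu]_x (w2 x * pderiv psi i x)) / 2.
    rewrite -RintegralD// mulrC -RintegralZl//; last exact: integrable_addr.
    by apply: eq_Rintegral => x _; ring.
  move: H1 H2; rewrite !ler_norml.
  by move: (\int[mu]_x (w1 x * _)) (\int[mu]_x (w2 x * _)) => a b; lra.
have [iw Hw2] := tmN w tw.
have mw : measurable_fun setT w by have [] := tail_mean_Np p1 mu_ uC tw.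
have iwv := integrable_subr iw iv0.
have := Hdl (fun x => w x - v0 x) (pderiv psi i) (measurable_funB mw mv0) mdp Hw hB.
have iwv2 := integrable_mul_test iwv tdp.
rewrite (_ : (fun x => _) = EFin \o (Num.norm \o (fun x : Rn R n => (w x - v0 x) * pderiv psi i x)))//.
rewrite (Rintegral_fineK (integrable_norm iwv2)) lee_fin => Hs.
have := le_trans (le_normr_Rintegral measurableT iwv2) Hs.
have -> : \int[mu]_x ((w x - v0 x) * pderiv psi i x) =
    \int[mu]_x (w x * pderiv psi i x) - \int[mu]_x (v0 x * pderiv psi i x).
  rewrite -RintegralB//; [|exact: integrable_mul_test iw tdp|exact: integrable_mul_test iv0 tdp].
  by apply: eq_Rintegral => x _; rewrite mulrBl.
move: Hw2; rewrite !ler_norml -/L.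
by move: (\int[mu]_x (w x * _)) (\int[mu]_x (v0 x * _)) => a b; lra.
Qed.

(** From $|f|\le|f|^p+1$, so the estimate is uniform over the bounded sequence. *)
Lemma Rintegral_mul_bound (f g : Rn R n -> R) (D : R) : measurable_fun setT f ->
  (Np mu p f <= C%:E)%E -> measurable_fun setT g -> (forall x, `|g x| <= D) ->
  `|\int[mu]_x (f x * g x)| <= D * (C + fine (mu setT)).
Proof.
move=> mf fC mg gD; have D0 : 0 <= D by apply: le_trans (gD 0).
have fy : (Np mu p f < +oo)%E by apply: le_lt_trans fC _; exact: ltry.
have fi := Lp_integrable (ltW p1) mf fy.
have ip : mu.-integrable setT (EFin \o (fun x : Rn R n => `|f x| `^ p)).
  apply/integrableP; split; first by apply/measurable_EFinP; exact: measurable_powR_norm.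
  move: fy; rewrite NpE; apply: le_lt_trans.
  rewrite le_eqVlt; apply/orP; left; apply/eqP; apply: eq_integral => t _ /=.
  by rewrite ger0_norm ?powR_ge0.
have i1 : mu.-integrable setT (EFin \o (cst 1 : Rn R n -> R)).
  by apply: (bounded_integrable mu (C := `|1|)).
have ifg : mu.-integrable setT (EFin \o (fun x => f x * g x)).
  rewrite (_ : (fun x => _) = fun x : Rn R n => g x * f x); last by apply/funext => x; rewrite mulrC.
  exact: (integrable_mul_bounded mg gD).
apply: (le_trans (le_normr_Rintegral measurableT ifg)).
apply: (@le_trans _ _ (\int[mu]_x (D * (`|f x| `^ p + cst 1 x)))).
  apply: le_Rintegral => //; first exact: (integrable_norm ifg).
    by apply: integrableZr; exact: integrable_addr.
  move=> x _; rewrite normrM mulrC; apply: ler_pM => //.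
  by have := young_le (f x) 1 p1; rewrite mulr1 normr1 powR1.
rewrite RintegralZl//; last exact: integrable_addr.
rewrite ler_wpM2l// RintegralD// Rintegral_cst// mul1r lerD2r.
by rewrite -lee_fin -(Rintegral_fineK ip) -NpE.
Qed.

(** The field is tested with $T=\psi W$, where $W$ is the wave of phase lowered by $\pi/2$, so that
    $\nabla W$ is $2\pi\mathbf{R}^*k/\varepsilon_j$ times the given wave. In the antisymmetric
    combination the second derivatives of $T$ lose all powers of $1/\varepsilon_j$; hence
    $1/\varepsilon_j$ times the wanted quantity is bounded. *)
Lemma curl_coef_small psi k s i l : test_fun Om psi -> k != 0 ->
  exists K : R, forall j, `|(intv R k *m Rm) 0 l * (\int[mu]_x (G j i x * (psi x * trig k s (osc Rm eps j x)))) -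
    (intv R k *m Rm) 0 i * (\int[mu]_x (G j l x * (psi x * trig k s (osc Rm eps j x))))| <= eps j * K.
Proof.
move=> tpsi k0; have spsi := test_fun_smooth tpsi.
have dpsi a : forall x, derivable psi x (delta_mx 0 a) := @smooth_derivable _ _ _ spsi a.
have sdpsi a : smooth (pderiv psi a) by exact: smooth_pderiv.
have ddpsi a b : forall x, derivable (pderiv psi a) x (delta_mx 0 b) := @smooth_derivable _ _ _ (sdpsi a) b.
have td a : test_fun Om (pderiv psi a) by exact: test_fun_pderiv.
have tdd a b : test_fun Om (pderiv (pderiv psi a) b) by exact: test_fun_pderiv.
have [D1 D10 HD1] := test_fun_bounded (tdd l i).
have [D2 D20 HD2] := test_fun_bounded (tdd i l).
have [D3 D30 HD3] := test_fun_bounded (td l).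
have [D4 D40 HD4] := test_fun_bounded (td i).
pose M := fine (mu setT).
exists ((2 * pi)^-1 * ((D1 + D2 + D3 + D4) * (C + M))) => j.
set kap := intv R k *m Rm.
pose b : 'rV[R]_n := (eps j)^-1 *: freq Rm k.
have bE a : b 0 a = (eps j)^-1 * (2 * pi) * kap 0 a by rewrite !mxE mulrA.
pose W := wave b (s - pi / 2).
have sW : smooth W by exact: smooth_wave.
have dW a : forall x, derivable W x (delta_mx 0 a) := @smooth_derivable _ _ _ sW a.
have mW : measurable_fun [set: Rn R n] (W : Rn R n -> R) by exact: measurable_wave.
have W1 x : `|W x| <= 1 by exact: wave_le1.
have sdW a : smooth (pderiv W a) by exact: smooth_pderiv.
have ddW a b : forall x, derivable (pderiv W a) x (delta_mx 0 b) := @smooth_derivable _ _ _ (sdW a) b.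
have WE a x : pderiv W a x = (eps j)^-1 * (2 * pi) * kap 0 a * trig k s (osc Rm eps j x).
  by rewrite /W pderiv_wave subrK trig_osc -bE.
(* Mixed derivatives of the wave commute by its explicit formula. *)
have WWE a c : pderiv (pderiv W a) c = pderiv (pderiv W c) a.
  have H a' c' : pderiv (pderiv W a') c' = fun x => b 0 a' * (b 0 c' * wave b (s - pi / 2 + pi / 2 + pi / 2) x).
    rewrite /W pderiv_wave (pderivZ (b 0 a') (i := c') (@smooth_derivable _ _ _ (smooth_wave _ _) c')).
    by rewrite pderiv_wave.
  by rewrite !H; apply/funext => x; rewrite mulrCA.
clearbody W.
pose T x := psi x * W x.
have tT : test_fun Om T by exact: test_funMr.
have dT a : pderiv T a = fun x => psi x * pderiv W a x + pderiv psi a x * W x.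
  by rewrite /T pderivM.
have ddT a c : pderiv (pderiv T a) c = fun x => (psi x * pderiv (pderiv W a) c x + pderiv psi c x * pderiv W a x) +
    (pderiv psi a x * pderiv W c x + pderiv (pderiv psi a) c x * W x).
  rewrite dT pderivD; last 2 first.
  - by apply: smooth_derivable; exact: smoothM.
  - by apply: smooth_derivable; exact: smoothM.
  by rewrite !pderivM.
clearbody T.
(* The terms in which the wave is differentiated cancel; second derivatives of $\psi$ remain and are
   bounded by [D1] and [D2]. *)
have comm (x : 'rV[R]_n) : pderiv (pderiv T l) i x - pderiv (pderiv T i) l x =
    (pderiv (pderiv psi l) i x - pderiv (pderiv psi i) l x) * W x.
  rewrite (ddT l i) (ddT i l) (WWE l i).
  move: (pderiv (pderiv W i) l x) (pderiv (pderiv psi l) i x) (pderiv (pderiv psi i) l x).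
  move: (pderiv psi i x) (pderiv psi l x) (pderiv W l x) (pderiv W i x) (psi x) (W x).
  by move=> *; ring.
(* The weak gradient relation for the test function $\partial_aT$, solved for the part in which the
   derivative falls on the wave. *)
have ex a c : (eps j)^-1 * (2 * pi) * (kap 0 a * \int[mu]_x (G j c x * (psi x * trig k s (osc Rm eps j x)))) =
    - (\int[mu]_x (u j x * pderiv (pderiv T a) c x)) - \int[mu]_x (G j c x * (pderiv psi a x * W x)).
  rewrite weak ?opprK; last exact: test_fun_pderiv.
  have t1 : test_fun Om (fun x => pderiv psi a x * W x) by exact: test_funMr.
  have t2 : test_fun Om (fun x => psi x * trig k s (osc Rm eps j x)).
    apply: test_funMr => //; rewrite (_ : (fun x => _) = wave ((eps j)^-1 *: freq Rm k) s).
      exact: smooth_wave.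
    by apply/funext => x; rewrite trig_osc.
  rewrite -RintegralB//; last 2 first.
  - exact: integrable_mul_test (iG j c) (test_fun_pderiv a tT).
  - exact: integrable_mul_test (iG j c) t1.
  rewrite mulrA -RintegralZl//; last exact: integrable_mul_test (iG j c) t2.
  apply: eq_Rintegral => x _; rewrite dT WE.
  move: (G j c x) (psi x) (pderiv psi a x) (W x) (trig k s _) (kap 0 a) (2 * pi) => *; ring.
have e0 := eps0 j; have pi0 := pi_gt0 R.
have e0' : eps j != 0 by rewrite gt_eqF.
have pi0' : (pi : R) != 0 by rewrite gt_eqF.
set X := _ - _.
(* [Z] is the combination bounded independently of [j]; writing [X] through it produces the factor
   [eps j]. *)
pose Z := (eps j)^-1 * (2 * pi) * X.
have -> : X = eps j * (2 * pi)^-1 * Z.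
  by rewrite [RHS]mulrA mulrACA mulfV// mul1r mulVf ?mul1r// mulf_neq0.
rewrite normrM ger0_norm; last by rewrite mulr_ge0 ?invr_ge0 ?mulr_ge0// ltW.
rewrite -mulrA; apply: ler_wpM2l; first exact: ltW.
apply: ler_wpM2l; first by rewrite invr_ge0 mulr_ge0// ltW.
rewrite /Z /X mulrBr !ex.
have iu1 a c : mu.-integrable setT (EFin \o (fun x : Rn R n => u j x * pderiv (pderiv T a) c x)).
  exact: integrable_mul_test (iu j) (test_fun_pderiv c (test_fun_pderiv a tT)).
have E1 : \int[mu]_x (u j x * pderiv (pderiv T l) i x) - \int[mu]_x (u j x * pderiv (pderiv T i) l x) =
   \int[mu]_x (u j x * ((pderiv (pderiv psi l) i x - pderiv (pderiv psi i) l x) * W x)).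
  by rewrite -(RintegralB measurableT (iu1 l i) (iu1 i l)); apply: eq_Rintegral => x _; rewrite -mulrBr comm.
have B1 : `|\int[mu]_x (u j x * ((pderiv (pderiv psi l) i x - pderiv (pderiv psi i) l x) * W x))| <= (D1 + D2) * (C + M).
  apply: Rintegral_mul_bound => //.
    apply: measurable_funM => //; apply: measurable_funB; exact: measurable_test_fun (tdd _ _).
  move=> x; rewrite normrM -[leRHS]mulr1; apply: ler_pM => //.
  by rewrite (le_trans (ler_normB _ _))// lerD.
have B2 : `|\int[mu]_x (G j i x * (pderiv psi l x * W x))| <= D3 * (C + M).
  apply: Rintegral_mul_bound => //.
    by apply: measurable_funM => //; exact: measurable_test_fun (td _).
  by move=> x; rewrite normrM -[leRHS]mulr1; apply: ler_pM.
have B3 : `|\int[mu]_x (G j l x * (pderiv psi i x * W x))| <= D4 * (C + M).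
  apply: Rintegral_mul_bound => //.
    by apply: measurable_funM => //; exact: measurable_test_fun (td _).
  by move=> x; rewrite normrM -[leRHS]mulr1; apply: ler_pM.
by rewrite [_ * (C + M)]mulrDl [(_ + D3) * _]mulrDl; exact: (normr_sub4_le E1 B1 B2 B3).
Qed.

(** Two-scale convergence gives the limit of the combination in [curl_coef_small], which is also
    zero; the fundamental lemma removes $\psi$. *)
Lemma forward_curl k s i l : k != 0 -> {ae mu, forall x,
  (intv R k *m Rm) 0 l * Fc lmum k s (V i x) = (intv R k *m Rm) 0 i * Fc lmum k s (V l x)}.
Proof.
move=> k0; set kap := intv R k *m Rm.
have mF a := measurable_FcV (mV a) k s; have Fy a := Np_FcV (mV a) (Vx a) (Vy a) k s.
have iF a := Lp_integrable (ltW p1) (mF a) (Fy a).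
have ZF c a : (Np mu p (fun x => c * Fc lmum k s (V a x))%R < +oo)%E.
  rewrite NpZ// -ge0_fin_numE ?mule_ge0 ?lee_fin ?powR_ge0 ?Np_ge0//.
  by rewrite fin_numM// ge0_fin_numE// Np_ge0.
have mZ c a : measurable_fun setT (fun x => c * Fc lmum k s (V a x)) by exact: measurable_funM.
suff H : {ae mu, forall x, kap 0 l * Fc lmum k s (V i x) - kap 0 i * Fc lmum k s (V l x) = 0}.
  by apply: (aeS H) => x /eqP; rewrite subr_eq0 => /eqP.
apply: fundamental_lemma.
- exact: measurable_funB.
- apply: (le_lt_trans (NpB mu (ltW p0) (mZ _ _) (mZ _ _))).
  rewrite -ge0_fin_numE ?mule_ge0 ?lee_fin ?powR_ge0 ?adde_ge0 ?Np_ge0//.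
  by rewrite fin_numM// fin_numD !ge0_fin_numE ?Np_ge0 ?ZF.
move=> psi tpsi.
have iP a : mu.-integrable setT (EFin \o (fun x : Rn R n => psi x * Fc lmum k s (V a x))).
  rewrite (_ : (fun x => _) = fun x : Rn R n => Fc lmum k s (V a x) * psi x); last by apply/funext => x; rewrite mulrC.
  exact: integrable_mul_test (iF a) tpsi.
have -> : \int[mu]_x (psi x * (kap 0 l * Fc lmum k s (V i x) - kap 0 i * Fc lmum k s (V l x))) =
   kap 0 l * \int[mu]_x (psi x * Fc lmum k s (V i x)) - kap 0 i * \int[mu]_x (psi x * Fc lmum k s (V l x)).
  rewrite -!RintegralZl// -RintegralB//; [|exact: integrableZr|exact: integrableZr].
  by apply: eq_Rintegral => x _; ring.
pose a i j := \int[mu]_x (G j i x * (psi x * trig k s (osc Rm eps j x))).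
have c1 : (fun j => kap 0 l * a i j - kap 0 i * a l j) @ \oo -->
    kap 0 l * \int[mu]_x (psi x * Fc lmum k s (V i x)) - kap 0 i * \int[mu]_x (psi x * Fc lmum k s (V l x)).
  by apply: cvgB; apply: cvgMr; exact: ts.
have [K HK] := curl_coef_small s i l tpsi k0.
apply: (@cvg_unique _ (@Rhausdorff R) _ _ _ _ c1).
have eK : (fun j => eps j * K) @ \oo --> (0 : R) by rewrite -[X in _ --> X](mul0r K); apply: cvgMl.
apply/cvgrPdist_le => e e0; move/cvgrPdist_le : eK => /(_ _ e0)[J _ HJ].
exists J => // j /= Jj; rewrite sub0r normrN; apply: (le_trans (HK j)).
by have := HJ j Jj; rewrite /= sub0r normrN; apply: le_trans; exact: ler_norm.
Qed.

End forward.
End joint.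

(** * Measurable periodic extension from the cell *)

Lemma measurable_rowP d (T : measurableType d) (R : realType) (m : nat) (f : T -> Rn R m) :
  (forall i, measurable_fun setT (fun x => f x 0 i)) -> measurable_fun setT f.
Proof.
move=> mf; apply: (@measurability _ _ T (Rn R m) setT f (@boxes R m)); first exact: measurable_boxes.
move=> _ [B [->|[a [b [_ ->]]]] <-]; first by rewrite preimage_set0 setI0; exact: measurable0.
rewrite setTI (_ : _ @^-1` _ = \bigcap_(i in [set: 'I_m]) ((fun x => f x 0 i) @^-1` `]a 0 i, b 0 i])).
  apply: fin_bigcap_measurable => [|i _]; first exact: finite_finset.
  by rewrite -[X in measurable X]setTI; apply: mf => //; exact: measurable_itv.
apply/seteqP; split => [x H i _|x H i]; first by rewrite /preimage /= in_itv /=; exact: H.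
by have := H i I; rewrite /preimage /= in_itv.
Qed.

Section fractional_part.
Context {R : realType} {m : nat}.

(** Composition with this map turns any function on the cell into a periodic one, as membership in
    $\mathcal{G}^p_{\mathbf{R}}$ demands. *)
Definition fracv (y : 'rV[R]_m) : 'rV[R]_m := \row_i (y 0 i - (Num.floor (y 0 i))%:~R).

Lemma fracv_Ycell y : Ycell R m y -> fracv y = y.
Proof.
move=> Yy; apply/rowP => i; rewrite mxE.
suff -> : Num.floor (y 0 i) = 0 by rewrite subr0.
by apply/eqP; rewrite floor_eq//= in_itv /= add0r; exact: Yy.
Qed.

Lemma fracv_periodic : periodic fracv.
Proof.
move=> y i; apply/rowP => l; rewrite !mxE eqxx /=.
case: (l == i) => /=; last by rewrite addr0.
by rewrite floorDrz ?int_num1// floor1 intrD opprD addrACA subrr addr0.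
Qed.

Lemma measurable_fracv : measurable_fun [set: Rn R m] (fracv : Rn R m -> Rn R m).
Proof.
apply: measurable_rowP => i; under eq_fun do rewrite mxE.
have mc : measurable_fun [set: Rn R m] (fun y : Rn R m => y 0 i).
  by apply: continuous_measurable_Rn; exact: coord_continuous.
apply: measurable_funB => //.
have mf : measurable_fun [set: R] (fun t : R => (Num.floor t)%:~R : R).
  by apply: nondecreasing_measurable => // a b ab; rewrite ler_int; exact: le_floor.
exact: (measurableT_comp mf mc).
Qed.

End fractional_part.

(** * Translation between the Sobolev data and restricted measures; product test fields *)

Section assembly.
Context {R : realType} {n m : nat} (mun : {measure set (Rn R n) -> \bar R})
  (mum : {measure set (Rn R m) -> \bar R}).
Hypothesis lmun : is_lebesgue mun.
Hypothesis lmum : is_lebesgue mum.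
Context {Om : set 'rV[R]_n}.
Hypothesis oOm : open Om.
Hypothesis Omoo : (mun (Om : set (Rn R n)) < +oo)%E.
Notation mu := (muO oOm Omoo).
Notation nu := (nuY lmum).
Variable p : R.
Hypothesis p1 : 1 < p.
Let p0 : 0 < p := lt_trans (@ltr01 R) p1.
Let Y : set (Rn R m) := Ycell R m.
Let mOm : measurable (Om : set (Rn R n)) := open_measurable_Rn oOm.
Let mY : measurable Y := measurable_Ycell.

Lemma cutMr d (T : measurableType d) (D : set T) (f g : T -> R) :
  cut D (fun x => f x * g x) = fun x => cut D f x * g x.
Proof. by apply/funext => x; rewrite /cut; case: ifP; rewrite ?mul0r. Qed.

Lemma muO_integral_cutM (f g : Rn R n -> R) :
  (\int[mun]_(x in (Om : set (Rn R n))) (f x * g x)%:E =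
   \int[mu]_x (cut (Om : set (Rn R n)) f x * g x)%:E)%E.
Proof. by rewrite muO_integral_cut cutMr. Qed.

Lemma vnorm_integral_le k (g : Rn R n -> 'rV[R]_k) :
  (forall i, measurable_fun setT (fun x => g x 0 i)) ->
  (\int[mun]_(x in (Om : set (Rn R n))) (vnorm (g x) `^ p)%:E <=
    (k%:R `^ p)%:E * \sum_(i < k) Np mu p (fun x => g x 0 i)%R)%E.
Proof.
move=> mg.
have mvn : measurable_fun setT (fun x => vnorm (g x) `^ p).
  by apply: (measurableT_comp (measurable_powR p)); exact: measurable_vnorm.
rewrite muO_integral_meas//.
have mp i : measurable_fun setT (fun x => (`|g x 0 i| `^ p)%:E) by exact: measurable_powR_normE.
under eq_bigr do rewrite NpE.
have p_ge0 (i : 'I_k) (x : Rn R n) : setT x -> (0 <= (`|g x 0 i| `^ p)%:E)%E by rewrite lee_fin powR_ge0.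
rewrite -(ge0_integral_sum mu measurableT mp p_ge0).
rewrite -ge0_integralZl_EFin ?powR_ge0//; last 2 first.
- by move=> x _; apply: sume_ge0 => i _; rewrite lee_fin powR_ge0.
- exact: emeasurable_sum.
apply: ge0_le_integral => //.
- by move=> x _; rewrite lee_fin powR_ge0.
- exact/measurable_EFinP.
- by apply: emeasurable_funM => //; exact: emeasurable_sum.
- by move=> x _; rewrite sumEFin -EFinM lee_fin; exact: vnorm_powR_le.
Qed.

Lemma Lp_vec_intro k (g : 'rV[R]_n -> 'rV[R]_k) :
  (forall i, measurable_fun [set: Rn R n] (fun x : Rn R n => g x 0 i)) ->
  (forall i, (Np mu p (fun x : Rn R n => g x 0 i)%R < +oo)%E) -> Lp_vec mun Om p g.
Proof.
move=> mg gy; split; first by move=> i; exact: measurable_funTS.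
apply: (le_lt_trans (vnorm_integral_le mg)).
rewrite -ge0_fin_numE ?mule_ge0 ?lee_fin ?powR_ge0 ?sume_ge0// => [|i _]; last exact: Np_ge0.
rewrite fin_numM// ge0_fin_numE; first by apply: lte_sum_pinfty.
by apply: sume_ge0 => i _; exact: Np_ge0.
Qed.

Lemma Lp_scal_intro (f : 'rV[R]_n -> R) : measurable_fun [set: Rn R n] (f : Rn R n -> R) ->
  (Np mu p (f : Rn R n -> R) < +oo)%E -> Lp_scal mun Om p f.
Proof.
move=> mf fy; split; first exact: measurable_funTS.
by rewrite muO_integral_meas -?NpE//; exact: measurable_powR_norm.
Qed.

Lemma weak_grad_intro (u : 'rV[R]_n -> R) (g : 'rV[R]_n -> 'rV[R]_n) :
  measurable_fun [set: Rn R n] (u : Rn R n -> R) -> (Np mu p (u : Rn R n -> R) < +oo)%E ->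
  (forall i, measurable_fun [set: Rn R n] (fun x : Rn R n => g x 0 i)) ->
  (forall i, (Np mu p (fun x : Rn R n => g x 0 i)%R < +oo)%E) ->
  (forall psi, test_fun Om psi -> forall i,
    \int[mu]_x (u x * pderiv psi i x) = - \int[mu]_x (g x 0 i * psi x)) ->
  weak_grad mun Om u g.
Proof.
move=> mu_ uy mg gy H psi tpsi i.
have iu := Lp_integrable (ltW p1) mu_ uy; have ig := Lp_integrable (ltW p1) (mg i) (gy i).
have td := test_fun_pderiv i tpsi.
have m1 := measurable_funM mu_ (measurable_test_fun td).
have m2 := measurable_funM (mg i) (measurable_test_fun tpsi).
rewrite (muO_integral_meas oOm Omoo m1) (muO_integral_meas oOm Omoo m2).
rewrite (Rintegral_fineK (integrable_mul_test iu td)) (Rintegral_fineK (integrable_mul_test ig tpsi)).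
by rewrite H// EFinN.
Qed.

Lemma weak_grad_elim (u : 'rV[R]_n -> R) (g : 'rV[R]_n -> 'rV[R]_n) :
  W1p mun Om p u g -> forall psi, test_fun Om psi -> forall i,
    \int[mu]_x (cut (Om : set (Rn R n)) u x * pderiv psi i x) =
    - \int[mu]_x (cut (Om : set (Rn R n)) (fun x : Rn R n => g x 0 i) x * psi x).
Proof.
move=> [[mu_ uy] [[mg gy] H]] psi tpsi i; have := H psi tpsi i.
rewrite (muO_integral_cutM u (pderiv psi i)) (muO_integral_cutM (fun x => g x 0 i) psi) /Rintegral => ->.
by rewrite fineN.
Qed.

(** The test fields used for necessity. Their supremum over the cell is $|\psi(x)|$ times a
    constant, hence measurable in $x$ and bounded. *)
Lemma ts_test_trig psi k s i : test_fun Om psi ->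
  ts_test mun Om (p / (p - 1)) (fun x (y : 'rV[R]_m) => (psi x * trig k s y) *: (delta_mx 0 i : 'rV[R]_n)).
Proof.
move=> tpsi; have mpsi : measurable_fun [set: Rn R n] (psi : Rn R n -> R) := measurable_test_fun tpsi.
have [D D0 HD] := test_fun_bounded tpsi.
have q0 := conj_exp_gt0 p1; rewrite -/(conj_exp p).
split.
  move=> x; split.
    apply: rV_continuousP => l; under eq_fun do rewrite mxE.
    apply: continuous_mulr; last exact: cst_continuous.
    by apply: continuous_mulr; [exact: cst_continuous|exact: continuous_trig].
  by move=> y l; rewrite periodic_trig.
split.
  move=> l; apply: measurable_funTS; under eq_fun do rewrite mxE.
  apply: measurable_funM => //; apply: measurable_funM.
    exact: (measurableT_comp mpsi measurable_fst).
  exact: (measurableT_comp (measurable_trig k s) measurable_snd).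
pose S := sup [set `|trig k s y| | y in Ycell R m].
have SE (x : 'rV[R]_n) : sup [set vnorm ((psi x * trig k s y) *: (delta_mx 0 i : 'rV[R]_n)) | y in Ycell R m] = `|psi x| * S.
  rewrite -(@sup_mull _ _ _ _ _ 1)//; last 2 first.
  - by exists 0 => l; rewrite mxE lexx ltr01.
  - by move=> y _; exact: trig_le1.
  by congr sup; apply: eq_imagel => y _; rewrite vnorm_delta normrM.
under eq_fun do rewrite SE.
have mS : measurable_fun [set: Rn R n] (fun x : Rn R n => `|psi x| * S).
  by apply: measurable_funM => //; exact: measurableT_comp.
split; first exact: measurable_funTS.
rewrite muO_integral_meas -?NpE; last exact: measurable_powR_norm.
apply: (Np_bounded_lty mu (ltW q0) mS (C := D * `|S|)) => x.
by rewrite normrM normr_id ler_wpM2r.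
Qed.

End assembly.

(** * Necessity: construction of $v_1$ and conclusion *)

Section forward_direction.
Context {R : realType} {n m : nat} (mun : {measure set (Rn R n) -> \bar R})
  (mum : {measure set (Rn R m) -> \bar R}).
Hypothesis lmun : is_lebesgue mun.
Hypothesis lmum : is_lebesgue mum.
Context {Om : set 'rV[R]_n}.
Hypothesis oOm : open Om.
Hypothesis Omoo : (mun (Om : set (Rn R n)) < +oo)%E.
Notation mu := (muO oOm Omoo).
Notation nu := (nuY lmum).
Variable p : R.
Hypothesis p1 : 1 < p.
Let p0 : 0 < p := lt_trans (@ltr01 R) p1.
Let Y : set (Rn R m) := Ycell R m.
Let mOm : measurable (Om : set (Rn R n)) := open_measurable_Rn oOm.
Let mY : measurable Y := measurable_Ycell.

Section fluctuation.
Variable V : 'I_n -> Rn R n -> Rn R m -> R.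
Hypothesis mV : forall i, measurable_fun setT (fun z : Rn R n * Rn R m => V i z.1 z.2).
Hypothesis Vx : forall i x, (Np nu p (V i x) < +oo)%E.
Hypothesis Vy : forall i, (\int[mu]_x Np nu p (V i x) < +oo)%E.

Definition cell_mean i x : R := \int[nu]_y V i x y.
(** The candidate for $v_1$: removing the cell mean forces $\lambda_0=0$ and leaves the other
    coefficients unchanged. *)
Definition fluct (x : 'rV[R]_n) (y : 'rV[R]_m) : 'rV[R]_n :=
  \row_i (V i x (fracv y) - cell_mean i x).

Lemma measurable_cell_mean i : measurable_fun setT (cell_mean i).
Proof. exact: measurable_Rint_param (mV i). Qed.

Lemma cell_mean_powR i x : ((`|cell_mean i x| `^ p)%:E <= Np nu p (V i x))%E.
Proof.
have := moment_powR p1 (mV i) (Vx i) x (h := cst 1) (measurable_cst _).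
rewrite /cell_mean; under eq_Rintegral do rewrite /= mul1r.
by apply => y; rewrite normr1.
Qed.

Lemma Np_cell_mean i : (Np mu p (cell_mean i) < +oo)%E.
Proof.
apply: le_lt_trans (Vy i); rewrite NpE; apply: ge0_le_integral => //.
- by apply: measurable_powR_normE; exact: measurable_cell_mean.
- exact: measurable_NpV.
- by move=> x _; exact: cell_mean_powR.
Qed.

Lemma measurable_fluct i :
  measurable_fun setT (fun z : Rn R n * Rn R m => fluct z.1 z.2 0 i).
Proof.
under eq_fun do rewrite mxE; apply: measurable_funB.
  have mf : measurable_fun setT (fun z : Rn R n * Rn R m => (z.1, fracv z.2 : Rn R m)).
    apply: measurable_fun_pair; first exact: measurable_fst.
    exact: (measurableT_comp measurable_fracv measurable_snd).
  exact: (measurableT_comp (mV i) mf).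
exact: (measurableT_comp (measurable_cell_mean i) measurable_fst).
Qed.

Lemma Np_fluct i x : (Np nu p (fun y : Rn R m => fluct x y 0 i)%R <=
  (2 `^ p * 2)%:E * Np nu p (V i x))%E.
Proof.
have mVx := measurable_V (mV i) x.
have mc : measurable_fun [set: Rn R m] (fun y : Rn R m => V i x y - cell_mean i x).
  exact: measurable_funB.
have -> : Np nu p (fun y : Rn R m => fluct x y 0 i) = Np nu p (fun y => V i x y - cell_mean i x).
  rewrite !NpE; apply: ae_eq_integral => //.
  - apply: measurable_powR_normE.
    exact: (section_measurable (F := fun x y => fluct x y 0 i) x (measurable_fluct i)).
  - exact: measurable_powR_normE.
  - by apply: nuY_ae => y Yy _; rewrite mxE fracv_Ycell.
apply: (le_trans (NpB nu (ltW p0) mVx (measurable_cst _))).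
rewrite EFinM -muleA; apply: lee_wpmul2l; first by rewrite lee_fin powR_ge0.
rewrite mule_natl mule2n leeD2l//.
rewrite [leLHS]NpE (_ : (fun y => _) = cst (`|cell_mean i x| `^ p)%:E); last exact/funext.
by rewrite integral_cst// [X in (_ * X <= _)%E]nuY_setT mule1; exact: cell_mean_powR.
Qed.

Lemma fluct_periodic x : periodic (fluct x).
Proof. by move=> y i; apply/rowP => l; rewrite !mxE fracv_periodic. Qed.

Lemma vnorm_fluct_le x :
  (\int[nu]_y (vnorm (fluct x y) `^ p)%:E <=
    (n%:R `^ p)%:E * \sum_(i < n) ((2 `^ p * 2)%:E * Np nu p (V i x)))%E.
Proof.
have ms i : measurable_fun setT (fun y : Rn R m => fluct x y 0 i).
  exact: (section_measurable (F := fun x y => fluct x y 0 i) x (measurable_fluct i)).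
have mp i : measurable_fun setT (fun y : Rn R m => (`|fluct x y 0 i| `^ p)%:E).
  exact: (measurable_powR_normE p (ms i)).
apply: (@le_trans _ _ ((n%:R `^ p)%:E * \sum_(i < n) Np nu p (fun y : Rn R m => fluct x y 0 i)%R)%E); last first.
  by apply: lee_wpmul2l; [rewrite lee_fin powR_ge0|apply: lee_sum => i _; exact: Np_fluct].
under eq_bigr do rewrite NpE.
have p_ge0 (i : 'I_n) (y : Rn R m) : setT y -> (0 <= (`|fluct x y 0 i| `^ p)%:E)%E.
  by rewrite lee_fin powR_ge0.
rewrite -(ge0_integral_sum nu measurableT mp p_ge0).
rewrite -ge0_integralZl_EFin ?powR_ge0//; last 2 first.
- by move=> y _; apply: sume_ge0 => i _; exact: p_ge0.
- exact: emeasurable_sum.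
apply: ge0_le_integral => //.
- by move=> y _; rewrite lee_fin powR_ge0.
- apply/measurable_EFinP; apply: (measurableT_comp (measurable_powR p)).
  exact: measurable_vnorm.
- by apply: emeasurable_funM => //; exact: emeasurable_sum.
- by move=> y _; rewrite sumEFin -EFinM lee_fin; exact: vnorm_powR_le.
Qed.

Lemma measurable_vnorm_fluct :
  measurable_fun setT (fun z : Rn R n * Rn R m => vnorm (fluct z.1 z.2) `^ p).
Proof.
apply: (measurableT_comp (measurable_powR p)).
by apply: measurable_vnorm => //; exact: measurable_fluct.
Qed.

Lemma Lp2_fluct : Lp2 mun mum Om p fluct.
Proof.
split; first by move=> i; apply: measurable_funTS; exact: measurable_fluct.
rewrite (int2E (lmum := lmum) (oOm := oOm) (Omoo := Omoo) (F' := fun x y => vnorm (fluct x y) `^ p)); last 3 first.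
- by apply: measurable_funTS; exact: measurable_vnorm_fluct.
- exact: measurable_vnorm_fluct.
- by apply: aeW => x; exact: aeW.
apply: (@le_lt_trans _ _ (\int[mu]_x ((n%:R `^ p)%:E * \sum_(i < n) ((2 `^ p * 2)%:E * Np nu p (V i x))))%E).
  apply: ge0_le_integral => //.
  - by move=> x _; apply: integral_ge0 => y _; rewrite lee_fin powR_ge0.
  - exact: (measurable_int_param_signed lmum (F := fun x y => vnorm (fluct x y) `^ p) measurable_vnorm_fluct).
  - apply: emeasurable_funM => //; apply: emeasurable_sum => i.
    by apply: emeasurable_funM => //; exact: measurable_NpV.
  - by move=> x _; exact: vnorm_fluct_le.
have m2 i : measurable_fun setT (fun x => (2 `^ p * 2)%:E * Np nu p (V i x))%E.
  by apply: emeasurable_funM => //; exact: measurable_NpV.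
have c0 : 0 <= 2 `^ p * 2 :> R by rewrite mulr_ge0 ?powR_ge0.
have z0 (i : 'I_n) (x : Rn R n) : setT x -> (0 <= (2 `^ p * 2)%:E * Np nu p (V i x))%E.
  by move=> _; rewrite mule_ge0 ?lee_fin ?Np_ge0.
rewrite ge0_integralZl_EFin ?powR_ge0//; last 2 first.
- by move=> x _; apply: sume_ge0 => i _; exact: z0.
- exact: emeasurable_sum.
rewrite (ge0_integral_sum mu measurableT m2 z0).
rewrite -ge0_fin_numE; last first.
  rewrite mule_ge0 ?lee_fin ?powR_ge0// sume_ge0// => i _; apply: integral_ge0 => x _; exact: z0.
rewrite fin_numM// ge0_fin_numE; last first.
  by rewrite sume_ge0// => i _; apply: integral_ge0 => x _; exact: z0.
apply: lte_sum_pinfty => i _; rewrite ge0_integralZl_EFin//; last 2 first.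
- by move=> x _; exact: Np_ge0.
- exact: measurable_NpV.
rewrite -ge0_fin_numE; last first.
  by rewrite mule_ge0 ?lee_fin// integral_ge0// => x _; exact: Np_ge0.
by rewrite fin_numM// ge0_fin_numE ?Vy// integral_ge0// => x _; exact: Np_ge0.
Qed.

Lemma fluct_Lp_vec x : Lp_vec mum (Ycell R m) p (fluct x).
Proof.
have ms i : measurable_fun setT (fun y : Rn R m => fluct x y 0 i).
  exact: (section_measurable (F := fun x y => fluct x y 0 i) x (measurable_fluct i)).
split; first by move=> i; exact: measurable_funTS.
rewrite -nuY_integral; last first.
  apply/measurable_EFinP; apply: (measurableT_comp (measurable_powR p)).
  exact: measurable_vnorm.
apply: (le_lt_trans (vnorm_fluct_le x)).
have c0 : 0 <= 2 `^ p * 2 :> R by rewrite mulr_ge0 ?powR_ge0.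
have z0 (i : 'I_n) : (0 <= (2 `^ p * 2)%:E * Np nu p (V i x))%E.
  by rewrite mule_ge0 ?lee_fin ?Np_ge0.
rewrite -ge0_fin_numE; last by rewrite mule_ge0 ?lee_fin ?powR_ge0// sume_ge0.
rewrite fin_numM// ge0_fin_numE ?sume_ge0//.
apply: lte_sum_pinfty => i _; rewrite -ge0_fin_numE//.
by rewrite fin_numM// ge0_fin_numE ?Vx ?Np_ge0.
Qed.

Lemma fluct_coef x i k s :
  (\int[mum]_(y in Y) (fluct x y 0 i * trig k s y)%:E =
    (Fc lmum k s (V i x) - cell_mean i x * ((k == 0)%:R * cos s))%:E)%E.
Proof.
have ms : measurable_fun setT (fun y : Rn R m => fluct x y 0 i * trig k s y).
  apply: measurable_funM; last exact: measurable_trig.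
  exact: (section_measurable (F := fun x y => fluct x y 0 i) x (measurable_fluct i)).
have iV := integrable_V p1 (mV i) (Vx i) x.
have itV := integrable_trig_mul k s iV.
have it := integrableZr (cell_mean i x) (integrable_trig lmum k s).
rewrite -nuY_integral; last exact/measurable_EFinP.
rewrite -(Rintegral_trig lmum) -(RintegralZl _ measurableT (integrable_trig lmum k s)) /Fc -(RintegralB measurableT itV it).
rewrite -(Rintegral_fineK (integrable_subr itV it)); apply: ae_eq_integral => //.
- exact/measurable_EFinP.
- by apply/measurable_EFinP; have /measurable_int/measurable_EFinP := integrable_subr itV it.
- by apply: nuY_ae => y Yy _; rewrite /fluct mxE fracv_Ycell//; congr EFin; ring.
Qed.

End fluctuation.

Variables (Rm : 'M[R]_(m, n)) (eps : nat -> R).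
Hypothesis Rm0 : forall k : 'rV[int]_m, k != 0 -> intv R k *m Rm != 0.
Hypothesis eps0 : forall j, 0 < eps j.
Hypothesis epsc : eps @ \oo --> 0.

(** With a product test field the limit integral over $\Omega\times Y^m$ becomes $\psi$ paired with
    a Fourier coefficient in $y$. *)
Lemma ts_trig_cvg (gs : nat -> 'rV[R]_n -> 'rV[R]_n) (v : 'rV[R]_n -> 'rV[R]_m -> 'rV[R]_n)
    (V : 'I_n -> Rn R n -> Rn R m -> R) :
  (forall j, Lp_vec mun Om p (gs j)) ->
  jmeas Om (Ycell R m) v ->
  (forall i, measurable_fun setT (fun z : Rn R n * Rn R m => V i z.1 z.2)) ->
  (forall i x, (Np nu p (V i x) < +oo)%E) ->
  (forall i, (\int[mu]_x Np nu p (V i x) < +oo)%E) ->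
  {ae mu, forall x : Rn R n, forall y : Rn R m, Y y -> forall i, V i x y = v x y 0 i} ->
  two_scale_conv mun mum Om p Rm eps gs v ->
  forall psi k s i, test_fun Om psi ->
  (fun j => \int[mu]_x (cut (Om : set (Rn R n)) (fun x => gs j x 0 i) x *
     (psi x * trig k s (osc Rm eps j x)))) @ \oo -->
  \int[mu]_x (psi x * Fc lmum k s (V i x)).
Proof.
move=> Lg mv mV Vx Vy Vae ts psi k s i tpsi.
have mpsi : measurable_fun [set: Rn R n] (psi : Rn R n -> R) := measurable_test_fun tpsi.
have := ts _ (ts_test_trig oOm Omoo p1 k s i tpsi).
have vd (a : 'rV[R]_n) (c : R) : vdot a (c *: delta_mx 0 i) = a 0 i * c.
  by rewrite vdotZr vdot_delta mulrC.
rewrite (int2E (lmum := lmum) (oOm := oOm) (Omoo := Omoo) (F' := fun x y => V i x y * (psi x * trig k s y))); last 3 first.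
- under eq_fun do rewrite vd; apply: measurable_funM; first exact: mv.
  apply: measurable_funTS; apply: measurable_funM.
    exact: (measurableT_comp mpsi measurable_fst).
  exact: (measurableT_comp (measurable_trig k s) measurable_snd).
- apply: measurable_funM; first exact: mV.
  apply: measurable_funM.
    exact: (measurableT_comp mpsi measurable_fst).
  exact: (measurableT_comp (measurable_trig k s) measurable_snd).
- by apply: (aeS Vae) => x Hx; apply: nuY_ae => y Yy; rewrite vd Hx.
have itV x := integrable_trig_mul k s (integrable_V p1 (mV i) (Vx i) x).
have -> : (\int[mu]_x \int[nu]_y (V i x y * (psi x * trig k s y))%:E)%E =
    (\int[mu]_x (psi x * Fc lmum k s (V i x)))%:E.
  have iF := Lp_integrable (ltW p1) (measurable_FcV lmum (mV i) k s) (Np_FcV p1 (mV i) (Vx i) (Vy i) k s).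
  have iF2 : mu.-integrable setT (EFin \o (fun x : Rn R n => psi x * Fc lmum k s (V i x))).
    have [D D0 HD] := test_fun_bounded tpsi.
    exact: (integrable_mul_bounded mpsi HD).
  rewrite -(Rintegral_fineK iF2); apply: eq_integral => x _.
  rewrite /Fc -(RintegralZl _ measurableT (itV x)) -(Rintegral_fineK (integrableZr (psi x) (itV x))).
  by apply: eq_integral => y _; congr EFin; ring.
move/fine_cvgP => [_]; apply: cvg_trans; apply: near_eq_cvg; apply: nearW => j /=.
rewrite /Rintegral; congr fine.
rewrite -(muO_integral_cutM oOm Omoo (fun x => gs j x 0 i) (fun x => psi x * trig k s (osc Rm eps j x))).
by apply: eq_integral => x _; rewrite vd.
Qed.

Lemma forward_direction (v : 'rV[R]_n -> 'rV[R]_m -> 'rV[R]_n)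
    (vs : nat -> 'rV[R]_n -> R) (gs : nat -> 'rV[R]_n -> 'rV[R]_n) (C : R) :
  Lp2 mun mum Om p v ->
  (forall j, W1p mun Om p (vs j) (gs j)) ->
  (forall j, (\int[mun]_(x in (Om : set (Rn R n))) (powR `|vs j x| p)%:E <= C%:E)%E /\
     (\int[mun]_(x in (Om : set (Rn R n))) (powR (vnorm (gs j x)) p)%:E <= C%:E)%E) ->
  two_scale_conv mun mum Om p Rm eps gs v ->
  exists (v0 : 'rV[R]_n -> R) (g0 : 'rV[R]_n -> 'rV[R]_n)
          (v1 : 'rV[R]_n -> 'rV[R]_m -> 'rV[R]_n),
      W1p mun Om p v0 g0 /\
      jmeas Om setT v1 /\
      Lp2 mun mum Om p v1 /\
      {ae mun, forall x : Rn R n, Om x -> inG mum p Rm (v1 x)} /\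
      {ae mun, forall x : Rn R n, Om x ->
         {ae mum, forall y : Rn R m, Ycell R m y ->
            v x y = g0 x + v1 x y}}.
Proof.
move=> Lv W HC ts.
have [V [mV Vx Vy Vae]] := Lp2_rep lmum oOm Omoo p0 Lv.
pose u j := cut (Om : set (Rn R n)) (vs j).
pose G j i := cut (Om : set (Rn R n)) (fun x : Rn R n => gs j x 0 i).
have mu_ j : measurable_fun setT (u j) by have [[? _] _] := W j; exact: measurable_cut.
have uC j : (Np mu p (u j) <= C%:E)%E by rewrite Np_cut//; have [] := HC j.
have mG j i : measurable_fun setT (G j i) by have [_ [[? _] _]] := W j; exact: measurable_cut.
have GC j i : (Np mu p (G j i) <= C%:E)%E.
  rewrite Np_cut//; have [_] := HC j; apply: le_trans.
  have [_ [[mg _] _]] := W j.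
  apply: ge0_le_integral => //.
  - apply/measurable_EFinP; apply: (measurableT_comp (measurable_powR p)).
    exact: (measurableT_comp (@normr_measurable _ setT)).
  - apply/measurable_EFinP; apply: (measurableT_comp (measurable_powR p)).
    exact: measurable_vnorm.
  - by move=> x _; rewrite lee_fin; apply: powR_le => //; [exact: ltW|exact: coord_le_vnorm].
have weak psi (tpsi : test_fun Om psi) j i := weak_grad_elim oOm Omoo (W j) tpsi i.
have Lg j : Lp_vec mun Om p (gs j) by have [_ []] := W j.
have tsc := ts_trig_cvg Lg Lv.1 mV Vx Vy Vae ts.
have [v0 [mv0 v0y Hv0]] := forward_potential p1 mu_ uC weak tsc.
pose g0 x : 'rV[R]_n := \row_i cell_mean V i x.
have mg0 i : measurable_fun [set: Rn R n] (fun x : Rn R n => g0 x 0 i).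
  by under eq_fun do rewrite mxE; exact: measurable_cell_mean.
have g0y i : (Np mu p (fun x : Rn R n => g0 x 0 i)%R < +oo)%E.
  rewrite (_ : (fun x => _) = cell_mean V i); first exact: Np_cell_mean.
  by apply/funext => x; rewrite mxE.
exists v0, g0, (fluct V); split; last split; last split; last split.
- split; first exact: (Lp_scal_intro mv0 v0y).
  split; first exact: (Lp_vec_intro p1 mg0 g0y).
  apply: (weak_grad_intro p1 mv0 v0y mg0 g0y) => psi tpsi i; rewrite Hv0//; congr (- _).
  by apply: eq_Rintegral => x _; rewrite mxE.
- by move=> i; apply: measurable_funTS; exact: measurable_fluct.
- exact: Lp2_fluct.
- apply/(muO_aeP oOm Omoo).
  (* Frequencies, phases and pairs of indices are countably many, so one null set of [x] serves them
     all. The boolean selects cosine or sine. *)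
  have curl : {ae mu, forall x, forall q : 'rV[int]_m * bool * 'I_n * 'I_n, q.1.1.1 != 0 ->
      (intv R q.1.1.1 *m Rm) 0 q.2 * Fc lmum q.1.1.1 (- (q.1.1.2%:R * (pi / 2))) (V q.1.2 x) =
      (intv R q.1.1.1 *m Rm) 0 q.1.2 * Fc lmum q.1.1.1 (- (q.1.1.2%:R * (pi / 2))) (V q.2 x)}.
    apply: ae_countable => -[[[k b] i] l]; have [->|k0] := eqVneq k 0.
      by apply: aeW => x.
    apply: (aeS (forward_curl p1 mu_ uC mG GC weak mV Vx Vy eps0 epsc tsc
      (- (b%:R * (pi / 2))) i l k0)) => x Hx _; exact: Hx.
  apply: (aeS curl) => x Hx; split; first exact: fluct_periodic.
  split; first exact: fluct_Lp_vec.
  move=> k.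
  have cosE y : cos (2 * pi * vdot (intv R k) y) = trig k 0 y by rewrite /trig addr0.
  have sinE y : sin (2 * pi * vdot (intv R k) y) = trig k (- (pi / 2)) y by rewrite /trig cosBpihalf.
  have cE i := fluct_coef mV Vx x i k 0; have sE i := fluct_coef mV Vx x i k (- (pi / 2)).
  (* At $k=0$ the cosine coefficient vanishes because the mean was removed, the sine coefficient
     because the sine is zero. *)
  have [k0|k0] := eqVneq k 0.
    exists 0, 0; split => // i; rewrite !mul0r; split.
      under eq_integral do rewrite cosE.
      rewrite cE k0 eqxx mul1r cos0 mulr1; congr EFin; apply/eqP; rewrite subr_eq0; apply/eqP.
      by rewrite Fc00.
    under eq_integral do rewrite sinE.
    rewrite sE k0 eqxx mul1r cosN cos_pihalf mulr0 subr0; congr EFin.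
    rewrite /Fc; under eq_Rintegral do rewrite trig0 cosN cos_pihalf mul0r.
    by rewrite Rintegral_cst1.
  have [l kl] : exists l, (intv R k *m Rm) 0 l != 0.
    apply/existsP; apply: contra_neqT (Rm0 k0); rewrite negb_exists => /forallP H.
    by apply/rowP => l; rewrite [RHS]mxE; apply/eqP; have := H l; rewrite negbK.
  (* Dividing the parallelism relation by the nonzero component [l] of $\mathbf{R}^*k$ exhibits the
     multiplier. *)
  have div (s : R) i : (intv R k *m Rm) 0 l * Fc lmum k s (V i x) = (intv R k *m Rm) 0 i * Fc lmum k s (V l x) ->
      Fc lmum k s (V i x) = Fc lmum k s (V l x) / (intv R k *m Rm) 0 l * (intv R k *m Rm) 0 i.
    by move=> H; apply: (mulfI kl); rewrite H; field.
  exists (Fc lmum k 0 (V l x) / (intv R k *m Rm) 0 l), (Fc lmum k (- (pi / 2)) (V l x) / (intv R k *m Rm) 0 l).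
  split; first by move=> kk; rewrite kk eqxx in k0.
  move=> i; split.
    under eq_integral do rewrite cosE.
    rewrite cE (negbTE k0) mul0r mulr0 subr0; congr EFin; apply: div.
    by have := Hx (k, false, i, l) k0; rewrite /= mul0r oppr0.
  under eq_integral do rewrite sinE.
  rewrite sE (negbTE k0) mul0r mulr0 subr0; congr EFin; apply: div.
  by have := Hx (k, true, i, l) k0; rewrite /= mul1r.
- apply/(muO_aeP oOm Omoo); apply: (aeS Vae) => x Hx.
  apply: aeW => y Yy; apply/rowP => i.
  by rewrite [RHS]mxE [g0 _ _ _]mxE mxE fracv_Ycell// addrC subrK Hx.
Qed.

End forward_direction.

(** * Approximation of $v_1$ by finite sums of waves with smooth coefficients *)

(** Each term of the list divides the budget by $2\cdot2^p$, so [eta] is fixed before the functions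
    are chosen. *)
Lemma Np_sum_small d (T : measurableType d) (R : realType) (mu : {measure set T -> \bar R})
    (E : Type) (s : seq E) (p dl : R) : 0 < p -> 0 < dl -> exists2 eta, 0 < eta &
  forall f : E -> T -> R, (forall e, measurable_fun setT (f e)) ->
  (forall e, (Np mu p (f e) <= eta%:E)%E) ->
  (Np mu p (fun x => \sum_(e <- s) f e x)%R <= dl%:E)%E.
Proof.
move=> p0; elim: s dl => [|e s IH] dl dl0.
  exists 1 => // f _ _; under eq_fun do rewrite big_nil.
  by rewrite Np0// lee_fin ltW.
have e1 : 0 < dl / 2 / 2 `^ p by rewrite !divr_gt0// powR_gt0.
have [eta eta0 H] := IH _ e1.
exists (Num.min eta (dl / 2 / 2 `^ p)); first by rewrite lt_min eta0 e1.
move=> f mf fe; under eq_fun do rewrite big_cons.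
apply: Np_add_small => //; [exact: ltW|exact: measurable_sum| |].
  by apply: le_trans (fe e) _; rewrite lee_fin ge_min lexx orbT.
apply: H => // e'; apply: le_trans (fe e') _; by rewrite lee_fin ge_min lexx.
Qed.

Section approximation.
Context {R : realType} {n m : nat} (mun : {measure set (Rn R n) -> \bar R})
  (mum : {measure set (Rn R m) -> \bar R}).
Hypothesis lmun : is_lebesgue mun.
Hypothesis lmum : is_lebesgue mum.
Context {Om : set 'rV[R]_n}.
Hypothesis oOm : open Om.
Hypothesis Omoo : (mun (Om : set (Rn R n)) < +oo)%E.
Notation mu := (muO oOm Omoo).
Notation nu := (nuY lmum).
Variable p : R.
Hypothesis p1 : 1 < p.
Let p0 : 0 < p := lt_trans (@ltr01 R) p1.
Variable Rm : 'M[R]_(m, n).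

(** A norm over the product measure, so that the estimates for [Np] apply as they stand to functions
    of two variables; [jNpE] returns to iterated integrals. *)
Definition jNp (F : Rn R n -> Rn R m -> R) : \bar R :=
  Np (mu \x nu)%E p (fun z : Rn R n * Rn R m => F z.1 z.2).

Lemma jNpE (F : Rn R n -> Rn R m -> R) :
  measurable_fun setT (fun z : Rn R n * Rn R m => F z.1 z.2) ->
  jNp F = (\int[mu]_x Np nu p (F x))%E.
Proof.
move=> mF; rewrite /jNp NpE.
rewrite (fubini_tonelli1 (fun z : Rn R n * Rn R m => (`|F z.1 z.2| `^ p)%:E)).
- by apply: eq_integral => x _; rewrite NpE.
- exact: (measurable_powR_normE p mF).
- by move=> z; rewrite lee_fin powR_ge0.
Qed.

(* An entry is (weight, frequency, phase). *)
Definition entry : Type := (R * 'rV[int]_m * R)%type.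
Definition kap (e : entry) : 'rV[R]_n := intv R e.1.2 *m Rm.
Definition osum (s : seq entry) (al : entry -> 'rV[R]_n -> R) (i : 'I_n)
    (x : 'rV[R]_n) (y : 'rV[R]_m) : R :=
  \sum_(e <- s) al e x * (trig e.1.2 e.2 y * kap e 0 i).

Lemma measurable_osum s al i : (forall e, test_fun Om (al e)) ->
  measurable_fun setT (fun z : Rn R n * Rn R m => osum s al i z.1 z.2).
Proof.
move=> tal; apply: measurable_sum => e; apply: measurable_funM.
  exact: (measurableT_comp (measurable_test_fun (tal e)) measurable_fst).
apply: measurable_funM => //.
exact: (measurableT_comp (measurable_trig e.1.2 e.2) measurable_snd).
Qed.

Lemma osum_bounded s al : (forall e, test_fun Om (al e)) ->
  exists2 C : R, 0 <= C & forall i x y, `|osum s al i x y| <= C.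
Proof.
move=> tal.
exists (\sum_(e <- s) projT1 (cid2 (test_fun_bounded (tal e))) * \sum_i `|kap e 0 i|).
  apply: sumr_ge0 => e _; apply: mulr_ge0; last exact: sumr_ge0.
  by case: cid2.
move=> i x y; apply: (le_trans (ler_norm_sum _ _ _)); apply: ler_sum => e _.
case: cid2 => C C0 HC /=; rewrite normrM; apply: ler_pM => //.
rewrite normrM (le_trans (ler_wpM2r _ (trig_le1 _ _ _)))// mul1r.
by rewrite (bigD1 i)//= lerDl; exact: sumr_ge0.
Qed.

Variable V : 'I_n -> Rn R n -> Rn R m -> R.
Hypothesis mV : forall i, measurable_fun setT (fun z : Rn R n * Rn R m => V i z.1 z.2).
Hypothesis Vx : forall i x, (Np nu p (V i x) < +oo)%E.
Hypothesis Vy : forall i, (\int[mu]_x Np nu p (V i x) < +oo)%E.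

Let iV i x := integrable_V p1 (mV i) (Vx i) x.

Lemma measurable_TNV N i :
  measurable_fun setT (fun z : Rn R n * Rn R m => TN lmum N (V i z.1) z.2).
Proof.
rewrite (_ : (fun z => _) = fun z : Rn R n * Rn R m =>
    \sum_(e <- KL lmum N) e.1.1 * trig e.1.2 e.2 z.2 * Fc lmum e.1.2 e.2 (V i z.1)); last first.
  by apply/funext => z; rewrite TN_expand.
apply: measurable_sum => e; apply: measurable_funM; last first.
  exact: (measurableT_comp (measurable_FcV lmum (mV i) e.1.2 e.2) measurable_fst).
apply: measurable_funM => //.
exact: (measurableT_comp (measurable_trig e.1.2 e.2) measurable_snd).
Qed.

(** On every fibre the convolutions converge, and by contraction the fibre errors are dominated by a
    multiple of the fibre norm of [V]. *)
Lemma TNV_cvg i dl : 0 < dl -> exists N0, forall N, (N0 <= N)%N ->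
  (jNp (fun x y => V i x y - TN lmum N (V i x) y)%R <= dl%:E)%E.
Proof.
move=> dl0.
have mD N : measurable_fun setT (fun z : Rn R n * Rn R m => V i z.1 z.2 - TN lmum N (V i z.1) z.2).
  by apply: measurable_funB => //; exact: measurable_TNV.
pose D N x := Np nu p (fun y => V i x y - TN lmum N (V i x) y).
have mDx N : measurable_fun setT (D N) := measurable_NpV lmum p (V := fun x y => V i x y - TN lmum N (V i x) y) (mD N).
pose g x := ((2 `^ p * 2)%:E * Np nu p (V i x))%E.
have D0 N x : (0 <= D N x)%E by exact: Np_ge0.
have Dg N x : (D N x <= g x)%E.
  have mTN : measurable_fun [set: Rn R m] (TN lmum N (V i x) : Rn R m -> R) by exact: measurable_TN.
  apply: (le_trans (NpB nu (ltW p0) (measurable_V (mV i) x) mTN)).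
  rewrite /g EFinM -muleA; apply: lee_wpmul2l; first by rewrite lee_fin powR_ge0.
  by rewrite mule_natl mule2n leeD2l//; apply: TN_contract => //; exact: measurable_V.
have mN := measurable_NpV lmum p (mV i).
have ig : mu.-integrable setT g.
  apply: integrableZl => //; apply/integrableP; split => //.
  rewrite (eq_integral (fun x => Np nu p (V i x)))// => x _.
  by rewrite gee0_abs// Np_ge0.
have Dc : {ae mu, forall x, setT x -> D ^~ x @ \oo --> (cst 0%E x : \bar R)}.
  apply: aeW => x _; have fD N : D N x \is a fin_num.
    rewrite ge0_fin_numE//; apply: (le_lt_trans (Dg N x)).
    rewrite /g -ge0_fin_numE ?mule_ge0 ?lee_fin ?Np_ge0 ?mulr_ge0 ?powR_ge0//.
    by rewrite fin_numM// ge0_fin_numE ?Vx ?Np_ge0.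
  apply/fine_cvgP; split; first exact: nearW.
  apply/cvgrPdist_le => e e0.
  have [N0 HN0] := TN_Lp p1 (measurable_V (mV i) x) (Vx i x) e0.
  exists N0 => // N /= jNp; rewrite sub0r normrN ger0_norm ?fine_ge0//.
  by rewrite -lee_fin fineK//; exact: HN0.
have Db : {ae mu, forall x, forall N, setT x -> (`|D N x| <= g x)%E}.
  by apply: aeW => x N _; rewrite gee0_abs.
have [_ _] := dominated_convergence measurableT mDx (measurable_cst _) Dc ig Db.
rewrite integral0 => /fine_cvgP[[N1 _ H1] /cvgrPdist_le/(_ _ dl0)[N2 _ H2]].
exists (maxn N1 N2) => N; rewrite geq_max => /andP[NN1 NN2].
have /= f1 := H1 N NN1; rewrite jNpE// -(fineK f1) lee_fin.
by have /= := H2 N NN2; rewrite sub0r normrN; apply: le_trans; exact: ler_norm.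
Qed.

Hypothesis Vcoef : {ae mu, forall x, forall (k : 'rV[int]_m) (b : bool), exists a : R,
  forall i, Fc lmum k (- (b%:R * (pi / 2))) (V i x) = a * (intv R k *m Rm) 0 i}.

(** Coordinate of the coefficient vector along [kap e] by orthogonal projection. For a vector
    parallel to [kap e] this recovers the multiplier, and it is measurable in [x] by
    construction. *)
Definition lam (e : entry) (x : Rn R n) : R :=
  \sum_i (kap e 0 i / vdot (kap e) (kap e)) * Fc lmum e.1.2 e.2 (V i x).

Lemma lam_coef (e : entry) : (e.2 == 0) || (e.2 == - (pi / 2)) ->
  {ae mu, forall x, forall i, Fc lmum e.1.2 e.2 (V i x) = lam e x * kap e 0 i}.
Proof.
move=> He; apply: (aeS Vcoef) => x Hx i.
have [b bE] : exists b : bool, e.2 = - (b%:R * (pi / 2)).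
  by move: He => /orP[/eqP ->|/eqP ->]; [exists false; rewrite mul0r oppr0|exists true; rewrite mul1r].
have [a Ha] := Hx e.1.2 b; rewrite -bE in Ha.
rewrite /lam; under eq_bigr do rewrite Ha.
(* When [kap e] is zero, as for $k=0$, the coefficient vanishes too and the inverse of zero does no
   harm. *)
rewrite Ha -/(kap e); have [k0|k0] := eqVneq (vdot (kap e) (kap e)) 0.
  have ki : kap e 0 i = 0.
    have /eqP := k0; rewrite /vdot psumr_eq0 => [/allP/(_ i)|l _]; last by rewrite -expr2 sqr_ge0.
    by rewrite mem_index_enum => /(_ isT); rewrite -expr2 sqrf_eq0 => /eqP.
  by rewrite ki !mulr0.
congr (_ * _); transitivity (a * (vdot (kap e) (kap e) / vdot (kap e) (kap e))); first by rewrite divff// mulr1.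
rewrite {1}/vdot mulr_suml mulr_sumr; apply: eq_bigr => l _.
by move: (vdot _ _)^-1 (kap e 0 l) => c d; ring.
Qed.

Lemma measurable_lam e : measurable_fun setT (lam e).
Proof. by apply: measurable_sum => i; apply: measurable_funM => //; exact: measurable_FcV. Qed.

Lemma Np_sum_lty (I : Type) (s : seq I) (f : I -> Rn R n -> R) :
  (forall i, measurable_fun setT (f i)) -> (forall i, (Np mu p (f i) < +oo)%E) ->
  (Np mu p (fun x => \sum_(i <- s) f i x)%R < +oo)%E.
Proof.
move=> mf fy; elim: s => [|i s IH].
  by under eq_fun do rewrite big_nil; rewrite Np0// ltry.
under eq_fun do rewrite big_cons.
apply: (le_lt_trans (NpD mu (ltW p0) (mf i) (measurable_sum s mf))).
rewrite -ge0_fin_numE ?mule_ge0 ?lee_fin ?powR_ge0 ?adde_ge0 ?Np_ge0//.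
by rewrite fin_numM// fin_numD !ge0_fin_numE ?Np_ge0 ?fy ?IH.
Qed.

Lemma NpZ_lty (c : R) (f : Rn R n -> R) : measurable_fun setT f -> (Np mu p f < +oo)%E ->
  (Np mu p (fun x => c * f x)%R < +oo)%E.
Proof.
move=> mf fy; rewrite NpZ// -ge0_fin_numE ?mule_ge0 ?lee_fin ?powR_ge0 ?Np_ge0//.
by rewrite fin_numM// ge0_fin_numE// Np_ge0.
Qed.

Lemma Np_lam e : (Np mu p (lam e) < +oo)%E.
Proof.
apply: Np_sum_lty => i; first by apply: measurable_funM => //; exact: measurable_FcV.
by apply: NpZ_lty; [exact: measurable_FcV|exact: Np_FcV].
Qed.

(** Two errors: convolution replaces [V] by a finite sum of waves whose coefficients are parallel to
    $\mathbf{R}^*k$ and $L^p$ in $x$; these coefficients are then replaced by test functions. *)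
Lemma osum_dense dl : 0 < dl -> exists (s : seq entry) (al : entry -> 'rV[R]_n -> R),
  (forall e, test_fun Om (al e)) /\
  forall i, (jNp (fun x y => V i x y - osum s al i x y)%R <= dl%:E)%E.
Proof.
move=> dl0; have d2 : 0 < dl / 2 / 2 `^ p by rewrite !divr_gt0// powR_gt0.
have /choice[N0 HN0] : forall i, exists N0, forall N, (N0 <= N)%N ->
    (jNp (fun x y => V i x y - TN lmum N (V i x) y)%R <= (dl / 2 / 2 `^ p)%:E)%E.
  by move=> i; exact: TNV_cvg.
pose N := \max_i N0 i.
have HN i : (jNp (fun x y => V i x y - TN lmum N (V i x) y)%R <= (dl / 2 / 2 `^ p)%:E)%E.
  by apply: HN0; exact: leq_bigmax.
have [eta eta0 Heta] := Np_sum_small (mu \x nu)%E (KL lmum N) p0 d2.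
have kp (e : entry) : 0 < (\sum_i `|kap e 0 i|) `^ p + 1 by rewrite ltr_wpDl ?powR_ge0.
have /choice[al Hal] : forall e : entry, exists al, test_fun Om al /\
    (Np mu p (fun x : Rn R n => e.1.1 * lam e x - al x)%R <= (eta / ((\sum_i `|kap e 0 i|) `^ p + 1))%:E)%E.
  move=> e; have e0 : 0 < eta / ((\sum_i `|kap e 0 i|) `^ p + 1) by rewrite divr_gt0.
  have ml : measurable_fun setT (fun x => e.1.1 * lam e x).
    by apply: measurable_funM => //; exact: measurable_lam.
  have [al tal Hal] := @test_fun_dense _ _ _ _ oOm Omoo p _ (ltW p1) ml (NpZ_lty _ (measurable_lam e) (Np_lam e)) _ e0.
  by exists al.
have tal e : test_fun Om (al e) by have [] := Hal e.
exists (KL lmum N), al; split => // i.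
(* The error of one entry when its $L^p$ coefficient gives way to the test function [al e]. *)
pose f (e : entry) (z : Rn R n * Rn R m) : R := (e.1.1 * lam e z.1 - al e z.1) * (trig e.1.2 e.2 z.2 * kap e 0 i).
have ma e : measurable_fun setT (fun x : Rn R n => e.1.1 * lam e x - al e x).
  apply: measurable_funB; last exact: measurable_test_fun (tal e).
  by apply: measurable_funM => //; exact: measurable_lam.
have mf e : measurable_fun setT (f e).
  apply: measurable_funM.
    exact: (measurableT_comp (ma e) measurable_fst).
  apply: measurable_funM => //.
  exact: (measurableT_comp (measurable_trig e.1.2 e.2) measurable_snd).
have fe e : (Np (mu \x nu)%E p (f e) <= eta%:E)%E.
  have -> : Np (mu \x nu)%E p (f e) = jNp (fun x y => f e (x, y)) by congr Np; apply/funext => -[].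
  rewrite jNpE; last by rewrite (_ : (fun z => _) = f e)//; apply/funext => -[].
  pose K := (\sum_i `|kap e 0 i|) `^ p.
  apply: (@le_trans _ _ (\int[mu]_x (K%:E * (`|e.1.1 * lam e x - al e x| `^ p)%:E))%E).
    apply: ge0_le_integral => //.
    - by move=> x _; exact: Np_ge0.
    - apply: (measurable_NpV lmum p (V := fun x y => f e (x, y))).
      by rewrite (_ : (fun z => _) = f e)//; apply/funext => -[].
    - by apply: emeasurable_funM => //; exact: measurable_powR_normE.
    - move=> x _; rewrite /f /= NpZ; last by apply: measurable_funM => //; exact: measurable_trig.
      rewrite muleC lee_wpmul2r ?lee_fin ?powR_ge0//.
      have mt : measurable_fun [set: Rn R m] (fun y : Rn R m => trig e.1.2 e.2 y * kap e 0 i).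
        by apply: measurable_funM => //; exact: measurable_trig.
      apply: (le_trans (Np_bounded nu (ltW p0) mt (C := \sum_i `|kap e 0 i|) _)).
        move=> y; rewrite normrM (le_trans (ler_wpM2r _ (trig_le1 _ _ _)))// mul1r.
        by rewrite (bigD1 i)//= lerDl; exact: sumr_ge0.
      by rewrite [X in (_ * X <= _)%E]nuY_setT mule1.
  rewrite ge0_integralZl_EFin ?powR_ge0//; last exact: measurable_powR_normE.
  rewrite -NpE; apply: (@le_trans _ _ (K%:E * (eta / (K + 1))%:E)%E).
    by rewrite lee_wpmul2l ?lee_fin ?powR_ge0//; have [] := Hal e.
  by rewrite -EFinM lee_fin mulrCA ler_piMr ?(ltW eta0)// ler_pdivrMr ?mul1r ?lerDl ?kp.
have Hf := Heta f mf fe.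
have mTN : measurable_fun setT (fun z : Rn R n * Rn R m => V i z.1 z.2 - TN lmum N (V i z.1) z.2).
  by apply: measurable_funB => //; exact: measurable_TNV.
have mos := measurable_osum (KL lmum N) i tal.
have mD : measurable_fun setT (fun z : Rn R n * Rn R m => V i z.1 z.2 - osum (KL lmum N) al i z.1 z.2).
  exact: measurable_funB.
have msum : measurable_fun setT (fun z : Rn R n * Rn R m => \sum_(e <- KL lmum N) f e z) by exact: measurable_sum.
pose F2 (x : Rn R n) (y : Rn R m) := (V i x y - TN lmum N (V i x) y) + \sum_(e <- KL lmum N) f e (x, y).
have mF2 : measurable_fun setT (fun z : Rn R n * Rn R m => F2 z.1 z.2).
  rewrite (_ : (fun z => _) = fun z => (V i z.1 z.2 - TN lmum N (V i z.1) z.2) + \sum_(e <- KL lmum N) f e z).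
    exact: measurable_funD.
  by apply/funext => -[].
(* Expansion of the convolution by [lam_coef], valid for almost every [x] simultaneously for the
   finitely many entries. *)
have -> : jNp (fun x y => V i x y - osum (KL lmum N) al i x y) = jNp F2.
  rewrite !jNpE//; apply: ae_eq_integral => //.
  - exact: (measurable_NpV lmum p (V := fun x y => V i x y - osum (KL lmum N) al i x y)).
  - exact: (measurable_NpV lmum p (V := F2)).
  have lam_all : {ae mu, forall x, forall (q : 'I_(size (KL lmum N))) (l : 'I_n),
      let e := nth (0, 0, 0) (KL lmum N) q in Fc lmum e.1.2 e.2 (V l x) = lam e x * kap e 0 l}.
    apply: ae_countable => q; apply: lam_coef.
    by apply: (allP (KL_phase lmum N)); exact: mem_nth.
  apply: (aeS lam_all) => x Hx _; congr Np; apply/funext => y.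
  rewrite /F2 TN_expand//.
  have -> : \sum_(e <- KL lmum N) e.1.1 * trig e.1.2 e.2 y * Fc lmum e.1.2 e.2 (V i x) =
     \sum_(e <- KL lmum N) (e.1.1 * lam e x) * (trig e.1.2 e.2 y * kap e 0 i).
    rewrite !(big_nth (0, 0, 0)) !big_mkord; apply: eq_bigr => q _.
    by have /= -> := Hx q i; ring.
  rewrite -addrA; congr (_ + _); rewrite /osum -sumrN -sumrN -big_split /=; apply: eq_bigr => e _.
  by rewrite /f /=; ring.
rewrite /jNp (_ : (fun z => F2 z.1 z.2) = fun z => (V i z.1 z.2 - TN lmum N (V i z.1) z.2) + \sum_(e <- KL lmum N) f e z).
  by apply: Np_add_small => //; [exact: ltW|exact: HN].
by apply/funext => -[].
Qed.

End approximation.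

Lemma pderiv_sum (R : realType) (n : nat) (I : Type) (s : seq I) (f : I -> 'rV[R]_n -> R) i :
  (forall e, smooth (f e)) ->
  pderiv (fun x => \sum_(e <- s) f e x) i = fun x => \sum_(e <- s) pderiv (f e) i x.
Proof.
move=> sf; elim: s => [|e s IH].
  apply/funext => x; rewrite big_nil /pderiv (_ : (fun x => _) = cst 0); first exact: derive_cst.
  by apply/funext => z; rewrite big_nil.
rewrite (_ : (fun x => _) = fun x => f e x + \sum_(e <- s) f e x); last first.
  by apply/funext => x; rewrite big_cons.
rewrite pderivD ?IH; first by apply/funext => x; rewrite big_cons.
  exact: smooth_derivable.
by apply: smooth_derivable; exact: smooth_sum.
Qed.

(** * Correctors and norms along the oscillation *)

Section corrector.
Context {R : realType} {n m : nat} (mun : {measure set (Rn R n) -> \bar R})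
  (mum : {measure set (Rn R m) -> \bar R}).
Hypothesis lmun : is_lebesgue mun.
Hypothesis lmum : is_lebesgue mum.
Context {Om : set 'rV[R]_n}.
Hypothesis oOm : open Om.
Hypothesis Omoo : (mun (Om : set (Rn R n)) < +oo)%E.
Notation mu := (muO oOm Omoo).
Notation nu := (nuY lmum).
Variable p : R.
Hypothesis p1 : 1 < p.
Let p0 : 0 < p := lt_trans (@ltr01 R) p1.
Variables (Rm : 'M[R]_(m, n)) (eps : nat -> R).
Hypothesis Rm0 : forall k : 'rV[int]_m, k != 0 -> intv R k *m Rm != 0.
Hypothesis eps0 : forall j, 0 < eps j.
Hypothesis epsc : eps @ \oo --> 0.
Notation osc := (osc Rm eps).
Notation NN := (jNp lmum oOm Omoo p).

Record approx := Approx {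
  ap_s : seq (entry (R := R) (m := m));
  ap_al : entry (R := R) (m := m) -> 'rV[R]_n -> R;
  ap_test : forall e, test_fun Om (ap_al e) }.

Definition agrad (a : approx) i x y : R := osum Rm (ap_s a) (ap_al a) i x y.

(** The zero approximant is the fallback of the diagonal choice and the reference for the uniform
    bound. *)
Definition approx0 : approx := @Approx [::] (fun _ _ => 0) (fun _ => test_fun0 Om).

Lemma agrad0 i x y : agrad approx0 i x y = 0.
Proof. by rewrite /agrad /osum big_nil. Qed.

Lemma measurable_agrad a i :
  measurable_fun setT (fun z : Rn R n * Rn R m => agrad a i z.1 z.2).
Proof. by apply: measurable_osum; exact: ap_test. Qed.

Lemma agrad_bounded a : exists2 C : R, 0 <= C & forall i x y, `|agrad a i x y| <= C.
Proof. by apply: osum_bounded; exact: ap_test. Qed.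

Lemma agrad_continuous a i x : continuous (agrad a i x).
Proof.
apply: continuous_sumr => e; apply: continuous_mulr; first exact: cst_continuous.
by apply: continuous_mulr; [exact: continuous_trig|exact: cst_continuous].
Qed.

Lemma agrad_periodic a i x : periodic (agrad a i x).
Proof. by move=> y l; apply: eq_bigr => e _; rewrite periodic_trig. Qed.

(** The phase is lowered by $\pi/2$ so that differentiation restores the phase of the entry. *)
Definition corr_wave j (e : entry (R := R) (m := m)) := wave ((eps j)^-1 *: freq Rm e.1.2) (e.2 - pi / 2).

(* The corrector: its gradient is the oscillating field [agrad a] along [osc j], up to
   the O(eps) remainder [crem]. *)
Definition corr a j x : R := eps j * ((2 * pi)^-1 * \sum_(e <- ap_s a) ap_al a e x * corr_wave j e x).
Definition crem a j i x : R := (2 * pi)^-1 * \sum_(e <- ap_s a) pderiv (ap_al a e) i x * corr_wave j e x.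

Lemma corr_test a j : test_fun Om (corr a j).
Proof.
apply: test_funZ; apply: test_funZ; apply: test_fun_sum => e.
by apply: test_funMr; [exact: ap_test|exact: smooth_wave].
Qed.

Lemma pderiv_corr a j i x :
  pderiv (corr a j) i x = agrad a i x (osc j x) + eps j * crem a j i x.
Proof.
have sal e : smooth (ap_al a e) by exact: test_fun_smooth (ap_test a e).
have st e : smooth (fun x => ap_al a e x * corr_wave j e x) by apply: smoothM => //; exact: smooth_wave.
have ss : smooth (fun x => \sum_(e <- ap_s a) ap_al a e x * corr_wave j e x) by exact: smooth_sum.
rewrite /corr (pderivZ (eps j)); last by apply: smooth_derivable; exact: smoothZ.
rewrite (pderivZ (2 * pi)^-1); last exact: smooth_derivable.
rewrite pderiv_sum// /agrad /osum /crem [in RHS]mulrA !mulr_sumr -big_split /=; apply: eq_bigr => e _.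
rewrite pderivM; [|exact: smooth_derivable|by apply: smooth_derivable; exact: smooth_wave].
rewrite /corr_wave pderiv_wave subrK -trig_osc /freq /kap !mxE.
have e0 : eps j != 0 by rewrite gt_eqF.
have pi0 : (2 * pi : R) != 0 by rewrite mulf_neq0// gt_eqF// pi_gt0.
move: (eps j) (2 * pi) e0 pi0 (ap_al a e x) (trig _ _ _) (\sum_j _) (pderiv _ _ _) (wave _ _ _) => c d c0 d0 *.
by field; rewrite c0 d0.
Qed.

Lemma measurable_crem a j i :
  measurable_fun setT (fun x : Rn R n => eps j * crem a j i x).
Proof.
apply: measurable_funM => //; apply: measurable_funM => //; apply: measurable_sum => b.
apply: measurable_funM; last exact: measurable_wave.
exact: measurable_test_fun (test_fun_pderiv i (ap_test a b)).
Qed.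

Definition corr_small a j (d : R) :=
  (forall x, `|corr a j x| <= d) /\ forall i x, `|eps j * crem a j i x| <= d.

Lemma corr_small_near a d : 0 < d -> exists J, forall j, (J <= j)%N -> corr_small a j d.
Proof.
move=> d0.
have pi0 : 0 <= (2 * pi : R)^-1 by rewrite invr_ge0 mulr_ge0// ltW// pi_gt0.
have wle (f : entry (R := R) (m := m) -> 'rV[R]_n -> R) (B : entry (R := R) (m := m) -> R) :
    (forall e x, `|f e x| <= B e) -> forall j x,
    `|(2 * pi)^-1 * \sum_(e <- ap_s a) f e x * corr_wave j e x| <= (2 * pi)^-1 * \sum_(e <- ap_s a) B e.
  move=> fB j x; rewrite normrM (ger0_norm pi0) ler_wpM2l//.
  apply: (le_trans (ler_norm_sum _ _ _)); apply: ler_sum => e _.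
  by rewrite normrM -[leRHS]mulr1; apply: ler_pM => //; exact: wave_le1.
have /choice[B0 HB0] : forall e, exists C : R, forall x, `|ap_al a e x| <= C.
  by move=> e; have [C _ HC] := test_fun_bounded (ap_test a e); exists C.
have /choice[B1 HB1] : forall i, exists C : entry (R := R) (m := m) -> R,
    forall e x, `|pderiv (ap_al a e) i x| <= C e.
  move=> i; have /choice[B HB] : forall e, exists C : R, forall x, `|pderiv (ap_al a e) i x| <= C.
    by move=> e; have [C _ HC] := test_fun_bounded (test_fun_pderiv i (ap_test a e)); exists C.
  by exists B.
pose D := `|(2 * pi)^-1 * \sum_(e <- ap_s a) B0 e| + \sum_i `|(2 * pi)^-1 * \sum_(e <- ap_s a) B1 i e|.
have D0 : 0 <= D by rewrite addr_ge0// sumr_ge0.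
have e3 : 0 < d / (D + 1) by rewrite divr_gt0// ltr_wpDl.
have /cvgrPdist_le/(_ _ e3)[J _ HJ] := epsc.
exists J => j /HJ; rewrite /= sub0r normrN (gtr0_norm (eps0 j)) => Hj.
have le (r : R) : `|r| <= D -> `|eps j * r| <= d.
  move=> rD; rewrite normrM (gtr0_norm (eps0 j)).
  apply: (@le_trans _ _ (d / (D + 1) * D)); first by apply: ler_pM => //; exact: ltW.
  by rewrite -mulrA ler_piMr ?(ltW d0)// mulrC ler_pdivrMr ?mul1r ?lerDl// ltr_wpDl.
split=> [x|i x]; apply: le.
  apply: (le_trans (wle _ _ HB0 j x)); rewrite /D (le_trans (ler_norm _))// lerDl.
  exact: sumr_ge0.
apply: (le_trans (wle _ _ (HB1 i) j x)); rewrite (le_trans (ler_norm _))// /D.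
by rewrite (bigD1 i)//= addrCA lerDl addr_ge0// sumr_ge0.
Qed.

Lemma corr_small0 j d : 0 <= d -> corr_small approx0 j d.
Proof.
by move=> d0; split => [x|i x]; rewrite /corr /crem /= big_nil !mulr0 normr0.
Qed.

Lemma measurable_osc_comp (F : Rn R n -> Rn R m -> R) j :
  measurable_fun setT (fun z : Rn R n * Rn R m => F z.1 z.2) ->
  measurable_fun setT (fun x => F x (osc j x)).
Proof.
move=> mF; have := measurable_fun_pair (@measurable_id _ (Rn R n) setT) (measurable_osc Rm eps j).
exact: measurableT_comp mF.
Qed.

Lemma measurable_agrad_osc a i j :
  measurable_fun setT (fun x : Rn R n => agrad a i x (osc j x)).
Proof. by apply: measurable_osc_comp; exact: measurable_agrad. Qed.

Lemma Np_agrad_osc a i j : (Np mu p (fun x : Rn R n => agrad a i x (osc j x)) < +oo)%E.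
Proof.
have [C C0 HC] := agrad_bounded a.
by apply: (Np_bounded_lty mu (ltW p0) (measurable_agrad_osc a i j) (C := C)) => x; exact: HC.
Qed.

(** [osc_cvg] for the function $|a-b|^p$, which is continuous and periodic in $y$ and bounded. This
    transfers $L^p$ closeness on $\Omega\times Y^m$ to closeness along the oscillation. *)
Lemma osc_Np a b i e : 0 < e -> exists J, forall j, (J <= j)%N ->
  (Np mu p (fun x : Rn R n => agrad a i x (osc j x) - agrad b i x (osc j x))%R <=
   NN (fun x y => agrad a i x y - agrad b i x y)%R + e%:E)%E.
Proof.
move=> e0; have [Ca Ca0 HCa] := agrad_bounded a; have [Cb Cb0 HCb] := agrad_bounded b.
pose g (x : Rn R n) (y : 'rV[R]_m) : R := `|agrad a i x y - agrad b i x y| `^ p.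
have mD : measurable_fun setT (fun z : Rn R n * Rn R m => agrad a i z.1 z.2 - agrad b i z.1 z.2).
  by apply: measurable_funB; exact: measurable_agrad.
have mg : measurable_fun setT (fun z : Rn R n * Rn R m => g z.1 z.2).
  exact: (measurable_powR_norm p mD).
have cg x : continuous (g x).
  have cD : continuous (fun y => agrad a i x y - agrad b i x y).
    by move=> y; exact: (cvgB (@agrad_continuous a i x y) (@agrad_continuous b i x y)).
  move=> y; exact: (@continuous_comp _ _ _ (fun y => agrad a i x y - agrad b i x y)
    (fun t : R => `|t| `^ p) y (cD y) (@continuous_normr_powR _ p p0 _)).
have pg x : periodic (g x) by move=> y l; rewrite /g !agrad_periodic.
have mG : measurable_fun [set: Rn R n] (cst ((Ca + Cb) `^ p)) by exact: measurable_cst.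
have Gy : (Np mu 1 (cst ((Ca + Cb) `^ p)%R : Rn R n -> R) < +oo)%E.
  by apply: (Np_bounded_lty mu ler01 mG (C := `|(Ca + Cb) `^ p|)).
have gG x y : `|g x y| <= cst ((Ca + Cb) `^ p) x.
  rewrite ger0_norm ?powR_ge0//; apply: powR_le => //; first exact: ltW.
  by rewrite (le_trans (ler_normB _ _))// lerD.
have /cvgrPdist_le/(_ _ e0)[J _ HJ] := osc_cvg lmun (lmum := lmum) (oOm := oOm) (Omoo := Omoo) Rm0 eps0 epsc mg cg pg mG Gy gG.
have igx x : nu.-integrable setT (EFin \o (g x : Rn R m -> R)).
  by apply: (bounded_integrable nu (C := (Ca + Cb) `^ p)); [exact: section_measurable|exact: gG].
have NE : NN (fun x y => agrad a i x y - agrad b i x y) = (\int[mu]_x \int[nu]_y g x y)%:E.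
  rewrite jNpE//.
  have ig : mu.-integrable setT (EFin \o (fun x : Rn R n => \int[nu]_y g x y)).
    apply: (bounded_integrable mu (C := (Ca + Cb) `^ p)); first exact: measurable_Rint_param.
    move=> x; have := Rintegral_bound nu (section_measurable x mg) (gG x).
    by rewrite [X in _ * fine X](nuY_setT lmum) mulr1.
  rewrite -(Rintegral_fineK ig); apply: eq_integral => x _.
  by rewrite NpE -(Rintegral_fineK (igx x)).
exists J => j /HJ Hj; rewrite NE -EFinD.
have ij : mu.-integrable setT (EFin \o (fun x : Rn R n => g x (osc j x))).
  by apply: (bounded_integrable mu (C := (Ca + Cb) `^ p)); [exact: measurable_osc_comp|move=> x; exact: gG].
rewrite NpE (_ : (fun x => _) = EFin \o (fun x : Rn R n => g x (osc j x)))// (Rintegral_fineK ij) lee_fin.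
by move: Hj; rewrite ler_distl lerBlDr => /andP[].
Qed.

End corrector.

Lemma small_invS (R : realType) (d : R) : 0 < d -> exists M : nat, forall M', (M <= M')%N -> (M'.+1%:R^-1 : R) <= d.
Proof.
move=> d0; have /cvgrPdist_le/(_ _ d0)[M _ HM] := @cvg_harmonic R.
exists M => M' /HM; rewrite /= sub0r normrN ger0_norm//.
Qed.

Lemma normr_chain3 (R : realType) (a b c d e : R) : `|a - b| <= e / 3 -> `|b - c| <= e / 3 ->
  `|d - c| <= e / 3 -> `|a - d| <= e.
Proof. by rewrite !ler_norml; lra. Qed.

(** With $c=2^p$: comparing two approximants through [V] costs $2^p$ times two errors, and passing
    to the oscillation costs one more. *)
Lemma budget_split (R : realType) (c d : R) : 0 <= c ->
  c * (d / (c * 2 + 1) + d / (c * 2 + 1)) + d / (c * 2 + 1) = d.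
Proof.
move=> c0; have h : c * 2 + 1 != 0 by rewrite gt_eqF//; lra.
by field.
Qed.

(** * The diagonal sequence and its two-scale limit *)

Section diagonal.
Context {R : realType} {n m : nat} (mun : {measure set (Rn R n) -> \bar R})
  (mum : {measure set (Rn R m) -> \bar R}).
Hypothesis lmun : is_lebesgue mun.
Hypothesis lmum : is_lebesgue mum.
Context {Om : set 'rV[R]_n}.
Hypothesis oOm : open Om.
Hypothesis Omoo : (mun (Om : set (Rn R n)) < +oo)%E.
Notation mu := (muO oOm Omoo).
Notation nu := (nuY lmum).
Variable p : R.
Hypothesis p1 : 1 < p.
Let p0 : 0 < p := lt_trans (@ltr01 R) p1.
Variables (Rm : 'M[R]_(m, n)) (eps : nat -> R).
Hypothesis Rm0 : forall k : 'rV[int]_m, k != 0 -> intv R k *m Rm != 0.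
Hypothesis eps0 : forall j, 0 < eps j.
Hypothesis epsc : eps @ \oo --> 0.
Notation osc := (osc Rm eps).
Notation NN := (jNp lmum oOm Omoo p).
Notation agrad := (agrad Rm).
Variable V : 'I_n -> Rn R n -> Rn R m -> R.
Hypothesis mV : forall i, measurable_fun setT (fun z : Rn R n * Rn R m => V i z.1 z.2).
Hypothesis Vx : forall i x, (Np nu p (V i x) < +oo)%E.
Hypothesis Vy : forall i, (\int[mu]_x Np nu p (V i x) < +oo)%E.
Hypothesis Vcoef : {ae mu, forall x, forall (k : 'rV[int]_m) (b : bool), exists a : R,
  forall i, Fc lmum k (- (b%:R * (pi / 2))) (V i x) = a * (intv R k *m Rm) 0 i}.

(** For each [M] the requirements [Q M j] hold for all large [j], and [Q 0 j] holds always. Taking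
    for [Mf j] the largest admissible [M] not above [j] therefore gives an index that is defined for
    every [j] and tends to infinity. *)
Lemma diagonal_sequence : exists (A : nat -> @approx R n m Om) (Mf : nat -> nat), [/\
  (forall M i, (0 < M)%N -> (NN (fun x y => V i x y - agrad (A M) i x y)%R <= (M.+1%:R^-1)%:E)%E),
  A 0%N = approx0,
  (forall j, corr_small Rm eps (A (Mf j)) j (Mf j).+1%:R^-1),
  (forall j M' i, (M' <= Mf j)%N ->
    (Np mu p (fun x : Rn R n => agrad (A (Mf j)) i x (osc j x) - agrad (A M') i x (osc j x))%R <=
     NN (fun x y => agrad (A (Mf j)) i x y - agrad (A M') i x y)%R + ((Mf j).+1%:R^-1)%:E)%E) &
  (forall M, exists J, forall j, (J <= j)%N -> (M <= Mf j)%N)].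
Proof.
have ip M : 0 < M.+1%:R^-1 :> R by rewrite invr_gt0.
have /choice[B HB] : forall M : nat, exists a : @approx R n m Om,
    forall i, (NN (fun x y => V i x y - agrad a i x y)%R <= (M.+1%:R^-1)%:E)%E.
  move=> M; have [s [al [tal H]]] := osum_dense p1 mV Vx Vy Vcoef (ip M).
  by exists (Approx s tal).
(* Index 0 is reserved for the zero approximant, which is why closeness to [V] is claimed for
   positive [M] only. *)
pose A M := if M is M'.+1 then B M else approx0.
pose Q M j := corr_small Rm eps (A M) j M.+1%:R^-1 /\ forall M' i, (M' <= M)%N ->
    (Np mu p (fun x : Rn R n => agrad (A M) i x (osc j x) - agrad (A M') i x (osc j x))%R <=
     NN (fun x y => agrad (A M) i x y - agrad (A M') i x y)%R + (M.+1%:R^-1)%:E)%E.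
have Q0 j : Q 0%N j.
  split; first by apply: corr_small0; exact: ltW.
  move=> M' i; rewrite leqn0 => /eqP ->.
  rewrite (_ : (fun x => _) = fun=> 0); last by apply/funext => x; rewrite subrr.
  by rewrite Np0// adde_ge0 ?Np_ge0// lee_fin ltW.
have Qev M : exists J, forall j, (J <= j)%N -> Q M j.
  have [J1 H1] := corr_small_near Rm eps0 epsc (A M) (ip M).
  (* For fixed [M] the earlier indices and components are finitely many, so a single threshold works
     for all comparisons. *)
  have /choice[J2 H2] : forall q : 'I_M.+1 * 'I_n, exists J, forall j, (J <= j)%N ->
      (Np mu p (fun x : Rn R n => agrad (A M) q.2 x (osc j x) - agrad (A q.1) q.2 x (osc j x))%R <=
       NN (fun x y => agrad (A M) q.2 x y - agrad (A q.1) q.2 x y)%R + (M.+1%:R^-1)%:E)%E.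
    by move=> q; exact: (osc_Np lmun lmum oOm Omoo p1 Rm0 eps0 epsc).
  exists (maxn J1 (\max_q J2 q)) => j; rewrite geq_max => /andP[j1 j2]; split; first exact: H1.
  move=> M' i MM'; have := H2 (Ordinal (MM' : (M' < M.+1)%N), i) j; apply.
  by apply: leq_trans j2; exact: leq_bigmax.
have /choice[Mf HMf] : forall j, exists M, [/\ Q M j & forall M', (M' <= j)%N -> Q M' j -> (M' <= M)%N].
  move=> j; pose P M := `[< Q M j >] && (M <= j)%N.
  have exP : exists M, P M by exists 0%N; rewrite /P leq0n andbT; apply/asboolP.
  have bP M : P M -> (M <= j)%N by case/andP.
  case: (ex_maxnP exP bP) => M /andP[/asboolP QM Mj] HM; exists M; split => // M' M'j QM'.
  by apply: HM; rewrite /P M'j andbT; apply/asboolP.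
exists A, Mf; split.
- by move=> [//|M] i _; exact: HB.
- by [].
- by move=> j; have [[]] := HMf j.
- by move=> j M' i; have [[_ H] _] := HMf j; exact: H.
move=> M; have [J HJ] := Qev M; exists (maxn J M) => j; rewrite geq_max => /andP[Jj Mj].
by have [_] := HMf j; apply => //; exact: HJ.
Qed.

(** * Passage to the limit against one component of an admissible test field *)

Section test_function.
Variables (Phi : Rn R n -> 'rV[R]_m -> R) (S : Rn R n -> R).
Hypothesis mPhi : measurable_fun setT (fun z : Rn R n * Rn R m => Phi z.1 z.2).
Hypothesis cPhi : forall x, continuous (Phi x).
Hypothesis pPhi : forall x, periodic (Phi x).
Hypothesis mS : measurable_fun setT S.
Hypothesis Sy : (Np mu (conj_exp p) S < +oo)%E.
Hypothesis PhiS : forall x y, `|Phi x y| <= S x.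
Let S0 x : 0 <= S x. Proof. by apply: le_trans (PhiS x 0). Qed.
Let q1 := conj_exp_gt1 p1.
Let q0 : 0 < conj_exp p := lt_trans (@ltr01 R) q1.

Let mPo j : measurable_fun setT (fun x => Phi x (osc j x)).
Proof. exact: measurable_osc_comp. Qed.

Let Poy j : (Np mu (conj_exp p) (fun x => Phi x (osc j x)) <= Np mu (conj_exp p) S)%E.
Proof. by apply: Np_le => //; [exact: ltW|move=> x; rewrite (ger0_norm (S0 x))]. Qed.

Lemma integrable_Lp_test (f : Rn R n -> R) j : measurable_fun setT f -> (Np mu p f < +oo)%E ->
  mu.-integrable setT (EFin \o (fun x => f x * Phi x (osc j x))).
Proof. by move=> mf fy; apply: (integrable_mul p1 mf (mPo j) fy); exact: le_lt_trans (Poy j) Sy. Qed.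

Section pairing.
Variable F : Rn R n -> Rn R m -> R.
Hypothesis mF : measurable_fun setT (fun z : Rn R n * Rn R m => F z.1 z.2).
Hypothesis Fx : forall x, (Np nu p (F x) < +oo)%E.
Hypothesis Fy : (\int[mu]_x Np nu p (F x) < +oo)%E.

(** Pairing on a fibre is at most this mean times [S x], so conjugate exponents are needed on
    $\Omega$ alone. *)
Definition absmean x : R := \int[nu]_y `|F x y|.

Let mAF : measurable_fun setT (fun z : Rn R n * Rn R m => `|F z.1 z.2|).
Proof. exact: measurableT_comp. Qed.

Let NpA x : Np nu p (fun y => `|F x y|) = Np nu p (F x).
Proof. by rewrite !NpE; apply: eq_integral => y _; rewrite normr_id. Qed.

Lemma measurable_absmean : measurable_fun setT absmean.
Proof. exact: measurable_Rint_param mAF. Qed.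

Lemma Np_absmean : (Np mu p absmean <= \int[mu]_x Np nu p (F x))%E.
Proof.
have Fx' x : (Np nu p (fun y => `|F x y|)%R < +oo)%E by rewrite NpA.
have := Np_moment oOm Omoo p1 (V := fun x y => `|F x y|) mAF Fx' (h := cst 1) (measurable_cst _).
under eq_integral do rewrite NpA.
rewrite (_ : (fun x => \int[nu]_y (cst 1 y * `|F x y|)) = absmean).
  by apply => y; rewrite normr1.
by apply/funext => x; apply: eq_Rintegral => y _; rewrite mul1r.
Qed.

Lemma integrable_pairing_section x : nu.-integrable setT (EFin \o (fun y => F x y * Phi x y)).
Proof.
rewrite (_ : (fun y => _) = fun y : Rn R m => Phi x y * F x y); last by apply/funext => y; rewrite mulrC.
apply: (integrable_mul_bounded (C := S x)); first exact: section_measurable.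
- exact: PhiS.
- exact: (integrable_V p1 mF Fx).
Qed.

Lemma measurable_pairing : measurable_fun setT (fun x => \int[nu]_y (F x y * Phi x y)).
Proof. by apply: (measurable_Rint_param nu (F := fun x y => F x y * Phi x y)); exact: measurable_funM. Qed.

Lemma pairing_le x : `|\int[nu]_y (F x y * Phi x y)| <= absmean x * S x.
Proof.
have iF := integrable_norm (integrable_V p1 mF Fx x).
apply: (le_trans (le_normr_Rintegral measurableT (integrable_pairing_section x))).
rewrite mulrC /absmean -(RintegralZl _ measurableT iF); apply: le_Rintegral => //.
- exact: (integrable_norm (integrable_pairing_section x)).
- exact: integrableZr.
- by move=> y _; rewrite normrM mulrC ler_wpM2r.
Qed.

Lemma integrable_pairing : mu.-integrable setT (EFin \o (fun x => \int[nu]_y (F x y * Phi x y))).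
Proof.
apply: (@le_integrable _ _ _ mu _ measurableT _ (fun x => (absmean x * S x)%:E)).
- by apply/measurable_EFinP; exact: measurable_pairing.
- by move=> x _; rewrite lee_fin (le_trans (pairing_le x))// ler_norm.
- apply: (integrable_mul p1 measurable_absmean mS _ Sy); exact: le_lt_trans Np_absmean Fy.
Qed.

End pairing.

Variable g0 : 'I_n -> Rn R n -> R.
Hypothesis mg0 : forall i, measurable_fun setT (g0 i).
Hypothesis g0y : forall i, (Np mu p (g0 i) < +oo)%E.
Variables (A : nat -> @approx R n m Om) (Mf : nat -> nat).
Hypothesis AV : forall M i, (0 < M)%N ->
  (NN (fun x y => V i x y - agrad (A M) i x y)%R <= (M.+1%:R^-1)%:E)%E.
Hypothesis Acorr : forall j, corr_small Rm eps (A (Mf j)) j (Mf j).+1%:R^-1.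
Hypothesis AA : forall j M' i, (M' <= Mf j)%N ->
  (Np mu p (fun x : Rn R n => agrad (A (Mf j)) i x (osc j x) - agrad (A M') i x (osc j x))%R <=
   NN (fun x y => agrad (A (Mf j)) i x y - agrad (A M') i x y)%R + ((Mf j).+1%:R^-1)%:E)%E.
Hypothesis Mfoo : forall M, exists J, forall j, (J <= j)%N -> (M <= Mf j)%N.

(** [osc_cvg] with majorant $|g_0|S$, integrable as a product of conjugate powers. *)
Lemma slow_cvg i : (fun j => \int[mu]_x (g0 i x * Phi x (osc j x))) @ \oo -->
  \int[mu]_x \int[nu]_y (g0 i x * Phi x y).
Proof.
have mgS : measurable_fun setT (fun x => `|g0 i x| * S x).
  by apply: measurable_funM => //; exact: measurableT_comp.
apply: (osc_cvg lmun (lmum := lmum) (oOm := oOm) (Omoo := Omoo) Rm0 eps0 epsc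
  (g := fun x y => g0 i x * Phi x y) (G := fun x => `|g0 i x| * S x)) => //.
- by apply: measurable_funM => //; exact: (measurableT_comp (mg0 i) measurable_fst).
- by move=> x; apply: continuous_mulr; [exact: cst_continuous|exact: cPhi].
- by move=> x y l; rewrite pPhi.
- have := integrable_mul p1 (mg0 i) mS (g0y i) Sy => /integrableP[_].
  rewrite Np1E; apply: le_lt_trans; apply: ge0_le_integral => //.
  + by apply/measurable_EFinP; exact: measurableT_comp.
  + by apply/measurable_EFinP; apply: measurableT_comp => //; exact: measurable_funM.
  + by move=> x _ /=; rewrite lee_fin !normrM normr_id.
- by move=> x y; rewrite normrM ler_wpM2l.
Qed.

Lemma remainder_cvg i : (fun j => \int[mu]_x ((eps j * crem Rm eps (A (Mf j)) j i x) * Phi x (osc j x))) @ \oo -->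
  (0 : R).
Proof.
have iS : mu.-integrable setT (EFin \o S) := Lp_integrable (ltW q1) mS Sy.
have I0 : 0 <= \int[mu]_x S x by apply: Rintegral_ge0.
apply/cvgrPdist_le => e e0.
have e1 : 0 < e / (\int[mu]_x S x + 1) by rewrite divr_gt0// ltr_wpDl.
have [M HM] := small_invS e1; have [J HJ] := Mfoo M.
exists J => // j /= /HJ MM; rewrite sub0r normrN.
have [_ cs] := Acorr j.
have mr := measurable_crem Rm eps (A (Mf j)) j i.
have iP : mu.-integrable setT (EFin \o (fun x => (eps j * crem Rm eps (A (Mf j)) j i x) * Phi x (osc j x))).
  apply: (integrable_mul_bounded (C := (Mf j).+1%:R^-1) mr (cs i)).
  apply: (Lp_integrable (ltW q1)) => //; exact: le_lt_trans (Poy j) Sy.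
apply: (le_trans (le_normr_Rintegral measurableT iP)).
apply: (@le_trans _ _ (\int[mu]_x (e / (\int[mu]_x S x + 1) * S x))).
  apply: le_Rintegral => //; [exact: (integrable_norm iP)|exact: integrableZr|].
  move=> x _; rewrite normrM; apply: ler_pM => //.
  by apply: (le_trans (cs i x)); exact: HM.
rewrite RintegralZl//.
by rewrite -mulrA ler_piMr ?(ltW e0)// mulrC ler_pdivrMr ?mul1r ?lerDl// ltr_wpDl.
Qed.

Lemma jNp_agradB i M M' : (0 < M)%N -> (0 < M')%N ->
  (NN (fun x y => agrad (A M) i x y - agrad (A M') i x y)%R <= (2 `^ p * (M.+1%:R^-1 + M'.+1%:R^-1))%:E)%E.
Proof.
move=> M0 M'0.
have mVP k : measurable_fun setT (fun z : Rn R n * Rn R m => V i z.1 z.2 - agrad (A k) i z.1 z.2).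
  by apply: measurable_funB => //; exact: measurable_agrad.
rewrite /jNp (_ : (fun z => _) = fun z : Rn R n * Rn R m =>
    (V i z.1 z.2 - agrad (A M') i z.1 z.2) - (V i z.1 z.2 - agrad (A M) i z.1 z.2)); last first.
  by apply/funext => z; ring.
apply: (le_trans (NpB _ (ltW p0) (mVP M') (mVP M))).
rewrite EFinM; apply: lee_wpmul2l; first by rewrite lee_fin powR_ge0.
by rewrite addrC EFinD; apply: leeD; [exact: AV|exact: AV].
Qed.

(** Three comparisons through a fixed approximant [A M]: with [V] on $\Omega\times Y^m$, between its
    oscillating and its mean pairing by [osc_cvg], and with [A (Mf j)] along the oscillation. *)
Lemma fast_cvg i : (fun j => \int[mu]_x (agrad (A (Mf j)) i x (osc j x) * Phi x (osc j x))) @ \oo -->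
  \int[mu]_x \int[nu]_y (V i x y * Phi x y).
Proof.
pose B := fine (Np mu (conj_exp p) S); have B0 : 0 <= B by rewrite fine_ge0// Np_ge0.
have SB : (Np mu (conj_exp p) S <= B%:E)%E by rewrite fineK// ge0_fin_numE// Np_ge0.
apply/cvgrPdist_le => e e0; have e3 : 0 < e / 3 by rewrite divr_gt0.
have [dl dl0 Hdl] := integral_mul_small mu p1 e3 B0.
have c0 : 0 < 2 `^ p * 2 + 1 :> R by rewrite ltr_wpDl// mulr_ge0 ?powR_ge0.
have d1 : 0 < dl / (2 `^ p * 2 + 1) by rewrite divr_gt0.
have [M1 HM1] := small_invS d1.
(* A successor, since the approximant of index 0 need not be close to [V]. *)
pose M := M1.+1; have M0 : (0 < M)%N by [].
have HM k : (M <= k)%N -> (k.+1%:R^-1 : R) <= dl / (2 `^ p * 2 + 1) by move=> Mk; apply: HM1; exact: ltnW.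
have dl1 : dl / (2 `^ p * 2 + 1) <= dl.
  by rewrite ler_piMr ?(ltW dl0)// invf_le1// lerDr mulr_ge0 ?powR_ge0.
have [C C0 HC] := agrad_bounded Rm (A M).
have mPM := measurable_agrad Rm (A M) i.
have mD : measurable_fun setT (fun z : Rn R n * Rn R m => V i z.1 z.2 - agrad (A M) i z.1 z.2).
  exact: measurable_funB.
have PMx x : (Np nu p (fun y : Rn R m => agrad (A M) i x y) < +oo)%E.
  by apply: (Np_bounded_lty nu (ltW p0) (section_measurable x mPM) (C := C)).
have Dx x : (Np nu p (fun y : Rn R m => V i x y - agrad (A M) i x y)%R < +oo)%E.
  apply: (le_lt_trans (NpB nu (ltW p0) (section_measurable x (mV i)) (section_measurable x mPM))).
  rewrite -ge0_fin_numE ?mule_ge0 ?lee_fin ?powR_ge0 ?adde_ge0 ?Np_ge0//.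
  by rewrite fin_numM// fin_numD !ge0_fin_numE ?Np_ge0 ?Vx ?PMx.
have Dd : (\int[mu]_x Np nu p (fun y : Rn R m => V i x y - agrad (A M) i x y)%R <= dl%:E)%E.
  rewrite -(jNpE lmum oOm Omoo p (F := fun x y => V i x y - agrad (A M) i x y))//.
  by apply: (le_trans (AV i M0)); rewrite lee_fin (le_trans _ dl1)// HM.
have Dy : (\int[mu]_x Np nu p (fun y : Rn R m => V i x y - agrad (A M) i x y)%R < +oo)%E.
  by apply: le_lt_trans Dd _; exact: ltry.
have PMy : (\int[mu]_x Np nu p (fun y : Rn R m => agrad (A M) i x y) < +oo)%E.
  rewrite -(jNpE lmum oOm Omoo p mPM) /jNp.
  rewrite (_ : (fun z => _) = fun z : Rn R n * Rn R m => V i z.1 z.2 - (V i z.1 z.2 - agrad (A M) i z.1 z.2)); last first.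
    by apply/funext => z; ring.
  apply: (le_lt_trans (NpB _ (ltW p0) (mV i) mD)).
  have e1 : Np (mu \x nu)%E p (fun z : Rn R n * Rn R m => V i z.1 z.2) = (\int[mu]_x Np nu p (V i x))%E := jNpE lmum oOm Omoo p (mV i).
  have e2 : Np (mu \x nu)%E p (fun z : Rn R n * Rn R m => V i z.1 z.2 - agrad (A M) i z.1 z.2)%R = (\int[mu]_x Np nu p (fun y => V i x y - agrad (A M) i x y)%R)%E
    := jNpE lmum oOm Omoo p (F := fun x y => V i x y - agrad (A M) i x y) mD.
  rewrite e1 e2 -ge0_fin_numE; last by rewrite mule_ge0 ?lee_fin ?powR_ge0// adde_ge0// integral_ge0// => x _; exact: Np_ge0.
  rewrite fin_numM// fin_numD !ge0_fin_numE ?Vy ?Dy// integral_ge0// => x _; exact: Np_ge0.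
pose IP := \int[mu]_x \int[nu]_y (agrad (A M) i x y * Phi x y).
have st1 : `|\int[mu]_x \int[nu]_y (V i x y * Phi x y) - IP| <= e / 3.
  rewrite /IP -RintegralB//; [|exact: integrable_pairing|exact: integrable_pairing].
  have -> : \int[mu]_x (\int[nu]_y (V i x y * Phi x y) - \int[nu]_y (agrad (A M) i x y * Phi x y)) =
      \int[mu]_x \int[nu]_y ((V i x y - agrad (A M) i x y) * Phi x y).
    apply: eq_Rintegral => x _.
    rewrite -(RintegralB measurableT (integrable_pairing_section (mV i) (Vx i) x) (integrable_pairing_section mPM PMx x)).
    by apply: eq_Rintegral => y _; rewrite mulrBl.
  have iD := integrable_pairing (F := fun x y => V i x y - agrad (A M) i x y) mD Dx Dy.
  apply: (le_trans (le_normr_Rintegral measurableT iD)).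
  pose aa := absmean (fun x y => V i x y - agrad (A M) i x y).
  have maa : measurable_fun setT aa := measurable_absmean mD.
  have Naa : (Np mu p aa <= dl%:E)%E := le_trans (Np_absmean mD Dx) Dd.
  have ia := integrable_mul p1 maa mS (le_lt_trans Naa (ltry _)) Sy.
  apply: (@le_trans _ _ (\int[mu]_x `|aa x * S x|)).
    apply: le_Rintegral => //; [exact: (integrable_norm iD)|exact: (integrable_norm ia)|].
    move=> x _; apply: (le_trans (pairing_le (F := fun x y => V i x y - agrad (A M) i x y) mD Dx x)).
    exact: ler_norm.
  rewrite -lee_fin; have := Hdl aa S maa mS Naa SB.
  rewrite (_ : (fun x => _) = EFin \o (Num.norm \o (fun x => aa x * S x)))//.
  by rewrite (Rintegral_fineK (integrable_norm ia)).
have mCS : measurable_fun setT (fun x => C * S x) by exact: measurable_funM.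
have CSy : (Np mu 1 (fun x => C * S x)%R < +oo)%E.
  have iS : mu.-integrable setT (EFin \o S) := Lp_integrable (ltW q1) mS Sy.
  have /integrableP[_] := integrableZr C iS; rewrite Np1E; apply: le_lt_trans.
  by rewrite le_eqVlt; apply/orP; left; apply/eqP; apply: eq_integral.
have /cvgrPdist_le/(_ _ e3)[J1 _ HJ1] := osc_cvg lmun (lmum := lmum) (oOm := oOm) (Omoo := Omoo) Rm0 eps0 epsc
  (g := fun x y => agrad (A M) i x y * Phi x y) (G := fun x => C * S x) (measurable_funM mPM mPhi)
  (fun x => continuous_mulr (@agrad_continuous _ _ _ _ Rm (A M) i x) (@cPhi x))
  (fun x y l => congr2 *%R (agrad_periodic Rm (A M) i x y l) (pPhi x y l)) mCS CSy
  (fun x y => le_trans (eq_ind_r (fun z => z <= C * S x) (ler_pM (normr_ge0 _) (normr_ge0 _) (HC i x y) (PhiS x y)) (normrM _ _)) (lexx _)).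
have [J2 HJ2] := Mfoo M.
exists (maxn J1 J2) => // j /=; rewrite geq_max => /andP[/HJ1 jJ1 /HJ2 jJ2].
have i1 := integrable_Lp_test j (measurable_agrad_osc Rm eps (A (Mf j)) i j) (Np_agrad_osc oOm Omoo p1 Rm eps (A (Mf j)) i j).
have i2 := integrable_Lp_test j (measurable_agrad_osc Rm eps (A M) i j) (Np_agrad_osc oOm Omoo p1 Rm eps (A M) i j).
(* Here the diagonal property is used: for large [j] the index [M] is an earlier one, so the
   comparison with it holds along [osc j]. *)
have st3 : `|\int[mu]_x (agrad (A (Mf j)) i x (osc j x) * Phi x (osc j x)) - \int[mu]_x (agrad (A M) i x (osc j x) * Phi x (osc j x))| <= e / 3.
  rewrite -(RintegralB measurableT i1 i2).
  pose f (x : Rn R n) := agrad (A (Mf j)) i x (osc j x) - agrad (A M) i x (osc j x).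
  have mf : measurable_fun setT f := measurable_funB (measurable_agrad_osc Rm eps _ i j) (measurable_agrad_osc Rm eps _ i j).
  have fd : (Np mu p f <= dl%:E)%E.
    apply: (le_trans (AA i jJ2)).
    have Mf0 : (0 < Mf j)%N by exact: leq_trans jJ2.
    apply: (@le_trans _ _ ((2 `^ p * ((Mf j).+1%:R^-1 + M.+1%:R^-1))%:E + ((Mf j).+1%:R^-1)%:E)%E).
      by rewrite leeD2r// jNp_agradB.
    rewrite -EFinD lee_fin.
    have h1 := HM _ jJ2; have h2 := HM _ (leqnn M).
    have p20 : 0 <= 2 `^ p :> R := powR_ge0 _ _.
    apply: (@le_trans _ _ (2 `^ p * (dl / (2 `^ p * 2 + 1) + dl / (2 `^ p * 2 + 1)) + dl / (2 `^ p * 2 + 1))).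
      by apply: lerD => //; rewrite ler_wpM2l// lerD.
    by rewrite budget_split.
  have if1 := integrable_Lp_test j mf (le_lt_trans fd (ltry _)).
  have -> : \int[mu]_x (agrad (A (Mf j)) i x (osc j x) * Phi x (osc j x) - agrad (A M) i x (osc j x) * Phi x (osc j x)) =
      \int[mu]_x (f x * Phi x (osc j x)).
    by apply: eq_Rintegral => x _; rewrite mulrBl.
  apply: (le_trans (le_normr_Rintegral measurableT if1)).
  rewrite -lee_fin; have := Hdl f _ mf (mPo j) fd (le_trans (Poy j) SB).
  rewrite (_ : (fun x => _) = EFin \o (Num.norm \o (fun x => f x * Phi x (osc j x))))//.
  by rewrite (Rintegral_fineK (integrable_norm if1)).
exact: (normr_chain3 st1 jJ1 st3).
Qed.

Lemma gradient_cvg i : (fun j => \int[mu]_x ((g0 i x + (agrad (A (Mf j)) i x (osc j x) +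
    eps j * crem Rm eps (A (Mf j)) j i x)) * Phi x (osc j x))) @ \oo -->
  (\int[mu]_x \int[nu]_y (g0 i x * Phi x y)) + \int[mu]_x \int[nu]_y (V i x y * Phi x y).
Proof.
rewrite -[X in _ --> _ + X]addr0.
rewrite (_ : (fun j => _) = fun j => \int[mu]_x (g0 i x * Phi x (osc j x)) +
    (\int[mu]_x (agrad (A (Mf j)) i x (osc j x) * Phi x (osc j x)) +
     \int[mu]_x ((eps j * crem Rm eps (A (Mf j)) j i x) * Phi x (osc j x)))).
  apply: cvgD; first exact: slow_cvg.
  by apply: cvgD; [exact: fast_cvg|exact: remainder_cvg].
apply/funext => j.
have i1 := integrable_Lp_test j (mg0 i) (g0y i).
have i2 := integrable_Lp_test j (measurable_agrad_osc Rm eps (A (Mf j)) i j) (Np_agrad_osc oOm Omoo p1 Rm eps (A (Mf j)) i j).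
have [_ cs] := Acorr j.
have mr := measurable_crem Rm eps (A (Mf j)) j i.
have i3 := integrable_Lp_test j mr (Np_bounded_lty mu (ltW p0) mr (cs i)).
have i23 := integrable_addr i2 i3.
rewrite -(RintegralD measurableT i2 i3) -(RintegralD measurableT i1 i23).
by apply: eq_Rintegral => x _; rewrite !mulrDl.
Qed.

End test_function.

(** Comparison with index 0, whose approximant vanishes, bounds the oscillating field by its joint
    norm, and that stays near the norm of [V]. *)
Lemma gradient_bounded (A : nat -> @approx R n m Om) (Mf : nat -> nat) :
  (forall M i, (0 < M)%N ->
    (NN (fun x y => V i x y - agrad (A M) i x y)%R <= (M.+1%:R^-1)%:E)%E) ->
  A 0%N = approx0 ->
  (forall j M' i, (M' <= Mf j)%N ->
    (Np mu p (fun x : Rn R n => agrad (A (Mf j)) i x (osc j x) - agrad (A M') i x (osc j x))%R <=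
     NN (fun x y => agrad (A (Mf j)) i x y - agrad (A M') i x y)%R + ((Mf j).+1%:R^-1)%:E)%E) ->
  forall i, exists K : R, forall j, (Np mu p (fun x : Rn R n => agrad (A (Mf j)) i x (osc j x)) <= K%:E)%E.
Proof.
move=> AV A0 AA i.
have iv1 M : (M.+1%:R^-1 : R) <= 1 by rewrite invf_le1// ler1n.
have e1 : NN (V i) = (\int[mu]_x Np nu p (V i x))%E := jNpE lmum oOm Omoo p (mV i).
have VK : NN (V i) \is a fin_num by rewrite ge0_fin_numE ?Np_ge0// e1 Vy.
exists (2 `^ p * (fine (NN (V i)) + 1) + 1) => j.
have := AA j 0%N i (leq0n _); rewrite A0.
rewrite (_ : (fun x => _) = fun x : Rn R n => agrad (A (Mf j)) i x (osc j x)); last first.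
  by apply/funext => x; rewrite agrad0 subr0.
move/le_trans; apply.
rewrite EFinD; apply: leeD; last by rewrite lee_fin.
rewrite (_ : (fun x y => _) = fun x y => agrad (A (Mf j)) i x y); last first.
  by apply/funext => x; apply/funext => y; rewrite agrad0 subr0.
have [M0|M0] := posnP (Mf j).
  rewrite M0 A0 /jNp (_ : (fun z => _) = fun=> 0); last by apply/funext => z; rewrite agrad0.
  by rewrite Np0// lee_fin mulr_ge0 ?powR_ge0 ?addr_ge0 ?fine_ge0 ?Np_ge0.
have mPM := measurable_agrad Rm (A (Mf j)) i.
have mD : measurable_fun setT (fun z : Rn R n * Rn R m => V i z.1 z.2 - agrad (A (Mf j)) i z.1 z.2).
  exact: measurable_funB.
rewrite /jNp (_ : (fun z => _) = fun z : Rn R n * Rn R m => V i z.1 z.2 - (V i z.1 z.2 - agrad (A (Mf j)) i z.1 z.2)); last first.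
  by apply/funext => z; ring.
apply: (le_trans (NpB _ (ltW p0) (mV i) mD)).
rewrite EFinM; apply: lee_wpmul2l; first by rewrite lee_fin powR_ge0.
rewrite EFinD; apply: leeD; first by rewrite fineK.
by apply: (le_trans (AV _ i M0)); rewrite lee_fin.
Qed.

End diagonal.

(** Periodicity carries any [y] into the cell, and continuity bounds the set whose supremum is
    taken. *)
Lemma vnorm_sup_bound (R : realType) (n m : nat) (phi : 'rV[R]_m -> 'rV[R]_n) i y :
  continuous phi -> periodic phi ->
  `|phi y 0 i| <= sup [set vnorm (phi y) | y in Ycell R m].
Proof.
move=> cphi pphi.
have cc l : continuous (fun y => phi y 0 l).
  by move=> z; apply: (@continuous_comp _ _ _ phi (fun w : 'rV[R]_n => w 0 l)); [exact: cphi|exact: coord_continuous].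
have pc l : periodic (fun y => phi y 0 l) by move=> z q; rewrite pphi.
have /choice[C HC] : forall l, exists C : R, forall y, `|phi y 0 l| <= C.
  by move=> l; exact: periodic_bounded.
have [z Yz] := periodic_reduce y; rewrite -(periodic_int pphi y z).
apply: (le_trans (coord_le_vnorm _ _)); apply: ub_le_sup; last by exists (y + intv R z).
exists (\sum_l C l) => _ [w _ <-]; apply: (le_trans (vnorm_le_sum _)).
by apply: ler_sum => l _.
Qed.

(** * Sufficiency: the recovery sequence *)

Section backward_direction.
Context {R : realType} {n m : nat} (mun : {measure set (Rn R n) -> \bar R})
  (mum : {measure set (Rn R m) -> \bar R}).
Hypothesis lmun : is_lebesgue mun.
Hypothesis lmum : is_lebesgue mum.
Context {Om : set 'rV[R]_n}.
Hypothesis oOm : open Om.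
Hypothesis Omoo : (mun (Om : set (Rn R n)) < +oo)%E.
Notation mu := (muO oOm Omoo).
Notation nu := (nuY lmum).
Variable p : R.
Hypothesis p1 : 1 < p.
Let p0 : 0 < p := lt_trans (@ltr01 R) p1.
Variables (Rm : 'M[R]_(m, n)) (eps : nat -> R).
Hypothesis Rm0 : forall k : 'rV[int]_m, k != 0 -> intv R k *m Rm != 0.
Hypothesis eps0 : forall j, 0 < eps j.
Hypothesis epsc : eps @ \oo --> 0.
Let Y : set (Rn R m) := Ycell R m.
Let mOm : measurable (Om : set (Rn R n)) := open_measurable_Rn oOm.
Let mY : measurable Y := measurable_Ycell.

(** The boolean chooses between the real and the imaginary part of the multiplier, through the phase
    0 or $-\pi/2$. *)
Lemma inG_coef (v1 : 'rV[R]_m -> 'rV[R]_n) (V : 'I_n -> Rn R m -> R) :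
  inG mum p Rm v1 -> (forall i, measurable_fun setT (V i)) -> (forall i, (Np nu p (V i) < +oo)%E) ->
  (forall y : Rn R m, Y y -> forall i, V i y = v1 y 0 i) ->
  forall (k : 'rV[int]_m) (b : bool), exists a : R,
    forall i, Fc lmum k (- (b%:R * (pi / 2))) (V i) = a * (intv R k *m Rm) 0 i.
Proof.
move=> [_ [_ H]] mV Vy VE k b; have [a1 [a2 [_ Ha]]] := H k.
have FcE s i : (\int[mum]_(y in Y) (v1 y 0 i * trig k s y)%:E)%E = (Fc lmum k s (V i))%:E.
  have it := integrable_trig_mul k s (Lp_integrable (ltW p1) (mV i) (Vy i)).
  rewrite /Fc -(Rintegral_fineK it) nuY_integral; last exact: measurable_int it.
  by apply: eq_integral => y /set_mem Yy; rewrite VE// mulrC.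
case: b; [exists a2|exists a1] => i; have [H1 H2] := Ha i.
  rewrite mul1r; apply: EFin_inj; rewrite -FcE -H2; apply: eq_integral => y _.
  by rewrite /trig cosBpihalf.
rewrite mul0r oppr0; apply: EFin_inj; rewrite -FcE -H1; apply: eq_integral => y _.
by rewrite /trig addr0.
Qed.

Lemma backward_direction (v v1 : 'rV[R]_n -> 'rV[R]_m -> 'rV[R]_n) (v0 : 'rV[R]_n -> R)
    (g0 : 'rV[R]_n -> 'rV[R]_n) :
  Lp2 mun mum Om p v ->
  W1p mun Om p v0 g0 ->
  Lp2 mun mum Om p v1 ->
  {ae mun, forall x : Rn R n, Om x -> inG mum p Rm (v1 x)} ->
  {ae mun, forall x : Rn R n, Om x -> {ae mum, forall y : Rn R m, Ycell R m y ->
     v x y = g0 x + v1 x y}} ->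
  exists (vs : nat -> 'rV[R]_n -> R) (gs : nat -> 'rV[R]_n -> 'rV[R]_n),
      (forall j, W1p mun Om p (vs j) (gs j)) /\
      (exists C : R, forall j,
          (\int[mun]_(x in (Om : set (Rn R n))) (powR `|vs j x| p)%:E
             <= C%:E)%E /\
          (\int[mun]_(x in (Om : set (Rn R n))) (powR (vnorm (gs j x)) p)%:E
             <= C%:E)%E) /\
      two_scale_conv mun mum Om p Rm eps gs v.
Proof.
move=> Lv W Lv1 /(muO_aeP oOm Omoo) aeG /(muO_aeP oOm Omoo) aeV.
have [V [mV Vx Vy Vae]] := Lp2_rep lmum oOm Omoo p0 Lv1.
have Vcoef : {ae mu, forall x, forall (k : 'rV[int]_m) (b : bool), exists a : R,
    forall i, Fc lmum k (- (b%:R * (pi / 2))) (V i x) = a * (intv R k *m Rm) 0 i}.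
  apply: (aeS2 aeG Vae) => x Gx VEx.
  by apply: (inG_coef Gx (V := fun i => V i x)) => // i; exact: section_measurable.
pose u0 := cut (Om : set (Rn R n)) v0.
pose G0 i := cut (Om : set (Rn R n)) (fun x : Rn R n => g0 x 0 i).
have mu0 : measurable_fun setT u0 by have [[? _] _] := W; exact: measurable_cut.
have u0y : (Np mu p u0 < +oo)%E by rewrite Np_cut//; have [[_ ?] _] := W.
have mG0 i : measurable_fun setT (G0 i) by have [_ [[? _] _]] := W; exact: measurable_cut.
have G0y i : (Np mu p (G0 i) < +oo)%E.
  rewrite Np_cut//; have [_ [[mg gy] _]] := W; apply: le_lt_trans gy.
  apply: ge0_le_integral => //.
  - apply/measurable_EFinP; apply: (measurableT_comp (measurable_powR p)).
    exact: (measurableT_comp (@normr_measurable _ setT)).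
  - apply/measurable_EFinP; apply: (measurableT_comp (measurable_powR p)).
    exact: measurable_vnorm.
  - by move=> x _; rewrite lee_fin; apply: powR_le => //; [exact: ltW|exact: coord_le_vnorm].
have weak0 psi (tpsi : test_fun Om psi) i := weak_grad_elim oOm Omoo W tpsi i.
have [A [Mf [AV A0 Acorr AA Mfoo]]] := diagonal_sequence lmun p1 Rm0 eps0 epsc mV Vx Vy Vcoef.
pose c j := corr Rm eps (A (Mf j)) j.
have tc j : test_fun Om (c j) by exact: corr_test.
have mc j : measurable_fun [set: Rn R n] (c j : Rn R n -> R) := measurable_test_fun (tc j).
have tdc j i : test_fun Om (pderiv (c j) i) by exact: test_fun_pderiv.
have mdc j i : measurable_fun [set: Rn R n] (pderiv (c j) i : Rn R n -> R) := measurable_test_fun (tdc j i).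
(* The recovery sequence: $v_0$, extended by zero, plus the corrector of the slowly growing
   index. *)
pose U j (x : 'rV[R]_n) : R := u0 x + c j x.
pose H j i (x : Rn R n) : R := G0 i x + pderiv (c j) i x.
pose gs j (x : 'rV[R]_n) : 'rV[R]_n := \row_i H j i x.
have gsE j i : (fun x : Rn R n => gs j x 0 i) = H j i by apply/funext => x; rewrite mxE.
have mU j : measurable_fun [set: Rn R n] (U j : Rn R n -> R) by exact: measurable_funD.
have mH j i : measurable_fun setT (H j i) by exact: measurable_funD.
have iv1 M : (M.+1%:R^-1 : R) <= 1 by rewrite invf_le1// ler1n.
have fmu : ((1 `^ p)%:E * mu setT)%E \is a fin_num by rewrite fin_numM// fin_num_measure.
(* Common bound in [Np] for all functions with values in $[-1,1]$: the measure of $\Omega$. *)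
pose m0 := fine ((1 `^ p)%:E * mu setT)%E.
have N1 (f : Rn R n -> R) : measurable_fun setT f -> (forall x, `|f x| <= 1) -> (Np mu p f <= m0%:E)%E.
  by move=> mf f1; rewrite fineK//; exact: (Np_bounded mu (ltW p0) mf f1).
have fin_le (f : Rn R n -> R) : (Np mu p f < +oo)%E -> (Np mu p f <= (fine (Np mu p f))%:E)%E.
  by move=> fy; rewrite fineK// ge0_fin_numE// Np_ge0.
have addb (f g : Rn R n -> R) (a b : R) : measurable_fun setT f -> measurable_fun setT g ->
    (Np mu p f <= a%:E)%E -> (Np mu p g <= b%:E)%E ->
    (Np mu p (fun x => f x + g x)%R <= (2 `^ p * (a + b))%:E)%E.
  move=> mf mg fa gb; apply: (le_trans (NpD mu (ltW p0) mf mg)).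
  by rewrite EFinM; apply: lee_wpmul2l; [rewrite lee_fin powR_ge0|rewrite EFinD leeD].
have Ub j : (Np mu p (U j : Rn R n -> R) <= (2 `^ p * (fine (Np mu p u0) + m0))%:E)%E.
  apply: (addb) => //; first exact: fin_le.
  by apply: (N1) => // x; have [+ _] := Acorr j; move=> /(_ x)/le_trans; apply.
have /choice[K HK] := gradient_bounded p1 mV Vy AV A0 AA.
(* The gradient is $\nabla v_0$ plus the oscillating field plus a remainder at most 1; the two
   nested factors $2^p$ pay for the two sums. *)
pose KH i := 2 `^ p * (fine (Np mu p (G0 i)) + 2 `^ p * (K i + m0)).
have Hb j i : (Np mu p (H j i) <= (KH i)%:E)%E.
  apply: (addb) => //; first exact: fin_le.
  have -> : (pderiv (c j) i : Rn R n -> R) = fun x : Rn R n =>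
      agrad Rm (A (Mf j)) i x (osc Rm eps j x) + eps j * crem Rm eps (A (Mf j)) j i x.
    by apply/funext => x; exact: pderiv_corr.
  apply: (addb); [exact: measurable_agrad_osc|exact: measurable_crem|exact: HK|].
  apply: (N1); first exact: measurable_crem.
  by move=> x; have [_ /(_ i x)/le_trans] := Acorr j; apply.
have Uy j : (Np mu p (U j : Rn R n -> R) < +oo)%E by apply: le_lt_trans (Ub j) _; exact: ltry.
have Hy j i : (Np mu p (H j i) < +oo)%E by apply: le_lt_trans (Hb j i) _; exact: ltry.
have mgs j i : measurable_fun [set: Rn R n] (fun x : Rn R n => gs j x 0 i) by rewrite gsE.
have gsy j i : (Np mu p (fun x : Rn R n => gs j x 0 i)%R < +oo)%E by rewrite gsE.
exists U, gs; split; last split.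
- move=> j; split; first exact: (Lp_scal_intro (mU j) (Uy j)).
  split; first exact: (Lp_vec_intro p1 (mgs j) (gsy j)).
  apply: (weak_grad_intro p1 (mU j) (Uy j) (mgs j) (gsy j)) => psi tpsi i.
  have iu0 := Lp_integrable (ltW p1) mu0 u0y; have iG0 := Lp_integrable (ltW p1) (mG0 i) (G0y i).
  have td := test_fun_pderiv i tpsi.
  have j1 := integrable_mul_test iu0 td; have j2 := integrable_mul_test (integrable_test oOm Omoo (tc j)) td.
  have j3 := integrable_mul_test iG0 tpsi; have j4 := integrable_mul_test (integrable_test oOm Omoo (tdc j i)) tpsi.
  transitivity (\int[mu]_x (u0 x * pderiv psi i x) + \int[mu]_x (c j x * pderiv psi i x)).
    by rewrite -(RintegralD measurableT j1 j2); apply: eq_Rintegral => x _; rewrite mulrDl.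
  (* The corrector is itself a test function, so its classical derivative serves as weak
     gradient. *)
  rewrite weak0// (integration_by_parts lmun oOm Omoo i (tc j) (test_fun_smooth tpsi)) -opprD.
  congr (- _); rewrite -(RintegralD measurableT j3 j4); apply: eq_Rintegral => x _.
  by rewrite mxE mulrDl.
- exists (2 `^ p * (fine (Np mu p u0) + m0) + n%:R `^ p * \sum_i KH i) => j.
  have m00 : 0 <= m0 by rewrite fine_ge0// mule_ge0 ?lee_fin ?powR_ge0.
  have KH0 i : 0 <= KH i by have := le_trans (Np_ge0 mu p (H j i)) (Hb j i); rewrite lee_fin.
  have t1 : 0 <= 2 `^ p * (fine (Np mu p u0) + m0).
    by rewrite mulr_ge0 ?powR_ge0// addr_ge0// fine_ge0// Np_ge0.
  split.
    rewrite (muO_integral_meas oOm Omoo (measurable_powR_norm p (mU j))) -NpE.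
    apply: (le_trans (Ub j)); rewrite lee_fin lerDl mulr_ge0 ?powR_ge0//.
    exact: sumr_ge0.
  apply: (le_trans (vnorm_integral_le oOm Omoo p1 (mgs j))).
  apply: (@le_trans _ _ (n%:R `^ p * \sum_i KH i)%:E); last by rewrite lee_fin lerDr.
  rewrite EFinM; apply: lee_wpmul2l; first by rewrite lee_fin powR_ge0.
  by rewrite -sumEFin; apply: lee_sum => i _; rewrite gsE.
move=> phi [cpphi [mphi [mS Sy]]].
(* Components of the test field, set to zero off $\Omega$, where the field may fail to be measurable
   jointly or bounded by an $L^{p'}$ function. *)
pose Phi i (x : Rn R n) (y : 'rV[R]_m) : R := cut (Om : set (Rn R n)) (fun x : Rn R n => phi x y 0 i) x.
pose S := cut (Om : set (Rn R n)) (fun x : Rn R n => sup [set vnorm (phi x y) | y in Ycell R m]).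
have mPhi i : measurable_fun setT (fun z : Rn R n * Rn R m => Phi i z.1 z.2).
  rewrite (_ : (fun z => _) = cut ((Om : set (Rn R n)) `*` [set: Rn R m]) (fun z : Rn R n * Rn R m => phi z.1 z.2 0 i)).
    by apply: measurable_cut; [exact: measurableX|exact: mphi].
  apply/funext => -[x y]; rewrite /Phi /=; have [Ox|nO] := pselect (Om x); first by rewrite !cut_in.
  by rewrite !cut_out// => -[].
have cPhi i x : continuous (Phi i x).
  have [Ox|nO] := pselect (Om x); last first.
    by rewrite (_ : Phi i x = cst 0); [exact: cst_continuous|apply/funext => y; exact: cut_out].
  rewrite (_ : Phi i x = fun y => phi x y 0 i); last by apply/funext => y; exact: cut_in.
  move=> z; apply: (@continuous_comp _ _ _ (phi x) (fun w : 'rV[R]_n => w 0 i)); last exact: coord_continuous.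
  by have [+ _] := cpphi x; apply.
have pPhi i x : periodic (Phi i x).
  move=> y l; rewrite /Phi; have [Ox|nO] := pselect (Om x); last by rewrite !cut_out.
  by rewrite !cut_in//; have [_ ->] := cpphi x.
have PhiS i x y : `|Phi i x y| <= S x.
  rewrite /Phi /S; have [Ox|nO] := pselect (Om x); last by rewrite !cut_out// normr0.
  by rewrite !cut_in//; have [? ?] := cpphi x; exact: vnorm_sup_bound.
have mScut : measurable_fun setT S by exact: measurable_cut.
have q0 := conj_exp_gt0 p1.
have Scy : (Np mu (conj_exp p) S < +oo)%E by rewrite Np_cut.
have cv i := gradient_cvg lmun p1 Rm0 eps0 epsc mV Vx Vy (mPhi i) (cPhi i) (pPhi i) mScut Scy (PhiS i) mG0 G0y AV Acorr AA Mfoo (i := i).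
(* The gradient of $v_0$ is paired as a field constant in $y$; its fibre norms reduce to powers
   because the cell has measure 1. *)
have G0x i x : (Np nu p (cst (G0 i x) : Rn R m -> R) < +oo)%E.
  by apply: (Np_bounded_lty nu (ltW p0) (measurable_cst _) (C := `|G0 i x|)).
have mG0z i : measurable_fun setT (fun z : Rn R n * Rn R m => G0 i z.1).
  exact: (measurableT_comp (mG0 i) measurable_fst).
have G0i i : (\int[mu]_x Np nu p (cst (G0 i x) : Rn R m -> R) < +oo)%E.
  move: (G0y i); rewrite NpE; apply: le_lt_trans; rewrite le_eqVlt; apply/orP; left; apply/eqP.
  apply: eq_integral => x _; rewrite NpE (_ : (fun y => _) = cst (`|G0 i x| `^ p)%:E)//.
  by rewrite integral_cst// [X in (_ * X = _)%E]nuY_setT mule1.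
pose L i := \int[mu]_x \int[nu]_y (G0 i x * Phi i x y) + \int[mu]_x \int[nu]_y (V i x y * Phi i x y).
have sPG i x := integrable_pairing_section p1 (mPhi i) (PhiS i) (F := fun x y => G0 i x) (mG0z i) (G0x i) x.
have sPV i x := integrable_pairing_section p1 (mPhi i) (PhiS i) (mV i) (Vx i) x.
have PG i := integrable_pairing p1 (mPhi i) mScut Scy (PhiS i) (F := fun x y => G0 i x) (mG0z i) (G0x i) (G0i i).
have PV i := integrable_pairing p1 (mPhi i) mScut Scy (PhiS i) (mV i) (Vx i) (Vy i).
have -> : int2 mun mum Om (fun x y => vdot (v x y) (phi x y)) = (\sum_i L i)%:E.
  rewrite (int2E (lmum := lmum) (oOm := oOm) (Omoo := Omoo)
    (F' := fun x y => \sum_i (G0 i x * Phi i x y + V i x y * Phi i x y))); last 3 first.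
  - apply: measurable_sum => i; apply: measurable_funM; first by have [+ _] := Lv; apply.
    apply: measurable_funS (mphi i) => //; first by apply: measurableX.
    by move=> [x y] [].
  - apply: measurable_sum => i; apply: measurable_funD; exact: measurable_funM.
  - have OmP : {ae mu, forall x : Rn R n, Om x} by apply/muO_aeP; exact: aeW.
    have aeV2 : {ae mu, forall x : Rn R n, {ae nu, forall y : Rn R m, v x y = g0 x + v1 x y}}.
      by apply: (aeS aeV) => x /nuY_aeP.
    apply: (aeS2 (aeS2 OmP aeV2 (fun x a b => conj a b)) Vae) => x [Ox vx] VEx.
    have YP : {ae nu, forall y : Rn R m, Y y} by apply/nuY_aeP; exact: aeW.
    apply: (aeS2 YP vx) => y Yy vxy; apply: eq_bigr => i _.
    by rewrite vxy mxE VEx// /G0 /Phi !cut_in// mulrDl.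
  have sT i x := integrable_addr (sPG i x) (sPV i x).
  have PT i := integrable_addr (PG i) (PV i).
  have -> : (\sum_i L i) = \int[mu]_x \sum_i (\int[nu]_y (G0 i x * Phi i x y) + \int[nu]_y (V i x y * Phi i x y)).
    rewrite Rintegral_sumr; last exact: PT.
    by apply: eq_bigr => i _; rewrite (RintegralD measurableT (PG i) (PV i)).
  rewrite -(Rintegral_fineK (integrable_sumr _ PT)); apply: eq_integral => x _ /=.
  have -> : \sum_i (\int[nu]_y (G0 i x * Phi i x y) + \int[nu]_y (V i x y * Phi i x y)) =
      \int[nu]_y \sum_i (G0 i x * Phi i x y + V i x y * Phi i x y).
    rewrite Rintegral_sumr; last by move=> i; exact: sT.
    by apply: eq_bigr => i _; rewrite (RintegralD measurableT (sPG i x) (sPV i x)).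
  by rewrite -(Rintegral_fineK (integrable_sumr _ (fun i => sT i x))).
have iH j i : mu.-integrable setT (EFin \o (fun x : Rn R n => H j i x * Phi i x (osc Rm eps j x))).
  exact: (integrable_Lp_test p1 Rm eps (mPhi i) mScut Scy (PhiS i) j (mH j i) (Hy j i)).
rewrite (_ : (fun j => _) = fun j => (\sum_i \int[mu]_x (H j i x * Phi i x (osc Rm eps j x)))%:E); last first.
  apply/funext => j; rewrite -Rintegral_sumr; last exact: iH.
  rewrite -(Rintegral_fineK (integrable_sumr _ (iH j))) muO_integral_cut; apply: eq_integral => x _ /=.
  have [Ox|nO] := pselect (Om x).
    rewrite cut_in//; congr EFin; apply: eq_bigr => i _.
    by rewrite mxE /Phi cut_in.
  by rewrite cut_out// big1// => i _; rewrite /Phi cut_out// mulr0.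
apply: cvg_EFin; first exact: nearW.
rewrite (_ : _ \o _ = fun j => \sum_i \int[mu]_x (H j i x * Phi i x (osc Rm eps j x)))//.
apply: cvg_sum_seq => i; apply: cvg_trans (cv i); apply: near_eq_cvg; apply: nearW => j /=.
by apply: eq_Rintegral => x _; rewrite /H /c pderiv_corr.
Qed.

End backward_direction.

Theorem theorem1p4 (R : realType) (n m : nat)
    (mun : {measure set (Rn R n) -> \bar R})
    (mum : {measure set (Rn R m) -> \bar R})
    (Om : set 'rV[R]_n) (p : R) (Rm : 'M[R]_(m, n)) (eps : nat -> R)
    (v : 'rV[R]_n -> 'rV[R]_m -> 'rV[R]_n) :
  is_lebesgue mun -> is_lebesgue mum ->
  open Om -> bounded_set Om -> (n < m)%N -> 1 < p ->
  (forall k : 'rV[int]_m, k != 0 -> intv R k *m Rm != 0) ->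
  (forall j, 0 < eps j) -> eps @ \oo --> 0 ->
  Lp2 mun mum Om p v ->
  (exists (vs : nat -> 'rV[R]_n -> R) (gs : nat -> 'rV[R]_n -> 'rV[R]_n),
      (forall j, W1p mun Om p (vs j) (gs j)) /\
      (exists C : R, forall j,
          (\int[mun]_(x in (Om : set (Rn R n))) (powR `|vs j x| p)%:E
             <= C%:E)%E /\
          (\int[mun]_(x in (Om : set (Rn R n))) (powR (vnorm (gs j x)) p)%:E
             <= C%:E)%E) /\
      two_scale_conv mun mum Om p Rm eps gs v)
  <->
  (exists (v0 : 'rV[R]_n -> R) (g0 : 'rV[R]_n -> 'rV[R]_n)
          (v1 : 'rV[R]_n -> 'rV[R]_m -> 'rV[R]_n),
      W1p mun Om p v0 g0 /\
      jmeas Om setT v1 /\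
      Lp2 mun mum Om p v1 /\
      {ae mun, forall x : Rn R n, Om x -> inG mum p Rm (v1 x)} /\
      {ae mun, forall x : Rn R n, Om x ->
         {ae mum, forall y : Rn R m, Ycell R m y ->
            v x y = g0 x + v1 x y}}).
Proof.
move=> lmun lmum oOm bOm nm p1 Rm0 eps0 epsc Lv.
(* Boundedness of $\Omega$ enters as finiteness of its measure. *)
have Omoo := bounded_lty lmun bOm (open_measurable_Rn oOm).
split=> [[vs [gs [W [[C HC] ts]]]]|[v0 [g0 [v1 [W [_ [Lv1 [aeG aeV]]]]]]]].
  exact: (forward_direction lmum oOm Omoo p1 Rm0 eps0 epsc Lv W HC ts).
exact: (backward_direction lmun lmum oOm Omoo p1 Rm0 eps0 epsc Lv W Lv1 aeG aeV).
Qed.
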